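(* For a natural number $N$, let $Z_I(N)$, $Z_{II}(N)$ and $Z_{III}(N)$ denote, respectively, the number of ordered pairs $(\lambda,\mu)$ of partitions of $N$ that are zeros of type I, of type II, and of type III (as defined in the context). Then for integers $N\ge 3$, each of $Z_I(N)$, $Z_{II}(N)$, $Z_{III}(N)$ equals $$ p(N)^2\Big(\frac{2}{\log N}+O\Big(\frac{(\log\log N)^2}{(\log N)^2}\Big)\Big), $$ where $p(N)$ is the number of partitions of $N$. Moreover, $$ Z_{III}(N)-Z_{II}(N)=O\big(N^{-1/2}p(N)^2\big). $$
   Context: For partitions $\lambda,\mu$ of $N$, $\chi^\lambda_\mu$ denotes the value of the irreducible character of the symmetric group $S_N$ indexed by $\lambda$ on the conjugacy class of permutations of cycle type $\mu$. Write the parts of $\mu$ as $\mu_1\ge\mu_2\ge\dots\ge\mu_{\ell(\mu)}$. For a box $u$ of the Young diagram of $\lambda$, the hook length $h(u)$ is the number of boxes in the same row to the right of $u$, plus the number in the same column below $u$, plus one. For a natural number $t$, $\mathcal{H}_t(\lambda)$ is the number of boxes $u$ of $\lambda$ with $t\mid h(u)$, and $\lambda$ is a $t$-core if $\mathcal{H}_t(\lambda)=0$. Let $\mathcal{P}_t(\mu)=\frac1t\sum_{j:\,t\mid\mu_j}\mu_j$. A pair $(\lambda,\mu)$ of partitions of $N$ is a zero of type I if $\lambda$ is a $\mu_1$-core; a zero of type II if $\lambda$ is a $t$-core for some part $t$ of $\mu$; a zero of type III if $\mathcal{P}_t(\mu)>\mathcal{H}_t(\lambda)$ for some natural number $t$.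 (In each case $\chi^\lambda_\mu=0$; type I pairs are type II pairs, which are type III pairs.) *)

(* Defs.v *)
From mathcomp Require Import all_boot all_order all_algebra.
From Stdlib Require Import ClassicalEpsilon.
Set Implicit Arguments. Unset Strict Implicit. Unset Printing Implicit Defensive.

Definition is_partition (N : nat) (s : seq nat) : bool :=
  [&& sorted geq s, all (fun x => 0 < x) s & sumn s == N].

(* Every partition of N has at most N parts, each at most N, so it is the
   list of nonzero entries of some N-tuple with entries in {0..N}. *)
Definition tpart (N : nat) (t : N.-tuple 'I_N.+1) : seq nat :=
  [seq x <- map val t | 0 < x].

Definition partitions_of (N : nat) : seq (seq nat) :=
  [seq s <- undup [seq tpart t | t : N.-tuple 'I_N.+1] | is_partition N s].

Definition npart (N : nat) : nat := size (partitions_of N).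

Definition conjpart (la : seq nat) (j : nat) : nat := count (fun x => j < x) la.

(* hook length of the box in row i, column j (0-indexed):
   arm = la_i - j - 1, leg = la'_j - i - 1, h = arm + leg + 1 *)
Definition hook (la : seq nat) (i j : nat) : nat :=
  (nth 0 la i - j) + (conjpart la j - i) - 1.

Definition Hcount (t : nat) (la : seq nat) : nat :=
  \sum_(i < size la) \sum_(j < nth 0 la i) (t %| hook la i j).

Definition is_core (t : nat) (la : seq nat) : Prop := Hcount t la = 0.

Definition Pcount (t : nat) (mu : seq nat) : rat :=
  ((\sum_(m <- mu | (t %| m)%N) m)%N%:R / t%:R)%R.

Definition zero_typeI (la mu : seq nat) : Prop := is_core (head 0 mu) la.
Definition zero_typeII (la mu : seq nat) : Prop :=
  exists t, t \in mu /\ is_core t la.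
Definition zero_typeIII (la mu : seq nat) : Prop :=
  exists t : nat, 0 < t /\ ((Hcount t la)%:R < Pcount t mu)%R.

Definition count_pairs (P : seq nat -> seq nat -> Prop) (N : nat) : nat :=
  \sum_(la <- partitions_of N) \sum_(mu <- partitions_of N)
     (if excluded_middle_informative (P la mu) then 1 else 0).

Definition ZI := count_pairs zero_typeI.
Definition ZII := count_pairs zero_typeII.
Definition ZIII := count_pairs zero_typeIII.

(* Main.v *)
(** Pairs with a part [t] of [mu] well below [sqrt N log N] have a [t]-weight
    [H_t(la)] at least [P_t(mu)] except with negligible probability, and for
    larger [t] a random partition rarely has two parts divisible by [t].  Hence
    all three counts are governed by the sum over [t] of the number
    [p(N - t) c_t(N)] of pairs such that [t] is a part of [mu] and [la] is a
    [t]-core, and [Z_III - Z_II] by the two error terms.  With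
    [z = exp (- cz t / sqrt N)], where [cz = pi / sqrt 6], one has
    [p(N - t) ~ z p(N)] and [c_t(N) ~ exp (- t z) p(N)].  Since
    [d z / d t = - cz z / sqrt N], and [t] may be replaced by
    [u = (sqrt N / cz) (log N / 2)] inside the exponential,
    the sum of [z exp (- u z)] telescopes to [sqrt N / (cz u) = 2 / log N].
    In the lower bound for [Z_I], pairs whose [mu] has a part larger than [t]
    are subtracted; they are of relative order [1 / log N].

    The ratio asymptotics come from [n p(n) = sum_k sigma(k) p(n - k)]: it makes
    [p(n - 1) / p(n)] nearly harmonic for a Markov kernel, and a coupling
    argument bounds its oscillation, so that its logarithm can be read off from
    the recurrence with error [O(1 / n)].  Core counts come from the abacus: the
    generating function of [t]-cores is that of partitions times [t] powers of
    the inverse of the partition generating function in [q^t], of which only the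
    leading factor [(1 - q^t)^t] matters. *)

Require Import Defs.
From HB Require Import structures.
From mathcomp Require Import all_boot.
From mathcomp Require Import zify.
From mathcomp Require ssralg poly ssrnum rat.
From Stdlib Require Import Reals Lra Lia Psatz FunctionalExtensionality.
From Stdlib Require ClassicalEpsilon.
Set Implicit Arguments. Unset Strict Implicit. Unset Printing Implicit Defensive.

(** * Partitions and multiplicities *)

(** The difficulty is uniformity in [t]. The number of [t]-cores is essentially a [t]-th finite
    difference of [i |-> p (N - t * i)], with [t] of order sqrt N log N, so the relative error in
    [p (N - t * i) ~ z ^ i p N] is amplified by up to [(1 + 2 z) ^ t <= exp (2 t z)]. A ratio
    estimate with error O(1 / n) leaves a relative error of order [t ^ 2 / N ^ (3/2)], which
    survives amplification by a small power of N. Hence all [t] differences are taken only while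
    [t z <= log N / 16]; for larger [t z] fewer differences already show that cores are rare. Small
    and large [t] are separated where [z] is about [1 / sqrt N]. Above that point the sum of [z ^ 2]
    over [t], which bounds the effect of two units of divisible parts, is of order [1 / sqrt N], the
    rate claimed for [Z_III - Z_II]. Below it [t z] is a large multiple of log N and a Chernoff
    bound saves any wanted power of N, except for [t] up to a small multiple of [sqrt N / log N],
    where [t z (1 - sqrt z)] is too small; there a crude count of cores by their runner lengths is
    strong enough. *)

Lemma mem_partitions_of N (s : seq nat) : (s \in partitions_of N) = is_partition N s.
Proof.
rewrite /partitions_of mem_filter; case Hp : (is_partition N s) => //=.
rewrite mem_undup; apply/imageP.
move/and3P: Hp => [Hs Ha /eqP Hsum].
have Hle : forall s', all (fun x => (0 < x)%nat) s' -> (size s' <= sumn s')%nat.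
  by elim=> //= x s' IH /andP [Hx /IH]; lia.
have Hsz := Hle _ Ha; rewrite Hsum in Hsz.
have Hx : forall x, x \in s -> (x <= N)%nat.
  rewrite -Hsum => x; elim: {Hs Ha Hsum Hle Hsz} s => //= y s' IH; rewrite inE => /orP [/eqP ->|/IH]; lia.
have Ht : size (map inord s ++ nseq (N - size s) ord0 : seq 'I_N.+1) == N.
  by rewrite size_cat size_map size_nseq; apply/eqP; lia.
exists (Tuple Ht) => //=.
rewrite /tpart /= map_cat filter_cat map_nseq -map_comp.
have -> : [seq x <- nseq (N - size s) (\val (ord0 : 'I_N.+1)) | (0 < x)%nat] = [::].
  by elim: (N - size s)%nat.
rewrite cats0 (eq_in_map _ idfun _).1 ?map_id; last first.
  by move=> x /Hx Hxx /=; rewrite inordK.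
by symmetry; apply/all_filterP.
Qed.

Lemma uniq_partitions_of N : uniq (partitions_of N).
Proof. by rewrite filter_uniq // undup_uniq. Qed.

Lemma geq_total : total geq. Proof. by move=> x y; rewrite /geq /=; lia. Qed.
Lemma geq_trans : transitive geq. Proof. by move=> x y z; rewrite /geq /=; lia. Qed.
Lemma geq_anti : antisymmetric geq. Proof. by move=> x y; rewrite /geq /=; lia. Qed.

Lemma is_partition_sort n (s : seq nat) :
  all (fun x => (0 < x)%nat) s -> sumn s = n -> is_partition n (sort geq s).
Proof.
move=> Ha Hs; rewrite /is_partition (sort_sorted geq_total) /=.
rewrite all_sort Ha /=; apply/eqP; rewrite -Hs.
by apply: perm_sumn; rewrite perm_sort.
Qed.

Lemma partition_perm_eq n m (s1 s2 : seq nat) :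
  is_partition n s1 -> is_partition m s2 -> perm_eq s1 s2 -> s1 = s2.
Proof.
by move=> /and3P [H1 _ _] /and3P [H2 _ _]; apply: sorted_eq geq_trans geq_anti _ _ H1 H2.
Qed.

(** Inclusion of multisets. Only the entries of [nu] are tested, the others having multiplicity zero
    in [nu]. *)
Definition msub (nu mu : seq nat) := all (fun x => (count_mem x nu <= count_mem x mu)%nat) nu.

Lemma msub_exists (nu mu : seq nat) : msub nu mu -> exists rho, perm_eq mu (nu ++ rho).
Proof.
move=> /allP Hall.
have H : forall x, (count_mem x nu <= count_mem x mu)%nat.
  move=> x; case Hx : (x \in nu); first exact: Hall.
  by move/negbT: Hx => /count_memPn ->.
elim: nu mu H {Hall} => [|x nu IH] mu H; first by exists mu.
have Hx : x \in mu.
  by rewrite -has_pred1 has_count; move: (H x) => /=; rewrite eqxx; lia.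
have Hp := perm_to_rem Hx.
have [|rho Hrho] := IH (rem x mu).
  move=> y; move: (H y); rewrite (permP Hp) /=; lia.
exists rho; apply: (perm_trans Hp).
by rewrite /= perm_cons.
Qed.

Lemma msub_cat (nu rho mu : seq nat) : perm_eq mu (nu ++ rho) -> msub nu mu.
Proof.
by move=> Hp; apply/allP => x _; rewrite (permP Hp) count_cat leq_addr.
Qed.

(** Adding the parts of [nu] and sorting is a bijection from the partitions of [N - sumn nu] onto
    the partitions of [N] that contain [nu]. *)
Lemma count_msub (nu : seq nat) N : all (fun x => (0 < x)%nat) nu ->
  count (msub nu) (partitions_of N)
  = (if (sumn nu <= N)%nat then npart (N - sumn nu) else 0)%nat.
Proof.
move=> Hnu; case: ifP => HN; last first.
  apply/eqP; rewrite eqn0Ngt -has_count; apply/hasP => -[mu].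
  rewrite mem_partitions_of => /and3P [_ _ /eqP Hs] /msub_exists [rho /perm_sumn].
  by rewrite sumn_cat; lia.
rewrite -size_filter /npart -[RHS](size_map (fun mu => sort geq (nu ++ mu))).
apply: perm_size; apply: uniq_perm.
- by rewrite filter_uniq // uniq_partitions_of.
- rewrite map_inj_in_uniq ?uniq_partitions_of // => m1 m2.
  rewrite !mem_partitions_of => H1 H2 Heq.
  apply: (partition_perm_eq H1 H2); rewrite -(perm_cat2l nu).
  by rewrite -(perm_sort geq) Heq perm_sort.
move=> mu; rewrite mem_filter mem_partitions_of; apply/andP/mapP.
  move=> [/msub_exists [rho Hrho] Hmu].
  have Hrho2 : is_partition (N - sumn nu) (sort geq rho).
    case/and3P: (Hmu) => [_ Ha /eqP Hs].
    apply: is_partition_sort.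
      by move: Ha; rewrite (perm_all _ Hrho) all_cat => /andP [].
    by move: Hs; rewrite (perm_sumn Hrho) sumn_cat; lia.
  exists (sort geq rho); first by rewrite mem_partitions_of.
  apply: (partition_perm_eq (n:=N) (m:=N)) => //.
    apply: is_partition_sort; last first.
      by rewrite sumn_cat; case/and3P: Hrho2 => [_ _ /eqP ->]; lia.
    by rewrite all_cat Hnu /= ; case/and3P: Hrho2 => [_ ->].
  by rewrite perm_sym perm_sort; apply: perm_trans (_ : perm_eq _ (nu ++ rho)) _;
    rewrite ?perm_cat2l ?perm_sort // perm_sym.
move=> [m]; rewrite mem_partitions_of => /and3P [_ Ha /eqP Hs] ->.
split; first by apply: (@msub_cat _ m); rewrite perm_sort.
by apply: is_partition_sort; rewrite ?all_cat ?Hnu // sumn_cat; lia.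
Qed.

Lemma npart_gt0 N : (0 < npart N)%nat.
Proof.
have H : is_partition N (sort geq (nseq N 1%nat)).
  by apply: is_partition_sort; rewrite ?all_nseq ?orbT // sumn_nseq; lia.
rewrite /npart lt0n size_eq0; apply/eqP => H0.
by move: H; rewrite -mem_partitions_of H0.
Qed.

Lemma npart0 : npart 0 = 1%nat.
Proof.
suff Hp : perm_eq (partitions_of 0) [:: [::]] by rewrite /npart (perm_size Hp).
apply: uniq_perm; rewrite ?uniq_partitions_of // => s.
rewrite mem_partitions_of inE; apply/idP/eqP => [|-> //].
by case: s => // x s /and3P [_ /= /andP [Hx _] /eqP]; lia.
Qed.

Lemma npart_leS N : (npart N <= npart N.+1)%nat.
Proof.
have := @count_msub [:: 1%nat] N.+1 isT; rewrite /= addn0 subn1 /= => <-.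
exact: count_size.
Qed.

Lemma npart_le m n : (m <= n)%nat -> (npart m <= npart n)%nat.
Proof.
elim: n => [|n IH]; first by case: m.
rewrite leq_eqVlt => /orP [/eqP -> //|/IH H].
exact: leq_trans H (npart_leS n).
Qed.

Lemma partition_le N mu x : is_partition N mu -> x \in mu -> (x <= N)%nat.
Proof.
by move=> /and3P [_ _ /eqP <-] Hx; rewrite (perm_sumn (perm_to_rem Hx)) /= leq_addr.
Qed.

Lemma partition_gt0 N mu x : is_partition N mu -> x \in mu -> (0 < x)%nat.
Proof. by move=> /and3P [_ /allP Ha _]; apply: Ha. Qed.

Lemma count_as_sum (T : Type) (P : pred T) s : count P s = (\sum_(x <- s) P x)%nat.
Proof. by elim: s => [|x s IH]; rewrite ?big_nil ?big_cons //= IH. Qed.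

(** Layer-cake form of a multiplicity [c], which turns it into the conditions of having at least [m]
    copies. *)
Lemma leq_as_sum c N : (c <= N)%nat -> c = (\sum_(1 <= m < N.+1) (m <= c)%nat)%nat.
Proof.
elim: N => [|N IH] H; first by rewrite big_geq //; lia.
rewrite big_nat_recr //=; case: (ltngtP c N.+1) H => // H _.
  by rewrite -IH //; lia.
subst; rewrite (eq_big_nat _ _ (F2 := fun=> 1%nat)); last by move=> i Hi; rewrite (_ : (i <= N.+1)%nat) //; lia.
by rewrite sum_nat_const_nat; lia.
Qed.

Lemma msub_nseq m d (mu : seq nat) : msub (nseq m d) mu = (m <= count_mem d mu)%nat.
Proof.
case: m => [|m] //; apply/idP/idP.
  by move=> /allP /(_ d); rewrite count_nseq mem_nseq /= eqxx mul1n; apply.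
move=> H; apply/allP => x; rewrite mem_nseq count_nseq /= => /eqP ->.
by rewrite eqxx mul1n.
Qed.

(** Double counting of the sum of all parts of all partitions of [N]. A part [d] of multiplicity [c]
    contributes [d] once for each [m <= c], and the partitions with at least [m] copies of [d] are
    counted by [count_msub]. Grouping by [k = d * m] turns this into the recurrence with the divisor
    sum. *)
Lemma npart_rec N :
  (N * npart N = \sum_(1 <= d < N.+1) \sum_(1 <= m < N.+1)
     (if d * m <= N then d * npart (N - d * m) else 0))%nat.
Proof.
have Hd : forall mu, is_partition N mu ->
    N = (\sum_(1 <= d < N.+1) \sum_(1 <= m < N.+1) d * msub (nseq m d) mu)%nat.
  move=> mu Hmu; case/and3P: (Hmu) => [_ _ /eqP {1}<-].
  rewrite (eq_big_nat _ _ (F2 := fun d => (\sum_(x <- mu) d * (x == d))%nat)); last first.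
    move=> d Hdd; rewrite -!big_distrr /= -(count_as_sum (pred1 d) mu).
    have Hc : (count_mem d mu <= N)%nat.
      have Hle : forall s', all (fun x => (0 < x)%nat) s' -> (size s' <= sumn s')%nat.
        by elim=> //= x s' IH /andP [Hx /IH]; lia.
      case/and3P: Hmu => [_ /Hle Ha /eqP Hs].
      by rewrite Hs in Ha; apply: leq_trans (count_size _ _) Ha.
    rewrite {1}(leq_as_sum Hc); congr (_ * _)%nat.
    by apply: eq_big_nat => m _; rewrite msub_nseq.
  rewrite exchange_big /= sumnE; apply: eq_big_seq => x Hx.
  have [H0 H1] := (partition_gt0 Hmu Hx, partition_le Hmu Hx).
  rewrite (bigD1_seq x) ?iota_uniq ?mem_index_iota /=; [|lia|by []].
  rewrite eqxx muln1 big1 ?addn0 // => i /negbTE; rewrite eq_sym => ->; lia.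
transitivity (\sum_(mu <- partitions_of N) N)%nat.
  by rewrite big_const_seq count_predT iter_addn_0 mulnC.
rewrite (eq_big_seq (fun mu => \sum_(1 <= d < N.+1) \sum_(1 <= m < N.+1)
   d * msub (nseq m d) mu)%nat); last first.
  by move=> mu; rewrite mem_partitions_of => /Hd.
rewrite exchange_big /=; apply: eq_big_nat => d Hdd.
rewrite exchange_big /=; apply: eq_big_nat => m Hm.
rewrite -big_distrr -count_as_sum /= count_msub; last first.
  by rewrite all_nseq; lia.
by rewrite sumn_nseq; case: ifP; lia.
Qed.

(** * Beta sets and the abacus *)

(* [bset l] lists the beta numbers l_i + (size l - 1 - i) of the nonincreasing
   list [l] (trailing zeros allowed); its gaps below a beta number [x] lie at
   distances from [x] equal to the hook lengths of the row of [x]. *)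
Fixpoint bset (l : seq nat) : seq nat :=
  if l is a :: l' then (a + size l')%nat :: bset l' else [::].

(** It is invariant under permutations of [b], so the beads may be regrouped by their residue modulo
    [t]. *)
Definition invl (t : nat) (b : seq nat) : nat :=
  (\sum_(x <- b) \sum_(0 <= y < x | y \notin b) (t %| x - y))%nat.

Lemma size_bset l : size (bset l) = size l.
Proof. by elim: l => //= a l ->. Qed.

Lemma sumn_bset l : sumn (bset l) = (sumn l + 'C(size l, 2))%nat.
Proof. by elim: l => //= a l ->; rewrite binS bin1; lia. Qed.

Lemma bset_lt a l x : all (geq a) l -> x \in bset l -> (x < a + size l)%nat.
Proof.
elim: l => //= b l IH /andP [Hb Ha]; rewrite inE => /orP [/eqP ->|/(IH Ha)].
  by move: Hb; rewrite /geq /=; lia.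
by lia.
Qed.

Lemma sorted_cons a l : sorted geq (a :: l) -> all (geq a) l /\ sorted geq l.
Proof.
move=> /= H; split; first exact: (order_path_min geq_trans).
exact: path_sorted H.
Qed.

Lemma bset_sorted l : sorted geq l -> sorted gtn (bset l).
Proof.
elim: l => // a l IH /sorted_cons [Ha Hs]; rewrite /= path_min_sorted ?IH //.
by apply/allP => x /(bset_lt Ha).
Qed.

(** The gaps below the leading beta number [a + size l] correspond to the columns [j < a] of the
    first row. In the induction the next row [b] splits them: columns below [b] give the gaps under
    [b + size l], and in the remaining columns [conjpart] vanishes. *)
Lemma gap_sum (G : nat -> nat) a l : sorted geq l -> all (geq a) l ->
  (\sum_(0 <= y < a + size l | y \notin bset l) G y
   = \sum_(0 <= j < a) G (j + size l - conjpart l j))%nat.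
Proof.
elim: l a => [|b l IH] a; first by move=> _ _; rewrite /= addn0; apply: eq_big_nat => j _; rewrite addn0 subn0.
move=> /sorted_cons [Hb Hs] /andP [Hba _].
have Hba' : (b <= a)%nat by [].
rewrite /= (@big_cat_nat _ _ _ (b + size l)) //=; last by lia.
rewrite [X in (_ + X)%nat]big_ltn_cond; last by lia.
rewrite inE eqxx /=.
have -> : (\sum_(0 <= i < b + size l | i \notin b + size l :: bset l) G i =
  \sum_(0 <= i < b + size l | i \notin bset l) G i)%nat.
  rewrite big_nat_cond [RHS]big_nat_cond; apply: eq_bigl => i.
  rewrite inE negb_or; case: ltnP => //= Hi.
  by have -> : i != (b + size l)%nat by lia.
rewrite IH // [RHS](@big_cat_nat _ _ _ b) //=; congr addn.
  apply: eq_big_nat => j /= Hj; congr G.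
  have -> : (j < b)%nat by [].
  by lia.
have -> : (\sum_((b + size l).+1 <= i < a + (size l).+1 | i \notin b + size l :: bset l) G i =
  \sum_((b + size l).+1 <= i < a + (size l).+1) G i)%nat.
  rewrite big_nat_cond [RHS]big_nat_cond; apply: eq_bigl => i.
  case Hi : (_ <= i < _)%nat => //=; rewrite inE negb_or.
  have -> : i != (b + size l)%nat by lia.
  by apply/negP => /(bset_lt Hb); lia.
have -> : ((b + size l).+1 = b + (size l).+1)%nat by lia.
rewrite big_addn addnK; apply: eq_big_nat => j /= Hj; congr G.
have -> : (j < b)%nat = false by lia.
suff -> : conjpart l j = 0%nat by lia.
apply/eqP; rewrite eqn0Ngt -has_count; apply/hasP => -[x Hx Hjx].
by move/allP: Hb => /(_ x Hx); rewrite /geq /=; lia.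
Qed.

(** Removing the first row preserves the hook lengths of the lower rows, because for their boxes the
    column height and the row index both drop by one. *)
Lemma Hcount_cons t a l : all (geq a) l ->
  Hcount t (a :: l) = (\sum_(0 <= j < a) (t %| a - j + conjpart l j) + Hcount t l)%nat.
Proof.
move=> Ha; rewrite /Hcount big_ord_recl /=; congr addn.
  rewrite -(big_mkord xpredT (fun j => (t %| hook (a :: l) 0 j) : nat)).
  apply: eq_big_nat => j /= Hj; congr (nat_of_bool (t %| _)); rewrite /hook /=.
  by rewrite /conjpart /=; lia.
apply: eq_bigr => i _; rewrite /= add0n; apply: eq_bigr => j _.
congr (nat_of_bool (t %| _)); rewrite /hook /= /conjpart /=.
have Hi : nth 0%nat l i \in l by apply: mem_nth.
have Hj := ltn_ord j; move/allP: Ha => /(_ _ Hi); rewrite /geq /= => Hia.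
by have -> : (j < a)%nat by lia; rewrite /bump /=; lia.
Qed.

Lemma invl_bset t l : sorted geq l -> invl t (bset l) = Hcount t l.
Proof.
elim: l => [|a l IH] Hs; first by rewrite /invl /Hcount /= big_nil big_ord0.
have [Ha Hl] := sorted_cons Hs; rewrite Hcount_cons // -IH // /invl /= big_cons; congr addn.
  transitivity (\sum_(0 <= y < a + size l | y \notin bset l) (t %| a + size l - y))%nat.
    rewrite big_nat_cond [RHS]big_nat_cond; apply: eq_bigl => i.
    rewrite inE negb_or; case: ltnP => //= Hi.
    by have -> : i != (a + size l)%nat by lia.
  rewrite (gap_sum (fun y => (t %| a + size l - y) : nat) Hl Ha); apply: eq_big_nat => j /= Hj.
  congr (nat_of_bool (t %| _)).
  have : (conjpart l j <= size l)%nat by apply: count_size.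
  by lia.
rewrite big_seq [RHS]big_seq; apply: eq_bigr => x Hx.
have Hxa := bset_lt Ha Hx.
rewrite big_nat_cond [RHS]big_nat_cond; apply: eq_bigl => i.
rewrite inE negb_or; case: ltnP => //= Hi.
by have -> : i != (a + size l)%nat by lia.
Qed.

(** The case [t = 1] recovers the size, so that the size and the [t]-weight of a partition are read
    off from the same bead statistic. *)
Lemma Hcount1 l : sorted geq l -> Hcount 1 l = sumn l.
Proof.
elim: l => [|a l IH] Hs; first by rewrite /Hcount /= big_ord0.
have [Ha Hl] := sorted_cons Hs; rewrite Hcount_cons //= IH //; congr addn.
rewrite (eq_bigr (fun=> 1%nat)) => [|j _]; last by rewrite dvd1n.
by rewrite sum_nat_const_nat; lia.
Qed.

Lemma bset_inj l1 l2 : size l1 = size l2 -> bset l1 = bset l2 -> l1 = l2.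
Proof.
elim: l1 l2 => [|a l1 IH] [|b l2] //= [Hsz] [H1 H2].
by rewrite (IH _ Hsz H2); congr cons; lia.
Qed.

Lemma bset_surj b : sorted gtn b -> exists l, sorted geq l /\ bset l = b.
Proof.
elim: b => [|x b IH] Hs; first by exists [::].
have Hb : sorted gtn b by exact: path_sorted Hs.
have [l [Hl Hbl]] := IH Hb; exists ((x - size b)%nat :: l).
have Hgt : transitive gtn by move=> u v w; rewrite /gtn /=; lia.
case: b IH Hs Hb Hbl => [|y b] _ Hs Hb Hbl.
  case: l Hl Hbl => // _ _; split=> //=; congr cons; lia.
case: l Hl Hbl => // c l Hl /= [Hc Hbl].
have Hxy : (y < x)%nat by move: Hs => /= /andP [].
have Hsz : size b = size l by rewrite -Hbl size_bset.
split; last by rewrite Hbl; congr [:: _ , _ & _]; lia.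
by move: Hl => /= ->; rewrite andbT /geq /=; lia.
Qed.

(** * Padding by zeros, which fixes the number of beads *)

Definition pad (L : nat) (la : seq nat) := la ++ nseq (L - size la) 0%nat.

Lemma size_pad L la : (size la <= L)%nat -> size (pad L la) = L.
Proof. by move=> H; rewrite size_cat size_nseq; lia. Qed.

Lemma sorted_nseq0 k : sorted geq (nseq k 0%nat).
Proof. by case: k => // k /=; elim: k => //= k ->. Qed.

Lemma sorted_pad L la : sorted geq la -> sorted geq (pad L la).
Proof.
elim: la => [|a la IH]; first by rewrite /pad /= => _; exact: sorted_nseq0.
move=> /sorted_cons [Ha Hs]; rewrite /pad /= path_min_sorted.
  elim: la {IH Ha} Hs (_ - _)%nat => [|b la IH] Hs k; first exact: sorted_nseq0.
  move/sorted_cons: Hs => [Hb Hs]; rewrite /= path_min_sorted ?IH //.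
  by rewrite all_cat Hb all_nseq /geq /= orbT.
by rewrite all_cat Ha all_nseq /geq /= orbT.
Qed.

Lemma Hcount_pad t L la : sorted geq la -> Hcount t (pad L la) = Hcount t la.
Proof.
move=> Hs; rewrite /Hcount /pad size_cat size_nseq big_split_ord /=.
rewrite [X in (_ + X)%nat]big1 ?addn0 => [|i _]; last first.
  by rewrite nth_cat ltnNge leq_addr /= nth_nseq if_same big_ord0.
have Hc j : conjpart (la ++ nseq (L - size la) 0%nat) j = conjpart la j.
  by rewrite /conjpart count_cat count_nseq ltn0 mul0n addn0.
apply: eq_bigr => i _; rewrite nth_cat ltn_ord; apply: eq_bigr => j _.
by rewrite /hook Hc nth_cat ltn_ord.
Qed.

Lemma pad_filter l : sorted geq l -> pad (size l) [seq x <- l | (0 < x)%nat] = l.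
Proof.
elim: l => // a l IH /sorted_cons [Ha Hs]; rewrite /pad /=.
case: (posnP a) => [Ha0|Ha0] /=.
  have Hall : all (pred1 0%nat) (a :: l).
    by rewrite /= Ha0 /=; apply/allP => x Hx; move/allP: Ha => /(_ x Hx); rewrite /geq Ha0 /=; lia.
  have -> : [seq x <- l | (0 < x)%nat] = [::].
    apply/eqP; rewrite -[_ == _]negbK -has_filter; apply/hasPn => x Hx.
    by move/allP: Hall => /(_ x); rewrite inE Hx orbT => /(_ isT) /eqP ->.
  by move/all_pred1P: Hall => Hall; rewrite /= [RHS]Hall.
by congr cons; rewrite subSS; exact: IH.
Qed.

Lemma invl_perm t b1 b2 : perm_eq b1 b2 -> invl t b1 = invl t b2.
Proof.
move=> Hp; rewrite /invl (perm_big _ Hp) /=; apply: eq_bigr => x _.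
by apply: eq_bigl => y; rewrite (perm_mem Hp).
Qed.

Lemma gtn_trans : transitive gtn. Proof. by move=> x y z; rewrite /gtn /=; lia. Qed.
Lemma gtn_irr : irreflexive gtn. Proof. by move=> x; rewrite /gtn /=; lia. Qed.

Lemma sorted_gtn_sort (b : seq nat) : uniq b -> sorted gtn (sort geq b).
Proof.
move=> Hu; have Hs := sort_sorted geq_total b.
have {Hu} : uniq (sort geq b) by rewrite sort_uniq.
elim: (sort geq b) Hs => // x s IH /sorted_cons [Ha Hs] /= /andP [Hx Hu].
rewrite path_min_sorted ?IH //; apply/allP => y Hy.
move/allP: Ha => /(_ y Hy); rewrite /geq /gtn /=.
have : x != y by apply: contraNneq Hx => ->.
by lia.
Qed.

Lemma sumn_filter_pos (l : seq nat) : sumn [seq x <- l | (0 < x)%nat] = sumn l.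
Proof. by elim: l => //= x l; case: (posnP x) => [->|_] /= ->. Qed.

Lemma partition_size N la : is_partition N la -> (size la <= N)%nat.
Proof.
move=> /and3P [_ Ha /eqP <-].
by elim: la Ha => //= x s IH /andP [Hx /IH]; lia.
Qed.

(** * Partitions as sets of beads at positions below [K] *)

Section BeadSets.

(** [v] identifies [T] with the positions below [K]. The type stays abstract because two labellings
    occur: ordinals for a single runner, and pairs of an index and a residue for the whole
    abacus. *)
Variables (T : finType) (v : T -> nat) (K : nat).
Hypotheses (v_inj : injective v) (v_lt : forall x, (v x < K)%nat)
  (v_surj : forall y, (y < K)%nat -> exists x, v x = y).

Definition beads (B : {set T}) : seq nat := [seq v x | x <- enum B].

Definition invs t (B : {set T}) : nat := invl t (beads B).

Lemma uniq_beads B : uniq (beads B).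
Proof. by rewrite map_inj_uniq // enum_uniq. Qed.

Lemma mem_beads B x : (v x \in beads B) = (x \in B).
Proof. by rewrite mem_map // mem_enum. Qed.

Lemma size_beads B : size (beads B) = #|B|.
Proof. by rewrite size_map -cardE. Qed.

Definition setof (b : seq nat) : {set T} := [set x | v x \in b].

Lemma beads_setof b : uniq b -> all (fun y => (y < K)%nat) b -> perm_eq (beads (setof b)) b.
Proof.
move=> Hu /allP Ha; apply: uniq_perm => //; first exact: uniq_beads.
move=> y; apply/mapP/idP => [[x]|Hy]; first by rewrite mem_enum inE => Hx ->.
by have [x Hx] := v_surj (Ha y Hy); exists x => //; rewrite mem_enum inE Hx.
Qed.

Lemma setof_beads b B : perm_eq b (beads B) -> setof b = B.
Proof. by move=> Hp; apply/setP => x; rewrite inE (perm_mem Hp) mem_beads. Qed.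

Definition bead_set L la := setof (bset (pad L la)).

Section Count.

Variables (n L : nat).
Hypotheses (HnL : (n <= L)%nat) (HLK : (L + n <= K)%nat).

Lemma partition_pad la : is_partition n la ->
  [/\ sorted geq (pad L la), size (pad L la) = L & perm_eq (beads (bead_set L la)) (bset (pad L la))].
Proof.
move=> Hla; case/and3P: (Hla) => [Hs Ha /eqP Hn].
have Hsz := partition_size Hla; have Hsz' : size (pad L la) = L by apply: size_pad; lia.
have Hsp : sorted geq (pad L la) by apply: sorted_pad.
split=> //; apply: beads_setof.
  by apply: (sorted_uniq gtn_trans gtn_irr); apply: bset_sorted.
apply/allP => y Hy; apply: leq_trans HLK.
have := @bset_lt n (pad L la) y; rewrite Hsz' addnC; apply=> //.
apply/allP => x; rewrite mem_cat mem_nseq /geq /= => /orP [/(partition_le Hla) //|/andP [_ /eqP ->]].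
by [].
Qed.

Lemma invs_bead_set t la : is_partition n la -> invs t (bead_set L la) = Hcount t la.
Proof.
move=> Hla; have [Hsp Hsz Hp] := partition_pad Hla.
rewrite /invs (invl_perm t Hp) invl_bset // Hcount_pad //.
by case/and3P: Hla.
Qed.

Lemma card_bead_set la : is_partition n la -> #|bead_set L la| = L.
Proof.
by move=> Hla; have [Hsp Hsz Hp] := partition_pad Hla; rewrite -size_beads (perm_size Hp) size_bset.
Qed.

Lemma bead_set_inj la1 la2 : is_partition n la1 -> is_partition n la2 ->
  bead_set L la1 = bead_set L la2 -> la1 = la2.
Proof.
move=> H1 H2 He.
have [S1 Z1 P1] := partition_pad H1; have [S2 Z2 P2] := partition_pad H2.
rewrite He in P1.
have Hb : bset (pad L la1) = bset (pad L la2).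
  apply: (irr_sorted_eq gtn_trans gtn_irr); try exact: bset_sorted.
  by apply: perm_mem; apply: perm_trans P2; rewrite perm_sym.
have Hpad : pad L la1 = pad L la2 by apply: bset_inj; rewrite ?Z1 ?Z2.
have Hf la : is_partition n la -> [seq x <- pad L la | (0 < x)%nat] = la.
  move=> /and3P [_ /all_filterP Ha _]; rewrite /pad filter_cat Ha.
  by rewrite (eq_in_filter (a2 := pred0)) ?filter_pred0 ?cats0 // => x; rewrite mem_nseq => /andP [_ /eqP ->].
by rewrite -(Hf la1 H1) Hpad Hf.
Qed.

Lemma bead_set_surj (B : {set T}) : #|B| = L -> invs 1 B = n ->
  exists2 la, is_partition n la & bead_set L la = B.
Proof.
move=> HB Hn; have Hsb := sorted_gtn_sort (uniq_beads B).
have [l [Hl Hbl]] := bset_surj Hsb.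
have Hp : perm_eq (bset l) (beads B) by rewrite Hbl perm_sort.
have Hsz : size l = L by rewrite -HB -size_beads -(perm_size Hp) size_bset.
have Hsum : sumn l = n.
  by rewrite -Hcount1 // -invl_bset // (invl_perm 1 Hp).
have Hpad : pad L [seq x <- l | (0 < x)%nat] = l by rewrite -Hsz; exact: pad_filter.
exists [seq x <- l | (0 < x)%nat].
  rewrite /is_partition sumn_filter_pos Hsum eqxx andbT filter_all andbT.
  exact: sorted_filter geq_trans _ _ Hl.
by rewrite /bead_set Hpad; exact: setof_beads.
Qed.

Lemma count_bead_sets t w :
  count (fun la => Hcount t la == w) (partitions_of n) =
  #|[set B : {set T} | [&& #|B| == L, invs 1 B == n & invs t B == w]]|.
Proof.
rewrite cardE -size_filter -(size_map (bead_set L)); apply: perm_size; apply: uniq_perm.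
- rewrite map_inj_in_uniq; first by apply: filter_uniq; exact: uniq_partitions_of.
  move=> la1 la2.
  rewrite mem_filter mem_partitions_of => /andP [_ H1].
  rewrite mem_filter mem_partitions_of => /andP [_ H2].
  exact: bead_set_inj.
- exact: enum_uniq.
move=> B; rewrite mem_enum inE; apply/mapP/and3P.
  move=> [la]; rewrite mem_filter mem_partitions_of => /andP [/eqP Hw Hla] ->.
  rewrite card_bead_set // !invs_bead_set // Hw !eqxx; split=> //.
  by case/and3P: (Hla) => [Hs _ /eqP Hn]; rewrite Hcount1 // Hn.
move=> [/eqP HB /eqP Hn /eqP Hw]; have [la Hla HlB] := bead_set_surj HB Hn.
exists la => //; rewrite mem_filter mem_partitions_of Hla andbT.
by rewrite -Hw -HlB invs_bead_set.
Qed.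

(** At most [n] of the [L] beads come from nonzero parts; the trailing zeros fill an initial segment
    of at least [L - n] positions. *)
Lemma bead_set_low (B : {set T}) y : #|B| = L -> invs 1 B = n -> (y + n < L)%nat -> y \in beads B.
Proof.
move=> HB Hn Hy; have [la Hla <-] := bead_set_surj HB Hn.
have [_ _ Hp] := partition_pad Hla; rewrite (perm_mem Hp) /pad.
have Hsz := partition_size Hla.
suff Hk : forall k, (y < k)%nat -> y \in bset (nseq k 0%nat).
  have Hcat : forall l1 l2, y \in bset l2 -> y \in bset (l1 ++ l2).
    by elim=> //= a l1 IH l2 H; rewrite inE IH ?orbT.
  by apply: Hcat; apply: Hk; lia.
elim=> // k IH Hk /=; rewrite inE size_nseq add0n; case: (eqVneq y k) => //= Hyk.
by apply: IH; lia.
Qed.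

Lemma bead_set_high (B : {set T}) y : #|B| = L -> invs 1 B = n -> y \in beads B -> (y < L + n)%nat.
Proof.
move=> HB Hn; have [la Hla <-] := bead_set_surj HB Hn.
have [_ Hsz Hp] := partition_pad Hla; rewrite (perm_mem Hp) => Hy.
have := @bset_lt n (pad L la) y; rewrite Hsz addnC; apply=> //.
apply/allP => x; rewrite mem_cat mem_nseq /geq /= => /orP [/(partition_le Hla) //|/andP [_ /eqP ->]].
by [].
Qed.

End Count.

(** The bead sum determines the size: with no gaps the beads would be the first [#|B|] numbers,
    whose sum is ['C(#|B|, 2)]. *)
Lemma sumn_beads (B : {set T}) : sumn (beads B) = (invs 1 B + 'C(#|B|, 2))%nat.
Proof.
have [l [Hl Hbl]] := bset_surj (sorted_gtn_sort (uniq_beads B)).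
have Hp : perm_eq (bset l) (beads B) by rewrite Hbl perm_sort.
rewrite -(perm_sumn Hp) sumn_bset -size_beads -(perm_size Hp) size_bset.
by rewrite /invs -(invl_perm 1 Hp) invl_bset // Hcount1.
Qed.

End BeadSets.

(* The number of [t]-tuples of partitions of total size [w], that is, of
   [t]-quotients of weight [w]. *)
Fixpoint pconv (t w : nat) : nat :=
  if t is s.+1 then (\sum_(i < w.+1) pconv s i * npart (w - i))%nat else (w == 0%nat).

Section RunnerProduct.
Import ssralg poly.
Import GRing.Theory.
Local Open Scope ring_scope.

(** Agreement is required up to degree [W] only, since a runner with finitely many positions holds
    only partitions of bounded size. *)
Lemma coef_prod_pconv t W (P : 'I_t -> {poly nat}) :
  (forall r i, (i <= W)%nat -> (P r)`_i = npart i) ->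
  forall i, (i <= W)%nat -> (\prod_r P r)`_i = pconv t i.
Proof.
elim: t P => [|t IH] P HP i Hi; first by rewrite big_ord0 coef1 /=; case: eqP.
rewrite big_ord_recr coefM /=; apply: eq_bigr => j _.
have Hj := ltn_ord j.
rewrite HP; last by lia.
by rewrite (IH _ (fun r k => HP (widen_ord (leqnSn t) r) k) j) //; lia.
Qed.

(** Each runner is encoded by the polynomial that enumerates its admissible sets by [s]; expanding
    the product over the runners turns tuples into monomials. *)
Lemma count_runner_tuples (T : finType) t W (C : 'I_t -> pred T) (s : T -> nat) w :
  (forall r i, (i <= W)%nat -> #|[set S | C r S & s S == i]| = npart i) -> (w <= W)%nat ->
  #|[set f : {ffun 'I_t -> T} | [forall r, C r (f r)] & (\sum_r s (f r) == w)%nat]| = pconv t w.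
Proof.
move=> HC Hw; pose P r : {poly nat} := \sum_(S | C r S) 'X^(s S).
have HP r i : (i <= W)%nat -> (P r)`_i = npart i.
  move=> Hi; rewrite -(HC r i Hi) coef_sum -sum1_card big_mkcond [RHS]big_mkcond /=; apply: eq_bigr => S _.
  by rewrite inE coefXn eq_sym; case: (C r S) => //=; case: eqP.
rewrite -(coef_prod_pconv HP Hw) /P.
rewrite (eq_bigr (fun r => \sum_S (if C r S then 'X^(s S) else 0))); last first.
  by move=> r _; rewrite -big_mkcond.
rewrite bigA_distr_bigA coef_sum -sum1_card big_mkcond /=.
apply: eq_bigr => f _; rewrite inE.
case: forallP => Hf /=.
  rewrite (eq_bigr (fun r => 'X^(s (f r)))); last by move=> r _; rewrite Hf.
  have -> : \prod_(r < t) 'X^(s (f r)) = 'X^(\sum_(r < t) s (f r))%nat :> {poly nat}.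
    by elim/big_rec2: _ => [|r a b _ ->]; rewrite ?expr0 // exprD.
  by rewrite coefXn eq_sym; case: eqP.
have [r Hr] : exists r, ~~ C r (f r).
  by apply/existsP; rewrite -negb_forall; apply/forallP.
by rewrite (bigD1 r) //= (negbTE Hr) mul0r coef0.
Qed.

End RunnerProduct.

(** The positions below [q * t + r] at a distance divisible by [t] are those on the same runner. The
    trivial condition [1 %| q - i] on the right is kept to match the form of [invl 1]. *)
Lemma sum_dvd_runner t q r (P : pred nat) : (r < t)%nat ->
  (\sum_(0 <= y < q * t + r | P y) (t %| q * t + r - y)
   = \sum_(0 <= i < q | P (i * t + r)%nat) (1 %| q - i))%nat.
Proof.
move=> Hr; elim: q => [|q IH].
  rewrite mul0n add0n [RHS]big_geq // big_nat_cond big1 // => y /andP [Hy _].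
  by apply/eqP; rewrite eqb0; apply/negP => /dvdn_leq; lia.
rewrite (@big_cat_nat _ _ _ (q * t + r)) //=; last by rewrite mulSn; lia.
have -> : (\sum_(0 <= i < q * t + r | P i) (t %| q.+1 * t + r - i)
  = \sum_(0 <= i < q * t + r | P i) (t %| q * t + r - i))%nat.
  rewrite big_nat_cond [RHS]big_nat_cond; apply: eq_bigr => i /andP [Hi _].
  have -> : (q.+1 * t + r - i = t + (q * t + r - i))%nat by rewrite mulSn; lia.
  by rewrite dvdn_addr.
rewrite IH [RHS]big_mkcond big_nat_recr //= -big_mkcond /=; congr addn.
  by apply: eq_bigr => i _; rewrite !dvd1n.
rewrite big_mkcond big_ltn /=; last by rewrite mulSn; lia.
rewrite big_nat_cond big1 ?addn0 => [|i /andP [Hi _]]; last first.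
  case: (P i) => //; apply/eqP; rewrite eqb0; apply/negP => /dvdn_leq; move: Hi; rewrite mulSn; lia.
have -> : (q.+1 * t + r - (q * t + r) = t)%nat by rewrite mulSn; lia.
by rewrite dvdnn dvd1n.
Qed.

(** * The abacus: bead sets split into runners, cores and quotients *)

Section Abacus.

Variables (t Q : nat).
Hypothesis Ht : (0 < t)%nat.

Let T := ('I_Q * 'I_t)%type.
Definition pos (x : T) : nat := (x.1 * t + x.2)%nat.

Lemma pos_inj : injective pos.
Proof.
move=> [q r] [q' r']; rewrite /pos /= => H.
have Hr : r = r' :> nat.
  by have := congr1 (fun z => z %% t)%nat H; rewrite !modnMDl !modn_small.
have Hq : q = q' :> nat.
  by have := congr1 (fun z => z %/ t)%nat H; rewrite !divnMDl // !divn_small // !addn0.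
by congr pair; apply: val_inj.
Qed.

Lemma pos_surj y : (y < Q * t)%nat -> exists x, pos x = y.
Proof.
move=> Hy; have Hq : (y %/ t < Q)%nat by rewrite ltn_divLR.
by exists (Ordinal Hq, Ordinal (ltn_pmod y Ht)); rewrite /pos /= -divn_eq.
Qed.

Lemma ord_surj (K y : nat) : (y < K)%nat -> exists x : 'I_K, val x = y.
Proof. by move=> Hy; exists (Ordinal Hy). Qed.

Definition runner (B : {set T}) (r : 'I_t) : {set 'I_Q} := [set q | (q, r) \in B].

Definition rinv (S : {set 'I_Q}) := invs (val : 'I_Q -> nat) 1 S.

Lemma sum_over_runners (B : {set T}) (F : T -> nat) :
  (\sum_(x in B) F x = \sum_r \sum_(q in runner B r) F (q, r))%nat.
Proof.
rewrite (exchange_big_dep xpredT) //=.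
transitivity (\sum_(q : 'I_Q) \sum_(r : 'I_t | (q, r) \in B) F (q, r))%nat.
  by rewrite pair_big_dep /=; apply: eq_big => [[q r]|[q r] _].
by apply: eq_bigr => q _; apply: eq_bigl => r; rewrite inE.
Qed.

Lemma invsE (S : finType) (v : S -> nat) k (B : {set S}) :
  invs v k B = (\sum_(x in B) \sum_(0 <= y < v x | y \notin beads v B) (k %| v x - y))%nat.
Proof. by rewrite /invs /invl {1}/beads big_map big_enum. Qed.

Lemma sumn_beadsE (S : finType) (v : S -> nat) (B : {set S}) : sumn (beads v B) = (\sum_(x in B) v x)%nat.
Proof. by rewrite sumnE /beads big_map big_enum. Qed.

(** The [t]-weight is the total size of the partitions read on the runners, that is, of the
    [t]-quotient. *)
Lemma invs_runners (B : {set T}) : invs pos t B = (\sum_r rinv (runner B r))%nat.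
Proof.
rewrite invsE sum_over_runners; apply: eq_bigr => r _.
rewrite /rinv invsE; apply: eq_bigr => q _.
rewrite /pos /= (sum_dvd_runner _ _ (ltn_ord r)) big_nat_cond [RHS]big_nat_cond.
apply: eq_bigl => i; case Hi : (0 <= i < q)%nat => //=; congr negb.
have HiQ : (i < Q)%nat by have := ltn_ord q; lia.
have := mem_beads pos_inj B (Ordinal HiQ, r); rewrite /pos /= => ->.
by have := mem_beads val_inj (runner B r) (Ordinal HiQ); rewrite /= => ->; rewrite inE.
Qed.

Lemma card_runners (B : {set T}) : #|B| = (\sum_r #|runner B r|)%nat.
Proof.
rewrite -sum1_card sum_over_runners; apply: eq_bigr => r _.
by rewrite sum1_card.
Qed.

(* The sum of the beads when runner [r] holds [n r] beads pushed down as far as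
   possible, i.e. of the beads of a [t]-core. *)
Definition kappa (n : 'I_t -> nat) := (\sum_r (t * 'C(n r, 2) + r * n r))%nat.

(** Size equals [t] times the weight plus the size of the core: the bead sum is computed once on the
    whole board and once runner by runner. *)
Lemma invs1_runners (B : {set T}) :
  (invs pos 1 B + 'C(#|B|, 2)
   = t * (\sum_r rinv (runner B r)) + kappa (fun r => #|runner B r|))%nat.
Proof.
rewrite -(sumn_beads pos_inj) sumn_beadsE sum_over_runners.
rewrite big_distrr /= /kappa -big_split /=; apply: eq_bigr => r _.
rewrite addnA -mulnDr /rinv -(sumn_beads val_inj) sumn_beadsE /pos big_split /=.
by rewrite -big_distrl /= mulnC sum_nat_const (mulnC #|_|).
Qed.

Definition of_runners (f : {ffun 'I_t -> {set 'I_Q}}) : {set T} := [set x | x.1 \in f x.2].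

Lemma runner_of_runners f r : runner (of_runners f) r = f r.
Proof. by apply/setP => q; rewrite !inE. Qed.

Lemma of_runners_bij : bijective of_runners.
Proof.
exists (fun B => [ffun r => runner B r]) => [f|B].
  by apply/ffunP => r; rewrite ffunE runner_of_runners.
by apply/setP => -[q r]; rewrite !inE ffunE inE.
Qed.

(* With [2 N] beads expected on each runner, the runners of a partition of
   size at most [N] have lengths in [N, 3 N]. *)
Definition runner_lengths N N' : {set {ffun 'I_t -> 'I_Q.+1}} :=
  [set n : {ffun 'I_t -> 'I_Q.+1} |
    (\sum_r n r == 2 * N * t)%nat && (kappa (fun r => n r) == N' + 'C(2 * N * t, 2))%nat].

Lemma card_flush k : (k <= Q)%nat -> #|[set q : 'I_Q | (q < k)%nat]| = k.
Proof.
move=> H; rewrite -sum1_card (eq_bigl (fun q : 'I_Q => (q < k)%nat)); last by move=> q; rewrite inE.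
by rewrite -(big_ord_widen Q (fun=> 1%nat) H) sum1_card card_ord.
Qed.

Lemma rinv_flush k : rinv [set q : 'I_Q | (q < k)%nat] = 0%nat.
Proof.
rewrite /rinv invsE big1 // => q; rewrite inE => Hq.
rewrite big_nat_cond big1 // => y /andP [/andP [_ Hy]]; case/negP.
have HyQ : (y < Q)%nat := ltn_trans Hy (ltn_ord q).
have := mem_beads val_inj [set q : 'I_Q | (q < k)%nat] (Ordinal HyQ) => /= ->.
by rewrite inE; exact: ltn_trans Hy Hq.
Qed.

(** Such lengths, with all beads pushed down, give the bead set of a partition of [N']. A runner
    shorter than [N] would leave a gap among the positions that must be full, and one longer than
    [3 * N] would hold a bead above the highest possible position. *)
Lemma runner_lengths_ge N N' (n : {ffun 'I_t -> 'I_Q.+1}) r : (N' <= N)%nat -> (4 * N <= Q)%nat ->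
  n \in runner_lengths N N' -> (N <= n r <= 3 * N)%nat.
Proof.
move=> HN HQ; rewrite inE => /andP [/eqP Hn /eqP Hk].
pose f := [ffun r => [set q : 'I_Q | (q < n r)%nat]]; pose B := of_runners f.
have Hcr r' : #|runner B r'| = n r'.
  by rewrite runner_of_runners ffunE card_flush // -ltnS.
have HB : #|B| = (2 * N * t)%nat.
  by rewrite card_runners -Hn; apply: eq_bigr => r' _; exact: Hcr.
have Hinv : invs pos 1 B = N'.
  have := invs1_runners B; rewrite HB big1 => [|r' _]; last first.
    by rewrite runner_of_runners ffunE rinv_flush.
  rewrite muln0 add0n; have -> : kappa (fun r => #|runner B r|) = kappa (fun r => n r).
    by apply: eq_bigr => r' _; rewrite Hcr.
  by rewrite Hk => /addIn.
have HL : (N' <= 2 * N * t)%nat by nia.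
have HK : (2 * N * t + N' <= Q * t)%nat by nia.
apply/andP; split; rewrite leqNgt; apply/negP => Hr.
  have HrQ : (n r < Q)%nat by lia.
  have := bead_set_low (y := pos (Ordinal HrQ, r)) pos_inj pos_surj HL HK HB Hinv.
  rewrite (mem_beads pos_inj) inE /= ffunE inE ltnn => H; suff : false by [].
  apply: H; rewrite /pos /=; have := ltn_ord r; nia.
have HrQ : (3 * N < Q)%nat by have := ltn_ord (n r); lia.
have := bead_set_high (y := pos (Ordinal HrQ, r)) pos_inj pos_surj HL HK HB Hinv.
rewrite (mem_beads pos_inj) inE /= ffunE inE /= => /(_ Hr); rewrite /pos /=; nia.
Qed.

(** Pushing all beads down keeps the runner lengths, hence [kappa], and leaves a bead set of
    nonnegative size. *)
Lemma mul_invs_le (B : {set T}) : (t * invs pos t B <= invs pos 1 B)%nat.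
Proof.
pose f := [ffun r => [set q : 'I_Q | (q < #|runner B r|)%nat]]; pose B' := of_runners f.
have Hcr r : #|runner B' r| = #|runner B r|.
  rewrite runner_of_runners ffunE card_flush //.
  by rewrite -[X in (_ <= X)%nat](card_ord Q) max_card.
have := invs1_runners B; have := invs1_runners B'; rewrite !card_runners -(invs_runners B).
have -> : kappa (fun r => #|runner B' r|) = kappa (fun r => #|runner B r|).
  by apply: eq_bigr => r _; rewrite Hcr.
have -> : (\sum_r #|runner B' r| = \sum_r #|runner B r|)%nat.
  by apply: eq_bigr => r _; rewrite Hcr.
have -> : (\sum_r rinv (runner B' r) = 0)%nat.
  by apply: big1 => r _; rewrite runner_of_runners ffunE rinv_flush.
by lia.
Qed.

Lemma card_runner_sets k i : (i <= k)%nat -> (k + i <= Q)%nat ->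
  #|[set S : {set 'I_Q} | (#|S| == k) & (rinv S == i)]| = npart i.
Proof.
move=> Hik HkQ; have := count_bead_sets val_inj (@ord_surj Q) Hik HkQ 1 i.
have -> : count (fun la => Hcount 1 la == i) (partitions_of i) = npart i.
  apply/eqP; rewrite -all_count; apply/allP => la; rewrite mem_partitions_of.
  by move=> /and3P [Hs _ /eqP Hn]; rewrite Hcount1 // Hn.
move=> ->; congr #|pred_of_set _|; apply/setP => S; rewrite !inE.
by rewrite andbb.
Qed.

(** A bead set amounts to runner lengths together with one partition per runner. The lengths see [w]
    only through the core size [N' - t * w], and every runner has room for all partitions of size at
    most [N], so the count factors. *)
Lemma count_by_lengths N N' w : (N' <= N)%nat -> (4 * N <= Q)%nat -> (t * w <= N')%nat ->
  count (fun la => Hcount t la == w) (partitions_of N')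
  = (#|runner_lengths N (N' - t * w)| * pconv t w)%nat.
Proof.
move=> HN HQ Hw; set L := (2 * N * t)%nat.
have HL : (N' <= L)%nat by rewrite /L; nia.
have HK : (L + N' <= Q * t)%nat by rewrite /L; nia.
rewrite (count_bead_sets pos_inj pos_surj HL HK).
pose len (f : {ffun 'I_t -> {set 'I_Q}}) : {ffun 'I_t -> 'I_Q.+1} := [ffun r => inord #|f r|].
have Hlen f r : len f r = #|f r| :> nat.
  by rewrite ffunE inordK // ltnS -[X in (_ <= X)%nat](card_ord Q) max_card.
rewrite -sum1_card (reindex of_runners) /=; last exact: onW_bij of_runners_bij.
have Hcond f : (of_runners f \in [set B : {set T} | [&& #|B| == L, invs pos 1 B == N' & invs pos t B == w]])
   = (len f \in runner_lengths N (N' - t * w)) && (\sum_r rinv (f r) == w)%nat.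
  rewrite !inE card_runners invs_runners.
  have -> : (\sum_r #|runner (of_runners f) r| = \sum_r len f r)%nat.
    by apply: eq_bigr => r _; rewrite runner_of_runners Hlen.
  have -> : (\sum_r rinv (runner (of_runners f) r) = \sum_r rinv (f r))%nat.
    by apply: eq_bigr => r _; rewrite runner_of_runners.
  have := invs1_runners (of_runners f); rewrite card_runners.
  have -> : (\sum_r #|runner (of_runners f) r| = \sum_r len f r)%nat.
    by apply: eq_bigr => r _; rewrite runner_of_runners Hlen.
  have -> : (\sum_r rinv (runner (of_runners f) r) = \sum_r rinv (f r))%nat.
    by apply: eq_bigr => r _; rewrite runner_of_runners.
  have -> : kappa (fun r => #|runner (of_runners f) r|) = kappa (fun r => len f r).
    by apply: eq_bigr => r _; rewrite runner_of_runners Hlen.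
  case: eqP => //= ->; rewrite -/L; case: (eqVneq (\sum_r rinv (f r))%nat w) => [->|_]; last by rewrite !andbF.
  by rewrite !andbT => E; apply/eqP/eqP; lia.
under eq_bigl => f do rewrite Hcond.
rewrite (partition_big len (fun n => n \in runner_lengths N (N' - t * w))) /=; last by move=> f /andP [].
rewrite -sum_nat_const; apply: eq_bigr => n Hn.
have HnN r := runner_lengths_ge r (leq_trans (leq_subr _ _) HN) HQ Hn.
rewrite -(@count_runner_tuples _ t N (fun r (S : {set 'I_Q}) => #|S| == n r) rinv w); [|
  move=> r i Hi; apply: card_runner_sets; have := HnN r; lia | nia].
rewrite -sum1_card; apply: eq_bigl => f; rewrite inE.
case: (eqVneq (len f) n) => [Hf|Hf].
  rewrite andbT Hf Hn; have -> // : [forall r, #|f r| == n r].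
  by apply/forallP => r; rewrite -Hf Hlen.
rewrite andbF; symmetry; apply/negP => /andP [/forallP Ha _]; case/eqP: Hf.
by apply/ffunP => r; apply: val_inj; rewrite /= Hlen; apply/eqP.
Qed.

End Abacus.

Lemma mul_Hcount_le t n la : (0 < t)%nat -> is_partition n la -> (t * Hcount t la <= n)%nat.
Proof.
move=> Ht Hla; have HK : (n + n <= (2 * n) * t)%nat by nia.
have := mul_invs_le Ht (bead_set (@pos t (2 * n)) n la).
rewrite !(invs_bead_set (@pos_inj t (2 * n) Ht) (@pos_surj t (2 * n) Ht) (leqnn n) HK) //.
by case/and3P: (Hla) => [Hs _ /eqP Hn]; rewrite (Hcount1 Hs) Hn.
Qed.

Definition hcnt t n w := count (fun la => Hcount t la == w) (partitions_of n).

Definition core_cnt t n := hcnt t n 0.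

Lemma pconv0 t : pconv t 0 = 1%nat.
Proof. by elim: t => //= t IH; rewrite big_ord1 IH subnn npart0. Qed.

Lemma core_cntE t N n : (0 < t)%nat -> (n <= N)%nat ->
  core_cnt t n = #|@runner_lengths t (4 * N) N n|.
Proof.
move=> Ht Hn; rewrite /core_cnt /hcnt (@count_by_lengths t (4 * N) Ht N n 0) //; last by lia.
by rewrite muln0 subn0 pconv0 muln1.
Qed.

(** Core and quotient are chosen independently: a partition of weight [w] is a [t]-core of size
    [n - t * w] with a [t]-quotient of size [w]. *)
Theorem hcntE t n w : (0 < t)%nat -> (t * w <= n)%nat ->
  hcnt t n w = (core_cnt t (n - t * w) * pconv t w)%nat.
Proof.
move=> Ht Hw; rewrite /hcnt (@count_by_lengths t (4 * n) Ht n n w) //.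
by rewrite (core_cntE (N := n)) //; lia.
Qed.

Lemma npart_hcnt t n : (0 < t)%nat ->
  npart n = (\sum_(0 <= w < n.+1 | t * w <= n) core_cnt t (n - t * w) * pconv t w)%nat.
Proof.
move=> Ht; transitivity (\sum_(la <- partitions_of n) \sum_(0 <= w < n.+1 | t * w <= n) (Hcount t la == w))%nat.
  rewrite /npart -sum1_size; apply: eq_big_seq => la; rewrite mem_partitions_of => Hla.
  have H := mul_Hcount_le Ht Hla; rewrite big_mkcond.
  rewrite (bigD1_seq (Hcount t la)) ?iota_uniq ?mem_index_iota //=; last by nia.
  rewrite H eqxx big1 // => w /negbTE; rewrite eq_sym => ->.
  by case: ifP.
rewrite exchange_big /=; apply: eq_bigr => w Hw.
by rewrite -hcntE // /hcnt count_as_sum.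
Qed.

(** A core is determined by its runner lengths. The bound is crude, but it is only
    [exp (O(t log N))], which is harmless for [t] up to a small multiple of [sqrt N / log N]. *)
Lemma core_cnt_le t N n : (0 < t)%nat -> (n <= N)%nat -> (core_cnt t n <= expn (4 * N).+1 t)%nat.
Proof.
move=> Ht Hn; rewrite (core_cntE Ht Hn); apply: leq_trans (max_card _) _.
by rewrite card_ffun !card_ord.
Qed.

(** * Reduction of the three kinds of zeros to counts *)

(** Integer counterpart of [Pcount]; the division is exact for the parts that are summed. *)
Definition Pc (t : nat) (mu : seq nat) : nat := (\sum_(m <- mu | t %| m) m %/ t)%nat.

Lemma mul_Pc t mu : (t * Pc t mu = \sum_(m <- mu | t %| m) m)%nat.
Proof.
rewrite /Pc big_distrr /=; apply: eq_bigr => m Hm.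
by rewrite mulnC divnK.
Qed.

Lemma mul_Pc_le t N mu : is_partition N mu -> (t * Pc t mu <= N)%nat.
Proof.
move=> /and3P [_ _ /eqP <-]; rewrite mul_Pc sumnE [X in (_ <= X)%nat](bigID (fun m => t %| m)) /=.
exact: leq_addr.
Qed.

Section Rational.
Import ssralg ssrnum rat.
Import GRing.Theory Num.Theory.

Lemma Pcount_lt t h mu : (0 < t)%nat -> (h%:R < Pcount t mu)%R = (h < Pc t mu)%nat.
Proof.
move=> Ht; rewrite /Pcount -mul_Pc natrM mulrAC divff ?pnatr_eq0 -?lt0n // mul1r.
by rewrite ltr_nat.
Qed.

End Rational.

(** Separating the parts divisible by [t], and dividing them by [t], injects these partitions into
    pairs of a partition of [k] and one of [N - t * k]. *)
Lemma count_Pc t N k : (0 < t)%nat ->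
  (count (fun mu => Pc t mu == k) (partitions_of N)
   <= if t * k <= N then npart k * npart (N - t * k) else 0)%nat.
Proof.
move=> Ht; case: (leqP (t * k) N) => HN /=; last first.
  rewrite leqn0 eqn0Ngt -has_count; apply/hasP => -[mu]; rewrite mem_partitions_of.
  by move=> /(mul_Pc_le t) H /eqP Hk; rewrite Hk in H; lia.
rewrite -size_filter /npart -(size_allpairs pair).
pose g mu := ([seq (m %/ t)%nat | m <- mu & t %| m], [seq m <- mu | ~~ (t %| m)]).
rewrite -(size_map g); apply: uniq_leq_size.
  rewrite map_inj_in_uniq; first by apply: filter_uniq; exact: uniq_partitions_of.
  move=> m1 m2; rewrite mem_filter mem_partitions_of => /andP [_ H1].
  rewrite mem_filter mem_partitions_of => /andP [_ H2] [E1 E2].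
  have Hback m : [seq x <- m | t %| x] = [seq (y * t)%nat | y <- [seq (x %/ t)%nat | x <- m & t %| x]].
    rewrite -map_comp -[LHS]map_id; apply/eq_in_map => x /=; rewrite mem_filter => /andP [Hx _].
    by rewrite divnK.
  apply: (partition_perm_eq H1 H2).
  have P1 := permEl (perm_filterC (fun m => t %| m) m1).
  have P2 := permEl (perm_filterC (fun m => t %| m) m2).
  rewrite perm_sym in P1; apply: perm_trans P1 _; apply: perm_trans P2.
  rewrite (Hback m1) (Hback m2) E1 perm_cat2l.
  by rewrite (_ : filter _ m1 = [seq x <- m2 | predC (fun m => t %| m) x]).
move=> xy /mapP [mu]; rewrite mem_filter mem_partitions_of => /andP [/eqP Hk Hmu] ->.
case/and3P: (Hmu) => [Hs Ha /eqP Hsum].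
have Hpos x : x \in mu -> (0 < x)%nat by move/allP: Ha => Ha; exact: Ha.
have Hsplit : (t * k + sumn [seq m <- mu | ~~ (t %| m)] = N)%nat.
  rewrite -Hsum -Hk mul_Pc !sumnE big_filter.
  by rewrite [RHS](bigID (fun m => t %| m)) /=.
apply: allpairs_f; rewrite mem_partitions_of; apply/and3P; split.
- rewrite sorted_map; apply: sub_in_sorted (sorted_filter geq_trans _ Hs) => //.
  by move=> x y _ _; rewrite /geq /=; exact: leq_div2r.
- apply/allP => x /mapP [y]; rewrite mem_filter => /andP [Hy Hy2] ->.
  by rewrite divn_gt0 // dvdn_leq // Hpos.
- by rewrite sumnE big_map big_filter -Hk.
- exact: sorted_filter geq_trans _ _ Hs.
- by apply/allP => x; rewrite mem_filter => /andP [_ /Hpos].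
by apply/eqP; lia.
Qed.

Lemma count_mem1 t N : (0 < t <= N)%nat ->
  count (fun mu => t \in mu) (partitions_of N) = npart (N - t).
Proof.
move=> /andP [Ht HN]; have := @count_msub [:: t] N; rewrite /= addn0 Ht HN => <- //.
by apply: eq_count => mu; rewrite /msub /= eqxx andbT -has_pred1 has_count.
Qed.

Lemma count_msub2_le x y N : (0 < x)%nat -> (0 < y)%nat ->
  count (msub [:: x; y]) (partitions_of N) = (if x + y <= N then npart (N - (x + y)) else 0)%nat.
Proof. by move=> Hx Hy; rewrite count_msub /= ?addn0 ?Hx ?Hy. Qed.

Lemma msub2 x y (mu : seq nat) : x != y -> x \in mu -> y \in mu -> msub [:: x; y] mu.
Proof.
move=> Hxy Hx Hy; rewrite /msub /= !eqxx (eq_sym y x) (negbTE Hxy) /= andbT.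
by rewrite !addn0 add0n -!has_count !has_pred1 Hx Hy.
Qed.

Lemma PcP t N mu : (0 < t)%nat -> is_partition N mu ->
  (exists x, [/\ x \in mu, t %| x & (2 <= x %/ t)%nat]) \/ Pc t mu = count_mem t mu.
Proof.
move=> Ht Hmu.
case: (boolP (has (fun x => (t %| x) && (2 <= x %/ t)%nat) mu)) => [/hasP [x Hx /andP [H1 H2]]|/hasPn H].
  by left; exists x.
right; rewrite /Pc count_as_sum big_mkcond; apply: eq_big_seq => x Hx.
have := H x Hx; have := partition_gt0 Hmu Hx.
case: (boolP (t %| x)) => [/dvdnP [k ->]|Hd] Hx0 /=.
  rewrite mulnK // -ltnNge => Hk; have -> : k = 1%nat by nia.
  by rewrite mul1n eqxx.
by move=> _; case: eqP => // E; rewrite E dvdnn in Hd.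
Qed.

Lemma Pc_ge x t (mu : seq nat) : x \in mu -> t %| x -> (x %/ t <= Pc t mu)%nat.
Proof.
move=> Hx Hd; rewrite /Pc (perm_big _ (perm_to_rem Hx)) /= big_cons Hd.
exact: leq_addr.
Qed.

Lemma Pc1_mem t N mu : (0 < t)%nat -> is_partition N mu -> Pc t mu = 1%nat -> t \in mu.
Proof.
move=> Ht Hmu H1; case: (PcP Ht Hmu) => [[x [Hx Hd H2]]|H].
  by have := Pc_ge Hx Hd; rewrite H1; lia.
by rewrite -has_pred1 has_count -H H1.
Qed.

Lemma mem_Pc t N mu : (0 < t)%nat -> is_partition N mu -> t \in mu -> (0 < Pc t mu)%nat.
Proof. by move=> Ht Hmu H; have := Pc_ge H (dvdnn t); rewrite divnn Ht. Qed.

Definition cnt2 t N := count (fun mu => (2 <= Pc t mu)%nat) (partitions_of N).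

(** Two units of [Pc] come either from a part [m * t] with [m >= 2] or from two copies of [t]. *)
Lemma cnt2_le t N : (0 < t)%nat ->
  (cnt2 t N <= \sum_(2 <= m < N.+1 | m * t <= N) npart (N - m * t)
     + (if t + t <= N then npart (N - (t + t)) else 0))%nat.
Proof.
move=> Ht; rewrite -(count_msub2_le N Ht Ht) /cnt2 !count_as_sum.
apply: (@leq_trans (\sum_(2 <= m < N.+1 | m * t <= N) \sum_(mu <- partitions_of N) ((m * t)%nat \in mu)
   + \sum_(mu <- partitions_of N) msub [:: t; t] mu)%nat); last first.
  rewrite leq_add2r; rewrite big_nat_cond [X in (_ <= X)%nat]big_nat_cond; apply: leq_sum => m /andP [Hm HmN].
  by rewrite -count_as_sum count_mem1 //; nia.
rewrite exchange_big /= -big_split /= big_seq [X in (_ <= X)%nat]big_seq; apply: leq_sum => mu.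
rewrite mem_partitions_of => Hmu; case: leqP => // H2.
case: (PcP Ht Hmu) => [[x [Hx Hd Hx2]]|H]; last first.
  suff -> : msub [:: t; t] mu by rewrite addnC.
  by rewrite (msub_nseq 2) -H.
have HxN := partition_le Hmu Hx; have Hxx := divnK Hd.
rewrite -Hxx in Hx HxN; set m := (x %/ t)%nat in Hx HxN Hx2.
rewrite big_mkcond (bigD1_seq m) ?iota_uniq //=; last by rewrite mem_index_iota; nia.
by rewrite HxN Hx.
Qed.

Definition pairs_gt t N :=
  (\sum_(la <- partitions_of N) \sum_(mu <- partitions_of N) (Hcount t la < Pc t mu))%nat.

Definition ind (P : Prop) : nat := if ClassicalEpsilon.excluded_middle_informative P then 1 else 0.

Lemma indT (P : Prop) : P -> ind P = 1%nat.
Proof. by rewrite /ind; case: ClassicalEpsilon.excluded_middle_informative. Qed.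

Lemma ind_le (P : Prop) k : (P -> (0 < k)%nat) -> (ind P <= k)%nat.
Proof. by rewrite /ind; case: ClassicalEpsilon.excluded_middle_informative => // H /(_ H). Qed.

Lemma typeIII_E la mu : zero_typeIII la mu <-> exists t, (0 < t)%nat /\ (Hcount t la < Pc t mu)%nat.
Proof.
split=> -[t [Ht H]]; exists t; split=> //; move: H; rewrite Pcount_lt //.
Qed.

Lemma typeI_II N la mu : (0 < N)%nat -> is_partition N mu -> zero_typeI la mu -> zero_typeII la mu.
Proof.
move=> HN Hmu H; exists (head 0%nat mu); split=> //.
case: mu Hmu {H} => [|x mu] /=; last by rewrite mem_head.
by case/and3P => _ _ /= /eqP; lia.
Qed.

Lemma typeII_III N la mu : is_partition N mu -> zero_typeII la mu -> zero_typeIII la mu.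
Proof.
move=> Hmu [t [Ht H]]; apply/typeIII_E; have Ht0 := partition_gt0 Hmu Ht.
by exists t; split=> //; rewrite H; exact: (mem_Pc Ht0 Hmu Ht).
Qed.

Lemma sum_pairs_le (F G : seq nat -> seq nat -> nat) N :
  (forall la mu, is_partition N la -> is_partition N mu -> (F la mu <= G la mu)%nat) ->
  (\sum_(la <- partitions_of N) \sum_(mu <- partitions_of N) F la mu
   <= \sum_(la <- partitions_of N) \sum_(mu <- partitions_of N) G la mu)%nat.
Proof.
move=> H; rewrite big_seq [X in (_ <= X)%nat]big_seq; apply: leq_sum => la.
rewrite mem_partitions_of => Hla; rewrite big_seq [X in (_ <= X)%nat]big_seq; apply: leq_sum => mu.
by rewrite mem_partitions_of => Hmu; exact: H.
Qed.

Lemma ZI_le_ZII N : (0 < N)%nat -> (ZI N <= ZII N)%nat.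
Proof.
move=> HN; apply: sum_pairs_le => la mu Hla Hmu; apply: ind_le => H.
by rewrite -/(ind _) indT //; exact: (typeI_II HN Hmu H).
Qed.

Lemma ZII_le_ZIII N : (ZII N <= ZIII N)%nat.
Proof.
apply: sum_pairs_le => la mu Hla Hmu; apply: ind_le => H.
by rewrite -/(ind _) indT //; exact: (typeII_III Hmu H).
Qed.

(* A type III witness [t >= T0] has either [2 <= Pc t mu], or
   [Pc t mu = 1] and [Hcount t la = 0], which makes [t] a type II witness. *)
Lemma typeIII_cases N T0 la mu : is_partition N la -> is_partition N mu -> zero_typeIII la mu ->
  (exists2 t, (2 <= t < T0)%nat & (Hcount t la < Pc t mu)%nat) \/
  (exists2 t, (T0 <= t < N.+1)%nat & (2 <= Pc t mu)%nat) \/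
  (exists2 t, (T0 <= t < N.+1)%nat & (t \in mu) && (Hcount t la == 0%nat)).
Proof.
move=> Hla Hmu /typeIII_E [t [Ht H]].
have HtN := mul_Pc_le t Hmu.
(* [t = 1] is never a witness: every hook length is a multiple of 1, so [Hcount 1 la = N], which
   [Pc] cannot exceed. *)
have Ht2 : (2 <= t)%nat.
  case: t Ht H HtN => [|[|t]] // _ H HtN.
  case/and3P: (Hla) => [Hs _ /eqP Hn]; rewrite (Hcount1 Hs) Hn in H; lia.
case: (ltnP t T0) => HT; first by left; exists t; rewrite ?Ht2.
have HtN1 : (T0 <= t < N.+1)%nat by apply/andP; split=> //; nia.
right; case: (leqP 2 (Pc t mu)) => H2; first by left; exists t.
right; exists t => //; have HP : Pc t mu = 1%nat by lia.
by rewrite (Pc1_mem Ht Hmu HP) /=; apply/eqP; lia.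
Qed.

Lemma sum_nat_gt0 a b (F : nat -> nat) t : (a <= t < b)%nat -> (0 < F t)%nat ->
  (0 < \sum_(a <= i < b) F i)%nat.
Proof.
move=> Ht HF; rewrite (bigD1_seq t) ?iota_uniq ?mem_index_iota //=; lia.
Qed.

Lemma sum_pairs_exch a b N (F : nat -> seq nat -> seq nat -> nat) :
  (\sum_(la <- partitions_of N) \sum_(mu <- partitions_of N) \sum_(a <= t < b) F t la mu
   = \sum_(a <= t < b) \sum_(la <- partitions_of N) \sum_(mu <- partitions_of N) F t la mu)%nat.
Proof. by rewrite [RHS]exchange_big /=; apply: eq_bigr => la _; rewrite exchange_big. Qed.

Lemma sum_pairs_mu N (G : pred (seq nat)) :
  (\sum_(la <- partitions_of N) \sum_(mu <- partitions_of N) G mu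
   = npart N * count G (partitions_of N))%nat.
Proof.
rewrite (eq_bigr (fun=> count G (partitions_of N))) => [|la _]; last by rewrite count_as_sum.
by rewrite big_const_seq count_predT iter_addn_0 mulnC.
Qed.

Lemma sum_pairs_prod N (F G : pred (seq nat)) :
  (\sum_(la <- partitions_of N) \sum_(mu <- partitions_of N) (G mu && F la)
   = count G (partitions_of N) * count F (partitions_of N))%nat.
Proof.
rewrite (count_as_sum F) big_distrr /=; apply: eq_bigr => la _.
by rewrite count_as_sum big_distrl /=; apply: eq_bigr => mu _; rewrite mulnb.
Qed.

(** Union bound over the witnesses of [typeIII_cases]; in the last sum the conditions on [la] and
    [mu] are independent. *)
Lemma ZIII_le N T0 : (2 <= T0)%nat -> (ZIII N <= \sum_(2 <= t < T0) pairs_gt t N +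
  \sum_(T0 <= t < N.+1) (npart N * cnt2 t N) + \sum_(T0 <= t < N.+1) (npart (N - t) * core_cnt t N))%nat.
Proof.
move=> HT; pose F la mu := (\sum_(2 <= t < T0) (Hcount t la < Pc t mu)
  + \sum_(T0 <= t < N.+1) (2 <= Pc t mu) + \sum_(T0 <= t < N.+1) ((t \in mu) && (Hcount t la == 0%nat)))%nat.
apply: (@leq_trans (\sum_(la <- partitions_of N) \sum_(mu <- partitions_of N) F la mu)%nat).
  apply: sum_pairs_le => la mu Hla Hmu; apply: ind_le => H; rewrite /F.
  case: (typeIII_cases T0 Hla Hmu H) => [[t Ht H1]|[[t Ht H1]|[t Ht H1]]].
  - by have := @sum_nat_gt0 _ _ (fun t => (Hcount t la < Pc t mu)%nat : nat) t Ht; rewrite H1 => /(_ isT); lia.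
  - by have := @sum_nat_gt0 _ _ (fun t => (2 <= Pc t mu)%nat : nat) t Ht; rewrite H1 => /(_ isT); lia.
  by have := @sum_nat_gt0 _ _ (fun t => ((t \in mu) && (Hcount t la == 0%nat)) : nat) t Ht; rewrite H1 => /(_ isT); lia.
rewrite /F; under eq_bigr => la _ do rewrite !big_split /=.
rewrite !big_split /= !sum_pairs_exch; apply: leq_add; first apply: leq_add => //.
  by apply: leq_sum => t _; rewrite (sum_pairs_mu N (fun mu => 2 <= Pc t mu)%nat).
rewrite big_nat_cond [X in (_ <= X)%nat]big_nat_cond; apply: leq_sum => t /andP [Ht _].
rewrite (sum_pairs_prod N (fun la => Hcount t la == 0%nat) (fun mu => t \in mu)) count_mem1 //; lia.
Qed.

Lemma ZIII_le_ZII N T0 : (2 <= T0)%nat -> (ZIII N <= ZII N + (\sum_(2 <= t < T0) pairs_gt t N +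
  \sum_(T0 <= t < N.+1) (npart N * cnt2 t N)))%nat.
Proof.
move=> HT; pose F la mu := (ind (zero_typeII la mu) + (\sum_(2 <= t < T0) (Hcount t la < Pc t mu)
  + \sum_(T0 <= t < N.+1) (2 <= Pc t mu)))%nat.
apply: (@leq_trans (\sum_(la <- partitions_of N) \sum_(mu <- partitions_of N) F la mu)%nat).
  apply: sum_pairs_le => la mu Hla Hmu; apply: ind_le => H; rewrite /F.
  case: (typeIII_cases T0 Hla Hmu H) => [[t Ht H1]|[[t Ht H1]|[t Ht H1]]].
  - by have := @sum_nat_gt0 _ _ (fun t => (Hcount t la < Pc t mu)%nat : nat) t Ht; rewrite H1 => /(_ isT); lia.
  - by have := @sum_nat_gt0 _ _ (fun t => (2 <= Pc t mu)%nat : nat) t Ht; rewrite H1 => /(_ isT); lia.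
  rewrite indT //; exists t; move: H1 => /andP [H1 /eqP H2]; by split.
rewrite /F; under eq_bigr => la _ do rewrite !big_split /=.
rewrite !big_split /= !sum_pairs_exch; apply: leq_add => //; apply: leq_add => //.
by apply: leq_sum => t _; rewrite (sum_pairs_mu N (fun mu => 2 <= Pc t mu)%nat).
Qed.

(** Different values of the largest part give disjoint sets of pairs, so summing over [t] overcounts
    nothing. A partition with a part [t] and a larger largest part [s] contains both, and these are
    counted by [npart (N - (t + s))]. *)
Lemma ZI_ge N a b : (0 < a)%nat -> (b <= N.+1)%nat ->
  (\sum_(a <= t < b) npart (N - t) * core_cnt t N <= ZI N +
   \sum_(a <= t < b) (\sum_(t.+1 <= s < N.+1 | t + s <= N) npart (N - (t + s))) * core_cnt t N)%nat.
Proof.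
move=> Ha Hb.
have HZ : (\sum_(a <= t < b) count (fun mu => head 0%nat mu == t) (partitions_of N) * core_cnt t N <= ZI N)%nat.
  rewrite (eq_bigr (fun t => (\sum_(la <- partitions_of N) \sum_(mu <- partitions_of N)
      ((head 0%nat mu == t) && (Hcount t la == 0%nat)))%nat)); last first.
    by move=> t _; rewrite -(sum_pairs_prod N (fun la => Hcount t la == 0%nat) (fun mu => head 0%nat mu == t)).
  rewrite -sum_pairs_exch; apply: sum_pairs_le => la mu Hla Hmu.
  case: (boolP ((a <= head 0%nat mu < b)%nat && (Hcount (head 0%nat mu) la == 0%nat))) => [/andP [H1 /eqP H2]|H].
    rewrite -/(ind _) indT // (bigD1_seq (head 0%nat mu)) ?iota_uniq ?mem_index_iota //=.
    rewrite H2 !eqxx big1 // => t; rewrite eq_sym => /negbTE ->.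
    by [].
  rewrite big_nat_cond big1 // => t /andP [Ht _]; apply/eqP; rewrite eqb0.
  by apply: contra H => /andP [/eqP -> ->]; rewrite Ht.
apply: leq_trans (leq_add HZ (leqnn _)); rewrite -big_split /=.
rewrite big_nat_cond [X in (_ <= X)%nat]big_nat_cond; apply: leq_sum => t /andP [Ht _].
rewrite -mulnDl leq_mul2r; apply/orP; right.
rewrite -(@count_mem1 t N); last by lia.
apply: (@leq_trans (count (fun mu => head 0%nat mu == t) (partitions_of N)
    + \sum_(t.+1 <= s < N.+1) count (msub [:: t; s]) (partitions_of N))%nat).
  rewrite !count_as_sum; under [X in (_ <= _ + X)%nat]eq_bigr => s _ do rewrite count_as_sum.
  rewrite exchange_big /= -big_split /= big_seq [X in (_ <= X)%nat]big_seq; apply: leq_sum => mu.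
  rewrite mem_partitions_of => Hmu; case Htm : (t \in mu) => //.
  case: eqP => [_|Hh]; first exact: leq_addr.
  have Hmu0 : head 0%nat mu \in mu by case: (mu) Htm => //= x s _; rewrite mem_head.
  have Hle : (t <= head 0%nat mu)%nat.
    case/and3P: (Hmu) => [Hs _ _]; case: (mu) Hs Htm => // x s /sorted_cons [/allP Hx _].
    by rewrite inE => /orP [/eqP -> //|/Hx].
  have := partition_le Hmu Hmu0 => HhN.
  rewrite (bigD1_seq (head 0%nat mu)) ?iota_uniq //=; last by rewrite mem_index_iota; lia.
  by rewrite msub2 //; apply/eqP => E; apply: Hh; rewrite E.
rewrite leq_add2l [X in (_ <= X)%nat]big_mkcond big_nat_cond [X in (_ <= X)%nat]big_nat_cond.
by apply: leq_sum => s /andP [Hs _]; rewrite count_msub2_le //; lia.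
Qed.

Open Scope R_scope.

(** * Real sums and the divisor-sum recurrence *)

Arguments INR : simpl never.

Lemma Rplus_associative : associative Rplus.
Proof. by move=> x y z; rewrite Rplus_assoc. Qed.
Lemma Rmult_associative : associative Rmult.
Proof. by move=> x y z; rewrite Rmult_assoc. Qed.
Lemma Rmult_left_distr : left_distributive Rmult Rplus.
Proof. by move=> x y z; ring. Qed.
Lemma Rmult_right_distr : right_distributive Rmult Rplus.
Proof. by move=> x y z; ring. Qed.

(** These instances let the big-operator lemmas apply to sums in the standard library reals. *)
HB.instance Definition _ :=
  Monoid.isComLaw.Build R 0 Rplus Rplus_associative Rplus_comm Rplus_0_l.
HB.instance Definition _ :=
  Monoid.isComLaw.Build R 1 Rmult Rmult_associative Rmult_comm Rmult_1_l.
HB.instance Definition _ := Monoid.isMulLaw.Build R 0 Rmult Rmult_0_l Rmult_0_r.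
HB.instance Definition _ :=
  Monoid.isAddLaw.Build R Rmult Rplus Rmult_left_distr Rmult_right_distr.

Reserved Notation "\rsum_ ( i <- r | P ) F"
  (at level 34, F at level 41, i, r at level 60).
Reserved Notation "\rsum_ ( i <- r ) F"
  (at level 34, F at level 41, i, r at level 60).
Reserved Notation "\rsum_ ( m <= i < n | P ) F"
  (at level 34, F at level 41, i, m, n at level 60).
Reserved Notation "\rsum_ ( m <= i < n ) F"
  (at level 34, F at level 41, i, m, n at level 60).
Notation "\rsum_ ( i <- r | P ) F" := (\big[Rplus/0]_(i <- r | P%B) F) : R_scope.
Notation "\rsum_ ( i <- r ) F" := (\big[Rplus/0]_(i <- r) F) : R_scope.
Notation "\rsum_ ( m <= i < n | P ) F" := (\big[Rplus/0]_(m <= i < n | P%B) F) : R_scope.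
Notation "\rsum_ ( m <= i < n ) F" := (\big[Rplus/0]_(m <= i < n) F) : R_scope.

Lemma rsum_seq_ge0 (I : eqType) (r : seq I) (P : pred I) (F : I -> R) :
  (forall i, i \in r -> P i -> 0 <= F i) -> 0 <= \rsum_(i <- r | P i) F i.
Proof.
by move=> H; rewrite big_seq_cond; apply: big_ind => [|x y|i /andP [Hi Hp]]; [lra|lra|apply: H].
Qed.

Lemma rsum_seq_le (I : eqType) (r : seq I) (P : pred I) (F G : I -> R) :
  (forall i, i \in r -> P i -> F i <= G i) ->
  \rsum_(i <- r | P i) F i <= \rsum_(i <- r | P i) G i.
Proof.
move=> H; rewrite big_seq_cond [X in _ <= X]big_seq_cond.
by apply: (big_ind2 (fun x y => x <= y)) => [|x1 x2 y1 y2|i /andP [Hi Hp]]; [lra|lra|apply: H].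
Qed.

Lemma rsum_ge0 m n (P : pred nat) (F : nat -> R) :
  (forall i, (m <= i < n)%nat -> P i -> 0 <= F i) -> 0 <= \rsum_(m <= i < n | P i) F i.
Proof. by move=> H; apply: rsum_seq_ge0 => i; rewrite mem_index_iota; apply: H. Qed.

Lemma rsum_le m n (P : pred nat) (F G : nat -> R) :
  (forall i, (m <= i < n)%nat -> P i -> F i <= G i) ->
  \rsum_(m <= i < n | P i) F i <= \rsum_(m <= i < n | P i) G i.
Proof. by move=> H; apply: rsum_seq_le => i; rewrite mem_index_iota; apply: H. Qed.

Lemma rsum_scal (I : Type) (r : seq I) (P : pred I) (F : I -> R) c :
  \rsum_(i <- r | P i) (c * F i) = c * \rsum_(i <- r | P i) F i.
Proof. by rewrite big_distrr. Qed.

Lemma rsum_scar (I : Type) (r : seq I) (P : pred I) (F : I -> R) c :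
  \rsum_(i <- r | P i) (F i * c) = (\rsum_(i <- r | P i) F i) * c.
Proof. by rewrite big_distrl. Qed.

Lemma rsum_plus (I : Type) (r : seq I) (P : pred I) (F G : I -> R) :
  \rsum_(i <- r | P i) (F i + G i) = \rsum_(i <- r | P i) F i + \rsum_(i <- r | P i) G i.
Proof. by rewrite big_split. Qed.

Lemma rsum_opp (I : Type) (r : seq I) (P : pred I) (F : I -> R) :
  \rsum_(i <- r | P i) (- F i) = - \rsum_(i <- r | P i) F i.
Proof. by rewrite (big_morph Ropp Ropp_plus_distr Ropp_0). Qed.

Lemma rsum_minus (I : Type) (r : seq I) (P : pred I) (F G : I -> R) :
  \rsum_(i <- r | P i) (F i - G i) = \rsum_(i <- r | P i) F i - \rsum_(i <- r | P i) G i.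
Proof. by rewrite /Rminus rsum_plus rsum_opp. Qed.

Lemma rsum_abs (I : Type) (r : seq I) (P : pred I) (F : I -> R) :
  Rabs (\rsum_(i <- r | P i) F i) <= \rsum_(i <- r | P i) Rabs (F i).
Proof.
apply: (big_rec2 (fun x y => Rabs x <= y)) => [|i y1 y2 _ H]; first by rewrite Rabs_R0; lra.
by apply: Rle_trans (Rabs_triang _ _) _; lra.
Qed.

Lemma INR_sum (I : Type) (r : seq I) (P : pred I) (F : I -> nat) :
  INR (\sum_(i <- r | P i) F i)%nat = \rsum_(i <- r | P i) INR (F i).
Proof. by apply: (big_morph INR) => // x y; rewrite plus_INR. Qed.

Lemma INR_mul m n : INR (m * n)%nat = INR m * INR n.
Proof. exact: mult_INR. Qed.

Lemma INR_add m n : INR (m + n)%nat = INR m + INR n.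
Proof. exact: plus_INR. Qed.

Lemma INR_sub m n : (n <= m)%nat -> INR (m - n)%nat = INR m - INR n.
Proof. by move=> H; rewrite -minus_INR //; apply/leP. Qed.

Lemma INR_leq m n : (m <= n)%nat -> INR m <= INR n.
Proof. by move=> H; apply: le_INR; apply/leP. Qed.

Lemma INR_ltn m n : (m < n)%nat -> INR m < INR n.
Proof. by move=> H; apply: lt_INR; apply/leP. Qed.

Lemma INR_gt0 n : (0 < n)%nat -> 0 < INR n.
Proof. by move=> H; apply: lt_0_INR; apply/leP. Qed.

Lemma rsum_const m n (x : R) : (m <= n)%nat -> \rsum_(m <= i < n) x = INR (n - m) * x.
Proof.
elim: n => [|n IH]; first by case: m => // _; rewrite big_geq // Rmult_0_l.
rewrite leq_eqVlt => /orP [/eqP ->|H]; first by rewrite big_geq // subnn Rmult_0_l.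
by rewrite big_nat_recr // IH // subSn // S_INR /=; ring.
Qed.

Lemma rsum_widen m n n' (P : pred nat) (F : nat -> R) : (n <= n')%nat ->
  (forall i, (m <= i < n')%nat -> P i -> 0 <= F i) ->
  \rsum_(m <= i < n | P i) F i <= \rsum_(m <= i < n' | P i) F i.
Proof.
move=> Hn H; case: (leqP m n) => Hm; last by rewrite big_geq; [exact: rsum_ge0 | lia].
rewrite [X in _ <= X](@big_cat_nat _ _ _ n) //=.
have : 0 <= \rsum_(n <= i < n' | P i) F i by apply: rsum_ge0 => i Hi; apply: H; lia.
by move=> H0; lra.
Qed.

Lemma rsum_mult_of d N (G : nat -> R) : (0 < d)%nat ->
  \rsum_(1 <= k < N.+1 | d %| k) G k = \rsum_(1 <= m < N.+1 | (d * m <= N)%nat) G (d * m)%nat.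
Proof.
move=> Hd; rewrite -big_filter -[RHS]big_filter -(big_map (muln d) xpredT G).
apply: perm_big; apply: uniq_perm.
- by rewrite filter_uniq // iota_uniq.
- rewrite map_inj_uniq ?filter_uniq ?iota_uniq // => x y /eqP; rewrite eqn_pmul2l //.
  by move/eqP.
move=> k; rewrite mem_filter mem_index_iota; apply/andP/mapP.
  move=> [/dvdnP [m Hm] Hk]; exists m; last by rewrite mulnC.
  by rewrite mem_filter mem_index_iota; apply/andP; split; [lia|nia].
move=> [m]; rewrite mem_filter mem_index_iota => /andP [H1 H2] ->.
by split; [exact: dvdn_mulr | nia].
Qed.

(** The divisor function sigma. *)
Definition sg (k : nat) : R := \rsum_(1 <= d < k.+1 | d %| k) INR d.

Lemma sg_sum N (g : nat -> R) :
  \rsum_(1 <= k < N.+1) (sg k * g k) =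
  \rsum_(1 <= d < N.+1) \rsum_(1 <= m < N.+1 | (d * m <= N)%nat) (INR d * g (d * m)%nat).
Proof.
transitivity (\rsum_(1 <= k < N.+1) \rsum_(1 <= d < N.+1) (if d %| k then INR d * g k else 0)).
  apply: eq_big_nat => k Hk; rewrite -rsum_scar -big_mkcond [RHS](@big_cat_nat _ _ _ k.+1 1 N.+1) //=; last by lia.
  rewrite [X in _ + X]big_nat_cond [X in _ + X]big_pred0 ?Rplus_0_r // => i.
    apply/negP => /andP [Hi /dvdn_leq]; lia.
rewrite exchange_big /=.
by apply: eq_big_nat => d Hd; rewrite -big_mkcond -(@rsum_mult_of d N (fun k => INR d * g k)) //; lia.
Qed.

Lemma sg_ge0 k : 0 <= sg k.
Proof. by apply: rsum_ge0 => *; apply: pos_INR. Qed.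

Lemma sg_ge k : INR k <= sg k.
Proof.
case: k => [|k]; first exact: sg_ge0.
rewrite /sg big_mkcond big_nat_recr //= dvdnn.
have : 0 <= \rsum_(1 <= i < k.+1) (if i %| k.+1 then INR i else 0).
  by apply: rsum_ge0 => i _ _; case: ifP => _; [apply: pos_INR | lra].
by lra.
Qed.

Notation p n := (INR (npart n)).

Lemma p_rec N : INR N * p N = \rsum_(1 <= k < N.+1) (sg k * p (N - k)).
Proof.
rewrite sg_sum -INR_mul npart_rec INR_sum; apply: eq_big_nat => d _.
rewrite INR_sum [RHS]big_mkcond; apply: eq_big_nat => m _.
by case: ifP => // _; rewrite INR_mul.
Qed.

(** * Exponential sums *)

Lemma rsum_telescope m n (f : nat -> R) : (m <= n)%nat ->
  \rsum_(m <= i < n) (f i - f i.+1) = f m - f n.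
Proof.
elim: n => [|n IH]; first by case: m => // _; rewrite big_geq //; lra.
rewrite leq_eqVlt => /orP [/eqP ->|H]; first by rewrite big_geq //; lra.
by rewrite big_nat_recr //= IH //; lra.
Qed.

Lemma exp_le x y : x <= y -> exp x <= exp y.
Proof. by case=> [H|->]; [left; apply: exp_increasing | right]. Qed.

Lemma exp_ge1 x : 1 + x <= exp x.
Proof. exact: exp_ineq1_le. Qed.

Lemma pow_le_exp k y : (0 < k)%nat -> 0 <= y -> y ^ k <= INR k ^ k * exp y.
Proof.
move=> Hk Hy; have Hk' : 0 < INR k by apply: INR_gt0.
have -> : exp y = exp (y / INR k) ^ k.
  by rewrite -Rpower_pow ?/Rpower ?ln_exp; [congr exp; field; lra | apply: exp_pos].
rewrite -Rpow_mult_distr; apply: pow_incr; split=> //.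
have := exp_ge1 (y / INR k); have : y = INR k * (y / INR k) by field; lra.
have : 0 <= y / INR k by apply: Rmult_le_pos => //; left; apply: Rinv_0_lt_compat.
by set t := y / INR k => H1 -> H3; nra.
Qed.

(** By [1 + u <= exp u], each term is at most a telescoping difference divided by [u]. *)
Lemma exp_sum_le D u : 0 < u -> \rsum_(1 <= d < D) exp (- (INR d * u)) <= / u.
Proof.
move=> Hu; case: (leqP 1 D) => HD; last first.
  by rewrite big_geq; [left; apply: Rinv_0_lt_compat | lia].
apply: (Rle_trans _ (\rsum_(1 <= d < D)
   (exp (- (INR d.-1 * u)) / u - exp (- (INR d.+1.-1 * u)) / u))).
  apply: rsum_le => -[|d] // _ _; rewrite [d.+1.-1]/= [d.+2.-1]/= S_INR.
  have -> : exp (- (INR d * u)) = exp (- ((INR d + 1) * u)) * exp u.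
    by rewrite -exp_plus; congr exp; ring.
  have := exp_ge1 u; have := exp_pos (- ((INR d + 1) * u)).
  set E := exp (- _); set F := exp u => H1 H2.
  apply: (Rmult_le_reg_r u) => //; have -> : (E * F / u - E / u) * u = E * F - E by field; lra.
  nra.
rewrite (@rsum_telescope 1 D (fun d => exp (- (INR d.-1 * u)) / u)) //=.
rewrite Rmult_0_l Ropp_0 exp_0.
have := exp_pos (- (INR D.-1 * u)); have := Rinv_0_lt_compat _ Hu.
by move=> H1 H2; rewrite /Rdiv; nra.
Qed.

Lemma nonneg_derivative_le (f f' : R -> R) b : 0 <= b ->
  (forall x, 0 <= x <= b -> derivable_pt_lim f x (f' x)) ->
  (forall x, 0 <= x <= b -> 0 <= f' x) -> f 0 <= f b.
Proof.
case=> [Hb|<-]; last by lra.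
move=> Hd Hp; have [x [Hx1 Hx2]] := MVT_cor2 f f' 0 b Hb Hd.
have := Hp x; nra.
Qed.

Lemma derivable_exp_opp x : derivable_pt_lim (fun s => exp (- s)) x (- exp (- x)).
Proof.
have -> : - exp (- x) = exp (- x) * (-1) by ring.
apply: (derivable_pt_lim_comp Ropp exp); last exact: derivable_pt_lim_exp.
exact: (derivable_pt_lim_opp id x 1 (derivable_pt_lim_id x)).
Qed.

Lemma sinh_ge s : 0 <= s -> 2 * s <= exp s - exp (- s).
Proof.
move=> Hs; have := @nonneg_derivative_le (fun s => exp s - exp (- s) - 2 * s)
  (fun s => exp s - - exp (- s) - 2 * 1) s Hs.
rewrite Ropp_0 exp_0 => H; suff : 1 - 1 - 2 * 0 <= exp s - exp (- s) - 2 * s by lra.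
apply: H => x Hx.
  apply: derivable_pt_lim_minus.
    by apply: derivable_pt_lim_minus; [apply: derivable_pt_lim_exp | apply: derivable_exp_opp].
  exact: (derivable_pt_lim_scal id 2 x 1 (derivable_pt_lim_id x)).
by have := exp_ge1 x; have := exp_ge1 (- x); lra.
Qed.

Lemma exp_le_lin s : 0 <= s <= / 2 -> exp s <= 1 + 2 * s.
Proof.
move=> Hs; have H := exp_ge1 (- s); have H2 := exp_pos s.
have H3 : exp s * exp (- s) = 1 by rewrite -exp_plus -exp_0; congr exp; ring.
by nra.
Qed.

Lemma cosh_le s : 0 <= s <= / 2 -> exp s + exp (- s) <= 2 + 6 * s ^ 2.
Proof.
move=> Hs; have := @nonneg_derivative_le (fun s => 2 + 6 * s ^ 2 - (exp s + exp (- s)))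
  (fun s => 0 + 6 * (2 * s ^ 1) - (exp s + - exp (- s))) s (proj1 Hs).
rewrite Ropp_0 exp_0 => H.
suff : 2 + 6 * 0 ^ 2 - (1 + 1) <= 2 + 6 * s ^ 2 - (exp s + exp (- s)) by lra.
apply: H => x Hx.
  apply: derivable_pt_lim_minus; last first.
    by apply: derivable_pt_lim_plus; [apply: derivable_pt_lim_exp | apply: derivable_exp_opp].
  apply: derivable_pt_lim_plus; first exact: derivable_pt_lim_const.
  exact: (derivable_pt_lim_scal (fun y => y ^ 2) 6 x _ (derivable_pt_lim_pow x 2)).
have := @exp_le_lin x; have := exp_ge1 (- x); rewrite pow_1; lra.
Qed.

Lemma sinh_le s : 0 <= s <= / 2 -> exp s - exp (- s) <= 2 * s + 2 * s ^ 3.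
Proof.
move=> Hs; have := @nonneg_derivative_le (fun s => 2 * s + 2 * s ^ 3 - (exp s - exp (- s)))
  (fun s => 2 * 1 + 2 * (3 * s ^ 2) - (exp s - - exp (- s))) s (proj1 Hs).
rewrite Ropp_0 exp_0 => H.
suff : 2 * 0 + 2 * 0 ^ 3 - (1 - 1) <= 2 * s + 2 * s ^ 3 - (exp s - exp (- s)) by lra.
apply: H => x Hx.
  apply: derivable_pt_lim_minus; last first.
    by apply: derivable_pt_lim_minus; [apply: derivable_pt_lim_exp | apply: derivable_exp_opp].
  apply: derivable_pt_lim_plus.
    exact: (derivable_pt_lim_scal id 2 x 1 (derivable_pt_lim_id x)).
  have -> : 3 = INR 3 by rewrite /INR; ring.
  exact: (derivable_pt_lim_scal (fun y => y ^ 3) 2 x _ (derivable_pt_lim_pow x 3)).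
have := @cosh_le x; lra.
Qed.

Lemma geom_d_closed D y :
  (1 - y) ^ 2 * \rsum_(1 <= d < D.+1) (INR d * y ^ d)
  = y * (1 - (INR D + 1) * y ^ D + INR D * y ^ D.+1).
Proof.
elim: D => [|D IH]; first by rewrite big_geq //= /INR; ring.
rewrite big_nat_recr //= Rmult_plus_distr_l IH S_INR /=; ring.
Qed.

Lemma exp_opp_mul d u : exp (- (INR d * u)) = exp (- u) ^ d.
Proof.
rewrite -Rpower_pow ?/Rpower ?ln_exp; last exact: exp_pos.
by congr exp; ring.
Qed.

(** With [y = exp (- u)] the full series is [y / (1 - y) ^ 2], the inverse square of
    [2 sinh (u / 2)], and [2 sinh (u / 2) >= u]. *)
Lemma exp_d_sum_le D u : 0 < u ->
  \rsum_(1 <= d < D) (INR d * exp (- (INR d * u))) <= / u ^ 2.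
Proof.
move=> Hu; case: D => [|D]; first by rewrite big_geq //; left; apply: Rinv_0_lt_compat; nra.
under eq_bigr => d _ do rewrite exp_opp_mul.
set y := exp (- u); have := geom_d_closed D y; set S := (X in _ * X = _) => HS.
have Hy : 0 < y < 1 by split; [apply: exp_pos | rewrite -exp_0; apply: exp_increasing; lra].
have Hs : u * exp (- (u / 2)) <= 1 - y.
  have := @sinh_ge (u / 2); set E := exp (- (u / 2)).
  have -> : y = E * E by rewrite -exp_plus; congr exp; field.
  have : exp (u / 2) * E = 1 by rewrite -exp_plus -exp_0; congr exp; ring.
  have : 0 < E by apply: exp_pos.
  by move=> H1 H2 H3; nra.
have Hs2 : u ^ 2 * y <= (1 - y) ^ 2.
  have -> : u ^ 2 * y = (u * exp (- (u / 2))) ^ 2.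
    have -> : y = exp (- (u / 2)) * exp (- (u / 2)) by rewrite -exp_plus; congr exp; field.
    ring.
  by apply: pow_incr; split=> //; apply: Rmult_le_pos; [lra | left; apply: exp_pos].
have HyD : 0 <= y ^ D by apply: pow_le; lra.
have HD := pos_INR D.
have H1 : (1 - y) ^ 2 * S <= y.
  rewrite HS -[X in _ <= X]Rmult_1_r; apply: Rmult_le_compat_l; first lra.
  have H1 : INR D * y ^ D.+1 <= INR D * y ^ D by apply: Rmult_le_compat_l => //=; nra.
  lra.
have Hu2 : 0 < u ^ 2 by nra.
apply: (Rmult_le_reg_l (u ^ 2)) => //; rewrite Rinv_r; last lra.
have H1y : 0 < (1 - y) ^ 2 by nra.
apply: (Rmult_le_reg_l ((1 - y) ^ 2)) => //.
by have := Rmult_le_compat_l (u ^ 2) _ _ (Rlt_le _ _ Hu2) H1; rewrite -/S; lra.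
Qed.

(** From [2 sinh (u / 2) <= u + u ^ 3 / 4] the full series is at least [1 / u ^ 2 - 1]; the last
    factor bounds the loss from stopping at [D]. *)
Lemma exp_d_sum_ge D u : 0 < u <= 1 ->
  (/ u ^ 2 - 1) * (1 - (INR D + 1) * exp (- (INR D * u)))
  <= \rsum_(1 <= d < D.+1) (INR d * exp (- (INR d * u))).
Proof.
move=> Hu; under eq_bigr => d _ do rewrite exp_opp_mul.
rewrite exp_opp_mul.
set y := exp (- u); have := geom_d_closed D y; set S := (X in _ * X = _) => HS.
have Hy : 0 < y < 1 by split; [apply: exp_pos | rewrite -exp_0; apply: exp_increasing; lra].
have HyD : 0 <= y ^ D by apply: pow_le; lra.
have HD := pos_INR D.
set E := exp (- (u / 2)).
have HyE : y = E * E by rewrite -exp_plus; congr exp; field.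
have HE0 : 0 < E by apply: exp_pos.
have Hs : 1 - y <= E * (u + u ^ 3 / 4).
  have := @sinh_le (u / 2); rewrite -/E.
  have : exp (u / 2) * E = 1 by rewrite -exp_plus -exp_0; congr exp; ring.
  rewrite HyE => H1 H2; have {}H2 := H2 ltac:(lra).
  have := Rmult_le_compat_r E _ _ (Rlt_le _ _ HE0) H2; nra.
have Hs2 : (1 - y) ^ 2 <= y * (u ^ 2 * (1 + u ^ 2)).
  have : (1 - y) ^ 2 <= (E * (u + u ^ 3 / 4)) ^ 2 by apply: pow_incr; lra.
  have : (u + u ^ 3 / 4) ^ 2 <= u ^ 2 * (1 + u ^ 2).
    have -> : (u + u ^ 3 / 4) ^ 2 = u ^ 2 * (1 + u ^ 2 / 4) ^ 2 by field.
    have : 0 <= u ^ 2 <= 1 by nra.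
    by set v := u ^ 2 => Hv; apply: Rmult_le_compat_l; nra.
  move=> Ha Hb; apply: Rle_trans Hb _; rewrite Rpow_mult_distr HyE.
  have -> : E ^ 2 = E * E by ring.
  by apply: Rmult_le_compat_l => //; nra.
have Hu2 : 0 < u ^ 2 <= 1 by nra.
have H1y : 0 < (1 - y) ^ 2 by nra.
set Q := 1 - (INR D + 1) * y ^ D.
have HSQ : y * Q <= (1 - y) ^ 2 * S.
  have Hz : 0 <= INR D * y ^ D.+1 by apply: Rmult_le_pos => //; apply: pow_le; lra.
  by rewrite HS /Q; apply: Rmult_le_compat_l; lra.
have Hi : (/ u ^ 2 - 1) * (u ^ 2 * (1 + u ^ 2)) <= 1.
  by have -> : (/ u ^ 2 - 1) * (u ^ 2 * (1 + u ^ 2)) = (1 - u ^ 2) * (1 + u ^ 2); [field; lra | nra].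
have Hi0 : 0 <= / u ^ 2 - 1.
  by have := Rinv_le_contravar _ _ (proj1 Hu2) (proj2 Hu2); rewrite Rinv_1; lra.
have HS0 : 0 <= S.
  by apply: rsum_ge0 => i _ _; apply: Rmult_le_pos; [apply: pos_INR | apply: pow_le; lra].
case: (Rle_dec Q 0) => HQ; first by apply: Rle_trans HS0; nra.
apply: (Rmult_le_reg_l ((1 - y) ^ 2)) => //.
apply: Rle_trans HSQ; set k := / u ^ 2 - 1 in Hi Hi0 *.
have : (1 - y) ^ 2 * k <= y.
  apply: (Rle_trans _ (y * (u ^ 2 * (1 + u ^ 2)) * k)); first by nra.
  nra.
nra.
Qed.

Arguments pow : simpl never.

Lemma nat_floor x : 0 <= x -> exists M, INR M <= x < INR M + 1.
Proof.
move=> Hx; have [n] := INR_unbounded x.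
elim: n => [|n IH] Hn; first by move: Hn; rewrite /INR; lra.
by case: (Rlt_le_dec x (INR n)) => [/IH //|H]; exists n; rewrite -S_INR.
Qed.

(** * The sum of inverse squares, and divisor sums weighted by exponentials *)

Definition invsq_sum (M : nat) : R := \rsum_(1 <= m < M.+1) / INR m ^ 2.

Lemma invsq_sum_mono M M' : (M <= M')%nat -> invsq_sum M <= invsq_sum M'.
Proof.
move=> H; apply: rsum_widen => // i Hi _; left; apply: Rinv_0_lt_compat.
by apply: pow_lt; apply: INR_gt0; lia.
Qed.

Lemma invsq_sum_tail M M' : (0 < M)%nat -> invsq_sum M' <= invsq_sum M + / INR M.
Proof.
move=> HM; have HM' := INR_gt0 HM; have Hi := Rinv_0_lt_compat _ HM'.
case: (leqP M' M) => H; first by have := invsq_sum_mono H; lra.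
rewrite /invsq_sum [X in X <= _](@big_cat_nat _ _ _ M.+1) //=; last by lia.
have Hc : \rsum_(M.+1 <= i < M'.+1) / INR i ^ 2 <= / INR M.
  apply: (Rle_trans _ (\rsum_(M.+1 <= i < M'.+1) (/ INR i.-1 - / INR i.+1.-1))).
    apply: rsum_le => -[|i] // Hii _ /=; rewrite S_INR.
    have H0 : 0 < INR i by apply: INR_gt0; lia.
    have -> : / INR i - / (INR i + 1) = / (INR i * (INR i + 1)) by field; lra.
    by apply: Rinv_le_contravar; nra.
  rewrite (@rsum_telescope M.+1 M'.+1 (fun i => / INR i.-1)) //=; last by lia.
  have : 0 < / INR M' by apply: Rinv_0_lt_compat; apply: INR_gt0; lia.
  by lra.
lra.
Qed.

Lemma invsq_sum_bounded : bound (fun x => exists M, x = invsq_sum M).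
Proof.
exists 2 => _ [M ->]; have := @invsq_sum_tail 1 M isT.
by rewrite {2}/invsq_sum big_nat1 /INR; lra.
Qed.

Lemma invsq_sum_inhabited : exists x, exists M, x = invsq_sum M.
Proof. by exists (invsq_sum 0), 0%nat. Qed.

(** This is pi^2 / 6. The proof works with the bounds [1 < zeta2 <= 2] and with the tail
    estimate. *)
Definition zeta2 : R := proj1_sig (completeness _ invsq_sum_bounded invsq_sum_inhabited).

Lemma invsq_sum_le_zeta2 M : invsq_sum M <= zeta2.
Proof. by rewrite /zeta2; case: completeness => z [H _] /=; apply: H; exists M. Qed.

Lemma zeta2_le_tail M : (0 < M)%nat -> zeta2 <= invsq_sum M + / INR M.
Proof.
move=> HM; rewrite /zeta2; case: completeness => z [_ H] /=; apply: H => _ [M' ->].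
exact: invsq_sum_tail.
Qed.

Lemma zeta2_gt1 : 1 < zeta2.
Proof.
have := invsq_sum_le_zeta2 2; rewrite /invsq_sum big_nat_recr //= big_nat1 /INR; lra.
Qed.

Lemma zeta2_le2 : zeta2 <= 2.
Proof. have := @zeta2_le_tail 1 isT; rewrite /invsq_sum big_nat1 /INR; lra. Qed.

(** Writing [k = d * m], the inner sum over [d] is at most [1 / (m x) ^ 2]. *)
Lemma sg_exp_le n x : 0 < x ->
  \rsum_(1 <= k < n.+1) (sg k * exp (- (INR k * x))) <= zeta2 / x ^ 2.
Proof.
move=> Hx; rewrite (sg_sum n (fun k => exp (- (INR k * x)))).
apply: (Rle_trans _ (\rsum_(1 <= d < n.+1) \rsum_(1 <= m < n.+1)
   (INR d * exp (- (INR d * (INR m * x)))))).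
  apply: rsum_le => d _ _; rewrite big_mkcond; apply: rsum_le => m _ _; case: ifP => _.
    by right; rewrite INR_mul; congr (_ * exp _); ring.
  by apply: Rmult_le_pos; [apply: pos_INR | left; apply: exp_pos].
rewrite exchange_big /=.
apply: (Rle_trans _ (\rsum_(1 <= m < n.+1) (/ INR m ^ 2 * / x ^ 2))).
  apply: rsum_le => m Hm _; have H0 : 0 < INR m by apply: INR_gt0; lia.
  by rewrite -Rinv_mult -Rpow_mult_distr; apply: exp_d_sum_le; nra.
rewrite rsum_scar; apply: Rmult_le_compat_r; last exact: invsq_sum_le_zeta2.
by left; apply: Rinv_0_lt_compat; nra.
Qed.

(** Half of the exponential absorbs the power of [d]; the factors [m ^ a] then cancel and the sum of
    [1 / m ^ 2] remains. *)
Lemma sg_exp_moment a : exists C, 0 < C /\ forall n x, 0 < x ->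
  \rsum_(1 <= k < n.+1) (sg k * (INR k ^ a * exp (- (INR k * x)))) <= C / x ^ (a + 2).
Proof.
set K := (INR a.+1 ^ a.+1 * 2 ^ (a.+2)); exists (K * 2).
have HK : 0 < K by apply: Rmult_lt_0_compat; apply: pow_lt; [apply: INR_gt0 | lra].
split; first lra.
move=> n x Hx; rewrite (sg_sum n (fun k => INR k ^ a * exp (- (INR k * x)))).
apply: (Rle_trans _ (\rsum_(1 <= d < n.+1) \rsum_(1 <= m < n.+1)
   (INR m ^ a * (INR d ^ a.+1 * exp (- (INR d * (INR m * x))))))).
  apply: rsum_le => d _ _; rewrite big_mkcond; apply: rsum_le => m _ _; case: ifP => _.
    right; rewrite INR_mul Rpow_mult_distr -tech_pow_Rmult.
    by rewrite (_ : INR d * INR m * x = INR d * (INR m * x)); ring.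
  apply: Rmult_le_pos; first by apply: pow_le; apply: pos_INR.
  by apply: Rmult_le_pos; [apply: pow_le; apply: pos_INR | left; apply: exp_pos].
rewrite exchange_big /=.
have Hxa : 0 < / x ^ (a + 2) by apply: Rinv_0_lt_compat; apply: pow_lt.
apply: (Rle_trans _ (\rsum_(1 <= m < n.+1) (/ INR m ^ 2 * (K / x ^ (a + 2))))); last first.
  rewrite rsum_scar /Rdiv; have := invsq_sum_le_zeta2 n; have := zeta2_le2.
  rewrite /invsq_sum; set S := (X in X <= zeta2) => H1 H2.
  have : 0 < K * / x ^ (a + 2) by nra.
  move=> H3; apply: (Rle_trans _ (2 * (K * / x ^ (a + 2)))); last by right; ring.
  by apply: Rmult_le_compat_r; [lra | exact: Rle_trans H2 H1].
apply: rsum_le => m Hm _; have H0 : 0 < INR m by apply: INR_gt0; lia.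
rewrite rsum_scal; set u := INR m * x; have Hu : 0 < u by apply: Rmult_lt_0_compat.
have Hd d : INR d ^ a.+1 * exp (- (INR d * u)) <=
    (INR a.+1 * (2 / u)) ^ a.+1 * exp (- (INR d * (u / 2))).
  have Hdu : 0 <= INR d * (u / 2) by apply: Rmult_le_pos; [apply: pos_INR | lra].
  have := @pow_le_exp a.+1 _ isT Hdu.
  have -> : exp (- (INR d * u)) = exp (- (INR d * (u / 2))) * exp (- (INR d * (u / 2))).
    by rewrite -exp_plus; congr exp; field.
  have He : exp (INR d * (u / 2)) * exp (- (INR d * (u / 2))) = 1.
    by rewrite -exp_plus -exp_0; congr exp; ring.
  have H2u : (2 / u) ^ a.+1 * (u / 2) ^ a.+1 = 1.
    by rewrite -Rpow_mult_distr (_ : 2 / u * (u / 2) = 1) ?pow1 //; field; lra.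
  have Hp : 0 < (2 / u) ^ a.+1.
    by apply: pow_lt; apply: Rmult_lt_0_compat; [lra | apply: Rinv_0_lt_compat].
  rewrite (Rpow_mult_distr (INR d) (u / 2)) (Rpow_mult_distr (INR a.+1) (2 / u)); move: He (exp_pos (- (INR d * (u / 2)))) H2u Hp.
  set E := exp _; set F := exp _; set A := _ ^ _; set B := _ ^ _; set D := _ ^ _; set G := _ ^ _.
  move=> HEF HF HAB HA HDB.
  rewrite -Rmult_assoc; apply: Rmult_le_compat_r; first lra.
  have -> : D * F = A * (D * B) * F by rewrite -{1}(Rmult_1_l D) -HAB; ring.
  apply: (Rle_trans _ (A * (G * E) * F)); last by right; rewrite -(Rmult_1_r (G * A)) -HEF; ring.
  by apply: Rmult_le_compat_r; [lra | apply: Rmult_le_compat_l; lra].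
apply: (Rle_trans _ (INR m ^ a * ((INR a.+1 * (2 / u)) ^ a.+1 * (2 / u)))).
  apply: Rmult_le_compat_l; first by apply: pow_le; lra.
  apply: (Rle_trans _ (\rsum_(1 <= d < n.+1)
     ((INR a.+1 * (2 / u)) ^ a.+1 * exp (- (INR d * (u / 2)))))).
    by apply: rsum_le => d _ _; apply: Hd.
  rewrite rsum_scal; apply: Rmult_le_compat_l.
    by apply: pow_le; apply: Rmult_le_pos; [apply: pos_INR | left; apply: Rdiv_lt_0_compat; lra].
  have -> : 2 / u = / (u / 2) by field; lra.
  by apply: exp_sum_le; lra.
right; rewrite (_ : (a + 2)%nat = a.+2); last by lia.
rewrite /K /u /Rdiv !Rpow_mult_distr pow_inv !Rpow_mult_distr -!tech_pow_Rmult !pow_O; field.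
by repeat split; try apply: pow_nonzero; lra.
Qed.

(* The factor [1 - / u ^ 2] lost in [exp_d_sum_ge] costs one unit for each of
   the [1 / x] values of [m] that matter, hence an error of order [1 / x]. *)
Lemma sg_exp_ge n x : 0 < x <= 1 -> 2 <= INR n * x ->
  (INR n + 1) * exp (- (INR n * x / 2)) <= x ->
  zeta2 / x ^ 2 - 6 / x <= \rsum_(1 <= k < n.+1) (sg k * exp (- (INR k * x))).
Proof.
move=> Hx Hnx He; rewrite (sg_sum n (fun k => exp (- (INR k * x)))).
have Hix : 1 <= / x by rewrite -Rinv_1; apply: Rinv_le_contravar; lra.
(* [m <= M] is the range [m x <= 1], in which [exp_d_sum_ge] applies. *)
have [M [HM1 HM2]] : exists M, INR M <= / x < INR M + 1 by apply: nat_floor; lra.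
have HM : (0 < M)%nat.
  by case: M HM1 HM2 => // _; rewrite {1}/INR; lra.
have HM0 := INR_gt0 HM.
have Hxx : x * / x = 1 by field; lra.
have HMn : (2 * M <= n)%nat.
  apply/leP; apply: INR_le; rewrite INR_mul (_ : INR 2 = 2) //.
  nra.
set eps := (INR n + 1) * exp (- (INR n * x / 2)) in He.
have Heps : 0 <= eps by apply: Rmult_le_pos; [have := pos_INR n; lra | left; apply: exp_pos].
apply: (Rle_trans _ (\rsum_(1 <= m < M.+1) ((/ (INR m * x) ^ 2 - 1) * (1 - eps)))); last first.
  rewrite (exchange_big_dep_nat xpredT) //=.
  apply: (Rle_trans _ (\rsum_(1 <= m < M.+1) \rsum_(1 <= d < n.+1 | (d * m <= n)%nat)
      (INR d * exp (- (INR (d * m) * x))))); last first.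
    apply: rsum_widen => [|m _ _]; first lia.
    by apply: rsum_ge0 => d _ _; apply: Rmult_le_pos; [apply: pos_INR | left; apply: exp_pos].
  apply: rsum_le => m Hm _; have H0 : 0 < INR m by apply: INR_gt0; lia.
  have Hm1 : INR m * x <= 1.
    have : INR m <= INR M by apply: INR_leq; lia.
    nra.
  have Hmx : 0 < INR m * x by nra.
  apply: (Rle_trans _ (\rsum_(1 <= d < (n %/ m).+1) (INR d * exp (- (INR d * (INR m * x)))))).
    apply: Rle_trans (exp_d_sum_ge (n %/ m) (conj Hmx Hm1)).
    apply: Rmult_le_compat_l.
      have : 1 <= / (INR m * x) ^ 2.
        by rewrite -Rinv_1; apply: Rinv_le_contravar; nra.
      lra.
    have HD : INR (n %/ m) <= INR n by apply: INR_leq; exact: leq_div.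
    have HDm : INR n / 2 <= INR (n %/ m) * INR m.
      rewrite -INR_mul; have : INR n <= INR (2 * (n %/ m * m)).
        by apply: INR_leq; have := divn_eq n m; have := @ltn_pmod n m; lia.
      by rewrite INR_mul (_ : INR 2 = 2) //; lra.
    have HE : exp (- (INR (n %/ m) * (INR m * x))) <= exp (- (INR n * x / 2)).
      by apply: exp_le; nra.
    have : 0 <= INR (n %/ m) by apply: pos_INR.
    have := exp_pos (- (INR (n %/ m) * (INR m * x))).
    rewrite /eps; nra.
  rewrite [X in _ <= X]big_mkcond /=.
  rewrite [X in _ <= X](@big_cat_nat _ _ _ (n %/ m).+1) //=; last by rewrite ltnS leq_div.
  set T := (X in _ <= _ + X); have HT : 0 <= T.
    apply: rsum_ge0 => d _ _; case: ifP => _; last lra.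
    by apply: Rmult_le_pos; [apply: pos_INR | left; apply: exp_pos].
  set U := (X in _ <= X + _); suff -> : \rsum_(1 <= d < (n %/ m).+1)
     (INR d * exp (- (INR d * (INR m * x)))) = U by lra.
  apply: eq_big_nat => d Hd; rewrite ifT.
    by rewrite INR_mul; congr (_ * exp _); ring.
  by apply: leq_trans (leq_divM n m); rewrite leq_mul2r; lia.
rewrite rsum_scar rsum_minus rsum_const // subn1 /= Rmult_1_r.
have -> : \rsum_(1 <= i < M.+1) / (INR i * x) ^ 2 = invsq_sum M * / x ^ 2.
  rewrite -rsum_scar; apply: eq_big_nat => i _.
  by rewrite Rpow_mult_distr Rinv_mult.
have H1 := zeta2_le_tail HM; have H2 := invsq_sum_le_zeta2 M; have H3 := zeta2_le2.
have H4 : / INR M <= 2 * x.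
  have : / INR M * INR M = 1 by field; lra.
  have : 0 < / INR M by apply: Rinv_0_lt_compat.
  have : 1 <= INR M by apply: (@INR_leq 1).
  nra.
have Hx2 : / x ^ 2 = / x * / x by field; lra.
rewrite /Rdiv Hx2; set y := / x in Hix HM1 HM2 Hxx *; set S := invsq_sum M in H1 H2 *.
have H5 : S * (y * y) >= zeta2 * (y * y) - 2 * y.
  have : zeta2 * (y * y) <= (S + 2 * x) * (y * y) by apply: Rmult_le_compat_r; nra.
  have : 2 * x * (y * y) = 2 * y * (x * y) by ring.
  rewrite Hxx; nra.
have H6 : eps * (S * (y * y)) <= 2 * y.
  apply: (Rle_trans _ (x * (2 * (y * y)))).
    have : 0 <= S by apply: rsum_ge0 => i Hi _; left; apply: Rinv_0_lt_compat; apply: pow_lt; apply: INR_gt0; lia.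
    move=> HS; apply: Rmult_le_compat => //; nra.
  have -> : x * (2 * (y * y)) = 2 * y * (x * y) by ring.
  by rewrite Hxx; lra.
have : 0 <= eps * INR M by nra.
nra.
Qed.

(** * Growth of the partition function *)

Lemma p_gt0 n : 0 < p n.
Proof. exact/INR_gt0/npart_gt0. Qed.

Lemma p_ge1 n : 1 <= p n.
Proof. by apply: (@INR_leq 1); exact: npart_gt0. Qed.

Lemma p_le m n : (m <= n)%nat -> p m <= p n.
Proof. by move=> H; apply/INR_leq/npart_le. Qed.

Lemma INR_ge1 n : (0 < n)%nat -> 1 <= INR n.
Proof. exact: (@INR_leq 1). Qed.

Lemma sqrt_INR_ge1 n : (0 < n)%nat -> 1 <= sqrt (INR n).
Proof. by move=> H; rewrite -sqrt_1; apply: sqrt_le_1_alt; apply: INR_ge1. Qed.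

Lemma sqrt_INR_sqr n : sqrt (INR n) * sqrt (INR n) = INR n.
Proof. by apply: sqrt_sqrt; apply: pos_INR. Qed.

Lemma rsum_nat_id L : \rsum_(1 <= k < L.+1) INR k = INR L * (INR L + 1) / 2.
Proof.
elim: L => [|L IH]; first by rewrite big_geq // /INR; field.
by rewrite big_nat_recr //= IH !S_INR; field.
Qed.

Lemma exp_m1_ge : / 3 <= exp (- (1)).
Proof. by rewrite exp_Ropp; apply: Rinv_le_contravar; [apply: exp_pos | apply: exp_le_3]. Qed.

(** The first [L] terms of the recurrence are at least [k p (n - L)] each, together at least
    [9 n p (n - L) / 2], while all terms sum to [n p n]; and [2 / 9] is below [exp (- 1)]. *)
Lemma p_decay_step n L : (0 < n)%nat -> (L <= n)%nat -> (9 * n <= L * L)%nat ->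
  p (n - L) <= exp (- (1)) * p n.
Proof.
move=> Hn HL H9.
have Hrec : p (n - L) * (INR L * (INR L + 1) / 2) <= INR n * p n.
  rewrite p_rec -rsum_nat_id -rsum_scal.
  apply: (Rle_trans _ (\rsum_(1 <= k < L.+1) (sg k * p (n - k)))).
    apply: rsum_le => k Hk _; rewrite Rmult_comm.
    apply: Rmult_le_compat; [exact: pos_INR | exact: pos_INR | exact: sg_ge | ].
    by apply: p_le; lia.
  by apply: rsum_widen => // k _ _; apply: Rmult_le_pos; [apply: sg_ge0 | apply: pos_INR].
have H1 : 9 * INR n <= INR L * INR L.
  by rewrite -INR_mul (_ : 9 = INR 9) -?INR_mul; [apply: INR_leq | rewrite /INR; ring].
have H2 := INR_gt0 Hn; have H3 := pos_INR L; have H4 := p_gt0 (n - L).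
have H5 := exp_m1_ge; have H6 := p_gt0 n.
have : p (n - L) * (9 * INR n / 2) <= INR n * p n.
  apply: Rle_trans Hrec; apply: Rmult_le_compat_l; lra.
move=> H7; have : p (n - L) * (9 / 2) <= p n.
  by apply: (Rmult_le_reg_l (INR n)) => //; lra.
nra.
Qed.

Lemma p_decay_steps n L k : (0 < L)%nat -> (k <= n)%nat -> (9 * n <= L * L)%nat ->
  p (n - k) <= exp (1 - INR k / INR L) * p n.
Proof.
move=> HL; have HL0 := INR_gt0 HL.
elim/ltn_ind: k n => k IH n Hk H9; case: (leqP L k) => HkL; last first.
  apply: (Rle_trans _ (1 * p n)); first by rewrite Rmult_1_l; apply: p_le; lia.
  apply: Rmult_le_compat_r; first exact: pos_INR.
  rewrite -{1}exp_0; apply: exp_le.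
  have : INR k / INR L <= 1.
    by apply: (Rmult_le_reg_r (INR L)) => //; have := INR_ltn HkL;
      rewrite /Rdiv Rmult_assoc Rinv_l; lra.
  lra.
have -> : (n - k = (n - L) - (k - L))%nat by lia.
apply: Rle_trans (IH _ _ _ _ _) _; [lia|lia|lia|].
have Hst : p (n - L) <= exp (- (1)) * p n by apply: p_decay_step; lia.
apply: (Rle_trans _ (exp (1 - INR (k - L) / INR L) * (exp (- (1)) * p n))).
  by apply: Rmult_le_compat_l => //; left; apply: exp_pos.
right; rewrite -Rmult_assoc -exp_plus; congr (exp _ * _).
by rewrite INR_sub //; field; lra.
Qed.

Lemma p_decay n k : (0 < n)%nat -> (k <= n)%nat ->
  p (n - k) <= exp (1 - INR k / (4 * sqrt (INR n))) * p n.
Proof.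
move=> Hn Hk; have H1 := sqrt_INR_ge1 Hn; have H2 := sqrt_INR_sqr n.
set s := sqrt (INR n) in H1 H2 *.
(* [L] lies between [3 sqrt n] and [4 sqrt n]: the lower bound is the hypothesis of [p_decay_steps],
   the upper one fixes the rate. *)
have [L [HL1 HL2]] : exists M, INR M <= 4 * s < INR M + 1 by apply: nat_floor; lra.
have HL0 : (0 < L)%nat by case: L HL1 HL2 => // _; rewrite /INR; lra.
have H9 : (9 * n <= L * L)%nat.
  apply/leP; apply: INR_le; rewrite !INR_mul -H2 (_ : INR 9 = 9); last by rewrite /INR; ring.
  nra.
apply: Rle_trans (p_decay_steps HL0 Hk H9) _.
apply: Rmult_le_compat_r; first exact: pos_INR.
apply: exp_le; have HL := INR_gt0 HL0.
have : INR k * / (4 * s) <= INR k * / INR L.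
  by apply: Rmult_le_compat_l; [apply: pos_INR | apply: Rinv_le_contravar].
rewrite /Rdiv; lra.
Qed.

Lemma sg_p_moment a : exists C, 0 < C /\ forall n, (0 < n)%nat ->
  \rsum_(1 <= k < n.+1) (sg k * (INR k ^ a * p (n - k))) <= C * sqrt (INR n) ^ (a + 2) * p n.
Proof.
have [C [HC H]] := sg_exp_moment a; exists (exp 1 * C * 4 ^ (a + 2)).
split.
  apply: Rmult_lt_0_compat; last by apply: pow_lt; lra.
  by apply: Rmult_lt_0_compat => //; apply: exp_pos.
move=> n Hn; have Hs := sqrt_INR_ge1 Hn; set s := sqrt _ in Hs *.
have Hx : 0 < / (4 * s) by apply: Rinv_0_lt_compat; lra.
have := H n _ Hx; set S := (X in X <= _) => HS.
apply: (Rle_trans _ (S * (exp 1 * p n))).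
  rewrite /S -rsum_scar; apply: rsum_le => k Hk _.
  rewrite (Rmult_assoc (sg k)) (Rmult_assoc (INR k ^ a)).
  apply: Rmult_le_compat_l; first exact: sg_ge0.
  apply: Rmult_le_compat_l; first by apply: pow_le; apply: pos_INR.
  apply: Rle_trans (p_decay Hn _) _; first by lia.
  by right; rewrite -Rmult_assoc -exp_plus -/s /Rdiv; congr (exp _ * _); ring.
apply: (Rle_trans _ (C / (/ (4 * s)) ^ (a + 2) * (exp 1 * p n))).
  apply: Rmult_le_compat_r => //; apply: Rmult_le_pos; [left; apply: exp_pos | apply: pos_INR].
right; rewrite pow_inv /Rdiv Rinv_inv Rpow_mult_distr; ring.
Qed.

(** Rankin's trick: [1 <= exp (1 - k / X)] for [k <= X]. *)
Lemma sg_partial : exists C, 0 < C /\ forall X,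
  \rsum_(1 <= k < X.+1) sg k <= C * INR X ^ 2.
Proof.
have [C [HC H]] := sg_exp_moment 0; exists (exp 1 * C); split.
  by apply: Rmult_lt_0_compat => //; apply: exp_pos.
case=> [|X]; first by rewrite big_geq // /INR; lra.
have HX := @INR_gt0 X.+1 isT; have HX' := Rinv_0_lt_compat _ HX.
have := H X.+1 _ HX'; rewrite pow_inv /Rdiv Rinv_inv => H1.
rewrite Rmult_assoc.
apply: Rle_trans (Rmult_le_compat_l (exp 1) _ _ _ H1); last by left; apply: exp_pos.
rewrite -rsum_scal; apply: rsum_le => k Hk _; rewrite pow_O Rmult_1_l.
have -> : exp 1 * (sg k * exp (- (INR k * / INR X.+1)))
   = sg k * exp (1 - INR k * / INR X.+1) by rewrite /Rminus exp_plus; ring.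
rewrite -[X in X <= _]Rmult_1_r; apply: Rmult_le_compat_l; first exact: sg_ge0.
rewrite -{1}exp_0; apply: exp_le.
have : INR k <= INR X.+1 by apply: INR_leq; lia.
move=> Hkx; have := Rmult_le_compat_r _ _ _ (Rlt_le _ _ HX') Hkx.
by rewrite Rinv_r; lra.
Qed.

(** The terms with [k] below a small multiple of [sqrt n] carry at most half of the recurrence. This
    gives a lower bound for the typical step of the kernel. *)
Lemma sg_p_small : exists dl, 0 < dl <= / 2 /\ forall n X, (0 < n)%nat -> (X <= n)%nat ->
  INR X <= dl * sqrt (INR n) ->
  \rsum_(1 <= k < X.+1) (sg k * p (n - k)) <= INR n * p n / 2.
Proof.
have [C [HC H]] := sg_partial.
exists (/ (2 * (C + 1))); split.
  by split; [apply: Rinv_0_lt_compat; lra | apply: Rinv_le_contravar; lra].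
move=> n X Hn HXn HX.
apply: (Rle_trans _ (\rsum_(1 <= k < X.+1) (sg k * p n))).
  by apply: rsum_le => k _ _; apply: Rmult_le_compat_l; [apply: sg_ge0 | apply: p_le; lia].
rewrite rsum_scar; apply: (Rle_trans _ (C * INR X ^ 2 * p n)).
  by apply: Rmult_le_compat_r; [apply: pos_INR | apply: H].
have Hs := sqrt_INR_sqr n; have Hs1 := sqrt_INR_ge1 Hn.
set s := sqrt _ in HX Hs Hs1.
have -> : INR n * p n / 2 = INR n / 2 * p n by field.
apply: Rmult_le_compat_r; first exact: pos_INR.
have HX0 := pos_INR X.
have HX2 : INR X * (2 * (C + 1)) <= s.
  have := Rmult_le_compat_r (2 * (C + 1)) _ _ ltac:(lra) HX.
  by rewrite (_ : / (2 * (C + 1)) * s * (2 * (C + 1)) = s) //; field; lra.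
rewrite -Hs; have -> : INR X ^ 2 = INR X * INR X by ring.
have : (INR X * (2 * (C + 1))) * (INR X * (2 * (C + 1))) <= s * s.
  by apply: Rmult_le_compat => //; nra.
have : 0 <= INR X * INR X by nra.
set Y := INR X * INR X => HY.
have -> : INR X * (2 * (C + 1)) * (INR X * (2 * (C + 1))) = Y * (4 * (C + 1) * (C + 1)) by rewrite /Y; ring.
nra.
Qed.

(** At least half of [n p n] comes from the terms [p (n - j)] with [j > k]. Reading [n - j] as
    [(n - k) - (j - k)], the decay bounds them by multiples of [p (n - k)] whose weights sum to
    O(n). *)
Lemma p_harnack1 : exists dl C, 0 < dl <= / 2 /\ 1 <= C /\
  forall n k, (0 < n)%nat -> INR k <= dl * sqrt (INR n) -> p n <= C * p (n - k).
Proof.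
have [dl [Hdl H]] := sg_p_small; have [C [HC HM]] := sg_exp_moment 0.
exists dl, (32 * C * exp 2 + 1); split => //; split.
  by have := exp_pos 2; nra.
move=> n k Hn Hk.
have Hs := sqrt_INR_sqr n; have Hs1 := sqrt_INR_ge1 Hn.
have Hkn : (k < n)%nat.
  apply/ltP; apply: INR_lt; set s := sqrt _ in Hk Hs Hs1; nra.
have H1 := H n k Hn (ltnW Hkn) Hk.
have H2 := p_rec n.
have H3 : \rsum_(k.+1 <= j < n.+1) (sg j * p (n - j)) >= INR n * p n / 2.
  rewrite (@big_cat_nat _ _ _ k.+1) /= in H2; [|by []|by lia]; lra.
set s := sqrt _ in Hk Hs Hs1.
have Hx : 0 < / (4 * s) by apply: Rinv_0_lt_compat; lra.
have := HM n _ Hx; set S := (X in X <= _) => HS.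
have H4 : \rsum_(k.+1 <= j < n.+1) (sg j * p (n - j)) <= S * (exp 2 * p (n - k)).
  rewrite /S -rsum_scar [X in _ <= X](@big_cat_nat _ _ _ k.+1) //=; last by lia.
  set T := (X in _ <= X + _); have HT : 0 <= T.
    apply: rsum_ge0 => j _ _; apply: Rmult_le_pos.
      apply: Rmult_le_pos; first exact: sg_ge0.
      by apply: Rmult_le_pos; [rewrite pow_O; lra | left; apply: exp_pos].
    by apply: Rmult_le_pos; [left; apply: exp_pos | apply: pos_INR].
  apply: (Rle_trans _ (0 + \rsum_(k.+1 <= j < n.+1)
     (sg j * (INR j ^ 0 * exp (- (INR j * / (4 * s)))) * (exp 2 * p (n - k)))));
     last by apply: Rplus_le_compat_r.
  rewrite Rplus_0_l; apply: rsum_le => j Hj _.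
  rewrite (Rmult_assoc (sg j)); apply: Rmult_le_compat_l; first exact: sg_ge0.
  rewrite pow_O Rmult_1_l.
  have -> : (n - j = (n - k) - (j - k))%nat by lia.
  apply: Rle_trans (@p_decay (n - k) (j - k) _ _) _; [lia|lia|].
  rewrite -Rmult_assoc -exp_plus; apply: Rmult_le_compat_r; first exact: pos_INR.
  apply: exp_le.
  have Hs' : 1 <= sqrt (INR (n - k)) by apply: sqrt_INR_ge1; lia.
  have Hs2 : sqrt (INR (n - k)) <= s by apply: sqrt_le_1_alt; apply: INR_leq; lia.
  have : INR (j - k) * / (4 * s) <= INR (j - k) / (4 * sqrt (INR (n - k))).
    by apply: Rmult_le_compat_l; [apply: pos_INR | apply: Rinv_le_contravar; lra].
  rewrite INR_sub; last by lia.
  have : INR k * / (4 * s) <= 1.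
    apply: (Rmult_le_reg_r (4 * s)); first lra.
    rewrite Rmult_assoc Rinv_l; nra.
  nra.
have HS2 : S <= 16 * C * INR n.
  by apply: Rle_trans HS _; right; rewrite -Hs add0n; field; lra.
have Hp := p_gt0 (n - k); have He := exp_pos 2.
have H5 : INR n * p n / 2 <= 16 * C * INR n * (exp 2 * p (n - k)).
  apply: Rle_trans (Rge_le _ _ H3) _; apply: Rle_trans H4 _.
  by apply: Rmult_le_compat_r => //; nra.
have Hn0 := INR_gt0 Hn.
apply: (Rle_trans _ (32 * C * exp 2 * p (n - k))); last by nra.
apply: (Rmult_le_reg_l (INR n)) => //; nra.
Qed.

(** Chains [p_harnack1]: [i] steps of length at most [t] cover every admissible [k], and
    [2 * k <= n] keeps the square roots along the chain comparable with [sqrt n]. *)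
Lemma p_harnack J : exists n0 C, (0 < n0)%nat /\ 1 <= C /\
  forall n k, (n0 <= n)%nat -> (2 * k <= n)%nat -> INR k <= J * sqrt (INR n) ->
  p n <= C * p (n - k).
Proof.
have [dl [C [Hdl [HC H]]]] := p_harnack1.
have [n0 [Hn0 _]] : exists M, 16 / (dl * dl) <= INR M /\ True.
  by have [M HM] := INR_unbounded (16 / (dl * dl)); exists M; split; [lra|].
have [i Hi] := INR_unbounded (4 * J / dl).
exists n0.+1, (C ^ i); split=> //; split; first exact: pow_R1_Rle.
move=> n k Hn Hk HkJ.
have Hs := sqrt_INR_sqr n; have Hs1 : 1 <= sqrt (INR n) by apply: sqrt_INR_ge1; lia.
set s := sqrt (INR n) in Hs Hs1 HkJ.
have Hs2 : 4 <= dl * s.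
  have : INR n0 <= INR n by apply: INR_leq; lia.
  have : 16 / (dl * dl) * (dl * dl) = 16 by field; lra.
  have : 0 < dl * dl by nra.
  set D := dl * dl in Hn0 * => HD HD4 Hnn.
  have : 4 * 4 <= (dl * s) * (dl * s).
    have -> : (dl * s) * (dl * s) = INR n * D by rewrite -Hs /D; ring.
    have : 16 / D * D <= INR n * D by apply: Rmult_le_compat_r; lra.
    lra.
  have : 0 <= dl * s by apply: Rmult_le_pos; lra.
  by set q := dl * s => Hq0 Hq; nra.
have [t [Ht1 Ht2]] : exists M, INR M <= dl * s / 2 < INR M + 1 by apply: nat_floor; lra.
have Hti : (k <= i * t)%nat.
  apply/leP; apply: INR_le; rewrite INR_mul.
  apply: Rle_trans HkJ _.
  have : dl * s / 4 <= INR t by lra.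
  have : J <= INR i * dl / 4.
    have H4J : 4 * J / dl * dl = 4 * J by field; lra.
    have : 4 * J / dl * dl <= INR i * dl by apply: Rmult_le_compat_r; lra.
    lra.
  move=> H1 H2; have H3 : J * s <= INR i * dl / 4 * s by apply: Rmult_le_compat_r; lra.
  apply: Rle_trans H3 _; have H4 := pos_INR i.
  apply: (Rle_trans _ (INR i * (dl * s / 4))); first by right; field.
  exact: Rmult_le_compat_l.
elim: i k Hk Hti {Hi HkJ} => [|i IH] k Hk Hti.
  by have -> : k = 0%nat by [lia]; rewrite subn0 pow_O; lra.
have Hstep k' : (2 * k' <= n)%nat -> forall t', (t' <= t)%nat -> p (n - k') <= C * p (n - k' - t').
  move=> Hk' t' Ht'; apply: H; first by lia.
  have : INR t' <= INR t by apply: INR_leq.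
  have : s / 2 <= sqrt (INR (n - k')).
    rewrite -(sqrt_square (s / 2)); last lra.
    apply: sqrt_le_1_alt.
    have : INR n <= 2 * INR (n - k').
      by rewrite -(_ : INR 2 = 2) // -INR_mul; apply: INR_leq; lia.
    by rewrite -Hs; nra.
  nra.
case: (leqP k t) => Hkt.
  have := Hstep 0%nat isT k Hkt; rewrite subn0 => H1.
  apply: Rle_trans H1 _; apply: Rmult_le_compat_r; first exact: pos_INR.
  rewrite -tech_pow_Rmult; have := pow_R1_Rle C i HC; nra.
have H1 : p n <= C ^ i * p (n - (k - t)) by apply: IH; nia.
have H2 := Hstep (k - t)%nat ltac:(lia) t (leqnn t).
have H3 : (n - (k - t) - t = n - k)%nat by lia.
rewrite H3 in H2; rewrite -tech_pow_Rmult.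
apply: Rle_trans H1 _; have : 0 <= C ^ i by apply: pow_le; lra.
nra.
Qed.

(** * Oscillation of the ratios [p (n - 1) / p n] *)

Lemma rsum_rev n (G : nat -> R) : \rsum_(1 <= k < n.+1) G k = \rsum_(0 <= j < n) G (n - j)%nat.
Proof.
rewrite big_add1 big_nat_rev /=; apply: eq_big_nat => i Hi; congr G; lia.
Qed.

(** The common part [Rmin (f j) (g j)] cancels and leaves a mass of at most [1 - o] on each side. On
    it [h] oscillates by [u], apart from the allowances [v]. *)
Lemma coupling_bound N (f g h v : nat -> R) u o :
  (forall j, (j < N)%nat -> 0 <= f j) -> (forall j, (j < N)%nat -> 0 <= g j) ->
  (forall j, (j < N)%nat -> 0 <= v j) -> 0 <= u ->
  \rsum_(0 <= j < N) f j = 1 -> \rsum_(0 <= j < N) g j = 1 ->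
  o <= \rsum_(0 <= j < N) Rmin (f j) (g j) ->
  (forall i j, (i < N)%nat -> (j < N)%nat -> h i - h j <= u + v i + v j) ->
  \rsum_(0 <= j < N) (f j * h j) - \rsum_(0 <= j < N) (g j * h j)
  <= (1 - o) * u + \rsum_(0 <= j < N) (f j * v j) + \rsum_(0 <= j < N) (g j * v j).
Proof.
move=> Hf Hg Hv Hu Sf Sg Ho Hh.
(* [s] is the maximum of [h i - v i], which places [h] between [s - u - v] and [s + v]. *)
have [s [Hs1 Hs2]] : exists s, (forall i, (i < N)%nat -> h i <= s + v i) /\
    (forall j, (j < N)%nat -> s - u - v j <= h j).
  have [s [Hs [i0 [Hi0 Hi0s]]]] : exists s, (forall i, (i < N)%nat -> h i - v i <= s) /\
      exists i, (i < N)%nat /\ s = h i - v i.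
    have HN : (0 < N)%nat by case: (N) Sf => // Sf; move: Sf; rewrite big_geq //; lra.
    elim: N HN {Hf Hg Hv Sf Sg Ho Hh} => // -[|N] IH _.
      exists (h 0%nat - v 0%nat); split; last by exists 0%nat.
      by case=> // _; lra.
    have [//|s [H1 [i [Hi Hs]]]] := IH.
    case: (Rle_dec (h N.+1 - v N.+1) s) => H.
      exists s; split; last by exists i; split=> //; lia.
      by move=> j; rewrite ltnS leq_eqVlt => /orP [/eqP -> //|/H1].
    exists (h N.+1 - v N.+1); split; last by exists N.+1.
    by move=> j; rewrite ltnS leq_eqVlt => /orP [/eqP ->|/H1]; lra.
  exists s; split=> [i /Hs|j Hj]; first lra.
  by have := Hh i0 j Hi0 Hj; rewrite Hi0s; lra.
set mu := \rsum_(0 <= j < N) Rmin (f j) (g j) in Ho.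
have Ha : \rsum_(0 <= j < N) ((f j - Rmin (f j) (g j)) * h j)
    <= \rsum_(0 <= j < N) ((f j - Rmin (f j) (g j)) * s + f j * v j).
  apply: rsum_le => j Hj _; have H1 := Rmin_l (f j) (g j); have H2 := Hs1 j ltac:(lia).
  have H3 : 0 <= Rmin (f j) (g j) by apply: Rmin_glb; [apply: Hf|apply: Hg]; lia.
  have H4 := Hv j ltac:(lia).
  have : (f j - Rmin (f j) (g j)) * h j <= (f j - Rmin (f j) (g j)) * (s + v j).
    by apply: Rmult_le_compat_l; lra.
  nra.
have Hb : \rsum_(0 <= j < N) ((g j - Rmin (f j) (g j)) * (s - u) - g j * v j)
    <= \rsum_(0 <= j < N) ((g j - Rmin (f j) (g j)) * h j).
  apply: rsum_le => j Hj _; have H1 := Rmin_r (f j) (g j); have H2 := Hs2 j ltac:(lia).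
  have H3 : 0 <= Rmin (f j) (g j) by apply: Rmin_glb; [apply: Hf|apply: Hg]; lia.
  have H4 := Hv j ltac:(lia).
  have : (g j - Rmin (f j) (g j)) * (s - u - v j) <= (g j - Rmin (f j) (g j)) * h j.
    by apply: Rmult_le_compat_l; lra.
  nra.
move: Ha Hb; rewrite rsum_plus rsum_minus !rsum_scar !rsum_minus Sf Sg /= -/mu.
set F := \rsum_(0 <= j < N) (f j * v j); set G := \rsum_(0 <= j < N) (g j * v j).
have -> : \rsum_(0 <= j < N) ((f j - Rmin (f j) (g j)) * h j) =
   \rsum_(0 <= j < N) (f j * h j) - \rsum_(0 <= j < N) (Rmin (f j) (g j) * h j).
  by rewrite -rsum_minus; apply: eq_bigr => j _; ring.
have -> : \rsum_(0 <= j < N) ((g j - Rmin (f j) (g j)) * h j) =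
   \rsum_(0 <= j < N) (g j * h j) - \rsum_(0 <= j < N) (Rmin (f j) (g j) * h j).
  by rewrite -rsum_minus; apply: eq_bigr => j _; ring.
move=> Ha Hb; nra.
Qed.

(* The normalized weights of the recurrence n p(n) = sum_j sigma(n - j) p(j). *)
Definition wt n j := sg (n - j) * p j / (INR n * p n).

Lemma np_gt0 n : (0 < n)%nat -> 0 < INR n * p n.
Proof. by move=> H; apply: Rmult_lt_0_compat; [apply: INR_gt0 | apply: p_gt0]. Qed.

Lemma wt_ge0 n j : (0 < n)%nat -> 0 <= wt n j.
Proof.
move=> Hn; apply: Rmult_le_pos; last by left; apply/Rinv_0_lt_compat/np_gt0.
by apply: Rmult_le_pos; [apply: sg_ge0 | apply: pos_INR].
Qed.

Lemma wt_out n j : (n <= j)%nat -> wt n j = 0.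
Proof.
by move=> H; rewrite /wt (_ : (n - j)%nat = 0%nat) ?/sg ?big_geq //; [rewrite /Rdiv; ring | lia].
Qed.

Lemma wt_sum_le n N (f : nat -> R) : (n <= N)%nat ->
  \rsum_(0 <= j < N) (wt n j * f j) = \rsum_(0 <= j < n) (wt n j * f j).
Proof.
move=> H; rewrite (@big_cat_nat _ _ _ n) //= [X in _ + X]big_nat_cond.
rewrite [X in _ + X]big1 ?Rplus_0_r // => j /andP [/andP [Hj _] _].
by rewrite wt_out // Rmult_0_l.
Qed.

Lemma wt_sum_k n (f : nat -> R) : (0 < n)%nat ->
  \rsum_(0 <= j < n) (wt n j * f j)
  = (\rsum_(1 <= k < n.+1) (sg k * p (n - k) * f (n - k)%nat)) / (INR n * p n).
Proof.
move=> Hn; rewrite rsum_rev /Rdiv -rsum_scar; apply: eq_big_nat => j Hj.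
by rewrite (_ : (n - (n - j))%nat = j) /wt /Rdiv; [ring | lia].
Qed.

Lemma wt_sum1 n : (0 < n)%nat -> \rsum_(0 <= j < n) wt n j = 1.
Proof.
move=> Hn; have H := np_gt0 Hn; transitivity (\rsum_(0 <= j < n) (wt n j * 1)).
  by apply: eq_bigr => j _; rewrite Rmult_1_r.
rewrite (wt_sum_k (fun=> 1)) // (eq_bigr (fun k => sg k * p (n - k))) -?p_rec; first by rewrite /Rdiv Rinv_r //; lra.
by move=> k _; rewrite Rmult_1_r.
Qed.

Lemma wt_moment a : exists C, 0 < C /\ forall n, (0 < n)%nat ->
  \rsum_(0 <= j < n) (wt n j * INR (n - j) ^ a) <= C * sqrt (INR n) ^ a.
Proof.
have [C [HC H]] := sg_p_moment a; exists C; split=> // n Hn.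
have Hnp := np_gt0 Hn; rewrite (wt_sum_k (fun j => INR (n - j) ^ a)) //.
apply: (Rmult_le_reg_r (INR n * p n)) => //.
rewrite /Rdiv Rmult_assoc Rinv_l ?Rmult_1_r; last lra.
apply: (Rle_trans _ (C * sqrt (INR n) ^ (a + 2) * p n)).
  apply: Rle_trans (H n Hn); right; apply: eq_big_nat => k Hk.
  by rewrite (_ : (n - (n - k))%nat = k); [ring | lia].
right; rewrite -[X in _ = _ * _ * (X * _)]sqrt_INR_sqr.
by rewrite (_ : (a + 2)%nat = a.+2) -?tech_pow_Rmult; [ring | lia].
Qed.

Lemma wt_mean_ge : exists c, 0 < c /\ forall n, (0 < n)%nat ->
  c * sqrt (INR n) <= \rsum_(0 <= j < n) (wt n j * INR (n - j)).
Proof.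
have [dl [Hdl H]] := sg_p_small; exists (dl / 2); split; first lra.
move=> n Hn; have Hnp := np_gt0 Hn; rewrite (wt_sum_k (fun j => INR (n - j))) //.
have Hs1 := sqrt_INR_ge1 Hn; have Hs := sqrt_INR_sqr n; set s := sqrt _ in Hs Hs1 *.
have [X [HX1 HX2]] : exists M, INR M <= dl * s < INR M + 1 by apply: nat_floor; nra.
have HXn : (X <= n)%nat by apply/leP; apply: INR_le; nra.
have H1 := H n X Hn HXn HX1.
have H2 := p_rec n; rewrite (@big_cat_nat _ _ _ X.+1) //= in H2.
have H3 : INR n * p n / 2 <= \rsum_(X.+1 <= i < n.+1) (sg i * p (n - i)) by lra.
apply: (Rmult_le_reg_r (INR n * p n)) => //.
rewrite /Rdiv [X in _ <= X]Rmult_assoc Rinv_l ?Rmult_1_r; last lra.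
apply: (Rle_trans _ ((\rsum_(X.+1 <= i < n.+1) (sg i * p (n - i))) * (dl * s))).
  apply: (Rle_trans _ (INR n * p n / 2 * (dl * s))); first by right; field.
  by apply: Rmult_le_compat_r => //; nra.
rewrite -rsum_scar [X in _ <= X](@big_cat_nat _ _ _ X.+1) //=.
set T := (X in _ <= X + _); have HT : 0 <= T.
  apply: rsum_ge0 => j _ _; apply: Rmult_le_pos; last exact: pos_INR.
  by apply: Rmult_le_pos; [apply: sg_ge0 | apply: pos_INR].
apply: (Rle_trans _ (\rsum_(X.+1 <= i < n.+1) (sg i * p (n - i) * INR (n - (n - i))))); last lra.
apply: rsum_le => k Hk _; apply: Rmult_le_compat_l.
  by apply: Rmult_le_pos; [apply: sg_ge0 | apply: pos_INR].
rewrite (_ : (n - (n - k))%nat = k); last by lia.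
have : INR X.+1 <= INR k by apply: INR_leq; lia.
by rewrite S_INR; lra.
Qed.

(** On a window of about [sqrt n / 2] indices below [m], at a distance of order [sqrt n], both
    weights are at least [(t + 1) p a / (n p n)] because sigma(k) >= k. Harnack compares [p a] with
    [p n]. *)
Lemma wt_overlap J : 0 < J -> exists n0 o, 0 < o /\ o <= 1 /\ forall n m, (n0 <= m)%nat ->
  (m <= n)%nat -> INR (n - m) <= J * sqrt (INR n) ->
  o <= \rsum_(0 <= j < n) Rmin (wt n j) (wt m j).
Proof.
move=> HJ; have [n1 [C [Hn1 [HC H]]]] := p_harnack (J + 2).
have [n2 Hn2] := INR_unbounded (4 * (J + 2) * (J + 2) + 4).
exists (n1 + n2 + 1)%nat, (/ (4 * C)).
split; first by apply: Rinv_0_lt_compat; lra.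
split; first by rewrite -Rinv_1; apply: Rinv_le_contravar; lra.
move=> n m Hm Hmn Hnm.
have Hn0 : (0 < n)%nat by lia.
have Hs1 := sqrt_INR_ge1 Hn0; have Hs := sqrt_INR_sqr n; set s := sqrt _ in Hs Hs1 Hnm.
have Hs2 : 2 * (J + 2) <= s /\ 2 <= s.
  have Hnn : INR n2 <= INR n by apply: INR_leq; lia.
  have : (2 * (J + 2)) * (2 * (J + 2)) + 2 * 2 <= s * s by lra.
  by split; nra.
have Hmhalf : s * s / 2 <= INR m.
  by move: Hnm; rewrite INR_sub // -Hs; nra.
have [t [Ht1 Ht2]] : exists M, INR M <= s / 2 < INR M + 1 by apply: nat_floor; lra.
have Ht4 : s / 4 < INR t + 1 by lra.
have H2t : (2 * (t + 1) <= m)%nat.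
  apply/leP; apply: INR_le; rewrite INR_mul INR_add (_ : INR 2 = 2) // (_ : INR 1 = 1) //.
  nra.
have Hpn : p n <= C * p (m - 2 * (t + 1)).
  have -> : (m - 2 * (t + 1) = n - (n - m + 2 * (t + 1)))%nat by lia.
  have Hk : INR (n - m + 2 * (t + 1)) <= (J + 2) * s.
    by rewrite INR_add INR_mul INR_add (_ : INR 2 = 2) // (_ : INR 1 = 1) //; lra.
  apply: H => //; first by lia.
  apply/leP; apply: INR_le; rewrite INR_mul (_ : INR 2 = 2) // -Hs; nra.
set a := (m - 2 * (t + 1))%nat in Hpn *; set b := (m - (t + 1))%nat.
apply: (Rle_trans _ (\rsum_(a <= j < b) (INR (t + 1) * p a / (INR n * p n)))); last first.
  rewrite [X in _ <= X](@big_cat_nat _ _ _ a) //=; last by rewrite /a; lia.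
  rewrite [X in _ <= _ + X](@big_cat_nat _ _ _ b) //=; [|by rewrite /a /b; lia|by rewrite /b; lia].
  have Hmin : forall j, 0 <= Rmin (wt n j) (wt m j).
    by move=> j; apply: Rmin_glb; apply: wt_ge0; lia.
  set T1 := (X in _ <= X + _); set T2 := (X in _ <= _ + (_ + X)).
  have HT1 : 0 <= T1 by apply: rsum_ge0.
  have HT2 : 0 <= T2 by apply: rsum_ge0.
  suff : \rsum_(a <= j < b) (INR (t + 1) * p a / (INR n * p n)) <=
     \rsum_(a <= i < b) Rmin (wt n i) (wt m i) by lra.
  apply: rsum_le => j Hj _.
  have Hpm := np_gt0 (n := m) ltac:(lia); have Hpn' := np_gt0 Hn0.
  have Hnum : forall k, (t + 1 <= k)%nat -> INR (t + 1) * p a <= sg k * p j.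
    move=> k Hk; apply: Rmult_le_compat; try exact: pos_INR.
      by apply: Rle_trans (sg_ge k); apply: INR_leq.
    by apply: p_le; lia.
  have H0 : 0 <= INR (t + 1) * p a by apply: Rmult_le_pos; exact: pos_INR.
  apply: Rmin_glb.
    apply: Rmult_le_compat_r; first by left; apply: Rinv_0_lt_compat.
    by apply: Hnum; move: Hj; rewrite /a /b; lia.
  apply: Rmult_le_compat => //; first by left; apply: Rinv_0_lt_compat.
    by apply: Hnum; move: Hj; rewrite /a /b; lia.
  apply: Rinv_le_contravar => //; apply: Rmult_le_compat; try exact: pos_INR.
    exact: INR_leq.
  exact: p_le.
rewrite rsum_const; last by rewrite /a /b; lia.
rewrite (_ : (b - a)%nat = (t + 1)%nat); last by rewrite /a /b; lia.
have Hpa := p_gt0 a; have Hpn0 := p_gt0 n.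
apply: (Rmult_le_reg_r (4 * C * (INR n * p n))); first by have := np_gt0 Hn0; nra.
have -> : / (4 * C) * (4 * C * (INR n * p n)) = INR n * p n by field; lra.
have -> : INR (t + 1) * (INR (t + 1) * p a / (INR n * p n)) * (4 * C * (INR n * p n))
   = (4 * (INR (t + 1) * INR (t + 1))) * (C * p a).
  field; split; first lra.
  by have := INR_gt0 Hn0; lra.
apply: Rmult_le_compat => //; try exact: pos_INR.
rewrite INR_add (_ : INR 1 = 1) // -Hs; nra.
Qed.

(** * Drift of the kernel on [1 / n] and [1 / sqrt n] *)

Definition uinv n := / (INR n + 1).
Definition vinv n := / sqrt (INR n + 1).

Lemma uinv_gt0 n : 0 < uinv n.
Proof. by apply: Rinv_0_lt_compat; have := pos_INR n; lra. Qed.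

Lemma uinv_anti m n : (m <= n)%nat -> uinv n <= uinv m.
Proof.
by move=> /INR_leq H; apply: Rinv_le_contravar; have := pos_INR m; lra.
Qed.

Lemma sqrt_S_ge1 n : 1 <= sqrt (INR n + 1).
Proof. by rewrite -{1}sqrt_1; apply: sqrt_le_1_alt; have := pos_INR n; lra. Qed.

Lemma vinv_anti m n : (m <= n)%nat -> vinv n <= vinv m.
Proof.
move=> /INR_leq H; apply: Rinv_le_contravar; first by have := sqrt_S_ge1 m; lra.
by apply: sqrt_le_1_alt; lra.
Qed.

Lemma vinv_diff_le_half n j : (0 < n)%nat -> (j <= n)%nat -> 2 * INR (n - j) <= INR n + 1 ->
  vinv j - vinv n <= 2 * INR (n - j) / sqrt (INR n) ^ 3.
Proof.
move=> Hn Hj; have Hs1 := sqrt_INR_ge1 Hn; have Hs := sqrt_INR_sqr n.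
set s := sqrt (INR n) in Hs Hs1 *; rewrite /vinv.
have Ha1 := sqrt_S_ge1 j; have Hb1 := sqrt_S_ge1 n.
have Ha2 := sqrt_sqrt (INR j + 1) ltac:(have := pos_INR j; lra).
have Hb2 := sqrt_sqrt (INR n + 1) ltac:(have := pos_INR n; lra).
set a := sqrt (INR j + 1) in Ha1 Ha2 *; set b := sqrt (INR n + 1) in Hb1 Hb2 *.
have Hk : INR (n - j) = b * b - a * a by rewrite INR_sub //; lra.
set k := INR (n - j) in Hk *; have Hk0 : 0 <= k by apply: pos_INR.
rewrite -Hb2 => H.
have Hab : a <= b by nra.
have Hsb : s <= b by nra.
have Hp3 : 0 < / s ^ 3 by apply: Rinv_0_lt_compat; apply: pow_lt; lra.
have Ha : b / 2 <= a by nra.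
have -> : / a - / b = k * / (a * b * (a + b)) by rewrite Hk; field; split; [lra|split; lra].
have -> : 2 * k / s ^ 3 = k * (2 * / s ^ 3) by field; lra.
apply: Rmult_le_compat_l => //.
have -> : 2 * / s ^ 3 = / (s ^ 3 / 2) by field; lra.
apply: Rinv_le_contravar; first by have := pow_lt s 3 ltac:(lra); lra.
have : s ^ 3 <= b ^ 3 by apply: pow_incr; lra.
have -> : b ^ 3 = b * b * b by ring.
have : b / 2 * b <= a * b by nra.
move=> H3 H4; apply: (Rle_trans _ (b / 2 * b * b)); first by lra.
by apply: Rmult_le_compat; nra.
Qed.

(** The second term covers jumps past the midpoint, where it is at least 1. A polynomial in [n - j]
    is the form that [wt_moment] can average. *)
Lemma vinv_diff_le n j : (0 < n)%nat -> (j <= n)%nat ->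
  vinv j - vinv n <= 2 * INR (n - j) / sqrt (INR n) ^ 3
                     + 16 * INR (n - j) ^ 4 / sqrt (INR n) ^ 8.
Proof.
move=> Hn Hj; have Hs1 := sqrt_INR_ge1 Hn; have Hs := sqrt_INR_sqr n.
case: (Rle_dec (2 * INR (n - j)) (INR n + 1)) => H.
  apply: Rle_trans (vinv_diff_le_half Hn Hj H) _.
  have : 0 <= 16 * INR (n - j) ^ 4 / sqrt (INR n) ^ 8.
    apply: Rmult_le_pos; first by have := pow_le (INR (n - j)) 4 (pos_INR _); lra.
    by left; apply: Rinv_0_lt_compat; apply: pow_lt; lra.
  lra.
set s := sqrt (INR n) in Hs Hs1 *; rewrite /vinv.
have Hk0 := pos_INR (n - j); set k := INR (n - j) in H Hk0 *.
have Hp3 : 0 < / s ^ 3 by apply: Rinv_0_lt_compat; apply: pow_lt; lra.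
have H1 : / sqrt (INR j + 1) <= 1.
  by rewrite -[X in _ <= X]Rinv_1; apply: Rinv_le_contravar; [lra | apply: sqrt_S_ge1].
have H2 : 0 < / sqrt (INR n + 1).
  by apply: Rinv_0_lt_compat; have := sqrt_S_ge1 n; lra.
have H3 : 0 <= 2 * k / s ^ 3 by apply: Rmult_le_pos; lra.
suff : 1 <= 16 * k ^ 4 / s ^ 8 by lra.
apply: (Rmult_le_reg_r (s ^ 8)); first by apply: pow_lt; lra.
rewrite /Rdiv Rmult_assoc Rinv_l ?Rmult_1_r ?Rmult_1_l; last by apply: pow_nonzero; lra.
have -> : 16 * k ^ 4 = (2 * k) ^ 4 by ring.
have -> : s ^ 8 = (s * s) ^ 4 by ring.
by apply: pow_incr; nra.
Qed.

Lemma uinv_diff_le n j : (0 < n)%nat -> (j <= n)%nat ->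
  uinv j - uinv n <= 2 * INR (n - j) / sqrt (INR n) ^ 4
                     + 16 * INR (n - j) ^ 4 / sqrt (INR n) ^ 8.
Proof.
move=> Hn Hj; have Hs1 := sqrt_INR_ge1 Hn; have Hs := sqrt_INR_sqr n.
set s := sqrt (INR n) in Hs Hs1 *; rewrite /uinv.
have Ha1 := pos_INR j; set a := INR j + 1; set b := INR n + 1.
have Hk : INR (n - j) = b - a by rewrite INR_sub // /a /b; lra.
have Ha : 1 <= a by rewrite /a; lra.
have Hsb : s * s <= b by rewrite /b; lra.
set k := INR (n - j) in Hk *; have Hk0 : 0 <= k by apply: pos_INR.
have Hp4 : 0 < / s ^ 4 by apply: Rinv_0_lt_compat; apply: pow_lt; lra.
have Hp8 : 0 < / s ^ 8 by apply: Rinv_0_lt_compat; apply: pow_lt; lra.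
case: (Rle_dec (2 * k) b) => H.
  have H2 : 0 <= 16 * k ^ 4 / s ^ 8.
    by apply: Rmult_le_pos; [have := pow_le k 4 Hk0; lra | lra].
  suff : / a - / b <= 2 * k / s ^ 4 by lra.
  have -> : / a - / b = k * / (a * b) by rewrite Hk; field; lra.
  have -> : 2 * k / s ^ 4 = k * (2 * / s ^ 4) by field; lra.
  apply: Rmult_le_compat_l => //.
  have -> : 2 * / s ^ 4 = / (s ^ 4 / 2) by field; lra.
  apply: Rinv_le_contravar; first by have := pow_lt s 4 ltac:(lra); lra.
  have -> : s ^ 4 = (s * s) * (s * s) by ring.
  have : (s * s) * (s * s) <= b * b by apply: Rmult_le_compat; nra.
  have : b / 2 * b <= a * b by apply: Rmult_le_compat_r; lra.
  lra.
have H1 : / a <= 1 by rewrite -Rinv_1; apply: Rinv_le_contravar; lra.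
have H2 : 0 < / b by apply: Rinv_0_lt_compat; nra.
have H3 : 0 <= 2 * k / s ^ 4 by apply: Rmult_le_pos; lra.
suff : 1 <= 16 * k ^ 4 / s ^ 8 by lra.
apply: (Rmult_le_reg_r (s ^ 8)); first by apply: pow_lt; lra.
rewrite /Rdiv Rmult_assoc Rinv_l ?Rmult_1_r ?Rmult_1_l; last by apply: pow_nonzero; lra.
have -> : 16 * k ^ 4 = (2 * k) ^ 4 by ring.
have -> : s ^ 8 = (s * s) ^ 4 by ring.
by apply: pow_incr; nra.
Qed.

Lemma vinv_diff_ge n j : (0 < n)%nat -> (j <= n)%nat ->
  INR (n - j) / (16 * sqrt (INR n) ^ 3) <= vinv j - vinv n.
Proof.
move=> Hn Hj; have Hs1 := sqrt_INR_ge1 Hn; have Hs := sqrt_INR_sqr n.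
set s := sqrt (INR n) in Hs Hs1 *; rewrite /vinv.
have Ha1 := sqrt_S_ge1 j; have Hb1 := sqrt_S_ge1 n.
have Ha2 := sqrt_sqrt (INR j + 1) ltac:(have := pos_INR j; lra).
have Hb2 := sqrt_sqrt (INR n + 1) ltac:(have := pos_INR n; lra).
set a := sqrt (INR j + 1) in Ha1 Ha2 *; set b := sqrt (INR n + 1) in Hb1 Hb2 *.
have Hk : INR (n - j) = b * b - a * a by rewrite INR_sub //; lra.
set k := INR (n - j) in Hk *; have Hk0 : 0 <= k by apply: pos_INR.
have Hab : a <= b by nra.
have Hsb : b <= 2 * s by nra.
have -> : / a - / b = k * / (a * b * (a + b)) by rewrite Hk; field; split; [lra|split; lra].
apply: Rmult_le_compat_l => //; apply: Rinv_le_contravar.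
  by apply: Rmult_lt_0_compat; [apply: Rmult_lt_0_compat | ]; lra.
have : b ^ 3 <= (2 * s) ^ 3 by apply: pow_incr; lra.
have -> : (2 * s) ^ 3 = 8 * s ^ 3 by ring.
have -> : b ^ 3 = b * b * b by ring.
move=> H; apply: (Rle_trans _ (b * b * (b + b))); last lra.
apply: Rmult_le_compat; [nra|lra| |lra].
by apply: Rmult_le_compat; lra.
Qed.

(* [vinv] and [uinv] serve as Lyapunov functions for the kernel [wt n]. *)
Lemma wt_vinv_uinv_le : exists C, 0 < C /\ forall n, (0 < n)%nat ->
  \rsum_(0 <= j < n) (wt n j * (vinv j - vinv n)) <= C / INR n /\
  \rsum_(0 <= j < n) (wt n j * (uinv j - uinv n)) <= C / sqrt (INR n) ^ 3.
Proof.
have [C1 [HC1 H1]] := wt_moment 1; have [C4 [HC4 H4]] := wt_moment 4.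
exists (2 * C1 + 16 * C4); split; first lra.
move=> n Hn; have Hs1 := sqrt_INR_ge1 Hn; have Hs := sqrt_INR_sqr n.
have := H1 n Hn; have := H4 n Hn; set s := sqrt _ in Hs Hs1 *.
set S4 := (X in X <= _) => H4n; set S1 := (X in X <= _) => H1n.
have Hi a : 0 < / s ^ a by apply: Rinv_0_lt_compat; apply: pow_lt; lra.
have Hsum a : \rsum_(0 <= j < n) (wt n j * (2 * INR (n - j) / s ^ a
      + 16 * INR (n - j) ^ 4 / s ^ 8)) = 2 * S1 / s ^ a + 16 * S4 / s ^ 8.
  rewrite (_ : 2 * S1 / s ^ a = S1 * (2 / s ^ a)); last by rewrite /Rdiv; ring.
  rewrite (_ : 16 * S4 / s ^ 8 = S4 * (16 / s ^ 8)); last by rewrite /Rdiv; ring.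
  rewrite -!rsum_scar -rsum_plus; apply: eq_bigr => j _; rewrite pow_1 /Rdiv; ring.
have Hbnd a : (a <= 3)%nat -> 2 * S1 / s ^ a.+1 + 16 * S4 / s ^ 8
     <= (2 * C1 + 16 * C4) / s ^ a.
  move=> Ha; have E1 : 2 * S1 / s ^ a.+1 <= 2 * C1 / s ^ a.
    have -> : 2 * C1 / s ^ a = 2 * (C1 * s ^ 1) / s ^ a.+1.
      by rewrite pow_1 -tech_pow_Rmult; field; split; [apply: pow_nonzero|]; lra.
    by apply: Rmult_le_compat_r; [left; apply: Hi | lra].
  have E2 : 16 * S4 / s ^ 8 <= 16 * C4 / s ^ 4.
    have -> : 16 * C4 / s ^ 4 = 16 * (C4 * s ^ 4) / s ^ 8 by field; lra.
    by apply: Rmult_le_compat_r; [left; apply: Hi | lra].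
  have E3 : 16 * C4 / s ^ 4 <= 16 * C4 / s ^ a.
    apply: Rmult_le_compat_l; first lra; apply: Rinv_le_contravar; first by apply: pow_lt; lra.
    by apply: Rle_pow => //; lia.
  by rewrite /Rdiv Rmult_plus_distr_r; rewrite /Rdiv in E1 E2 E3; lra.
split.
  have -> : INR n = s ^ 2 by rewrite -Hs; ring.
  apply: Rle_trans (Hbnd 2%nat isT); rewrite -Hsum; apply: rsum_le => j Hj _.
  by apply: Rmult_le_compat_l; [apply: wt_ge0 | apply: vinv_diff_le; lia].
apply: Rle_trans (Hbnd 3%nat isT); rewrite -Hsum; apply: rsum_le => j Hj _.
by apply: Rmult_le_compat_l; [apply: wt_ge0 | apply: uinv_diff_le; lia].
Qed.

(** This drift of order [1 / n] has the order of the inhomogeneous term in [ratio_rec], which it has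
    to pay for. *)
Lemma wt_vinv_ge : exists c, 0 < c /\ forall n, (0 < n)%nat ->
  c / INR n <= \rsum_(0 <= j < n) (wt n j * (vinv j - vinv n)).
Proof.
have [c [Hc H]] := wt_mean_ge; exists (c / 16); split; first lra.
move=> n Hn; have Hs1 := sqrt_INR_ge1 Hn; have Hs := sqrt_INR_sqr n.
have := H n Hn; set s := sqrt _ in Hs Hs1 *; set S := (X in _ <= X) => HS.
apply: (Rle_trans _ (S / (16 * s ^ 3))).
  rewrite -Hs; have -> : c / 16 / (s * s) = (c * s) / (16 * s ^ 3) by field; lra.
  apply: Rmult_le_compat_r => //; left; apply: Rinv_0_lt_compat.
  by have := pow_lt s 3; lra.
rewrite /S /Rdiv -rsum_scar; apply: rsum_le => j Hj _; rewrite Rmult_assoc.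
by apply: Rmult_le_compat_l; [apply: wt_ge0 | apply: vinv_diff_ge; lia].
Qed.

(** Beyond [J sqrt n] one has [n - j <= (n - j) ^ 4 / (J sqrt n) ^ 3], so the fourth moment makes
    this part of the drift small for large [J]. *)
Lemma wt_vinv_tail : exists C, 0 < C /\ forall J n, 1 <= J -> (0 < n)%nat ->
  \rsum_(0 <= j < n | Rle_dec (J * sqrt (INR n)) (INR (n - j))) (wt n j * (vinv j - vinv n))
  <= C / (J * INR n) + C / INR n ^ 2.
Proof.
have [C4 [HC4 H4]] := wt_moment 4; exists (16 * C4); split; first lra.
move=> J n HJ Hn; have Hs1 := sqrt_INR_ge1 Hn; have Hs := sqrt_INR_sqr n.
have := H4 n Hn; set s := sqrt _ in Hs Hs1 *; set S4 := (X in X <= _) => H4n.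
have Hs6 : 0 < s ^ 6 by apply: pow_lt; lra.
have Hs8 : 0 < s ^ 8 by apply: pow_lt; lra.
have HJs : 0 < J * s ^ 6 by apply: Rmult_lt_0_compat; lra.
have Hw j : 0 <= INR (n - j) by apply: pos_INR.
apply: (Rle_trans _ (S4 * (2 / (J * s ^ 6) + 16 / s ^ 8))).
  rewrite /S4 -rsum_scar big_mkcond; apply: rsum_le => j Hj _.
  have H0 : 0 < 2 / (J * s ^ 6) + 16 / s ^ 8.
    by apply: Rplus_lt_0_compat; apply: Rdiv_lt_0_compat; lra.
  case: Rle_dec => /= Hk; last first.
    apply: Rmult_le_pos; last lra.
    by apply: Rmult_le_pos; [apply: wt_ge0 | apply: pow_le].
  rewrite Rmult_assoc; apply: Rmult_le_compat_l; first exact: wt_ge0.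
  apply: Rle_trans (vinv_diff_le Hn _) _; first by lia.
  rewrite -/s; set k := INR (n - j) in Hk *; have Hk0 : 0 <= k by apply: pos_INR.
  rewrite Rmult_plus_distr_l; apply: Rplus_le_compat; last by right; rewrite /Rdiv; ring.
  have -> : 2 * k / s ^ 3 = 2 * k * (J * s ^ 3) / (J * s ^ 6) by field; lra.
  have -> : k ^ 4 * (2 / (J * s ^ 6)) = 2 * k * (k * k * k) / (J * s ^ 6) by field; lra.
  apply: Rmult_le_compat_r; first by left; apply: Rinv_0_lt_compat; lra.
  apply: Rmult_le_compat_l; first lra.
  have : (J * s) * (J * s) * (J * s) <= k * k * k.
    by apply: Rmult_le_compat; [nra|nra|apply: Rmult_le_compat; nra|].
  have -> : (J * s) * (J * s) * (J * s) = (J * J) * (J * s ^ 3) by ring.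
  have : 0 < J * s ^ 3 by apply: Rmult_lt_0_compat; [lra | apply: pow_lt; lra].
  set Q := J * s ^ 3 => HQ H; apply: Rle_trans H; rewrite -{1}(Rmult_1_l Q).
  by apply: Rmult_le_compat_r; [lra | nra].
rewrite -Hs.
apply: (Rle_trans _ (C4 * s ^ 4 * (2 / (J * s ^ 6) + 16 / s ^ 8))).
  apply: Rmult_le_compat_r => //.
  by left; apply: Rplus_lt_0_compat; apply: Rdiv_lt_0_compat; lra.
have -> : C4 * s ^ 4 * (2 / (J * s ^ 6) + 16 / s ^ 8) = 2 * C4 / (J * (s * s)) + 16 * C4 / (s * s) ^ 2.
  by field; lra.
apply: Rplus_le_compat_r; apply: Rmult_le_compat_r; last lra.
by left; apply: Rinv_0_lt_compat; nra.
Qed.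

(** The value at 0 stands for [p (-1) = 0], with which [ratio_rec] holds from [n = 1] on. *)
Definition ratio n := if n is m.+1 then p m / p m.+1 else 0.

Lemma ratio_bounds n : 0 <= ratio n <= 1.
Proof.
case: n => [|n] /=; first lra.
have H1 := p_gt0 n; have H2 := p_gt0 n.+1; have H3 := p_le (leqnSn n).
split; first by apply: Rmult_le_pos; [lra | left; apply: Rinv_0_lt_compat].
by apply: (Rmult_le_reg_r (p n.+1)) => //; rewrite /Rdiv Rmult_assoc Rinv_l; lra.
Qed.

(** This is the recurrence for [(n - 1) p (n - 1)] divided by [n p n]; the last term makes up for
    [n - 1] in place of [n]. *)
Lemma ratio_rec n : (0 < n)%nat ->
  ratio n = \rsum_(0 <= j < n) (wt n j * ratio j) + ratio n / INR n.
Proof.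
case: n => // n _; have Hn := INR_gt0 (ltn0Sn n); have Hp := p_gt0 n.+1.
have -> : \rsum_(0 <= j < n.+1) (wt n.+1 j * ratio j) = INR n * p n / (INR n.+1 * p n.+1).
  rewrite big_nat_recl //= Rmult_0_r Rplus_0_l p_rec rsum_rev /Rdiv -rsum_scar.
  apply: eq_big_nat => j Hj; rewrite (_ : (n - (n - j))%nat = j); last by lia.
  rewrite /wt subSS; have Hj1 := p_gt0 j.+1; field; lra.
by rewrite /= S_INR in Hn *; field; lra.
Qed.

Lemma ratio_term_le n : 0 <= ratio n / INR n <= / INR n.
Proof.
have H := ratio_bounds n; case: n H => [|n] H.
  by rewrite /= /Rdiv Rmult_0_l; split; [lra | rewrite /INR Rinv_0; lra].
have Hn := Rinv_0_lt_compat _ (INR_gt0 (ltn0Sn n)); rewrite /Rdiv; nra.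
Qed.

(** The bound propagated by induction for [m < n]. The difference of [vinv] is additive along chains
    and serves distant pairs; [A * uinv m] is the part that the overlap of kernels contracts for
    close pairs. *)
Definition osc_bound A n m := A * uinv m + (vinv m - vinv n).

(* When [m] lies at least [J sqrt n] below [n] only [ratio n] is expanded: the
   kernel moves [n] towards [m], and the resulting decrease of [vinv m - vinv n]
   pays for the inhomogeneous term. *)
Lemma ratio_contract_far : exists J eta E, 1 <= J /\ 0 < eta /\ 0 < E /\
  forall A K n m, 0 <= A -> 8 / eta <= K -> (0 < n)%nat -> (m < n)%nat ->
  J * sqrt (INR n) <= INR (n - m) ->
  A * E <= eta / 8 * sqrt (INR n) -> E <= eta / 8 * INR n ->
  (forall n' m', (n' < n)%nat -> (m' < n')%nat ->
     Rabs (ratio n' - ratio m') <= K * osc_bound A n' m') ->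
  Rabs (ratio n - ratio m) <= K * osc_bound A n m.
Proof.
have [C [HC Hvu]] := wt_vinv_uinv_le; have [eta [Heta Hge]] := wt_vinv_ge.
have [D [HD Htail]] := wt_vinv_tail.
(* This [J] limits the cost of far jumps to a fraction of the drift [eta / n], and [K >= 8 / eta]
   does the same for [ratio n / n]. In all, five eighths of the drift are spent. *)
exists (16 * D / eta + 1), eta, (C + 2 * D).
have HDe : 0 < 16 * D / eta by apply: Rdiv_lt_0_compat; lra.
do 3 (split; first lra).
move=> A K n m HA HK Hn Hm HJ HAs HEn IH.
set J := _ + 1 in HJ; have HJ1 : 1 <= J by rewrite /J; lra.
have [Hv Hu] := Hvu n Hn; have {}Hge := Hge n Hn; have {}Htail := Htail J n HJ1 Hn.
have Hs1 := sqrt_INR_ge1 Hn; have Hs := sqrt_INR_sqr n.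
set s := sqrt _ in Hs Hs1 HJ HAs Htail Hu.
have HK0 : 0 < K by apply: Rlt_le_trans HK; apply: Rdiv_lt_0_compat; lra.
pose far j : bool := Rle_dec (J * s) (INR (n - j)).
(* [B j] bounds the difference at the landing point [j]. Landings below [m], all of them far jumps,
   reverse the sign of [vinv m - vinv j]; the doubled term corrects this. *)
pose B j := A * uinv m + vinv m - vinv j + A * (uinv j - uinv n)
            + (if far j then 2 * (vinv j - vinv n) else 0).
have HB j : (j < n)%nat -> Rabs (ratio j - ratio m) <= K * B j.
  move=> Hj; rewrite /B.
  have Hun : 0 <= A * (uinv j - uinv n).
    by apply: Rmult_le_pos => //; have := @uinv_anti j n (ltnW Hj); lra.
  have Hvn := @vinv_anti j n (ltnW Hj).
  have Hum : 0 <= A * uinv m by apply: Rmult_le_pos => //; left; apply: uinv_gt0.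
  have Hfar : 0 <= (if far j then 2 * (vinv j - vinv n) else 0) by case: ifP => _; lra.
  case: (ltngtP m j) => Hmj.
  - apply: Rle_trans (IH j m Hj Hmj) _; apply: Rmult_le_compat_l; first lra.
    by rewrite /osc_bound; lra.
  - rewrite Rabs_minus_sym; apply: Rle_trans (IH m j Hm Hmj) _.
    apply: Rmult_le_compat_l; first lra; rewrite /osc_bound.
    have -> : far j.
      rewrite /far; case: Rle_dec => //= H; exfalso; apply: H.
      by apply: Rle_trans HJ _; apply: INR_leq; lia.
    have := @vinv_anti m n (ltnW Hm); have := @uinv_anti m n (ltnW Hm) => H1 H2.
    have : A * uinv n <= A * uinv m by apply: Rmult_le_compat_l.
    lra.
  rewrite Hmj Rminus_diag Rabs_R0; apply: Rmult_le_pos; first lra.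
  rewrite Hmj in Hum; lra.
have Hw1 := wt_sum1 Hn.
have H1 : ratio n - ratio m = \rsum_(0 <= j < n) (wt n j * (ratio j - ratio m)) + ratio n / INR n.
  have -> : \rsum_(0 <= j < n) (wt n j * (ratio j - ratio m)) =
      \rsum_(0 <= j < n) (wt n j * ratio j) - ratio m.
    rewrite -[X in _ = _ - X]Rmult_1_l -{1}Hw1 -rsum_scar -rsum_minus.
    by apply: eq_bigr => j _; ring.
  by rewrite {1}(ratio_rec Hn); ring.
have H2 : Rabs (\rsum_(0 <= j < n) (wt n j * (ratio j - ratio m))) <= K * \rsum_(0 <= j < n) (wt n j * B j).
  apply: Rle_trans (rsum_abs _ _ _) _; rewrite -rsum_scal; apply: rsum_le => j Hj _.
  have Hw := wt_ge0 j Hn.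
  rewrite Rabs_mult Rabs_pos_eq //.
  have := HB j ltac:(lia) => H; apply: (Rle_trans _ (wt n j * (K * B j))); last by right; ring.
  exact: Rmult_le_compat_l.
have H3 : \rsum_(0 <= j < n) (wt n j * B j) = A * uinv m + vinv m - vinv n
   - \rsum_(0 <= j < n) (wt n j * (vinv j - vinv n))
   + A * \rsum_(0 <= j < n) (wt n j * (uinv j - uinv n))
   + 2 * \rsum_(0 <= j < n | far j) (wt n j * (vinv j - vinv n)).
  rewrite -[X in X - _ + _ + _]Rmult_1_l -{1}Hw1 -rsum_scar -rsum_minus.
  rewrite (big_mkcond (fun j => far j)) -!rsum_scal -!rsum_plus.
  by apply: eq_bigr => j _ /=; rewrite /B; case: ifP => _; ring.
have H4 : A * \rsum_(0 <= j < n) (wt n j * (uinv j - uinv n)) <= eta / 8 / INR n.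
  apply: (Rle_trans _ (A * (C / s ^ 3))); first exact: Rmult_le_compat_l.
  rewrite -Hs; have -> : A * (C / s ^ 3) = A * C / s / (s * s) by field; lra.
  apply: Rmult_le_compat_r; first by left; apply: Rinv_0_lt_compat; nra.
  apply: (Rmult_le_reg_r s); first lra.
  rewrite /Rdiv Rmult_assoc Rinv_l ?Rmult_1_r; nra.
have Hn0 := INR_gt0 Hn; have Hni := Rinv_0_lt_compat _ Hn0.
have H5 : 2 * (D / (J * INR n) + D / INR n ^ 2) <= 3 * (eta / 8) / INR n.
  have -> : D / (J * INR n) = D / J / INR n by field; lra.
  have -> : D / INR n ^ 2 = D / INR n / INR n by field; lra.
  have E1 : D / J <= eta / 16.
    apply: (Rmult_le_reg_r J); first lra.
    rewrite /Rdiv Rmult_assoc Rinv_l ?Rmult_1_r; last lra.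
    have : eta * / 16 * (16 * D * / eta) = D by field; lra.
    rewrite /J /Rdiv; nra.
  have E2 : D / INR n <= eta / 8.
    apply: (Rmult_le_reg_r (INR n)) => //; rewrite /Rdiv Rmult_assoc Rinv_l ?Rmult_1_r; lra.
  rewrite /Rdiv -Rmult_plus_distr_r -Rmult_assoc; apply: Rmult_le_compat_r; first lra.
  rewrite /Rdiv in E1 E2; lra.
have H6 : / INR n <= K * (eta / 8 / INR n).
  have : 8 / eta * (eta / 8) = 1 by field; lra.
  move=> E; have : 1 <= K * (eta / 8) by rewrite -E; apply: Rmult_le_compat_r; lra.
  move=> E2; rewrite /Rdiv in E2 *; nra.
have H7 := ratio_term_le n.
rewrite H1; apply: Rle_trans (Rabs_triang _ _) _.
rewrite [X in _ + X]Rabs_pos_eq; last lra.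
apply: (Rle_trans _ (K * (A * uinv m + vinv m - vinv n - eta / INR n
   + eta / 8 / INR n + 3 * (eta / 8) / INR n + eta / 8 / INR n))); last first.
  apply: Rmult_le_compat_l; first lra; rewrite /osc_bound /Rdiv.
  have : 0 < eta * / INR n by apply: Rmult_lt_0_compat.
  lra.
have H8 : \rsum_(0 <= j < n) (wt n j * B j) <= A * uinv m + vinv m - vinv n - eta / INR n
   + eta / 8 / INR n + 3 * (eta / 8) / INR n.
  rewrite H3; rewrite -/s in Htail; rewrite /far; lra.
have := Rmult_le_compat_l K _ _ (Rlt_le _ _ HK0) H8; rewrite Rmult_plus_distr_l; lra.
Qed.

(* For [m] close to [n] the kernels [wt n] and [wt m] overlap by a fixed amount
   [o], which shrinks the term [A * uinv n] of the bound by the factor [1 - o]. *)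
Lemma ratio_contract_near J : 1 <= J -> exists A n1, 0 < A /\ (0 < n1)%nat /\
  forall K n m, 2 <= K -> (n1 <= m)%nat -> (m < n)%nat ->
  INR (n - m) <= J * sqrt (INR n) ->
  (forall n' m', (n' < n)%nat -> (m' < n')%nat ->
     Rabs (ratio n' - ratio m') <= K * osc_bound A n' m') ->
  Rabs (ratio n - ratio m) <= K * osc_bound A n m.
Proof.
move=> HJ; have [n0 [o [Ho [Ho1 Hov]]]] := @wt_overlap J ltac:(lra).
have [C [HC Hvu]] := wt_vinv_uinv_le.
pose D := 2 * J + 16 * J ^ 4.
have HD : 0 < D by rewrite /D; have := pow_lt J 4 ltac:(lra); lra.
(* With this [A] the saving [o * A * uinv n] outweighs the drifts of [vinv], the gap
   [vinv m - vinv n] and both inhomogeneous terms, all of order [1 / n]; the terms carrying [A]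
   itself are of lower order. *)
pose A := 4 * (3 * C + D + 1) / o.
have HA : 0 < A by apply: Rdiv_lt_0_compat; lra.
have HAo : A * o = 4 * (3 * C + D + 1) by rewrite /A; field; lra.
have [n1 Hn1] := INR_unbounded (4 * J * J + (4 * (9 * C + D) / o) * (4 * (9 * C + D) / o)).
exists A, (n0 + n1 + 1)%nat; split=> //; split; first lia.
move=> K n m HK Hm Hmn Hnm IH.
have Hn : (0 < n)%nat by lia. have Hm0 : (0 < m)%nat by lia.
have Hs1 := sqrt_INR_ge1 Hn; have Hs := sqrt_INR_sqr n.
have [Hvn Hun] := Hvu n Hn; have [Hvm Hum] := Hvu m Hm0.
have Hq1 := sqrt_INR_ge1 Hm0; have Hq := sqrt_INR_sqr m.
have {}Hov := Hov n m ltac:(lia) (ltnW Hmn) Hnm.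
have HX0 : 0 <= 4 * (9 * C + D) / o by apply: Rmult_le_pos; [lra | left; apply: Rinv_0_lt_compat].
have Hvd := vinv_diff_le Hn (ltnW Hmn); have Hud := uinv_diff_le Hn (ltnW Hmn).
set s := sqrt (INR n) in Hs1 Hs Hun Hnm Hvd Hud *.
set q := sqrt (INR m) in Hq1 Hq Hum *.
have Hnn : INR n1 <= INR n by apply: INR_leq; lia.
have HsJ : 2 * J <= s.
  have : (2 * J) * (2 * J) <= s * s by nra.
  nra.
have HsX : 4 * (9 * C + D) / o <= s.
  move: HX0 Hn1; set X := _ / o => HX0 Hn1; have : X * X <= s * s by nra.
  nra.
have Hmhalf : s * s / 2 <= INR m.
  have : J * s <= s / 2 * s by apply: Rmult_le_compat_r; lra.
  by move: Hnm; rewrite (INR_sub (ltnW Hmn)); lra.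
have Hqs : s / 2 <= q.
  rewrite -(sqrt_square (s / 2)); last lra.
  apply: sqrt_le_1_alt; have : 0 <= s * s by nra.
  lra.
have Hk0 := pos_INR (n - m); set k := INR (n - m) in Hnm Hvd Hud Hk0.
have Hss : 0 < s * s by apply: Rmult_lt_0_compat; lra.
have Hs3 : 0 < s ^ 3 by apply: pow_lt; lra.
have Hs4 : 0 < s ^ 4 by apply: pow_lt; lra.
have Hs8 : 0 < s ^ 8 by apply: pow_lt; lra.
have Hk4 : 16 * k ^ 4 / s ^ 8 <= 16 * J ^ 4 / s ^ 4.
  have -> : 16 * J ^ 4 / s ^ 4 = 16 * (J * s) ^ 4 / s ^ 8 by field; lra.
  apply: Rmult_le_compat_r; first by left; apply: Rinv_0_lt_compat.
  by apply: Rmult_le_compat_l; [lra | apply: pow_incr].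
have Hs43 : / s ^ 4 <= / s ^ 3.
  apply: Rinv_le_contravar => //; rewrite -(tech_pow_Rmult s 3) -{1}(Rmult_1_l (s ^ 3)).
  by apply: Rmult_le_compat_r; lra.
have Hs32 : / s ^ 3 <= / (s * s).
  apply: Rinv_le_contravar => //; rewrite -(tech_pow_Rmult s 2) (_ : s ^ 2 = s * s); last by ring.
  by rewrite -{1}(Rmult_1_l (s * s)); apply: Rmult_le_compat_r; lra.
have HJ4 : 0 < J ^ 4 by apply: pow_lt; lra.
have Hum_n : uinv m - uinv n <= D / s ^ 3.
  have : 2 * k / s ^ 4 <= 2 * J / s ^ 3.
    have -> : 2 * J / s ^ 3 = 2 * (J * s) / s ^ 4 by field; lra.
    by apply: Rmult_le_compat_r; [left; apply: Rinv_0_lt_compat | lra].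
  have : 16 * J ^ 4 / s ^ 4 <= 16 * J ^ 4 / s ^ 3 by apply: Rmult_le_compat_l; lra.
  rewrite /D /Rdiv; rewrite /Rdiv in Hk4 Hud; lra.
have Hvm_n : vinv m - vinv n <= D / (s * s).
  have : 2 * k / s ^ 3 <= 2 * J / (s * s).
    have -> : 2 * J / (s * s) = 2 * (J * s) / s ^ 3 by field; lra.
    by apply: Rmult_le_compat_r; [left; apply: Rinv_0_lt_compat | lra].
  have : 16 * J ^ 4 / s ^ 4 <= 16 * J ^ 4 / (s * s) by apply: Rmult_le_compat_l; lra.
  rewrite /D /Rdiv; rewrite /Rdiv in Hk4 Hvd; lra.
have Hum' : C / q ^ 3 <= 8 * C / s ^ 3.
  have -> : 8 * C / s ^ 3 = C / (s / 2) ^ 3 by field; lra.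
  apply: Rmult_le_compat_l; first lra; apply: Rinv_le_contravar.
    by apply: pow_lt; lra.
  by apply: pow_incr; lra.
have Hnq : / INR m <= 2 / (s * s).
  have -> : 2 / (s * s) = / (s * s / 2) by field; lra.
  by apply: Rinv_le_contravar => //; lra.
have Hvm' : C / INR m <= 2 * C / (s * s).
  have -> : 2 * C / (s * s) = C * (2 / (s * s)) by rewrite /Rdiv; ring.
  by apply: Rmult_le_compat_l; lra.
(* The bound for all pairs below [n] is split into a common oscillation [u], which the coupling
   multiplies by [1 - o], and allowances [v j] whose averages are small by the drift estimates. *)
pose v j := K * (A * (uinv j - uinv n) + (vinv j - vinv n)).
pose u := K * (A * uinv n).
have Hv0 j : (j < n)%nat -> 0 <= v j.
  move=> Hj; rewrite /v; apply: Rmult_le_pos; first lra.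
  have H1 := @uinv_anti j n (ltnW Hj); have H2 := @vinv_anti j n (ltnW Hj).
  by have := Rmult_le_pos A (uinv j - uinv n) ltac:(lra) ltac:(lra); lra.
have Hu0 : 0 <= u.
  by apply: Rmult_le_pos; [lra | apply: Rmult_le_pos; [lra | left; apply: uinv_gt0]].
have Hh i j : (i < n)%nat -> (j < n)%nat -> ratio i - ratio j <= u + v i + v j.
  have Hlt i' j' : (i' < j')%nat -> (j' < n)%nat -> Rabs (ratio i' - ratio j') <= u + v i' + v j'.
    move=> H1 H2; rewrite Rabs_minus_sym; apply: Rle_trans (IH j' i' H2 H1) _.
    have := Hv0 j' H2; have := @vinv_anti j' n (ltnW H2) => H3 H4.
    suff : K * osc_bound A j' i' <= u + v i' by lra.
    rewrite /u /v /osc_bound -Rmult_plus_distr_l; apply: Rmult_le_compat_l; lra.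
  move=> Hi Hj; have := Rle_abs (ratio i - ratio j).
  case: (ltngtP i j) => Hij.
  - by have := Hlt i j Hij Hj; lra.
  - by have := Hlt j i Hij Hi; rewrite Rabs_minus_sym; lra.
  by have := Hv0 i Hi; rewrite Hij; lra.
have Hm1 : \rsum_(0 <= j < n) wt m j = 1.
  rewrite -(wt_sum1 Hm0); transitivity (\rsum_(0 <= j < n) (wt m j * 1)).
    by apply: eq_bigr => j _; rewrite Rmult_1_r.
  by rewrite (wt_sum_le _ (ltnW Hmn)); apply: eq_bigr => j _; rewrite Rmult_1_r.
have Hn1' := wt_sum1 Hn.
have Hwn j : (j < n)%nat -> 0 <= wt n j by move=> _; apply: wt_ge0.
have Hwm j : (j < n)%nat -> 0 <= wt m j by move=> _; apply: wt_ge0.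
have B1 := coupling_bound Hwn Hwm Hv0 Hu0 Hn1' Hm1 Hov Hh.
have Hov' : o <= \rsum_(0 <= j < n) Rmin (wt m j) (wt n j).
  by rewrite (eq_bigr (fun j => Rmin (wt n j) (wt m j))) // => j _; rewrite Rmin_comm.
have B2 := coupling_bound Hwm Hwn Hv0 Hu0 Hm1 Hn1' Hov' Hh.
have Vn : \rsum_(0 <= j < n) (wt n j * v j) <= K * (A * (C / s ^ 3) + C / (s * s)).
  have -> : \rsum_(0 <= j < n) (wt n j * v j) =
     K * (A * \rsum_(0 <= j < n) (wt n j * (uinv j - uinv n)) + \rsum_(0 <= j < n) (wt n j * (vinv j - vinv n))).
    by rewrite -rsum_scal -rsum_plus -rsum_scal; apply: eq_bigr => j _; rewrite /v; ring.
  apply: Rmult_le_compat_l; first lra; rewrite Hs.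
  by have := Rmult_le_compat_l A _ _ (Rlt_le _ _ HA) Hun; lra.
have Vm : \rsum_(0 <= j < n) (wt m j * v j) <=
    K * (A * (8 * C / s ^ 3 + D / s ^ 3) + (2 * C / (s * s) + D / (s * s))).
  have -> : \rsum_(0 <= j < n) (wt m j * v j) =
     K * (A * (\rsum_(0 <= j < m) (wt m j * (uinv j - uinv m)) + (uinv m - uinv n))
        + (\rsum_(0 <= j < m) (wt m j * (vinv j - vinv m)) + (vinv m - vinv n))).
    rewrite (wt_sum_le _ (ltnW Hmn)).
    rewrite -[uinv m - uinv n]Rmult_1_l -[vinv m - vinv n]Rmult_1_l -(wt_sum1 Hm0).
    rewrite -!rsum_scar -!rsum_plus -rsum_scal -rsum_plus -rsum_scal.
    by apply: eq_bigr => j _; rewrite /v; ring.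
  apply: Rmult_le_compat_l; first lra.
  apply: Rplus_le_compat; last lra.
  by apply: Rmult_le_compat_l; lra.
have Hu_ge : / (2 * (s * s)) <= uinv n.
  have Hs1' : 1 <= s * s by rewrite -{1}(Rmult_1_l 1); apply: Rmult_le_compat; lra.
  by apply: Rinv_le_contravar; lra.
have Hend : (1 - o) * u + K * (A * (C / s ^ 3) + C / (s * s))
   + K * (A * (8 * C / s ^ 3 + D / s ^ 3) + (2 * C / (s * s) + D / (s * s)))
   + 2 / (s * s) <= K * osc_bound A n m.
  have Hb : K * (A * uinv n) <= K * osc_bound A n m.
    apply: Rmult_le_compat_l; first lra; rewrite /osc_bound.
    have := @uinv_anti m n (ltnW Hmn); have := @vinv_anti m n (ltnW Hmn).
    by move=> H1 H2; have := Rmult_le_compat_l A _ _ (Rlt_le _ _ HA) H2; lra.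
  apply: Rle_trans Hb.
  have HE : A * (9 * C + D) / s ^ 3 <= (3 * C + D + 1) / (s * s).
    have -> : A * (9 * C + D) / s ^ 3 = A * (9 * C + D) / s / (s * s) by field; lra.
    apply: Rmult_le_compat_r; first by left; apply: Rinv_0_lt_compat.
    apply: (Rmult_le_reg_r s); first lra.
    rewrite /Rdiv Rmult_assoc Rinv_l ?Rmult_1_r; last lra.
    have : 3 * C + D + 1 = A * o / 4 by rewrite HAo; field.
    move=> ->; have : 4 * (9 * C + D) / o * o = 4 * (9 * C + D) by field; lra.
    set X := _ / o in HsX * => HX.
    have : A * (X * o) <= A * (s * o).
      by apply: Rmult_le_compat_l; [lra | apply: Rmult_le_compat_r; lra].
    rewrite HX; lra.
  have Hou : 2 * (3 * C + D + 1) / (s * s) <= o * (A * uinv n).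
    have -> : 2 * (3 * C + D + 1) / (s * s) = (A * o) * / (2 * (s * s)) by rewrite HAo; field; lra.
    have : 0 < A * o by apply: Rmult_lt_0_compat.
    move=> H; have := Rmult_le_compat_l (A * o) _ _ (Rlt_le _ _ H) Hu_ge; lra.
  have Hi2 : 0 < / (s * s) by apply: Rinv_0_lt_compat.
  have Hsum : A * (C / s ^ 3) + C / (s * s) + (A * (8 * C / s ^ 3 + D / s ^ 3)
     + (2 * C / (s * s) + D / (s * s))) + 1 / (s * s) <= o * (A * uinv n).
    rewrite /Rdiv in HE Hou *; lra.
  have H2K : 2 / (s * s) <= K * (1 / (s * s)).
    rewrite /Rdiv Rmult_1_l; apply: Rmult_le_compat_r; lra.
  have := Rmult_le_compat_l K _ _ ltac:(lra) Hsum.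
  rewrite /u; move: H2K; set X1 := A * (C / s ^ 3) + _; set X2 := A * (_ + _) + _.
  move=> H1 H2; lra.
have T1 := ratio_term_le n; have T2 := ratio_term_le m.
have Hnm' : / INR n <= / INR m by apply: Rinv_le_contravar; [exact: INR_gt0 | apply: INR_leq; lia].
have R1 := ratio_rec Hn.
have R2 : ratio m = \rsum_(0 <= j < n) (wt m j * ratio j) + ratio m / INR m.
  by rewrite (wt_sum_le _ (ltnW Hmn)); exact: ratio_rec.
apply: Rabs_le; lra.
Qed.

(** Strong induction on [n]. For [m] below the threshold [N] the bound is trivial, because
    [K * A * uinv m >= 1] and the ratios lie in the unit interval. *)
Theorem ratio_osc : exists C, 0 < C /\ forall n m, (m < n)%nat ->
  Rabs (ratio n - ratio m) <= C * (uinv m + (vinv m - vinv n)).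
Proof.
have [J [eta [E [HJ [Heta [HE Hfar]]]]]] := ratio_contract_far.
have [A [n1 [HA [Hn1 Hnear]]]] := ratio_contract_near HJ.
have [n2 Hn2] := INR_unbounded ((8 * A * E / eta) * (8 * A * E / eta) + 8 * E / eta).
pose N := (n1 + n2)%nat.
pose K := 8 / eta + 2 + (INR N + 1) / A.
have HN := pos_INR N.
have H8 : 0 < 8 / eta by apply: Rdiv_lt_0_compat; lra.
have HNA : 0 < (INR N + 1) / A by apply: Rdiv_lt_0_compat; lra.
have HKA : INR N + 1 <= K * A.
  have : (INR N + 1) / A * A = INR N + 1 by field; lra.
  rewrite /K; nra.
have Hmain n m : (m < n)%nat -> Rabs (ratio n - ratio m) <= K * osc_bound A n m.
  elim/ltn_ind: n m => n IH m Hmn.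
  have Hn : (0 < n)%nat by lia.
  have Hv := @vinv_anti m n (ltnW Hmn).
  case: (leqP N m) => HNm; last first.
    have Hr1 := ratio_bounds n; have Hr2 := ratio_bounds m.
    apply: (Rle_trans _ 1); first by apply: Rabs_le; lra.
    have Hum : 1 <= K * A * uinv m.
      rewrite -(Rinv_r (INR m + 1)); last by have := pos_INR m; lra.
      apply: Rmult_le_compat_r; first by left; apply: uinv_gt0.
      by have := INR_ltn HNm; lra.
    rewrite /osc_bound; have : 0 <= K * (vinv m - vinv n).
      by apply: Rmult_le_pos; rewrite /K; lra.
    lra.
  case: (Rle_dec (INR (n - m)) (J * sqrt (INR n))) => HJn.
    by apply: (Hnear K n m _ _ Hmn HJn (fun n1 m1 H1 => IH n1 H1 m1)); [rewrite /K; lra | rewrite /N in HNm; lia].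
  have Hs1 := sqrt_INR_ge1 Hn; have Hs := sqrt_INR_sqr n.
  have Hnn : INR n2 <= INR n by apply: INR_leq; rewrite /N in HNm; lia.
  have HX0 : 0 <= 8 * A * E / eta.
    by apply: Rmult_le_pos; [nra | left; apply: Rinv_0_lt_compat].
  have HE0 : 0 <= 8 * E / eta.
    by apply: Rmult_le_pos; [nra | left; apply: Rinv_0_lt_compat].
  apply: (Hfar A K n m _ _ Hn Hmn _ _ _ (fun n1 m1 H1 => IH n1 H1 m1)); [lra | rewrite /K; lra | lra | | ].
    have : 8 * A * E / eta * (eta / 8) = A * E by field; lra.
    set s := sqrt _ in Hs1 Hs *; set X := _ / eta in HX0 Hn2 * => HXe.
    have : X <= s by nra.
    nra.
  have : 8 * E / eta * (eta / 8) = E by field; lra.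
  set X := 8 * E / eta in HE0 Hn2 * => HXe.
  have : X <= INR n by nra.
  nra.
exists (K * (A + 1)); split; first by rewrite /K; apply: Rmult_lt_0_compat; lra.
move=> n m Hmn; apply: Rle_trans (Hmain n m Hmn) _.
have Hv := @vinv_anti m n (ltnW Hmn); have Hu := uinv_gt0 m.
rewrite Rmult_assoc; apply: Rmult_le_compat_l; first by rewrite /K; lra.
by rewrite /osc_bound; nra.
Qed.

(** * Asymptotics of [ln (p n)] *)

Lemma ln_le_sub1 x : 0 < x -> ln x <= x - 1.
Proof. by move=> H; have := exp_ge1 (ln x); rewrite exp_ln //; lra. Qed.

Lemma ln_le x y : 0 < x -> x <= y -> ln x <= ln y.
Proof. by move=> Hx [H|->]; [left; apply: ln_increasing | right]. Qed.

Lemma ln_div x y : 0 < x -> 0 < y -> ln (x / y) = ln x - ln y.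
Proof.
move=> Hx Hy; rewrite /Rdiv ln_mult ?ln_Rinv //; exact: Rinv_0_lt_compat.
Qed.

Lemma ln_lipschitz c x y : 0 < c -> c <= x -> c <= y -> Rabs (ln x - ln y) <= Rabs (x - y) / c.
Proof.
move=> Hc.
have H a b : c <= a -> c <= b -> ln a - ln b <= Rabs (a - b) / c.
  move=> Ha Hb; rewrite -ln_div; [|lra|lra].
  apply: Rle_trans (ln_le_sub1 _) _; first by apply: Rdiv_lt_0_compat; lra.
  have -> : a / b - 1 = (a - b) / b by field; lra.
  apply: (Rle_trans _ (Rabs (a - b) / b)).
    by apply: Rmult_le_compat_r; [left; apply: Rinv_0_lt_compat; lra | apply: Rle_abs].
  apply: Rmult_le_compat_l; first exact: Rabs_pos.
  by apply: Rinv_le_contravar.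
move=> Hx Hy; apply: Rabs_le; have := H x y Hx Hy; have := H y x Hy Hx.
by rewrite (Rabs_minus_sym y x); lra.
Qed.

Lemma ratio_lower : exists c, 0 < c <= 1 /\ forall n, (0 < n)%nat -> c <= ratio n.
Proof.
have [dl [C [Hdl [HC H]]]] := p_harnack1.
have [n0 Hn0] := INR_unbounded (/ (dl * dl)).
have Hp0 := p_ge1 n0; have Hp0' : 0 < / p n0 by apply: Rinv_0_lt_compat; lra.
have HCi : 0 < / C by apply: Rinv_0_lt_compat; lra.
exists (Rmin (/ C) (/ p n0)); split.
  split; first exact: Rmin_glb_lt.
  apply: Rle_trans (Rmin_l _ _) _; rewrite -[X in _ <= X]Rinv_1; apply: Rinv_le_contravar; lra.
case=> // n _ /=; have Hpn := p_gt0 n; have HpS := p_gt0 n.+1; have Hp1 := p_ge1 n.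
case: (leqP n0 n.+1) => Hn.
  apply: Rle_trans (Rmin_l _ _) _.
  have H1 : p n.+1 <= C * p n.
    have := H n.+1 1%nat isT; rewrite subn1 /=; apply.
    have Hs1 := sqrt_INR_ge1 (ltn0Sn n); have Hs := sqrt_INR_sqr n.+1.
    set s := sqrt _ in Hs1 Hs *.
    have : / (dl * dl) <= s * s.
      by rewrite Hs; have := INR_leq Hn; lra.
    have : / (dl * dl) * (dl * dl) = 1 by field; lra.
    have HD : 0 < dl * dl by nra.
    move=> E1 E2; have : 1 <= (s * s) * (dl * dl) by rewrite -E1; apply: Rmult_le_compat_r; lra.
    rewrite (_ : INR 1 = 1) // => E3; have : 0 <= dl * s by apply: Rmult_le_pos; lra.
    have E4 : (s * s) * (dl * dl) = (dl * s) * (dl * s) by ring.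
    rewrite E4 in E3; set q := dl * s in E3 *; nra.
  apply: (Rmult_le_reg_r (p n.+1)) => //; rewrite /Rdiv Rmult_assoc Rinv_l; last lra.
  apply: (Rmult_le_reg_l C); first lra.
  by rewrite -Rmult_assoc Rinv_r; lra.
apply: Rle_trans (Rmin_r _ _) _; apply: (Rle_trans _ (/ p n.+1)).
  by apply: Rinv_le_contravar => //; apply: p_le; lia.
rewrite -[X in X <= _]Rmult_1_l; apply: Rmult_le_compat_r => //.
by left; apply: Rinv_0_lt_compat.
Qed.

Definition lrat n := - ln (ratio n).

Lemma ratio_gt0 n : (0 < n)%nat -> 0 < ratio n.
Proof.
by case: n => // n _; apply: Rdiv_lt_0_compat; apply: p_gt0.
Qed.

Lemma ln_p_step n : (0 < n)%nat -> ln (p n.-1) = ln (p n) - lrat n.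
Proof.
case: n => // n _; rewrite /lrat /= ln_div; [ring | exact: p_gt0 | exact: p_gt0].
Qed.

Lemma lrat_osc : exists C, 0 < C /\ forall n i, (0 < n)%nat -> (2 * i <= n)%nat ->
  Rabs (lrat (n - i) - lrat n) <= C * (/ INR n + INR i / sqrt (INR n) ^ 3).
Proof.
have [c [Hc Hr]] := ratio_lower; have [C [HC Hosc]] := ratio_osc.
exists (C / c * 2); split.
  by apply: Rmult_lt_0_compat; [apply: Rdiv_lt_0_compat; lra | lra].
move=> n i Hn Hi; have Hn0 := INR_gt0 Hn; have Hs1 := sqrt_INR_ge1 Hn.
have Hni := Rinv_0_lt_compat _ Hn0.
have Hs3 : 0 < / sqrt (INR n) ^ 3 by apply: Rinv_0_lt_compat; apply: pow_lt; lra.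
have Hi0 := pos_INR i.
case: i Hi Hi0 => [|i] Hi Hi0.
  rewrite subn0 Rminus_diag Rabs_R0; apply: Rmult_le_pos.
    by apply: Rmult_le_pos; [left; apply: Rdiv_lt_0_compat|]; lra.
  by apply: Rplus_le_le_0_compat; [lra | apply: Rmult_le_pos; lra].
have Hin : (n - i.+1 < n)%nat by lia.
rewrite /lrat (_ : - ln (ratio (n - i.+1)) - - ln (ratio n) = ln (ratio n) - ln (ratio (n - i.+1))); last by ring.
apply: Rle_trans (ln_lipschitz (proj1 Hc) (Hr n Hn) (Hr (n - i.+1)%nat _)) _; first by lia.
have H1 := Hosc n (n - i.+1)%nat Hin.
have H2 : uinv (n - i.+1) <= 2 * / INR n.
  have -> : 2 * / INR n = / (INR n / 2) by field; lra.
  apply: Rinv_le_contravar; first lra.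
  have : INR n <= INR (2 * (n - i.+1)) by apply: INR_leq; lia.
  rewrite INR_mul (_ : INR 2 = 2) //; lra.
have H3 : vinv (n - i.+1) - vinv n <= 2 * INR i.+1 / sqrt (INR n) ^ 3.
  have := @vinv_diff_le_half n (n - i.+1) Hn (ltnW Hin).
  rewrite (_ : (n - (n - i.+1))%nat = i.+1); last by lia.
  apply; have : INR (2 * i.+1) <= INR n by apply: INR_leq.
  rewrite INR_mul (_ : INR 2 = 2) //; lra.
rewrite /Rdiv in H3.
apply: (Rle_trans _ (C * (2 * / INR n + 2 * INR i.+1 * / sqrt (INR n) ^ 3) / c)).
  apply: Rmult_le_compat_r; first by left; apply: Rinv_0_lt_compat; lra.
  by apply: Rle_trans H1 _; apply: Rmult_le_compat_l; lra.
by right; rewrite /Rdiv; ring.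
Qed.

Lemma ln_p_sum n k : (k <= n)%nat -> ln (p (n - k)) = ln (p n) - \rsum_(0 <= i < k) lrat (n - i).
Proof.
elim: k => [|k IH] Hk; first by rewrite subn0 big_geq //; ring.
rewrite big_nat_recr //=; have := IH (ltnW Hk).
have := @ln_p_step (n - k)%nat; rewrite subn_gt0 => /(_ Hk).
rewrite (_ : (n - k).-1 = (n - k.+1)%nat); last by lia.
lra.
Qed.

(** [lrat_osc] is summed over the [k] unit steps from [n] down to [n - k]. *)
Lemma ln_p_linear : exists C, 0 < C /\ forall n k, (0 < n)%nat -> (2 * k <= n)%nat ->
  Rabs (ln (p (n - k)) - ln (p n) + INR k * lrat n)
  <= C * (INR k / INR n + INR k ^ 2 / sqrt (INR n) ^ 3).
Proof.
have [C [HC H]] := lrat_osc; exists C; split=> // n k Hn Hk.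
have -> : ln (p (n - k)) - ln (p n) + INR k * lrat n = - \rsum_(0 <= i < k) (lrat (n - i) - lrat n).
  rewrite ln_p_sum; last by lia.
  by rewrite rsum_minus rsum_const // subn0; ring.
rewrite Rabs_Ropp; apply: Rle_trans (rsum_abs _ _ _) _.
apply: (Rle_trans _ (\rsum_(0 <= i < k) (C * (/ INR n + INR k / sqrt (INR n) ^ 3)))).
  apply: rsum_le => i Hi _; apply: Rle_trans (H n i Hn _) _; first by lia.
  apply: Rmult_le_compat_l; first lra; apply: Rplus_le_compat_l.
  apply: Rmult_le_compat_r; last by apply: INR_leq; lia.
  by left; apply: Rinv_0_lt_compat; apply: pow_lt; have := sqrt_INR_ge1 Hn; lra.
rewrite rsum_const // subn0; right; rewrite /Rdiv; ring.
Qed.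

Lemma exp_diff_le a b : Rabs (exp a - exp b) <= Rabs (a - b) * (exp a + exp b).
Proof.
have H x y : exp x - exp y <= Rabs (x - y) * (exp x + exp y).
  have Hx := exp_pos x; have Hy := exp_pos y.
  have : exp y = exp x * exp (y - x) by rewrite -exp_plus; congr exp; ring.
  have := exp_ge1 (y - x); have := Rle_abs (x - y); have := Rabs_pos (x - y).
  set A := Rabs _ => HA H1 H2 H3.
  have : exp x - exp y <= (x - y) * exp x by nra.
  nra.
apply: Rabs_le; have := H a b; have := H b a.
by rewrite (Rabs_minus_sym b a); lra.
Qed.

(** Compare with [p_decay] at [k] about [12 sqrt n]: decay makes the logarithm of [p (n - k) / p n]
    at most [- 7 / 4] and the linearization errs by at most 1, so [k * lrat n >= 3 / 4]. *)
Lemma lrat_lower : exists n0, (0 < n0)%nat /\ forall n, (n0 <= n)%nat ->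
  / (16 * sqrt (INR n)) <= lrat n.
Proof.
have [C [HC H]] := ln_p_linear.
have [n1 Hn1] := INR_unbounded (32 * 32 + (150 * C) * (150 * C) * 4).
exists n1.+1; split=> // n Hn.
have Hn0 : (0 < n)%nat by lia.
have Hs1 := sqrt_INR_ge1 Hn0; have Hs := sqrt_INR_sqr n.
have Hd := p_decay Hn0.
have {}H k := H n k Hn0.
set s := sqrt _ in Hs1 Hs Hd H *.
have Hnn : INR n1 <= s * s by rewrite Hs; apply: INR_leq; lia.
have HC2 : 0 <= (150 * C) * (150 * C) * 4 by nra.
have Hs32 : 32 <= s by nra.
have HsC : 300 * C <= s.
  have : (300 * C) * (300 * C) <= s * s by nra.
  nra.
have [k [Hk1 Hk2]] : exists M, INR M <= 12 * s < INR M + 1 by apply: nat_floor; lra.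
have Hk2n : (2 * k <= n)%nat.
  apply/leP; apply: INR_le; rewrite INR_mul (_ : INR 2 = 2) // -Hs; nra.
have Hkn : (k <= n)%nat by lia.
have {}Hd := Hd k Hkn; have {}H := H k Hk2n.
have Hln : ln (p (n - k)) <= 1 - INR k / (4 * s) + ln (p n).
  rewrite -[1 - _]ln_exp -ln_mult; [|exact: exp_pos|exact: p_gt0].
  by apply: ln_le Hd; apply: p_gt0.
have Hk11 : 11 * s <= INR k by lra.
have HT : INR k / INR n + INR k ^ 2 / s ^ 3 <= 156 / s.
  have -> : 156 / s = (12 * s) / (s * s) + (12 * s) ^ 2 / s ^ 3 by field; lra.
  rewrite -Hs; apply: Rplus_le_compat.
    by apply: Rmult_le_compat_r => //; left; apply: Rinv_0_lt_compat; nra.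
  apply: Rmult_le_compat_r; first by left; apply: Rinv_0_lt_compat; apply: pow_lt; lra.
  by apply: pow_incr; split=> //; apply: pos_INR.
have HCT : C * (156 / s) <= 1.
  apply: (Rmult_le_reg_r s); first lra.
  by rewrite (_ : C * (156 / s) * s = 156 * C); [lra | field; lra].
have HCT' : C * (INR k / INR n + INR k ^ 2 / s ^ 3) <= 1.
  by apply: Rle_trans HCT; apply: Rmult_le_compat_l; lra.
have Hk4 : 11 / 4 <= INR k / (4 * s).
  apply: (Rmult_le_reg_r (4 * s)); first lra.
  by rewrite /Rdiv Rmult_assoc (Rmult_assoc (INR k)) Rinv_l ?Rmult_1_r; lra.
have := Rle_abs (- (ln (p (n - k)) - ln (p n) + INR k * lrat n)); rewrite Rabs_Ropp => Hab.
have Hkl : 3 / 4 <= INR k * lrat n by lra.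
have Hk12 : 0 < 12 * s by lra.
apply: (Rmult_le_reg_l (12 * s)) => //.
rewrite (_ : 12 * s * / (16 * s) = 3 / 4); last by field; lra.
case: (Rle_dec 0 (lrat n)) => Hl; first by nra.
have := pos_INR k; nra.
Qed.

(** The recurrence is divided by [p n] and [p (n - k) / p n] is replaced by [exp (- k lrat n)]. The
    error factors [k / n] and [k ^ 2 / n ^ (3/2)], weighted by sigma and the decay, contribute
    O(sqrt n). *)
Lemma rec_exp_approx : exists C n0, 0 < C /\ (0 < n0)%nat /\ forall n, (n0 <= n)%nat ->
  Rabs (INR n - \rsum_(1 <= k < n.+1) (sg k * exp (- (INR k * lrat n)))) <= C * sqrt (INR n).
Proof.
have [C0 [HC0 Hlin]] := ln_p_linear; have [n0 [Hn0 Hlow]] := lrat_lower.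
have [M1 [HM1 H1]] := sg_exp_moment 1; have [M2 [HM2 H2]] := sg_exp_moment 2.
pose C1 := C0 + 4; exists (4 * C1 * (M1 * 16 ^ 3 + M2 * 16 ^ 4)), n0.
split; first by rewrite /C1; nra.
split=> // n Hn; have Hn1 : (0 < n)%nat by lia.
have Hs1 := sqrt_INR_ge1 Hn1; have Hs := sqrt_INR_sqr n.
have Hx := Hlow n Hn; have Hd := @p_decay n; have {}Hlin := Hlin n.
set s := sqrt _ in Hs1 Hs Hx Hd Hlin *; set x := lrat n in Hx Hlin *.
have Hpn := p_gt0 n; have Hy : 0 < / (16 * s) by apply: Rinv_0_lt_compat; lra.
pose th k := C1 * (INR k / INR n + INR k ^ 2 / s ^ 3).
have Hs3 : 0 < / s ^ 3 by apply: Rinv_0_lt_compat; apply: pow_lt; lra.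
have Hn0' := INR_gt0 Hn1; have Hni := Rinv_0_lt_compat _ Hn0'.
have Hterm k : (0 < k <= n)%nat ->
    Rabs (p (n - k) / p n - exp (- (INR k * x))) <= th k * (4 * exp (- (INR k * / (16 * s)))).
  move=> Hk; have Hk0 := pos_INR k.
  have Hr0 : 0 <= p (n - k) / p n by apply: Rmult_le_pos; [apply: pos_INR | left; apply: Rinv_0_lt_compat].
  have Hr : p (n - k) / p n <= 3 * exp (- (INR k * / (16 * s))).
    apply: (Rmult_le_reg_r (p n)) => //; rewrite /Rdiv Rmult_assoc Rinv_l ?Rmult_1_r; last lra.
    apply: Rle_trans (Hd k Hn1 _) _; first by lia.
    apply: Rmult_le_compat_r; first lra.
    rewrite /Rminus exp_plus; apply: Rmult_le_compat; try (by left; apply: exp_pos).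
      exact: exp_le_3.
    apply: exp_le; rewrite /Rdiv; apply: Ropp_le_contravar; apply: Rmult_le_compat_l => //.
    by apply: Rinv_le_contravar; lra.
  have He : exp (- (INR k * x)) <= exp (- (INR k * / (16 * s))).
    by apply: exp_le; apply: Ropp_le_contravar; apply: Rmult_le_compat_l.
  have Hexp := exp_pos (- (INR k * x)).
  set E := exp (- (INR k * / (16 * s))) in Hr He *; have HE : 0 < E by apply: exp_pos.
  have Hth0 : 0 <= INR k / INR n + INR k ^ 2 / s ^ 3.
    apply: Rplus_le_le_0_compat; apply: Rmult_le_pos => //; [lra | exact: pow_le | lra].
  case: (leqP (2 * k) n) => H2k.
    have -> : p (n - k) / p n = exp (ln (p (n - k)) - ln (p n)).
      by rewrite -ln_div ?exp_ln //; [apply: Rdiv_lt_0_compat; apply: p_gt0 | apply: p_gt0].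
    apply: Rle_trans (exp_diff_le _ _) _.
    have := Hlin k Hn1 H2k; rewrite (_ : forall a, a - - (INR k * x) = a + INR k * x); last by move=> a; ring.
    move=> Hl; apply: Rmult_le_compat; [exact: Rabs_pos| | |].
    - by apply: Rplus_le_le_0_compat; left; apply: exp_pos.
    - by apply: Rle_trans Hl _; rewrite /th /C1; apply: Rmult_le_compat_r; lra.
    by rewrite -ln_div ?exp_ln; [lra | apply: Rdiv_lt_0_compat; apply: p_gt0 | apply: p_gt0 | apply: p_gt0].
  (* Past the midpoint there is no linearization, but the error factor is at least 1 and both
     quantities obey the exponential decay. *)
  have Hth : 1 <= th k.
    have Hk2 : s * s <= 2 * INR k.
      by rewrite Hs -(_ : INR 2 = 2) // -INR_mul; apply: INR_leq; lia.
    have : / 4 <= INR k ^ 2 / s ^ 3.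
      apply: (Rmult_le_reg_r (s ^ 3)); first by apply: pow_lt; lra.
      rewrite /Rdiv Rmult_assoc Rinv_l ?Rmult_1_r; last by apply: pow_nonzero; lra.
      have : (s * s / 2) ^ 2 <= INR k ^ 2 by apply: pow_incr; nra.
      have : (s * s / 2) ^ 2 = s * s ^ 3 / 4 by field.
      have := pow_lt s 3 ltac:(lra); set q := s ^ 3; nra.
    have : 0 <= INR k / INR n by apply: Rmult_le_pos; lra.
    by rewrite /th /C1; nra.
  apply: (Rle_trans _ (1 * (4 * E))); last by apply: Rmult_le_compat_r; lra.
  by apply: Rabs_le; lra.
have -> : INR n - \rsum_(1 <= k < n.+1) (sg k * exp (- (INR k * x))) =
    \rsum_(1 <= k < n.+1) (sg k * (p (n - k) / p n - exp (- (INR k * x)))).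
  have -> : INR n = (\rsum_(1 <= k < n.+1) (sg k * p (n - k))) / p n by rewrite -p_rec; field; lra.
  by rewrite /Rdiv -rsum_scar -rsum_minus; apply: eq_bigr => k _; ring.
apply: Rle_trans (rsum_abs _ _ _) _.
apply: (Rle_trans _ (4 * C1 / INR n * \rsum_(1 <= k < n.+1) (sg k * (INR k ^ 1 * exp (- (INR k * / (16 * s)))))
   + 4 * C1 / s ^ 3 * \rsum_(1 <= k < n.+1) (sg k * (INR k ^ 2 * exp (- (INR k * / (16 * s))))))).
  rewrite -!rsum_scal -rsum_plus; apply: rsum_le => k Hk _.
  rewrite Rabs_mult Rabs_pos_eq; last exact: sg_ge0.
  apply: Rle_trans (Rmult_le_compat_l _ _ _ (sg_ge0 k) (Hterm k _)) _; first by lia.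
  by right; rewrite /th /= pow_1 /Rdiv; ring.
have {}H1 := H1 n _ Hy; have {}H2 := H2 n _ Hy.
have HC1 : 0 < C1 by rewrite /C1; lra.
apply: (Rle_trans _ (4 * C1 / INR n * (M1 / (/ (16 * s)) ^ (1 + 2)) + 4 * C1 / s ^ 3 * (M2 / (/ (16 * s)) ^ (2 + 2)))).
  apply: Rplus_le_compat; apply: Rmult_le_compat_l => //.
    by apply: Rmult_le_pos; lra.
  by apply: Rmult_le_pos; lra.
right; rewrite !pow_inv /Rdiv !Rinv_inv -Hs (_ : (1 + 2)%nat = 3%nat) // (_ : (2 + 2)%nat = 4%nat) //; field; lra.
Qed.

(* This is pi / sqrt 6, so that ln (p n) = 2 cz sqrt n + O(ln n). *)
Definition cz := sqrt zeta2.

Lemma cz_sqr : cz * cz = zeta2.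
Proof. by apply: sqrt_sqrt; have := zeta2_gt1; lra. Qed.

Lemma cz_gt1 : 1 < cz.
Proof. by have := cz_sqr; have := zeta2_gt1; have := sqrt_pos zeta2; rewrite -/cz; nra. Qed.

Lemma cz_lt2 : cz < 2.
Proof. by have := cz_sqr; have := zeta2_le2; have := cz_gt1; nra. Qed.

(** With [x = lrat n] the exponential sum is [zeta2 / x ^ 2 + O(1 / x)], so
    [n = zeta2 / x ^ 2 + O(sqrt n)]; factoring the difference of squares solves for [x] to relative
    precision [1 / sqrt n]. *)
Lemma lrat_asymp_ev : exists C n0, 0 < C /\ forall n, (n0 <= n)%nat ->
  Rabs (lrat n - cz / sqrt (INR n)) <= C / INR n.
Proof.
have [C [n0 [HC [Hn0 H]]]] := rec_exp_approx; have [n1 [Hn1 Hlow]] := lrat_lower.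
pose X := C + 96.
(* [8589934592] is [2 ^ 33]. Once [s] exceeds it, [exp (s / 32) >= s ^ 4 / 2 ^ 28 >= 32 * s ^ 3],
   which verifies the truncation hypothesis of [sg_exp_ge]. *)
have [n2 Hn2] := INR_unbounded (64 * 64 + (2 * C) * (2 * C) + 8589934592 * 8589934592).
exists (2 * X), (n0 + n1 + n2)%nat; split; first by rewrite /X; lra.
move=> n Hn; have Hn' : (0 < n)%nat by lia.
have Hs1 := sqrt_INR_ge1 Hn'; have Hs := sqrt_INR_sqr n.
have {}H := H n ltac:(lia); have Hx := Hlow n ltac:(lia).
set s := sqrt _ in Hs1 Hs Hx H *; set x := lrat n in Hx H *; set S := (X in Rabs (_ - X)) in H.
have Hnn : INR n2 <= s * s by rewrite Hs; apply: INR_leq; lia.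
have HC2 : 0 <= (2 * C) * (2 * C) by nra.
have Hs64 : 64 <= s by nra.
have HsC : 2 * C <= s by nra.
have HsQ : 8589934592 <= s by nra.
have Hx0 : 0 < x by apply: Rlt_le_trans Hx; apply: Rinv_0_lt_compat; lra.
have HxS : S <= zeta2 / x ^ 2 by apply: sg_exp_le.
have HS1 : s * s / 2 <= S.
  have := Rle_abs (INR n - S); rewrite -Hs in H *; nra.
have Hz2 := zeta2_le2; have Hx2 : 0 < x ^ 2 by apply: pow_lt.
have Hxs : x * s <= 2.
  have E1 : s * s / 2 * x ^ 2 <= 2.
    apply: (Rle_trans _ (zeta2 / x ^ 2 * x ^ 2)); first by apply: Rmult_le_compat_r; lra.
    by rewrite /Rdiv Rmult_assoc Rinv_l; lra.
  have : (x * s) * (x * s) <= 2 * 2 by rewrite (_ : (x * s) * (x * s) = s * s * x ^ 2); [lra | ring].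
  have : 0 <= x * s by apply: Rmult_le_pos; lra.
  set q := x * s; nra.
have Hxs16 : / 16 <= x * s.
  have := Rmult_le_compat_r s _ _ ltac:(lra) Hx.
  by rewrite (_ : / (16 * s) * s = / 16) //; field; lra.
have Hx1 : 0 < x <= 1 by split => //; nra.
have Hnx : 2 <= INR n * x by rewrite -Hs; nra.
have Hexp : (INR n + 1) * exp (- (INR n * x / 2)) <= x.
  apply: (Rle_trans _ ((INR n + 1) * exp (- (s / 32)))).
    apply: Rmult_le_compat_l; first by have := pos_INR n; lra.
    by apply: exp_le; rewrite -Hs; nra.
  apply: Rle_trans Hx; have Hs32 : 0 <= s / 32 by lra.
  have := @pow_le_exp 4 _ isT Hs32; rewrite exp_Ropp.
  have := exp_pos (s / 32); set E := exp _ => HE H4.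
  rewrite -Hs; apply: (Rmult_le_reg_r E) => //; rewrite Rmult_assoc Rinv_l ?Rmult_1_r; last lra.
  apply: (Rle_trans _ (2 * (s * s))); first by nra.
  apply: (Rmult_le_reg_l (16 * s)); first lra.
  have -> : 16 * s * (/ (16 * s) * E) = E by field; lra.
  have : s ^ 4 / 268435456 <= E.
    have -> : s ^ 4 / 268435456 = (s / 32) ^ 4 / 256 by field.
    move: H4; rewrite (_ : INR 4 = 4); [lra | by rewrite /INR; ring].
  apply: Rle_trans; have -> : s ^ 4 / 268435456 = s * (s * s * s) / 268435456 by field.
  have : 0 <= s * s * s by apply: Rmult_le_pos; nra.
  set q := s * s * s => Hq; have -> : 16 * s * (2 * (s * s)) = 32 * q by rewrite /q; ring.
  have : 8589934592 * q <= s * q by apply: Rmult_le_compat_r.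
  lra.
have HSge := sg_exp_ge Hx1 Hnx Hexp; rewrite -/S in HSge.
have H6x : 6 / x <= 96 * s.
  apply: (Rmult_le_reg_r x) => //; rewrite /Rdiv Rmult_assoc Rinv_l; last lra.
  nra.
have Hmain : Rabs (s * s - zeta2 / x ^ 2) <= X * s.
  have := Rabs_def2; move: H; rewrite -Hs => H _.
  have H' := Rle_abs (s * s - S); have H'' := Rle_abs (- (s * s - S)); rewrite Rabs_Ropp in H''.
  by apply: Rabs_le; rewrite /X; lra.
have Hc1 := cz_gt1; have Hc2 := cz_sqr.
have HX : 0 < X by rewrite /X; lra.
have Hd : Rabs (s - cz / x) <= X.
  have Hcx : 0 < cz / x by apply: Rdiv_lt_0_compat; lra.
  apply: (Rmult_le_reg_r s); first lra.
  apply: Rle_trans Hmain; have -> : s * s - zeta2 / x ^ 2 = (s - cz / x) * (s + cz / x).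
    by rewrite -Hc2; field; lra.
  rewrite Rabs_mult [X in _ <= _ * X]Rabs_pos_eq; last lra.
  by apply: Rmult_le_compat_l; [exact: Rabs_pos | lra].
have -> : x - cz / s = (s - cz / x) * (x / s) by field; lra.
have Hxs0 : 0 <= x / s by apply: Rmult_le_pos; [lra | left; apply: Rinv_0_lt_compat; lra].
rewrite Rabs_mult [X in _ * X]Rabs_pos_eq // -Hs.
have : x / s <= 2 / (s * s).
  have -> : x / s = (x * s) / (s * s) by field; lra.
  by apply: Rmult_le_compat_r => //; left; apply: Rinv_0_lt_compat; nra.
move=> E1; have -> : 2 * X / (s * s) = X * (2 / (s * s)) by rewrite /Rdiv; ring.
by apply: Rmult_le_compat => //; exact: Rabs_pos.
Qed.

Lemma lrat_asymp : exists C, 0 < C /\ forall n, (0 < n)%nat ->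
  Rabs (lrat n - cz / sqrt (INR n)) <= C / INR n.
Proof.
have [C [n0 [HC H]]] := lrat_asymp_ev; have [c [Hc Hr]] := ratio_lower.
have Hc1 := cz_gt1; have Hc2 := cz_lt2.
have Hlc : 0 <= - ln c.
  by have := ln_le (proj1 Hc) (proj2 Hc); rewrite ln_1; lra.
have Hn00 := pos_INR n0.
exists (C + (- ln c + 2) * INR n0); split; first by nra.
move=> n Hn; have Hn0 := INR_gt0 Hn; have Hs1 := sqrt_INR_ge1 Hn.
case: (leqP n0 n) => Hnn.
  apply: Rle_trans (H n Hnn) _; apply: Rmult_le_compat_r; last by nra.
  by left; apply: Rinv_0_lt_compat.
have Hl : 0 <= lrat n <= - ln c.
  rewrite /lrat; have Hrn := Hr n Hn; have Hb := ratio_bounds n.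
  have := ln_le (proj1 Hc) Hrn; have := ln_le (ratio_gt0 Hn) (proj2 Hb); rewrite ln_1; lra.
have Hcs : 0 <= cz / sqrt (INR n) <= 2.
  have : / sqrt (INR n) <= 1 by rewrite -[X in _ <= X]Rinv_1; apply: Rinv_le_contravar; lra.
  have : 0 < / sqrt (INR n) by apply: Rinv_0_lt_compat; lra.
  by rewrite /Rdiv; nra.
apply: (Rle_trans _ (- ln c + 2)); first by apply: Rabs_le; lra.
apply: (Rmult_le_reg_r (INR n)) => //; rewrite /Rdiv Rmult_assoc Rinv_l ?Rmult_1_r; last lra.
have : INR n <= INR n0 by apply: INR_leq; lia.
nra.
Qed.

(** * Summation of [lrat], and shifts of the partition function *)

Lemma harmonic_le n : (0 < n)%nat -> \rsum_(1 <= j < n.+1) / INR j <= 1 + ln (INR n).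
Proof.
elim: n => // n IH _; case: n IH => [_|n IH].
  by rewrite big_nat1 (_ : INR 1 = 1) // ln_1 Rinv_1; lra.
rewrite big_nat_recr //=; have {}IH := IH isT.
have H1 := INR_gt0 (ltn0Sn n); have H2 := INR_gt0 (ltn0Sn n.+1).
have : ln (INR n.+1 / INR n.+2) <= INR n.+1 / INR n.+2 - 1.
  by apply: ln_le_sub1; apply: Rdiv_lt_0_compat.
rewrite ln_div //.
have -> : INR n.+1 / INR n.+2 - 1 = - / INR n.+2.
  by rewrite (S_INR n.+1) in H2 *; field; lra.
lra.
Qed.

Lemma sum_inv_sqrt n : 2 * sqrt (INR n) - 2 <= \rsum_(1 <= j < n.+1) / sqrt (INR j) <= 2 * sqrt (INR n).
Proof.
suff : 2 * sqrt (INR n + 1) - 2 <= \rsum_(1 <= j < n.+1) / sqrt (INR j) <= 2 * sqrt (INR n).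
  by have : sqrt (INR n) <= sqrt (INR n + 1); [apply: sqrt_le_1_alt; lra | lra].
elim: n => [|n IH].
  by rewrite big_geq // (_ : INR 0 = 0) // Rplus_0_l sqrt_1 sqrt_0; lra.
rewrite big_nat_recr //=.
have Ha := pos_INR n.
have E1 := sqrt_sqrt (INR n) Ha; have E2 := sqrt_sqrt (INR n.+1) (pos_INR _).
have E3 := sqrt_sqrt (INR n.+1 + 1) ltac:(have := pos_INR n.+1; lra).
have P1 := sqrt_pos (INR n); have P2 := sqrt_INR_ge1 (ltn0Sn n).
have P3 : 1 <= sqrt (INR n.+1 + 1) by apply: sqrt_S_ge1.
move: IH E1 E2 E3 P1 P2 P3; rewrite S_INR; set a := sqrt (INR n); set b := sqrt (INR n + 1).
set c := sqrt (INR n + 1 + 1) => IH E1 E2 E3 P1 P2 P3.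
have Hb : 0 < / b by apply: Rinv_0_lt_compat; lra.
have Hbb : b * / b = 1 by apply: Rinv_r; lra.
have Hcb : 2 * c - 2 * b <= / b.
  apply: (Rmult_le_reg_l b); first lra; nra.
have Hba : / b <= 2 * b - 2 * a.
  apply: (Rmult_le_reg_l b); first lra; nra.
lra.
Qed.

Lemma ln_p_approx : exists C, 0 < C /\ forall n,
  Rabs (ln (p n) - 2 * cz * sqrt (INR n)) <= C * (1 + ln (INR n + 1)).
Proof.
have [C [HC H]] := lrat_asymp; have Hc1 := cz_gt1; have Hc2 := cz_lt2.
exists (C + 4); split; first lra.
case=> [|n].
  rewrite npart0 (_ : INR 1 = 1) // (_ : INR 0 = 0) // Rplus_0_l ln_1 sqrt_0.
  by rewrite Rmult_0_r Rminus_0_r Rabs_R0; lra.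
have Hlp : ln (p n.+1) = \rsum_(1 <= j < n.+2) lrat j.
  have := ln_p_sum (leqnn n.+1); rewrite subnn npart0 (_ : INR 1 = 1) // ln_1 => H0.
  rewrite rsum_rev; move: H0; set T := (X in _ = _ - X).
  by move=> H0; change (ln (p n.+1) = T); lra.
have Hd : Rabs (ln (p n.+1) - cz * \rsum_(1 <= j < n.+2) / sqrt (INR j)) <= C * \rsum_(1 <= j < n.+2) / INR j.
  rewrite Hlp -!rsum_scal -rsum_minus; apply: Rle_trans (rsum_abs _ _ _) _.
  by apply: rsum_le => j Hj _; apply: H; lia.
have Hh := harmonic_le (ltn0Sn n); have [Hsa Hsb] := sum_inv_sqrt n.+1.
set S1 := (X in _ <= X) in Hsa; rewrite -/S1 in Hd Hsb.
have Hln : ln (INR n.+1) <= ln (INR n.+1 + 1).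
  by apply: ln_le; [apply: INR_gt0 | lra].
have Hln0 : 0 <= ln (INR n.+1).
  by rewrite -ln_1; apply: ln_le; [lra | apply: INR_ge1].
have Hcs : Rabs (cz * S1 - 2 * cz * sqrt (INR n.+1)) <= 4.
  have E1 := Rmult_le_compat_l cz _ _ ltac:(lra) Hsa.
  have E2 := Rmult_le_compat_l cz _ _ ltac:(lra) Hsb.
  by apply: Rabs_le; lra.
have -> : ln (p n.+1) - 2 * cz * sqrt (INR n.+1)
   = (ln (p n.+1) - cz * S1) + (cz * S1 - 2 * cz * sqrt (INR n.+1)) by ring.
apply: Rle_trans (Rabs_triang _ _) _.
have := Rmult_le_compat_l C _ _ ltac:(lra) Hh; nra.
Qed.

Lemma ln_le_lin a y : 0 < a -> 0 < y -> ln y <= y / a + ln a.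
Proof.
move=> Ha Hy; have := ln_le_sub1 (Rdiv_lt_0_compat _ _ Hy Ha).
by rewrite ln_div //; lra.
Qed.

Lemma ln_le_sqrt A e : 0 <= A -> 0 < e -> exists C, forall n,
  A * (1 + ln (INR n + 1)) <= e * sqrt (INR n) + C.
Proof.
move=> HA He; pose a := 2 * (A + 1) / e.
have Ha : 0 < a by apply: Rdiv_lt_0_compat; lra.
exists (A * (1 + 2 * (1 / a + ln a))) => n.
have Hs0 := sqrt_pos (INR n); have Hs := sqrt_INR_sqr n; set s := sqrt _ in Hs0 Hs *.
have H1 : ln (INR n + 1) <= 2 * ln (s + 1).
  have -> : 2 * ln (s + 1) = ln ((s + 1) * (s + 1)) by rewrite ln_mult; lra.
  by apply: ln_le; [have := pos_INR n; lra | nra].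
have H2 := @ln_le_lin a (s + 1) Ha ltac:(lra).
have H3 : 2 * A * (s / a) <= e * s.
  have -> : 2 * A * (s / a) = e * s * (A / (A + 1)) by rewrite /a; field; lra.
  rewrite -[X in _ <= X]Rmult_1_r; apply: Rmult_le_compat_l; first by apply: Rmult_le_pos; lra.
  by apply: (Rmult_le_reg_r (A + 1)); first lra; rewrite /Rdiv Rmult_assoc Rinv_l; lra.
have H4 : ln (INR n + 1) <= 2 * (s / a + (1 / a + ln a)) by rewrite /Rdiv in H2 *; lra.
have := Rmult_le_compat_l A _ _ HA H4; lra.
Qed.

(* The approximate value of p(N - m) / p(N). *)
Definition zz N m := exp (- (cz * INR m / sqrt (INR N))).

Lemma p_shift_log : exists C, 0 < C /\ forall N m, (0 < N)%nat -> (2 * m <= N)%nat ->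
  Rabs (ln (p (N - m)) - ln (p N) + cz * INR m / sqrt (INR N))
  <= C * (INR m / INR N + INR m ^ 2 / sqrt (INR N) ^ 3).
Proof.
have [C1 [HC1 H1]] := ln_p_linear; have [C2 [HC2 H2]] := lrat_asymp.
exists (C1 + C2); split; first lra.
move=> N m HN Hm; have Hs1 := sqrt_INR_ge1 HN; have HN0 := INR_gt0 HN; have Hm0 := pos_INR m.
have := H1 N m HN Hm; have := H2 N HN; set s := sqrt _ in Hs1 *.
set T := INR m / INR N; set W := INR m ^ 2 / s ^ 3 => E2 E1.
have HT : 0 <= T by apply: Rmult_le_pos => //; left; apply: Rinv_0_lt_compat.
have HW : 0 <= W by apply: Rmult_le_pos; [apply: pow_le | left; apply: Rinv_0_lt_compat; apply: pow_lt; lra].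
have E3 : Rabs (INR m * (cz / s - lrat N)) <= C2 * T.
  rewrite Rabs_mult Rabs_pos_eq // Rabs_minus_sym.
  apply: Rle_trans (Rmult_le_compat_l _ _ _ Hm0 E2) _.
  by right; rewrite /T /Rdiv; ring.
have -> : ln (p (N - m)) - ln (p N) + cz * INR m / s =
  (ln (p (N - m)) - ln (p N) + INR m * lrat N) + INR m * (cz / s - lrat N) by rewrite /Rdiv; ring.
apply: Rle_trans (Rabs_triang _ _) _; nra.
Qed.

(** An upper bound for all [m], whereas the error in [p_shift_log] grows with [m]. Up to the
    midpoint each [lrat (N - i)] is at least [cz / sqrt N - O(1 / N)]. Beyond it the concavity of
    the square root gains [sqrt N / 16], which absorbs the logarithmic error of [ln_p_approx]. *)
Lemma p_shift_le : exists C, 1 <= C /\ forall N m, (0 < N)%nat -> (m <= N)%nat ->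
  p (N - m) <= C * zz N m * p N.
Proof.
have [C1 [HC1 H1]] := lrat_asymp; have [C3 [HC3 H3]] := ln_p_approx.
have Hc1 := cz_gt1.
have [C4 H4] := @ln_le_sqrt (2 * C3) (/ 16) ltac:(lra) ltac:(lra).
exists (exp C1 + exp C4); split.
  by have := exp_pos C4; have := exp_ge1 C1; lra.
suff H : forall N m, (0 < N)%nat -> (m <= N)%nat ->
   ln (p (N - m)) - ln (p N) + cz * INR m / sqrt (INR N) <= Rmax C1 C4.
  move=> N m HN Hm; have := H N m HN Hm.
  set b := cz * INR m / sqrt (INR N) => Hb.
  have -> : p (N - m) = exp (ln (p (N - m)) - ln (p N) + b) * zz N m * p N.
    have Hp1 := p_gt0 (N - m); have Hp2 := p_gt0 N.
    rewrite /zz -/b -exp_plus (_ : _ + b + - b = ln (p (N - m)) - ln (p N)); last by ring.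
    by rewrite -ln_div // exp_ln; [field; lra | apply: Rdiv_lt_0_compat].
  apply: Rmult_le_compat_r; first exact: pos_INR.
  apply: Rmult_le_compat_r; first by left; apply: exp_pos.
  apply: (Rle_trans _ (exp (Rmax C1 C4))); first exact: exp_le.
  by have := exp_pos C1; have := exp_pos C4; rewrite /Rmax; case: Rle_dec; lra.
move=> N m HN Hm; have Hs1 := sqrt_INR_ge1 HN; have Hs := sqrt_INR_sqr N.
have HN0 := INR_gt0 HN; have Hm0 := pos_INR m.
case: (leqP (2 * m) N) => H2m.
  apply: Rle_trans (Rmax_l _ _); rewrite ln_p_sum //.
  set s := sqrt _ in Hs1 Hs *.
  have HNm : INR N <= 2 * INR (N - m).
    by rewrite -(_ : INR 2 = 2) // -INR_mul; apply: INR_leq; lia.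
  have : \rsum_(0 <= i < m) (cz / s - C1 * 2 / INR N) <= \rsum_(0 <= i < m) lrat (N - i).
    apply: rsum_le => i Hi _; have Hi0 : (0 < N - i)%nat by lia.
    have HiN := INR_gt0 Hi0; have Hss := sqrt_INR_ge1 Hi0.
    have E1 := H1 (N - i)%nat Hi0; have E2 := Rle_abs (- (lrat (N - i) - cz / sqrt (INR (N - i)))).
    rewrite Rabs_Ropp in E2.
    have E3 : cz / s <= cz / sqrt (INR (N - i)).
      apply: Rmult_le_compat_l; first lra; apply: Rinv_le_contravar; first lra.
      by apply: sqrt_le_1_alt; apply: INR_leq; lia.
    have E4 : C1 / INR (N - i) <= C1 * 2 / INR N.
      have -> : C1 * 2 / INR N = C1 * / (INR N / 2) by field; lra.
      apply: Rmult_le_compat_l; first lra; apply: Rinv_le_contravar; first lra.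
      have : INR (N - m) <= INR (N - i) by apply: INR_leq; lia.
      lra.
    lra.
  rewrite rsum_const // subn0 => E.
  have : INR m * (C1 * 2 / INR N) <= C1.
    have -> : INR m * (C1 * 2 / INR N) = C1 * (2 * INR m / INR N) by rewrite /Rdiv; ring.
    rewrite -[X in _ <= X]Rmult_1_r; apply: Rmult_le_compat_l; first lra.
    apply: (Rmult_le_reg_r (INR N)) => //; rewrite /Rdiv Rmult_assoc Rinv_l ?Rmult_1_r ?Rmult_1_l; last lra.
    by rewrite -(_ : INR 2 = 2) // -INR_mul; apply: INR_leq.
  have -> : cz * INR m / s = INR m * (cz / s) by rewrite /Rdiv; ring.
  lra.
apply: Rle_trans (Rmax_r _ _).
have E1 := H3 N; have E2 := H3 (N - m)%nat.
have E1' := Rle_abs (- (ln (p N) - 2 * cz * sqrt (INR N))); rewrite Rabs_Ropp in E1'.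
have E2' := Rle_abs (ln (p (N - m)) - 2 * cz * sqrt (INR (N - m))).
have Hln : ln (INR (N - m) + 1) <= ln (INR N + 1).
  apply: ln_le; first by have := pos_INR (N - m); lra.
  by have : INR (N - m) <= INR N; [apply: INR_leq; lia | lra].
have E3 := H4 N; have Hn := sqrt_INR_sqr (N - m); have Hn0 := sqrt_pos (INR (N - m)).
have HC3l := Rmult_le_compat_l C3 _ _ (Rlt_le _ _ HC3) Hln.
set s := sqrt (INR N) in Hs1 Hs E1 E1' E3 *; set r := sqrt (INR (N - m)) in E2 E2' Hn Hn0.
have Hms : INR m = s * s - r * r by rewrite Hs Hn INR_sub //; ring.
have Hrs : r <= 3 / 4 * s.
  have : 2 * (r * r) <= s * s.
    by rewrite Hs Hn -(_ : INR 2 = 2) // -INR_mul; apply: INR_leq; lia.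
  nra.
have Hkey : cz * INR m / s + / 16 * s <= 2 * cz * s - 2 * cz * r.
  have -> : 2 * cz * s - 2 * cz * r = cz * INR m / s + cz * ((s - r) * (s - r) / s).
    by rewrite Hms; field; lra.
  apply: Rplus_le_compat_l.
  have : / 16 * s <= (s - r) * (s - r) / s.
    apply: (Rmult_le_reg_r s); first lra.
    rewrite /Rdiv Rmult_assoc Rmult_assoc Rinv_l ?Rmult_1_r; nra.
  have : 0 < s by lra.
  move=> Q1 Q2; nra.
lra.
Qed.

(** Extended by zero so that [i |-> psh N (t * i)] is a sequence on all natural numbers, to which
    [fdiff] applies. *)
Definition psh N m := if (m <= N)%nat then p (N - m) / p N else 0.

Lemma zz_gt0 N m : 0 < zz N m. Proof. exact: exp_pos. Qed.

Lemma psh_ge0 N m : 0 <= psh N m.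
Proof.
rewrite /psh; case: ifP => _; last lra.
by left; apply: Rdiv_lt_0_compat; apply: p_gt0.
Qed.

Lemma psh_le : exists C, 1 <= C /\ forall N m, (0 < N)%nat -> psh N m <= C * zz N m.
Proof.
have [C [HC H]] := p_shift_le; exists C; split=> // N m HN; rewrite /psh.
have Hz := zz_gt0 N m; case: leqP => Hm; last by nra.
have Hp := p_gt0 N; apply: (Rmult_le_reg_r (p N)) => //.
by rewrite /Rdiv Rmult_assoc Rinv_l ?Rmult_1_r; [apply: H | lra].
Qed.

Lemma psh_approx : exists C, 0 < C /\ forall N m, (0 < N)%nat ->
  Rabs (psh N m - zz N m)
  <= C * (INR m / INR N + INR m ^ 2 / sqrt (INR N) ^ 3) * zz N m.
Proof.
have [C1 [HC1 H1]] := p_shift_log; have [C2 [HC2 H2]] := psh_le.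
exists ((C1 + 4) * (C2 + 1)); split; first by nra.
move=> N m HN; have Hs1 := sqrt_INR_ge1 HN; have Hs := sqrt_INR_sqr N.
have HN0 := INR_gt0 HN; have Hm0 := pos_INR m; have Hz := zz_gt0 N m.
have {}H1 := H1 N m HN; have {}H2 := H2 N m HN; have Hp0 := psh_ge0 N m.
set s := sqrt _ in Hs1 Hs H1 *.
set T := INR m / INR N in H1 *; set W := INR m ^ 2 / s ^ 3 in H1 *.
have HT : 0 <= T by apply: Rmult_le_pos => //; left; apply: Rinv_0_lt_compat.
have HW : 0 <= W by apply: Rmult_le_pos; [apply: pow_le | left; apply: Rinv_0_lt_compat; apply: pow_lt; lra].
case: (leqP (2 * m) N) => H2m.
  have Hpm : psh N m = exp (ln (p (N - m)) - ln (p N)).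
    rewrite /psh ifT; last by lia.
    by rewrite -ln_div ?exp_ln //; [apply: Rdiv_lt_0_compat; apply: p_gt0 | apply: p_gt0 | apply: p_gt0].
  have := exp_diff_le (ln (p (N - m)) - ln (p N)) (- (cz * INR m / s)).
  rewrite -Hpm -/(zz N m) => Hd; apply: Rle_trans Hd _.
  have -> : forall a, a - - (cz * INR m / s) = a + cz * INR m / s by move=> a; ring.
  apply: (Rle_trans _ (C1 * (T + W) * ((C2 + 1) * zz N m))).
    apply: Rmult_le_compat; [exact: Rabs_pos | lra | exact: H1 | lra].
  have : 0 <= (T + W) * ((C2 + 1) * zz N m) by apply: Rmult_le_pos; [lra | apply: Rmult_le_pos; lra].
  set Q := (T + W) * _ => HQ.
  have -> : (C1 + 4) * (C2 + 1) * (T + W) * zz N m = (C1 + 4) * Q by rewrite /Q; ring.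
  by rewrite Rmult_assoc -/Q; apply: Rmult_le_compat_r; lra.
(* Past the midpoint the claimed error exceeds a constant, so [psh_le] is enough. *)
have HW4 : 1 <= 4 * W.
  have Hm2 : s * s <= 2 * INR m.
    by rewrite Hs -(_ : INR 2 = 2) // -INR_mul; apply: INR_leq; lia.
  apply: (Rmult_le_reg_r (s ^ 3)); first by apply: pow_lt; lra.
  rewrite Rmult_assoc /W /Rdiv Rmult_assoc Rinv_l ?Rmult_1_r ?Rmult_1_l; last by apply: pow_nonzero; lra.
  have : (s * s / 2) ^ 2 <= INR m ^ 2 by apply: pow_incr; nra.
  have : (s * s / 2) ^ 2 = s * s ^ 3 / 4 by field.
  have := pow_lt s 3 ltac:(lra); set q := s ^ 3; nra.
apply: (Rle_trans _ ((C2 + 1) * zz N m)); first by apply: Rabs_le; nra.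
rewrite Rmult_assoc; have Hq : 0 < (C2 + 1) * zz N m by nra.
have -> : (C1 + 4) * (C2 + 1) * ((T + W) * zz N m) = (C1 + 4) * (T + W) * ((C2 + 1) * zz N m) by ring.
rewrite -[X in X <= _]Rmult_1_l; apply: Rmult_le_compat_r; nra.
Qed.

(** * Counting cores *)

(** Sequences stand for the coefficients of generating functions, and [cv] for their product. *)
Definition cv (f g : nat -> R) (w : nat) : R := \rsum_(0 <= i < w.+1) (f i * g (w - i)%nat).

(* Multiplication of a generating function by 1 - X. *)
Definition dl (g : nat -> R) (w : nat) : R := if w is w'.+1 then g w - g w' else g 0%nat.

Definition unit0 (w : nat) : R := if w is 0%nat then 1 else 0.

Fixpoint cpow (g : nat -> R) (t : nat) : nat -> R :=
  if t is s.+1 then cv (cpow g s) g else unit0.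

Definition pseq (w : nat) : R := p w.

Lemma pconv_cpow t w : INR (pconv t w) = cpow pseq t w.
Proof.
elim: t w => [|t IH] w /=; first by case: w.
rewrite INR_sum /cv big_mkord; apply: eq_bigr => i _.
by rewrite INR_mul IH.
Qed.

Lemma dl_cvr f g : dl (cv f g) = cv f (dl g).
Proof.
apply: functional_extensionality => -[|w]; rewrite /dl /cv.
  by rewrite !big_nat1 subnn.
rewrite big_nat_recr //= [RHS]big_nat_recr //= subnn.
rewrite -[RHS]/(_ + f w.+1 * g 0%nat).
have -> : \rsum_(0 <= i < w.+1) (f i * (if (w.+1 - i)%nat is w'.+1 then g (w.+1 - i)%nat - g w' else g 0%nat))
   = \rsum_(0 <= i < w.+1) (f i * g (w.+1 - i)%nat) - \rsum_(0 <= i < w.+1) (f i * g (w - i)%nat).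
  by rewrite -rsum_minus; apply: eq_big_nat => i Hi; rewrite subSn ?ltnS //; ring.
ring.
Qed.

Lemma dl_cvl f g : dl (cv f g) = cv (dl f) g.
Proof.
apply: functional_extensionality => -[|w]; rewrite /dl /cv.
  by rewrite !big_nat1 subnn.
rewrite big_nat_recl // [RHS]big_nat_recl //=.
under [X in _ + X - _]eq_bigr => i _ do rewrite subSS.
under [X in _ = _ + X]eq_bigr => i _ do rewrite subSS.
have -> : \rsum_(0 <= i < w.+1) ((f i.+1 - f i) * g (w - i)%nat)
   = \rsum_(0 <= i < w.+1) (f i.+1 * g (w - i)%nat) - \rsum_(0 <= i < w.+1) (f i * g (w - i)%nat).
  by rewrite -rsum_minus; apply: eq_bigr => i _; ring.
ring.
Qed.

Lemma iter_dl_cvl s f g : iter s dl (cv f g) = cv (iter s dl f) g.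
Proof. by elim: s => //= s ->; rewrite dl_cvl. Qed.

Definition good (g : nat -> R) := g 0%nat = 1 /\ forall w, 0 <= g w.

Lemma good_cv f g : good f -> good g -> good (cv f g).
Proof.
move=> [F0 Fp] [G0 Gp]; split; first by rewrite /cv big_nat1 subnn F0 G0; ring.
by move=> w; apply: rsum_ge0 => i _ _; apply: Rmult_le_pos.
Qed.

Lemma good_cpow g t : good g -> good (cpow g t).
Proof.
move=> Hg; elim: t => [|t IH] /=; last exact: good_cv.
by split=> // -[|w] /=; lra.
Qed.

Lemma good_pseq : good pseq.
Proof. by split; [rewrite /pseq npart0 | move=> w; apply: pos_INR]. Qed.

Lemma good_dl_pseq : good (dl pseq).
Proof.
split; first by rewrite /= /pseq npart0.
case=> [|w] /=; rewrite /pseq ?npart0; first by apply: pos_INR.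
by have := p_le (leqnSn w); lra.
Qed.

(** [(1 - X) P] has nonnegative coefficients because [p] is nondecreasing, and [(1 - X) ^ s P ^ t]
    is a product of [s] such factors and [t - s] copies of [P]. *)
Lemma good_iter_dl s t : (s <= t)%nat -> good (iter s dl (cpow pseq t)).
Proof.
elim: t s => [|t IH] [|s] Hs //; try exact: (good_cpow _ good_pseq).
rewrite iterSr /= dl_cvr iter_dl_cvl; apply: good_cv good_dl_pseq.
exact: IH.
Qed.

Lemma iter_dl_cpow t : iter t dl (cpow pseq t) = cpow (dl pseq) t.
Proof. by elim: t => // t IH; rewrite iterSr /= dl_cvr iter_dl_cvl IH. Qed.

(** * Finite differences and their effect on geometric sequences *)

Definition fdiff (h : nat -> R) (i : nat) : R := h i - h i.+1.

Lemma fdiffE h i : fdiff h i = h i - h i.+1. Proof. by []. Qed.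

Definition shifted (g : nat -> R) (i j : nat) : R := if (i <= j)%nat then g (j - i)%nat else 0.

(** Differencing in the shift [i] multiplies the generating function of [g] by [1 - X]. *)
Lemma iter_fdiff_sum s M (a g h : nat -> R) :
  (forall i, h i = \rsum_(0 <= j < M) (a j * shifted g i j)) ->
  forall i, iter s fdiff h i = \rsum_(0 <= j < M) (a j * shifted (iter s dl g) i j).
Proof.
move=> H; elim: s => [|s IH] i //=.
rewrite !fdiffE !IH -rsum_minus; apply: eq_bigr => j _.
rewrite -Rmult_minus_distr_l; congr (_ * _); rewrite /shifted.
case: (ltngtP i j) => Hij; [|by ring|].
  have -> : (j - i = (j - i.+1).+1)%nat by lia.
  by [].
by rewrite Hij subnn /=; ring.
Qed.

Lemma iter_fdiff_sub s f g i : iter s fdiff (fun j => f j - g j) i = iter s fdiff f i - iter s fdiff g i.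
Proof. by elim: s i => //= s IH i; rewrite !fdiffE !IH; ring. Qed.

Lemma iter_fdiff_pow s z i : iter s fdiff (fun j => z ^ j) i = (1 - z) ^ s * z ^ i.
Proof.
elim: s i => [|s IH] i /=; first by rewrite pow_O; ring.
by rewrite !fdiffE !IH -!tech_pow_Rmult; ring.
Qed.

(** A mere bound by [y ^ i] costs a factor [1 + y] per difference, where an exact geometric sequence
    gains [1 - y]. This is the amplification that limits the number of differences. *)
Lemma iter_fdiff_bound s g G y i : 0 <= y -> (forall j, Rabs (g j) <= G * y ^ j) ->
  Rabs (iter s fdiff g i) <= G * (1 + y) ^ s * y ^ i.
Proof.
move=> Hy Hg; elim: s i => [|s IH] i /=; first by rewrite pow_O Rmult_1_r.
rewrite fdiffE; apply: Rle_trans (Rabs_triang _ _) _; rewrite Rabs_Ropp.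
have := IH i; have := IH i.+1; rewrite -!tech_pow_Rmult; lra.
Qed.

Section CoreCounts.

Variables (t N : nat).
Hypothesis Ht : (0 < t)%nat.

(* [hseq] is close to [p N] times the geometric sequence [zz N t ^ i], on which
   [fdiff] acts as multiplication by [1 - zz N t]. *)
Definition hseq (i : nat) : R := if (t * i <= N)%nat then p (N - t * i) else 0.
Definition cseq (i : nat) : R := if (t * i <= N)%nat then INR (core_cnt t (N - t * i)) else 0.

Lemma cseq_ge0 i : 0 <= cseq i.
Proof. by rewrite /cseq; case: ifP => _; [apply: pos_INR | lra]. Qed.

Lemma core_cnt_le_npart n : INR (core_cnt t n) <= p n.
Proof. by apply/INR_leq/count_size. Qed.

Lemma cseq_le_hseq i : cseq i <= hseq i.
Proof. by rewrite /cseq /hseq; case: ifP => _; [apply: core_cnt_le_npart | lra]. Qed.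

(** This is [npart_hcnt] at size [N - t * i], re-indexed so that [cseq] no longer depends on [i]: a
    core of size [N - t * j] is completed by a quotient of weight [j - i]. *)
Lemma hseq_expand i : hseq i = \rsum_(0 <= j < N.+1) (cseq j * shifted (cpow pseq t) i j).
Proof.
rewrite /hseq; case: leqP => Hi; last first.
  rewrite big_nat_cond big1 // => j /andP [Hj _]; rewrite /cseq /shifted.
  case: leqP => H1; last by ring.
  by case: leqP => H2; [nia | ring].
have HiN : (i <= N)%nat by nia.
rewrite [RHS](@big_cat_nat _ _ _ i) //=; last by lia.
rewrite [X in _ = X + _]big_nat_cond [X in _ = X + _]big1 ?Rplus_0_l => [|j /andP [Hj _]]; last first.
  by rewrite /shifted; case: leqP => H; [lia | ring].
rewrite (npart_hcnt (N - t * i) Ht) INR_sum big_mkcond /=.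
have Hre (F : nat -> R) : \rsum_(i <= j < N.+1) F j = \rsum_(0 <= w < (N - i).+1) F (w + i)%nat.
  by rewrite -{1}[i]add0n big_addn subSn.
rewrite Hre.
rewrite [X in _ = X](@big_cat_nat _ _ _ (N - t * i).+1) //=; last by nia.
rewrite [X in _ = _ + X]big_nat_cond [X in _ = _ + X]big1 ?Rplus_0_r => [|j /andP [Hj _]]; last first.
  by rewrite /cseq; case: leqP => H; [nia | ring].
apply: eq_big_nat => w Hw; rewrite /cseq /shifted leq_addl addnK.
have -> : (t * (w + i) <= N)%nat = (t * w <= N - t * i)%nat by apply/idP/idP; nia.
case: ifP => H; last by ring.
by rewrite INR_mul pconv_cpow; congr (INR (core_cnt t _) * _); nia.
Qed.

(** The [s]-th difference at 0 pairs [cseq] with the coefficients of [(1 - X) ^ s P ^ t], all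
    nonnegative for [s <= t], and the term [j = 0] is the core count. *)
Lemma core_cnt_le_fdiff s : (s <= t)%nat -> INR (core_cnt t N) <= iter s fdiff hseq 0%nat.
Proof.
move=> Hs; rewrite (iter_fdiff_sum s hseq_expand 0).
have [G0 Gp] := good_iter_dl Hs.
rewrite big_nat_recl //; have -> : cseq 0 * shifted (iter s dl (cpow pseq t)) 0 0 = INR (core_cnt t N).
  by rewrite /cseq muln0 leq0n subn0 /shifted leqnn subnn G0; ring.
set S := (X in _ <= _ + X); suff : 0 <= S by lra.
apply: rsum_ge0 => j _ _; apply: Rmult_le_pos; first exact: cseq_ge0.
by rewrite /shifted leq0n; exact: Gp.
Qed.

(** For [s = t] the coefficients are those of [((1 - X) P) ^ t]; in the terms with [j > 0] cores are
    bounded by all partitions. *)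
Lemma core_cnt_ge_fdiff :
  iter t fdiff hseq 0%nat <= INR (core_cnt t N) + \rsum_(1 <= j < N.+1) (hseq j * cpow (dl pseq) t j).
Proof.
rewrite (iter_fdiff_sum t hseq_expand 0) iter_dl_cpow.
have [G0 Gp] := good_cpow t good_dl_pseq.
rewrite (@big_ltn _ _ _ 0 N.+1) //.
have -> : cseq 0 * shifted (cpow (dl pseq) t) 0 0 = INR (core_cnt t N).
  by rewrite /cseq muln0 leq0n subn0 /shifted leqnn subnn G0; ring.
apply: Rplus_le_compat_l; apply: rsum_le => j Hj _.
rewrite /shifted leq0n subn0; apply: Rmult_le_compat_r; [exact: Gp | exact: cseq_le_hseq].
Qed.

End CoreCounts.

(** * Truncated generating functions *)

Lemma triangle_exchange M (F : nat -> nat -> R) :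
  \rsum_(0 <= w < M) \rsum_(0 <= i < w.+1) F i (w - i)%nat
  = \rsum_(0 <= i < M) \rsum_(0 <= j < M - i) F i j.
Proof.
elim: M => [|M IH]; first by rewrite !big_geq.
rewrite big_nat_recr //= IH big_nat_recr //= [RHS]big_nat_recr //=.
rewrite !subnn subSnn big_nat1 -[LHS]Rplus_assoc; congr (_ + _).
rewrite -big_split /=; apply: eq_big_nat => i Hi.
by rewrite subSn ?big_nat_recr //; lia.
Qed.

Lemma cv_gf M f g z : \rsum_(0 <= w < M) (cv f g w * z ^ w)
  = \rsum_(0 <= i < M) (f i * z ^ i * \rsum_(0 <= j < M - i) (g j * z ^ j)).
Proof.
transitivity (\rsum_(0 <= w < M) \rsum_(0 <= i < w.+1) (f i * z ^ i * (g (w - i)%nat * z ^ (w - i)%nat))).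
  apply: eq_big_nat => w Hw; rewrite /cv -rsum_scar; apply: eq_big_nat => i Hi.
  have -> : z ^ w = z ^ i * z ^ (w - i) by rewrite -pow_add; congr (z ^ _); lia.
  ring.
rewrite (triangle_exchange M (fun i j => f i * z ^ i * (g j * z ^ j))).
by apply: eq_bigr => i _; rewrite rsum_scal.
Qed.

Lemma cv_gf_le M f g z : 0 <= z -> (forall w, 0 <= f w) -> (forall w, 0 <= g w) ->
  \rsum_(0 <= w < M) (cv f g w * z ^ w)
  <= (\rsum_(0 <= w < M) (f w * z ^ w)) * (\rsum_(0 <= w < M) (g w * z ^ w)).
Proof.
move=> Hz Hf Hg; have Hzp w : 0 <= z ^ w by apply: pow_le.
rewrite cv_gf -rsum_scar; apply: rsum_le => i Hi _.
apply: Rmult_le_compat_l; first exact: Rmult_le_pos.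
by apply: rsum_widen => [|j _ _]; [lia | apply: Rmult_le_pos].
Qed.

Lemma cv_gf_ge M1 M2 f g z : 0 <= z -> (forall w, 0 <= f w) -> (forall w, 0 <= g w) ->
  (\rsum_(0 <= w < M1) (f w * z ^ w)) * (\rsum_(0 <= w < M2) (g w * z ^ w))
  <= \rsum_(0 <= w < M1 + M2) (cv f g w * z ^ w).
Proof.
move=> Hz Hf Hg; have Hzp w : 0 <= z ^ w by apply: pow_le.
rewrite cv_gf -rsum_scar.
have Hg0 k : 0 <= \rsum_(0 <= j < k) (g j * z ^ j).
  by apply: rsum_ge0 => j _ _; apply: Rmult_le_pos.
apply: (Rle_trans _ (\rsum_(0 <= i < M1) (f i * z ^ i * \rsum_(0 <= j < M1 + M2 - i) (g j * z ^ j)))).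
  apply: rsum_le => i Hi _; apply: Rmult_le_compat_l; first exact: Rmult_le_pos.
  by apply: rsum_widen => [|j _ _]; [lia | apply: Rmult_le_pos].
apply: rsum_widen => [|i _ _]; first exact: leq_addr.
by apply: Rmult_le_pos => //; apply: Rmult_le_pos.
Qed.

Lemma cpow_gf_le M g t z : 0 <= z -> good g -> (0 < M)%nat ->
  \rsum_(0 <= w < M) (cpow g t w * z ^ w) <= (\rsum_(0 <= w < M) (g w * z ^ w)) ^ t.
Proof.
move=> Hz Hg HM; have [_ Gp] := Hg; elim: t => [|t IH].
  rewrite pow_O (@big_ltn _ _ _ 0 M) //= pow_O big_nat_cond big1 ?Rplus_0_r; first lra.
  by case=> // w _; rewrite Rmult_0_l.
have [_ Cp] := good_cpow t Hg.
apply: Rle_trans (cv_gf_le _ Hz Cp Gp) _; rewrite -tech_pow_Rmult Rmult_comm.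
apply: Rmult_le_compat_l IH.
by apply: rsum_ge0 => j _ _; apply: Rmult_le_pos => //; apply: pow_le.
Qed.

(** The cutoff [M * t + 1] leaves room for every product of [t] terms of degree below [M]. *)
Lemma cpow_gf_ge M g t z : 0 <= z -> good g ->
  (\rsum_(0 <= w < M) (g w * z ^ w)) ^ t <= \rsum_(0 <= w < M * t + 1) (cpow g t w * z ^ w).
Proof.
move=> Hz Hg; have [_ Gp] := Hg; elim: t => [|t IH].
  by rewrite pow_O muln0 big_nat1 /= pow_O; lra.
have [_ Cp] := good_cpow t Hg.
rewrite (_ : (M * t.+1 + 1 = M * t + 1 + M)%nat); last by lia.
apply: Rle_trans (cv_gf_ge _ _ Hz Cp Gp); rewrite -tech_pow_Rmult Rmult_comm.
apply: Rmult_le_compat_r IH.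
by apply: rsum_ge0 => j _ _; apply: Rmult_le_pos => //; apply: pow_le.
Qed.

Lemma iter_fdiff_ext s f g i : (forall j, f j = g j) -> iter s fdiff f i = iter s fdiff g i.
Proof. by move=> H; elim: s i => //= s IH i; rewrite !fdiffE !IH. Qed.

Lemma iter_fdiff_scal s a f i : iter s fdiff (fun j => a * f j) i = a * iter s fdiff f i.
Proof. by elim: s i => //= s IH i; rewrite !fdiffE !IH; ring. Qed.

Lemma zz_mul N t i : zz N (t * i) = zz N t ^ i.
Proof.
rewrite /zz -Rpower_pow ?/Rpower ?ln_exp; last exact: exp_pos.
by congr exp; rewrite INR_mul /Rdiv; ring.
Qed.

Lemma zz_le1 N m : zz N m <= 1.
Proof.
rewrite /zz -exp_0; apply: exp_le.
have : 0 <= cz * INR m / sqrt (INR N); last by lra.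
apply: Rmult_le_pos; first by apply: Rmult_le_pos; [have := cz_gt1; lra | exact: pos_INR].
case: N => [|N]; first by rewrite (_ : INR 0 = 0) // sqrt_0 Rinv_0; lra.
by left; apply: Rinv_0_lt_compat; have := sqrt_INR_ge1 (ltn0Sn N); lra.
Qed.

(** Lets the factor [i ^ 2] in the error of [psh_approx] be absorbed by doubling the geometric
    ratio. *)
Lemma sqr_le_pow2 i : INR i ^ 2 <= 2 * 2 ^ i.
Proof.
have H : forall j, (3 <= j)%nat -> INR j ^ 2 <= 2 * 2 ^ j.
  elim=> // j IH; rewrite leq_eqVlt => /orP [/eqP <-|Hj]; first by rewrite (_ : INR 3 = 3) /INR; lra.
  have {}IH := IH Hj; rewrite S_INR -(tech_pow_Rmult 2 j).
  have : 3 <= INR j by rewrite -(_ : INR 3 = 3); [apply: INR_leq | rewrite /INR; ring].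
  by move=> H3; have : (INR j + 1) ^ 2 <= 2 * INR j ^ 2; [nra | lra].
case: i => [|[|[|i]]]; last by apply: H.
- by rewrite /INR /pow; lra.
- by rewrite /INR /pow; lra.
by rewrite /INR /pow; lra.
Qed.

Lemma one_plus_pow_le x s : 0 <= x -> (1 + x) ^ s <= exp (INR s * x).
Proof.
move=> Hx; have -> : exp (INR s * x) = exp x ^ s.
  by rewrite -Rpower_pow ?/Rpower ?ln_exp //; exact: exp_pos.
by apply: pow_incr; have := exp_ge1 x; lra.
Qed.

Lemma one_minus_pow_le x s : x <= 1 -> (1 - x) ^ s <= exp (- (INR s * x)).
Proof.
move=> Hx; have -> : exp (- (INR s * x)) = exp (- x) ^ s.
  by rewrite -Rpower_pow ?/Rpower ?ln_exp; [congr exp; ring | exact: exp_pos].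
by apply: pow_incr; have := exp_ge1 (- x); lra.
Qed.

Lemma bernoulli x s : 0 <= x <= 1 -> 1 - INR s * x <= (1 - x) ^ s.
Proof.
move=> Hx; elim: s => [|s IH]; first by rewrite pow_O (_ : INR 0 = 0) //; lra.
rewrite -tech_pow_Rmult S_INR; have := pos_INR s; nra.
Qed.

(** [psh N (t * i)] differs from [z ^ i] by O([t ^ 2 / N ^ (3/2)]) times [(2 z) ^ i], and [s]
    differences multiply this by at most [(1 + 2 z) ^ s]. The hypothesis [sqrt N <= t] lets the
    quadratic error of [psh_approx] dominate the linear one. *)
Lemma fdiff_approx : exists C, 0 < C /\ forall N t s, (0 < N)%nat -> sqrt (INR N) <= INR t ->
  Rabs (iter s fdiff (hseq t N) 0%nat - p N * (1 - zz N t) ^ s)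
  <= p N * (C * (INR t ^ 2 / sqrt (INR N) ^ 3) * exp (2 * INR s * zz N t)).
Proof.
have [C [HC H]] := psh_approx; exists (4 * C); split; first lra.
move=> N t s HN Ht; have Hs1 := sqrt_INR_ge1 HN; have Hs := sqrt_INR_sqr N.
have Hp := p_gt0 N; have Hz := zz_gt0 N t; set z := zz N t in Hz *.
set q := sqrt _ in Ht Hs1 Hs *; have Hq3 : 0 < q ^ 3 by apply: pow_lt; lra.
have Hq3i := Rinv_0_lt_compat _ Hq3.
have Ht0 : 0 <= INR t by apply: pos_INR.
have HG : 0 <= INR t ^ 2 / q ^ 3 by apply: Rmult_le_pos; [apply: pow_le | lra].
have -> : iter s fdiff (hseq t N) 0%nat = p N * iter s fdiff (fun i => psh N (t * i)) 0%nat.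
  rewrite -iter_fdiff_scal; apply: iter_fdiff_ext => j; rewrite /hseq /psh.
  by case: ifP => _; [field; lra | ring].
have -> : p N * iter s fdiff (fun i => psh N (t * i)) 0%nat - p N * (1 - z) ^ s
  = p N * iter s fdiff (fun i => psh N (t * i) - z ^ i) 0%nat.
  by rewrite iter_fdiff_sub iter_fdiff_pow pow_O; ring.
rewrite Rabs_mult Rabs_pos_eq; last lra.
apply: Rmult_le_compat_l; first lra.
have Hg i : Rabs (psh N (t * i) - z ^ i) <= (4 * C * (INR t ^ 2 / q ^ 3)) * (2 * z) ^ i.
  rewrite /z -zz_mul; apply: Rle_trans (H N (t * i)%nat HN) _.
  rewrite zz_mul -/z -/q Rpow_mult_distr.
  have Hzi : 0 < z ^ i by apply: pow_lt.
  have E1 : INR (t * i) / INR N <= INR t ^ 2 / q ^ 3 * INR i ^ 2.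
    rewrite INR_mul -Hs; case: i Hzi => [|i] _.
      rewrite (_ : INR 0 = 0) // Rmult_0_r /Rdiv Rmult_0_l pow_i ?Rmult_0_r; [lra | by apply/ltP].
    have Hi : 1 <= INR i.+1 by apply: INR_ge1.
    have -> : INR t ^ 2 / q ^ 3 * INR i.+1 ^ 2 = (INR t / q) * (INR i.+1 * (INR t * INR i.+1 / (q * q))).
      by field; lra.
    have H1 : 1 <= INR t / q.
      by apply: (Rmult_le_reg_r q); first lra; rewrite /Rdiv Rmult_assoc Rinv_l; lra.
    set X := INR t * INR i.+1 / (q * q); have HX : 0 <= X.
      apply: Rmult_le_pos; [apply: Rmult_le_pos; lra | left; apply: Rinv_0_lt_compat; nra].
    have : X <= INR i.+1 * X by nra.
    have : INR i.+1 * X <= INR t / q * (INR i.+1 * X).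
      by rewrite -{1}[INR i.+1 * X]Rmult_1_l; apply: Rmult_le_compat_r; [apply: Rmult_le_pos; lra|].
    lra.
  have E2 : INR (t * i) ^ 2 / q ^ 3 = INR t ^ 2 / q ^ 3 * INR i ^ 2.
    by rewrite INR_mul Rpow_mult_distr /Rdiv; ring.
  rewrite E2; have E3 := sqr_le_pow2 i.
  set G := INR t ^ 2 / q ^ 3 in HG E1 *.
  rewrite -Rmult_assoc; apply: Rmult_le_compat_r; first lra.
  have E4 : G * INR i ^ 2 <= G * (2 * 2 ^ i) by apply: Rmult_le_compat_l.
  have -> : 4 * C * G * 2 ^ i = C * (2 * (G * (2 * 2 ^ i))) by ring.
  by apply: Rmult_le_compat_l; lra.
have := @iter_fdiff_bound s _ _ _ 0%nat (_ : 0 <= 2 * z) Hg.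
rewrite pow_O Rmult_1_r => Hb; apply: Rle_trans (Hb ltac:(lra)) _.
apply: Rmult_le_compat_l; first by apply: Rmult_le_pos; lra.
apply: Rle_trans (one_plus_pow_le s _) _; first lra.
by right; congr exp; ring.
Qed.

Lemma core_upper : exists C, 0 < C /\ forall N t s, (0 < N)%nat -> (0 < t)%nat ->
  sqrt (INR N) <= INR t -> (s <= t)%nat ->
  INR (core_cnt t N) <= p N * ((1 - zz N t) ^ s + C * (INR t ^ 2 / sqrt (INR N) ^ 3) * exp (2 * INR s * zz N t)).
Proof.
have [C [HC H]] := fdiff_approx; exists C; split=> // N t s HN Ht HtN Hst.
have H1 := core_cnt_le_fdiff N Ht Hst; have H2 := H N t s HN HtN.
have := Rle_abs (iter s fdiff (hseq t N) 0%nat - p N * (1 - zz N t) ^ s); lra.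
Qed.

Lemma p_geometric : exists b, 1 <= b /\ forall n, p n <= b ^ n.
Proof.
have [c [Hc Hr]] := ratio_lower; have Hci : 1 <= / c.
  by rewrite -Rinv_1; apply: Rinv_le_contravar; lra.
exists (/ c); split=> //; elim=> [|n IH]; first by rewrite npart0 pow_O (_ : INR 1 = 1) //; lra.
have := Hr n.+1 isT; rewrite /= -tech_pow_Rmult => H.
have Hp := p_gt0 n.+1; have : c * p n.+1 <= p n.
  have := Rmult_le_compat_r _ _ _ (Rlt_le _ _ Hp) H.
  by rewrite /Rdiv Rmult_assoc Rinv_l; lra.
move=> H2; apply: (Rle_trans _ (/ c * p n)); last by apply: Rmult_le_compat_l; lra.
apply: (Rmult_le_reg_l c); first lra.
by rewrite -Rmult_assoc Rinv_r; lra.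
Qed.

Lemma pow_gf_le M x : 0 <= x <= / 2 -> \rsum_(0 <= w < M) x ^ w <= 2.
Proof.
move=> Hx; suff : forall k, \rsum_(0 <= w < k) x ^ w <= 2 - 2 * x ^ k.
  by move=> H; have := H M; have := pow_le x M ltac:(lra); lra.
elim=> [|k IH]; first by rewrite big_geq // pow_O; lra.
rewrite big_nat_recr //= -tech_pow_Rmult; have := pow_le x k ltac:(lra); nra.
Qed.

Lemma npart1 : npart 1 = 1%nat.
Proof.
have := npart_rec 1; rewrite mul1n => ->.
by rewrite !big_nat1 /= npart0.
Qed.

(** The series of [(1 - X) P] starts with 1 + 0 X because [p 0 = p 1]. Its deviation from 1 is
    therefore quadratic in [z], so its [t]-th power stays near 1 while [t z ^ 2] is small. *)
Lemma dl_gf_le : exists b, 1 <= b /\ forall M z, 0 <= z -> b * z <= / 2 ->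
  \rsum_(0 <= w < M) (dl pseq w * z ^ w) <= 1 + 2 * (b * z) ^ 2.
Proof.
have [b [Hb Hp]] := p_geometric; exists b; split=> // M z Hz Hbz.
have [D0 Dp] := good_dl_pseq.
have Hbz0 : 0 <= b * z by apply: Rmult_le_pos; lra.
have Hx2 : 0 <= (b * z) ^ 2 by apply: pow_le.
apply: (Rle_trans _ (\rsum_(0 <= w < M.+2) (dl pseq w * z ^ w))).
  by apply: rsum_widen => [|w _ _]; [lia | apply: Rmult_le_pos => //; apply: pow_le].
rewrite big_nat_recl // big_nat_recl // D0 pow_O.
have -> : dl pseq 1 = 0 by rewrite /dl /pseq npart0 npart1; ring.
rewrite Rmult_0_l Rplus_0_l Rmult_1_l; apply: Rplus_le_compat_l.
apply: (Rle_trans _ (\rsum_(0 <= w < M) ((b * z) ^ 2 * (b * z) ^ w))).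
  apply: rsum_le => w _ _; rewrite -pow_add (_ : (2 + w)%coq_nat = w.+2) // Rpow_mult_distr.
  apply: Rmult_le_compat_r; first exact: pow_le.
  apply: Rle_trans (Hp w.+2); rewrite /dl /pseq; have := p_gt0 w.+1; lra.
rewrite rsum_scal; have := pow_gf_le M (conj Hbz0 Hbz); nra.
Qed.

(** The extra error [t z ^ 2] comes from the terms with [j > 0] in [core_cnt_ge_fdiff]. *)
Lemma core_lower : exists C b, 0 < C /\ 1 <= b /\ forall N t, (0 < N)%nat -> (0 < t)%nat ->
  sqrt (INR N) <= INR t -> b * zz N t <= / 2 -> 4 * INR t * (b * zz N t) ^ 2 <= 1 ->
  p N * ((1 - zz N t) ^ t - C * (INR t ^ 2 / sqrt (INR N) ^ 3) * exp (2 * INR t * zz N t)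
     - C * (INR t * zz N t ^ 2)) <= INR (core_cnt t N).
Proof.
have [C1 [HC1 H1]] := fdiff_approx; have [b [Hb Hd]] := dl_gf_le; have [C2 [HC2 H2]] := psh_le.
exists (C1 + 4 * C2 * b ^ 2), b; split.
  by have := pow_le b 2 ltac:(lra); nra.
split=> // N t HN Ht HtN Hbz Htz.
have E1 := H1 N t t HN HtN; have E2 := core_cnt_ge_fdiff N Ht.
have Hp := p_gt0 N; have Hz := zz_gt0 N t; set z := zz N t in Hbz Htz E1 Hz *.
have Hgood := good_dl_pseq; have [C0 Cp] := good_cpow t Hgood.
have E3 : \rsum_(1 <= j < N.+1) (hseq t N j * cpow (dl pseq) t j)
   <= p N * (C2 * (4 * (INR t * (b * z) ^ 2))).
  apply: (Rle_trans _ (\rsum_(1 <= j < N.+1) (p N * C2 * (cpow (dl pseq) t j * z ^ j)))).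
    apply: rsum_le => j _ _.
    have -> : hseq t N j = p N * psh N (t * j).
      by rewrite /hseq /psh; case: ifP => _; [field; lra | ring].
    have := H2 N (t * j)%nat HN; rewrite zz_mul -/z => E.
    have := Cp j; set X := cpow _ _ _ => HX.
    have -> : p N * C2 * (X * z ^ j) = p N * (C2 * z ^ j) * X by ring.
    by apply: Rmult_le_compat_r => //; apply: Rmult_le_compat_l; lra.
  rewrite rsum_scal Rmult_assoc; apply: Rmult_le_compat_l; first lra.
  apply: Rmult_le_compat_l; first lra.
  have := cpow_gf_le t (Rlt_le _ _ Hz) Hgood (ltn0Sn N).
  rewrite (@big_ltn _ _ _ 0 N.+1) // C0 pow_O Rmult_1_l.
  have := Hd N.+1 z ltac:(lra) Hbz; set D := (X in X <= 1 + _) => HD E.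
  have HD0 : 0 <= D.
    by apply: rsum_ge0 => w _ _; apply: Rmult_le_pos; [apply: (proj2 Hgood) | apply: pow_le; lra].
  have Hx : 0 <= (b * z) ^ 2 by apply: pow_le; nra.
  have : D ^ t <= (1 + 2 * (b * z) ^ 2) ^ t by apply: pow_incr.
  have := @one_plus_pow_le (2 * (b * z) ^ 2) t ltac:(lra).
  have := @exp_le_lin (INR t * (2 * (b * z) ^ 2)) _.
  have Hrange : 0 <= INR t * (2 * (b * z) ^ 2) <= / 2.
    by split; [apply: Rmult_le_pos; [apply: pos_INR | lra] | lra].
  move=> /(_ Hrange) E5 E6 E7; apply: (Rplus_le_reg_l 1); apply: Rle_trans E _.
  by apply: Rle_trans E7 _; lra.
have E4 := Rle_abs (- (iter t fdiff (hseq t N) 0%nat - p N * (1 - z) ^ t)); rewrite Rabs_Ropp in E4.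
set X := INR t ^ 2 / _ in E1 *; set Y := exp _ in E1 *.
have HX : 0 <= X * Y.
  apply: Rmult_le_pos; last by left; apply: exp_pos.
  apply: Rmult_le_pos; first by apply: pow_le; apply: pos_INR.
  by left; apply: Rinv_0_lt_compat; apply: pow_lt; have := sqrt_INR_ge1 HN; lra.
have HT : 0 <= INR t * z ^ 2 by apply: Rmult_le_pos; [apply: pos_INR | apply: pow_le; lra].
have Hb2 : 0 <= b ^ 2 by apply: pow_le; lra.
rewrite Rpow_mult_distr in E3.
have F1 : C1 * (X * Y) <= (C1 + 4 * C2 * b ^ 2) * (X * Y).
  by apply: Rmult_le_compat_r => //; nra.
have F2 : C2 * (4 * (INR t * (b ^ 2 * z ^ 2))) <= (C1 + 4 * C2 * b ^ 2) * (INR t * z ^ 2).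
  have -> : C2 * (4 * (INR t * (b ^ 2 * z ^ 2))) = (4 * C2 * b ^ 2) * (INR t * z ^ 2) by ring.
  by apply: Rmult_le_compat_r => //; lra.
have F3 := Rmult_le_compat_l _ _ _ (Rlt_le _ _ Hp) F1.
have F4 := Rmult_le_compat_l _ _ _ (Rlt_le _ _ Hp) F2.
lra.
Qed.

(** * Large deviations of [Pc t mu - Hcount t la] *)

Lemma exp_INR_mul k y : exp (INR k * y) = exp y ^ k.
Proof. by rewrite -Rpower_pow ?/Rpower ?ln_exp //; exact: exp_pos. Qed.

Lemma p_poly : exists K a, 1 <= K /\ forall n,
  p n <= K * (INR n + 1) ^ a * exp (2 * cz * sqrt (INR n)) /\
  exp (2 * cz * sqrt (INR n)) <= K * (INR n + 1) ^ a * p n.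
Proof.
have [C [HC H]] := ln_p_approx; have [a Ha] := INR_unbounded C.
exists (exp 1 ^ a), a; split; first by apply: pow_R1_Rle; have := exp_ge1 1; lra.
move=> n; have Hn := pos_INR n; have Hp := p_gt0 n.
have HE : exp (C * (1 + ln (INR n + 1))) <= exp 1 ^ a * (INR n + 1) ^ a.
  rewrite -Rpow_mult_distr -{2}(exp_ln (INR n + 1)) -?exp_plus -?exp_INR_mul; last by lra.
  apply: exp_le; apply: Rmult_le_compat_r; last by lra.
  by have : ln 1 <= ln (INR n + 1); [apply: ln_le; lra | rewrite ln_1; lra].
have H1 := Rle_abs (ln (p n) - 2 * cz * sqrt (INR n)).
have H2 := Rle_abs (- (ln (p n) - 2 * cz * sqrt (INR n))); rewrite Rabs_Ropp in H2.
have Hn' := H n; split.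
  rewrite -{1}(exp_ln (p n)) //.
  apply: (Rle_trans _ (exp (C * (1 + ln (INR n + 1))) * exp (2 * cz * sqrt (INR n)))).
    by rewrite -exp_plus; apply: exp_le; lra.
  by apply: Rmult_le_compat_r => //; left; apply: exp_pos.
apply: (Rle_trans _ (exp (C * (1 + ln (INR n + 1))) * p n)).
  by rewrite -{1}(exp_ln (p n)) // -exp_plus; apply: exp_le; lra.
by apply: Rmult_le_compat_r; lra.
Qed.

(** The exponent [2 cz sqrt n - cz n / sqrt N] equals [cz (sqrt N - (sqrt n - sqrt N) ^ 2 / sqrt
    N)], maximal at [n = N]. Two additional powers of [n + 1] make the sum converge like that of
    [1 / n ^ 2]; beyond [16 N] the exponent is at most [- sqrt n] and beats every power. *)
Lemma gf_bound : exists K a, 1 <= K /\ forall N R, (0 < N)%nat ->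
  \rsum_(0 <= n < R) (p n * zz N n) <= K * (INR N + 1) ^ a * exp (cz * sqrt (INR N)).
Proof.
have [K [a [HK H]]] := p_poly; have Hc1 := cz_gt1.
pose e := a.+2; pose K2 := 16 ^ e + 2 ^ e * INR (2 * e) ^ (2 * e).
have He2 : 0 <= 2 ^ e * INR (2 * e) ^ (2 * e).
  by apply: Rmult_le_pos; apply: pow_le; [lra | exact: pos_INR].
have H16 : 1 <= 16 ^ e by apply: pow_R1_Rle; lra.
exists (2 * (K * K2)), e; split; first by rewrite /K2; nra.
move=> N M HN; have Hs1 := sqrt_INR_ge1 HN; have Hs := sqrt_INR_sqr N.
set s := sqrt _ in Hs1 Hs *; have HN0 := pos_INR N.
have HNe : 1 <= (INR N + 1) ^ e by apply: pow_R1_Rle; lra.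
have Hes : 1 <= exp (cz * s) by have := exp_ge1 (cz * s); nra.
have Hkey n : (INR n + 1) ^ e * exp (2 * cz * sqrt (INR n) - cz * INR n / s)
     <= K2 * ((INR N + 1) ^ e * exp (cz * s)).
  have Hr := sqrt_INR_sqr n; have Hr0 := sqrt_pos (INR n); have Hn0 := pos_INR n.
  set r := sqrt (INR n) in Hr Hr0 *.
  have Hne : 0 <= (INR n + 1) ^ e by apply: pow_le; lra.
  case: (Rle_dec (INR n) (16 * INR N)) => HnN.
    apply: (Rle_trans _ (16 ^ e * ((INR N + 1) ^ e * exp (cz * s)))); last first.
      apply: Rmult_le_compat_r; last by rewrite /K2; lra.
      by apply: Rmult_le_pos; lra.
    rewrite -Rmult_assoc -Rpow_mult_distr; apply: Rmult_le_compat => //.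
    - by left; apply: exp_pos.
    - by apply: pow_incr; lra.
    apply: exp_le; have : 0 <= (r - s) * (r - s) / s.
      by apply: Rmult_le_pos; [exact: Rle_0_sqr | left; apply: Rinv_0_lt_compat; lra].
    have -> : 2 * cz * r - cz * INR n / s = cz * (s - (r - s) * (r - s) / s).
      by rewrite -Hr; field; lra.
    by move=> Hq; apply: Rmult_le_compat_l; lra.
  have Hr4 : 4 * s <= r by nra.
  have Hr1 : 1 <= r by lra.
  apply: (Rle_trans _ (2 ^ e * INR (2 * e) ^ (2 * e))); last first.
    apply: (Rle_trans _ (K2 * 1)); first by rewrite /K2; lra.
    by apply: Rmult_le_compat_l; [rewrite /K2; lra | nra].
  have E1 : exp (2 * cz * r - cz * INR n / s) <= exp (- r).
    apply: exp_le; have : 4 * r <= INR n / s.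
      apply: (Rmult_le_reg_r s); first lra.
      by rewrite (_ : INR n / s * s = r * r); [nra | rewrite -Hr; field; lra].
    have -> : cz * INR n / s = cz * (INR n / s) by rewrite /Rdiv; ring.
    nra.
  have E2 : (INR n + 1) ^ e <= 2 ^ e * r ^ (2 * e).
    rewrite mulnC pow_mult; have -> : (r ^ e) ^ 2 = (r ^ 2) ^ e by rewrite -!pow_mult; congr (_ ^ _); lia.
    by rewrite -Rpow_mult_distr; apply: pow_incr; split; [lra | rewrite -Hr; nra].
  have E3 := @pow_le_exp (2 * e) r isT Hr0.
  apply: (Rle_trans _ (2 ^ e * r ^ (2 * e) * exp (- r))).
    by apply: Rmult_le_compat => //; left; apply: exp_pos.
  have -> : 2 ^ e * INR (2 * e) ^ (2 * e) = 2 ^ e * (INR (2 * e) ^ (2 * e) * exp r) * exp (- r).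
    have : exp r * exp (- r) = 1 by rewrite -exp_plus -exp_0; congr exp; ring.
    move: (2 ^ e) (INR (2 * e) ^ (2 * e)) => x y E.
    by transitivity (x * y * (exp r * exp (- r))); [rewrite E; ring | ring].
  apply: Rmult_le_compat_r; first by left; apply: exp_pos.
  by apply: Rmult_le_compat_l => //; apply: pow_le; lra.
apply: (Rle_trans _ (\rsum_(0 <= n < M) (/ INR n.+1 ^ 2 * (K * (K2 * ((INR N + 1) ^ e * exp (cz * s))))))).
  apply: rsum_le => n _ _; have Hn0 := pos_INR n.
  have [H1 _] := H n; have Hz := zz_gt0 N n.
  apply: (Rle_trans _ (K * (INR n + 1) ^ a * exp (2 * cz * sqrt (INR n)) * zz N n)).
    by apply: Rmult_le_compat_r; lra.
  have -> : K * (INR n + 1) ^ a * exp (2 * cz * sqrt (INR n)) * zz N n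
    = / INR n.+1 ^ 2 * (K * ((INR n + 1) ^ e * exp (2 * cz * sqrt (INR n) - cz * INR n / s))).
    rewrite /zz -/s S_INR /Rminus exp_plus /e -!tech_pow_Rmult pow_O; field; lra.
  apply: Rmult_le_compat_l; first by left; apply: Rinv_0_lt_compat; apply: pow_lt; rewrite S_INR; lra.
  by apply: Rmult_le_compat_l; [lra | exact: Hkey].
rewrite rsum_scar; have -> : \rsum_(0 <= n < M) / INR n.+1 ^ 2 = invsq_sum M.
  by rewrite /invsq_sum big_add1.
have HS := invsq_sum_le_zeta2 M; have Hz2 := zeta2_le2.
set Q := K * _; have HQ : 0 <= Q.
  by rewrite /Q /K2; apply: Rmult_le_pos; [lra | apply: Rmult_le_pos; [lra | apply: Rmult_le_pos; lra]].
apply: (Rle_trans _ (2 * Q)); first by apply: Rmult_le_compat_r; lra.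
by right; rewrite /Q; ring.
Qed.

Lemma zz_add N a b : zz N (a + b) = zz N a * zz N b.
Proof. by rewrite /zz -exp_plus INR_add; congr exp; rewrite /Rdiv; ring. Qed.

(** The constant sequence 1 is the inverse of [1 - X]. *)
Lemma cv_dl_one g : cv (dl g) (fun=> 1) = g.
Proof.
apply: functional_extensionality => w; rewrite /cv; elim: w => [|w IH].
  by rewrite big_nat1 /=; ring.
rewrite big_nat_recr //=; rewrite /= in IH; lra.
Qed.

Lemma geom_sum M y : (1 - y) * \rsum_(0 <= i < M) (1 * y ^ i) = 1 - y ^ M.
Proof.
elim: M => [|M IH]; first by rewrite big_geq // pow_O; ring.
by rewrite big_nat_recr //= Rmult_plus_distr_l IH -tech_pow_Rmult; ring.
Qed.

Lemma pgf_le_dl M y : 0 <= y < 1 ->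
  \rsum_(0 <= w < M) (pseq w * y ^ w) <= (\rsum_(0 <= w < M) (dl pseq w * y ^ w)) / (1 - y).
Proof.
move=> Hy; rewrite -{1}(cv_dl_one pseq).
have [_ Dp] := good_dl_pseq.
apply: Rle_trans (cv_gf_le M (proj1 Hy) Dp (fun=> Rle_0_1)) _.
apply: Rmult_le_compat_l.
  by apply: rsum_ge0 => w _ _; apply: Rmult_le_pos => //; apply: pow_le; lra.
apply: (Rmult_le_reg_l (1 - y)); first lra.
by rewrite geom_sum Rinv_r; [have := pow_le y M; lra | lra].
Qed.

Lemma pgf_ge_dl M M' y : 0 <= y < 1 ->
  (\rsum_(0 <= w < M) (dl pseq w * y ^ w)) * ((1 - y ^ M') / (1 - y))
  <= \rsum_(0 <= w < M + M') (pseq w * y ^ w).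
Proof.
move=> Hy; rewrite -{2}(cv_dl_one pseq).
have [_ Dp] := good_dl_pseq.
apply: Rle_trans (cv_gf_ge M M' (proj1 Hy) Dp (fun=> Rle_0_1)).
right; congr (_ * _); rewrite -geom_sum; field; lra.
Qed.

Section Chernoff.

Variables (N t : nat).
Hypotheses (HN : (0 < N)%nat) (Ht : (0 < t)%nat).

(* The square root of [zz N t] is the value at which the generating functions
   of [Hcount t] and of [- Pc t] balance in the Chernoff bound. *)
Definition vv := exp (- (cz * INR t / (2 * sqrt (INR N)))).

Lemma vv_sqr : vv * vv = zz N t.
Proof.
rewrite /vv /zz -exp_plus; congr exp; field.
by have := sqrt_INR_ge1 HN; lra.
Qed.

Lemma vv_bounds : 0 < vv < 1.
Proof.
split; first exact: exp_pos.
rewrite -exp_0; apply: exp_increasing.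
have : 0 < cz * INR t / (2 * sqrt (INR N)); last by lra.
apply: Rdiv_lt_0_compat; last by have := sqrt_INR_ge1 HN; lra.
by apply: Rmult_lt_0_compat; [have := cz_gt1; lra | exact: INR_gt0].
Qed.

Lemma zz_lt1 : 0 < zz N t < 1.
Proof. by rewrite -vv_sqr; have := vv_bounds; nra. Qed.

Definition core_gf := \rsum_(0 <= n < N.+1) (INR (core_cnt t n) * zz N n).

Lemma core_gf_ge0 : 0 <= core_gf.
Proof. by apply: rsum_ge0 => n _ _; apply: Rmult_le_pos; [apply: pos_INR | left; apply: zz_gt0]. Qed.

(** The core series times the quotient series is the partition series; [M] exceeds every degree of
    the truncated product. *)
Lemma core_gf_conv V : exists M, core_gf * \rsum_(0 <= w < V) (cpow pseq t w * zz N t ^ w)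
  <= \rsum_(0 <= n < M) (p n * zz N n).
Proof.
exists (N.+1 + t * V)%nat; set M := (N.+1 + t * V)%nat.
have [_ Cp] := good_cpow t good_pseq.
have Hz := zz_lt1; set z := zz N t in Hz *.
pose G m := INR (core_cnt t m) * zz N m.
have HG m : 0 <= G m by apply: Rmult_le_pos; [apply: pos_INR | left; apply: zz_gt0].
have HPz w : 0 <= cpow pseq t w * z ^ w by apply: Rmult_le_pos => //; apply: pow_le; lra.
apply: (Rle_trans _ (\rsum_(0 <= n < M) \rsum_(0 <= w < V) (if (t * w <= n)%nat then G (n - t * w)%nat * (cpow pseq t w * z ^ w) else 0))).
  rewrite exchange_big /= -rsum_scal; apply: rsum_le => w Hw _.
  have HtwM : (t * w <= M)%nat by rewrite /M; nia.
  rewrite [X in _ <= X](@big_cat_nat _ _ _ (t * w)) //=.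
  rewrite [X in _ <= X + _]big_nat_cond [X in _ <= X + _]big1 ?Rplus_0_l => [|n /andP [Hn _]]; last first.
    by rewrite ifF //; lia.
  rewrite -{1}[(t * w)%nat]add0n big_addn /core_gf -rsum_scar.
  apply: (Rle_trans _ (\rsum_(0 <= i < M - t * w) (G i * (cpow pseq t w * z ^ w)))).
    apply: rsum_widen => [|i _ _]; first by rewrite /M; nia.
    exact: (Rmult_le_pos _ _ (HG i) (HPz w)).
  by right; apply: eq_bigr => i _; rewrite leq_addl addnK.
apply: rsum_le => n _ _.
rewrite (npart_hcnt n Ht) INR_sum -rsum_scar.
apply: (Rle_trans _ (\rsum_(0 <= w < V + n.+1) (if (t * w <= n)%nat then G (n - t * w)%nat * (cpow pseq t w * z ^ w) else 0))).
  apply: rsum_widen => [|w _ _]; first exact: leq_addr.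
  by case: ifP => _; [exact: (Rmult_le_pos _ _ (HG _) (HPz w)) | lra].
rewrite (@big_cat_nat _ _ _ n.+1) //=; last exact: leq_addl.
rewrite [X in _ + X <= _]big_nat_cond [X in _ + X <= _]big1 ?Rplus_0_r => [|w /andP [Hw _]]; last first.
  by rewrite ifF //; nia.
right; rewrite [RHS]big_mkcond; apply: eq_bigr => w _; case: ifP => // Htw.
rewrite INR_mul pconv_cpow /G.
have -> : zz N n = zz N (n - t * w) * z ^ w by rewrite /z -zz_mul -zz_add subnK.
ring.
Qed.

(** Formally the partition series in [z] is [D / (1 - z)], so the core series times [D ^ t] is
    [(1 - z) ^ t] times the partition series in sizes. Truncation costs the factor 2. *)
Lemma core_gf_dl Pi : (forall M, \rsum_(0 <= n < M) (p n * zz N n) <= Pi) ->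
  core_gf * (\rsum_(0 <= w < N.+1) (dl pseq w * zz N t ^ w)) ^ t <= 2 * Pi * (1 - zz N t) ^ t.
Proof.
move=> HPi; have Hz := zz_lt1; set z := zz N t in Hz *; have Ht0 := INR_gt0 Ht.
set D := \rsum_(0 <= w < N.+1) _.
(* With this [M'] the [t]-th power of the truncation factor [1 - z ^ M'] is at least one half, by
   Bernoulli's inequality. *)
have [M' HM'] : exists M', z ^ M' <= / (2 * INR t).
  have [M' H] := pow_lt_1_zero z ltac:(rewrite Rabs_pos_eq; lra) (/ (2 * INR t)) ltac:(apply: Rinv_0_lt_compat; lra).
  exists M'; have := H M' (le_n _); rewrite Rabs_pos_eq; first lra.
  by apply: pow_le; lra.
have HzM : 0 < z ^ M' by apply: pow_lt; lra.
have Hhalf : / 2 <= (1 - z ^ M') ^ t.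
  have Hb := @bernoulli (z ^ M') t.
  have : z ^ M' <= 1 by rewrite -(pow1 M'); apply: pow_incr; lra.
  have : INR t * z ^ M' <= / 2.
    have -> : / 2 = INR t * / (2 * INR t) by field; lra.
    by apply: Rmult_le_compat_l; lra.
  move=> H1 H2; have := Hb ltac:(lra); lra.
have [_ Dp] := good_dl_pseq.
have HD : 0 <= D by apply: rsum_ge0 => w _ _; apply: Rmult_le_pos => //; apply: pow_le; lra.
have Hzt : 0 < (1 - z) ^ t by apply: pow_lt; lra.
have H1 := @pgf_ge_dl N.+1 M' z ltac:(lra); rewrite -/D in H1.
have H2 : (D * ((1 - z ^ M') / (1 - z))) ^ t <= (\rsum_(0 <= w < N.+1 + M') (pseq w * z ^ w)) ^ t.
  apply: pow_incr; split=> //; apply: Rmult_le_pos => //; apply: Rmult_le_pos.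
    have : z ^ M' <= 1 by rewrite -(pow1 M'); apply: pow_incr; lra.
    lra.
  by left; apply: Rinv_0_lt_compat; lra.
have H3 := cpow_gf_ge (N.+1 + M') t (Rlt_le _ _ (proj1 Hz)) good_pseq.
have [M HM] := core_gf_conv ((N.+1 + M') * t + 1).
have Hcg := core_gf_ge0.
have H4 : core_gf * (D * ((1 - z ^ M') / (1 - z))) ^ t <= Pi.
  apply: Rle_trans (HPi M); apply: Rle_trans HM; apply: Rmult_le_compat_l => //.
  exact: Rle_trans H2 H3.
have HX0 : 0 <= core_gf * D ^ t by apply: Rmult_le_pos => //; apply: pow_le.
have H5 : core_gf * D ^ t * (1 - z ^ M') ^ t <= Pi * (1 - z) ^ t.
  have -> : core_gf * D ^ t * (1 - z ^ M') ^ t = core_gf * (D * ((1 - z ^ M') / (1 - z))) ^ t * (1 - z) ^ t.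
    rewrite /Rdiv !Rpow_mult_distr pow_inv; field; lra.
  by apply: Rmult_le_compat_r; lra.
have : core_gf * D ^ t * / 2 <= core_gf * D ^ t * (1 - z ^ M') ^ t by apply: Rmult_le_compat_l.
lra.
Qed.

Lemma hcnt_cseq w : INR (hcnt t N w) = cseq t N w * cpow pseq t w.
Proof.
rewrite /cseq; case: leqP => Hw; first by rewrite hcntE // INR_mul pconv_cpow.
rewrite Rmult_0_l (_ : hcnt t N w = 0%nat) //; apply/eqP; rewrite eqn0Ngt -has_count.
apply/hasP => -[la]; rewrite mem_partitions_of => Hla /eqP Hc.
by have := mul_Hcount_le Ht Hla; rewrite Hc; lia.
Qed.

(** The Chernoff bound for the weight. Extracting size [N] costs [zz N N]; the quotient series at
    [vv * z] is at most [(D / (1 - vv z)) ^ t], and by [core_gf_dl] the factor [D] cancels, leaving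
    [((1 - z) / (1 - vv z)) ^ t]. *)
Lemma hcnt_gf_le Pi : (forall M, \rsum_(0 <= n < M) (p n * zz N n) <= Pi) ->
  (\rsum_(0 <= w < N.+1) (INR (hcnt t N w) * vv ^ w)) * zz N N
  <= 2 * Pi * exp (- (INR t * (zz N t * (1 - vv)))).
Proof.
move=> HPi; have Hz := zz_lt1; have Hv := vv_bounds; have Hg := core_gf_dl HPi.
set z := zz N t in Hz Hg *; have Hcg := core_gf_ge0.
have [_ Cp] := good_cpow t good_pseq; have [_ Dp] := good_dl_pseq.
have Hvz : 0 <= vv * z < 1 by nra.
apply: (Rle_trans _ (core_gf * \rsum_(0 <= w < N.+1) (cpow pseq t w * (vv * z) ^ w))).
  rewrite -rsum_scar -rsum_scal; apply: rsum_le => w Hw _.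
  have Hpv : 0 <= cpow pseq t w * vv ^ w by apply: Rmult_le_pos => //; apply: pow_le; lra.
  suff : cseq t N w * zz N N <= core_gf * z ^ w.
    move=> H; have := Rmult_le_compat_r _ _ _ Hpv H; rewrite hcnt_cseq Rpow_mult_distr; lra.
  have Hzw : 0 <= z ^ w by apply: pow_le; lra.
  rewrite /cseq; case: leqP => Htw; last by rewrite Rmult_0_l; apply: Rmult_le_pos.
  have -> : zz N N = zz N (N - t * w) * z ^ w by rewrite /z -zz_mul -zz_add subnK.
  rewrite -Rmult_assoc; apply: Rmult_le_compat_r => //.
  rewrite /core_gf (bigD1_seq (N - t * w)%nat) ?iota_uniq ?mem_index_iota //=; last by lia.
  set S := (X in _ <= _ + X); suff : 0 <= S by lra.
  by apply: rsum_seq_ge0 => n _ _; apply: Rmult_le_pos; [apply: pos_INR | left; apply: zz_gt0].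
have H1 := cpow_gf_le t (proj1 Hvz) good_pseq (ltn0Sn N).
have H2 := pgf_le_dl N.+1 Hvz.
have H3 : \rsum_(0 <= w < N.+1) (dl pseq w * (vv * z) ^ w) <= \rsum_(0 <= w < N.+1) (dl pseq w * z ^ w).
  by apply: rsum_le => w _ _; apply: Rmult_le_compat_l => //; apply: pow_incr; nra.
set D := \rsum_(0 <= w < N.+1) (dl pseq w * z ^ w) in H3 Hg.
have HD : 0 <= D by apply: rsum_ge0 => w _ _; apply: Rmult_le_pos => //; apply: pow_le; lra.
have H1vz : 0 < / (1 - vv * z) by apply: Rinv_0_lt_compat; lra.
have H4 : \rsum_(0 <= w < N.+1) (pseq w * (vv * z) ^ w) <= D / (1 - vv * z).
  by apply: Rle_trans H2 _; apply: Rmult_le_compat_r; lra.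
apply: (Rle_trans _ (core_gf * (D / (1 - vv * z)) ^ t)).
  apply: Rmult_le_compat_l => //; apply: Rle_trans H1 _; apply: pow_incr; split=> //.
  by apply: rsum_ge0 => w _ _; apply: Rmult_le_pos; [apply: pos_INR | apply: pow_le; lra].
have HPi0 : 0 <= Pi by have := HPi 0%nat; rewrite big_geq.
apply: (Rle_trans _ (2 * Pi * ((1 - z) / (1 - vv * z)) ^ t)).
  rewrite /Rdiv !Rpow_mult_distr -!Rmult_assoc; apply: Rmult_le_compat_r => //.
  by apply: pow_le; lra.
apply: Rmult_le_compat_l; first lra.
apply: Rle_trans (@one_minus_pow_le (z * (1 - vv)) t _); last by nra.
apply: pow_incr; split; first by apply: Rmult_le_pos; lra.
apply: (Rmult_le_reg_r (1 - vv * z)); first lra.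
rewrite /Rdiv Rmult_assoc Rinv_l ?Rmult_1_r; last lra.
have : 0 <= vv * (z * z) * (1 - vv) by apply: Rmult_le_pos; [apply: Rmult_le_pos; nra | lra].
lra.
Qed.

Lemma rsum_by_value (S : seq nat -> nat) (f : nat -> R) :
  (forall la, is_partition N la -> (S la <= N)%nat) ->
  \rsum_(la <- partitions_of N) f (S la)
  = \rsum_(0 <= w < N.+1) (INR (count (fun la => S la == w) (partitions_of N)) * f w).
Proof.
move=> HS; transitivity (\rsum_(la <- partitions_of N) \rsum_(0 <= w < N.+1) (INR (S la == w) * f w)).
  apply: eq_big_seq => la; rewrite mem_partitions_of => /HS H.
  rewrite (bigD1_seq (S la)) ?iota_uniq ?mem_index_iota //= eqxx big1 => [|w /negbTE].
    by rewrite (_ : INR true = 1) //; ring.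
  by rewrite eq_sym => ->; rewrite (_ : INR false = 0) //; ring.
rewrite exchange_big /=; apply: eq_bigr => w _.
by rewrite rsum_scar count_as_sum INR_sum.
Qed.

(** Markov's inequality: for [Hcount t la < Pc t mu] the product of [vv ^ Hcount t la] and
    [(/ vv) ^ Pc t mu] is at least 1, and the sum over pairs of this product factors. *)
Lemma pairs_gt_le : INR (pairs_gt t N) <=
  (\rsum_(0 <= w < N.+1) (INR (hcnt t N w) * vv ^ w)) *
  \rsum_(0 <= k < N.+1) (INR (count (fun mu => Pc t mu == k) (partitions_of N)) * (/ vv) ^ k).
Proof.
have Hv := vv_bounds; have Hvi : 1 <= / vv by rewrite -Rinv_1; apply: Rinv_le_contravar; lra.
rewrite -(@rsum_by_value (Hcount t) (fun w => vv ^ w)); last first.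
  by move=> la Hla; have := mul_Hcount_le Ht Hla; nia.
rewrite -(@rsum_by_value (Pc t) (fun k => (/ vv) ^ k)); last first.
  by move=> mu Hmu; have := mul_Pc_le t Hmu; nia.
rewrite /pairs_gt INR_sum -rsum_scar; apply: rsum_seq_le => la _ _.
rewrite INR_sum -rsum_scal; apply: rsum_seq_le => mu _ _.
have Hp : 0 < vv ^ Hcount t la by apply: pow_lt; lra.
case: ltnP => H; last first.
  rewrite (_ : INR false = 0) //; apply: Rmult_le_pos; first lra.
  by apply: pow_le; lra.
rewrite (_ : INR true = 1) //.
have -> : 1 = vv ^ Hcount t la * (/ vv) ^ Hcount t la.
  by rewrite -Rpow_mult_distr Rinv_r ?pow1; lra.
apply: Rmult_le_compat_l; first lra.
by apply: Rle_pow => //; lia.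
Qed.

End Chernoff.

(** As [zz N (t * k)] is [vv ^ (2 k)], each term is at most about [p k * vv ^ k * p N]. Completing
    the square in [sqrt k] bounds its exponent by the value at [sqrt k = 2 sqrt N / t]. *)
Lemma count_Pc_gf : exists K a, 1 <= K /\ forall N t, (0 < N)%nat -> (0 < t)%nat ->
  \rsum_(0 <= k < N.+1) (INR (count (fun mu => Pc t mu == k) (partitions_of N)) * (/ vv N t) ^ k)
  <= K * (INR N + 1) ^ a * exp (2 * cz * sqrt (INR N) / INR t) * p N.
Proof.
have [K [a [HK H]]] := p_poly; have [C [HC HCz]] := p_shift_le; have Hc := cz_gt1.
exists (C * K), a.+1; split; first by nra.
move=> N t HN Ht; have Hs1 := sqrt_INR_ge1 HN; have HN0 := pos_INR N; have Ht0 := INR_gt0 Ht.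
have Hv := vv_bounds HN Ht; have Hp := p_gt0 N.
have Hvi : 0 < / vv N t by apply: Rinv_0_lt_compat; lra.
set s := sqrt _ in Hs1 *.
have HNa : 0 < (INR N + 1) ^ a by apply: pow_lt; lra.
have HE := exp_pos (2 * cz * s / INR t).
apply: (Rle_trans _ (\rsum_(0 <= k < N.+1) (C * K * (INR N + 1) ^ a * exp (2 * cz * s / INR t) * p N))); last first.
  by rewrite rsum_const // subn0 S_INR -tech_pow_Rmult; right; ring.
apply: rsum_le => k Hk _; have Hk0 := pos_INR k.
have HR0 : 0 <= C * K * (INR N + 1) ^ a * exp (2 * cz * s / INR t) * p N.
  by repeat apply: Rmult_le_pos; lra.
have HPc := count_Pc N k Ht; case: (leqP (t * k) N) HPc => HtN Hcnt; last first.
  have -> : count (fun mu => Pc t mu == k) (partitions_of N) = 0%nat by lia.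
  by rewrite (_ : INR 0 = 0) // Rmult_0_l.
have {}Hcnt := INR_leq Hcnt; rewrite INR_mul in Hcnt.
have Hsh := HCz N (t * k)%nat HN HtN.
have [Hpk _] := H k.
have Hvk : 0 <= (/ vv N t) ^ k by apply: pow_le; lra.
apply: (Rle_trans _ (K * (INR k + 1) ^ a * exp (2 * cz * sqrt (INR k)) * (C * zz N (t * k) * p N) * (/ vv N t) ^ k)).
  apply: Rmult_le_compat_r => //; apply: Rle_trans Hcnt _.
  by apply: Rmult_le_compat; try exact: pos_INR.
have Hzv : zz N (t * k) * (/ vv N t) ^ k = vv N t ^ k.
  rewrite zz_mul -(vv_sqr t HN) Rpow_mult_distr Rmult_assoc -Rpow_mult_distr Rinv_r ?pow1; lra.
have -> : K * (INR k + 1) ^ a * exp (2 * cz * sqrt (INR k)) * (C * zz N (t * k) * p N) * (/ vv N t) ^ k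
  = C * K * (INR k + 1) ^ a * (exp (2 * cz * sqrt (INR k)) * vv N t ^ k) * p N by rewrite -Hzv; ring.
apply: Rmult_le_compat_r; first lra.
apply: Rmult_le_compat.
- by repeat apply: Rmult_le_pos; try lra; apply: pow_le; lra.
- by apply: Rmult_le_pos; [left; apply: exp_pos | apply: pow_le; lra].
- apply: Rmult_le_compat_l; first by nra.
  apply: pow_incr; split; first lra.
  by have : INR k <= INR N; [apply: INR_leq; lia | lra].
rewrite /vv -exp_INR_mul -exp_plus; apply: exp_le; rewrite -/s.
have Hr := sqrt_INR_sqr k; set r := sqrt (INR k) in Hr *; rewrite -Hr.
have -> : 2 * cz * s / INR t = 2 * cz * r + r * r * (- (cz * INR t / (2 * s)))
   + cz * INR t / (2 * s) * ((r - 2 * s / INR t) * (r - 2 * s / INR t)).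
  field; lra.
have : 0 <= cz * INR t / (2 * s).
  by apply: Rmult_le_pos; [nra | left; apply: Rinv_0_lt_compat; lra].
move=> H1; have : 0 <= (r - 2 * s / INR t) * (r - 2 * s / INR t) by apply: Rle_0_sqr.
move=> H2; have := Rmult_le_pos _ _ H1 H2; lra.
Qed.

Lemma pairs_gt_chernoff : exists K a, 1 <= K /\ forall N t, (0 < N)%nat -> (0 < t)%nat ->
  INR (pairs_gt t N) <= K * (INR N + 1) ^ a * exp (2 * cz * sqrt (INR N) / INR t)
     * exp (- (INR t * (zz N t * (1 - vv N t)))) * p N ^ 2.
Proof.
have [K1 [a1 [HK1 H1]]] := gf_bound; have [K2 [a2 [HK2 H2]]] := p_poly.
have [K3 [a3 [HK3 H3]]] := count_Pc_gf.
exists (2 * K1 * K2 * K3), (a1 + a2 + a3)%nat; split.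
  by have : 1 <= K1 * K2; [nra | nra].
move=> N t HN Ht; apply: Rle_trans (pairs_gt_le HN Ht) _.
have HX := hcnt_gf_le HN Ht (fun M => H1 N M HN); have HY := H3 N t HN Ht.
have [_ H2N] := H2 N; have Hv := vv_bounds HN Ht; have Hp := p_gt0 N.
have HN0 := pos_INR N; set s := sqrt (INR N) in HX HY H2N *.
set X := \rsum_(0 <= w < N.+1) (INR (hcnt t N w) * _) in HX *.
set Y := \rsum_(0 <= k < N.+1) _ in HY *.
have HX0 : 0 <= X by apply: rsum_ge0 => w _ _; apply: Rmult_le_pos; [apply: pos_INR | apply: pow_le; lra].
set E := exp (- (INR t * _)) in HX *; have HE : 0 < E by apply: exp_pos.
have Hzz : zz N N = exp (- (cz * s)).
  rewrite /zz -/s -[in LHS](sqrt_INR_sqr N) -/s; congr (exp (- _)); field.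
  by have := sqrt_INR_ge1 HN; rewrite -/s; lra.
have HP1 : 0 < (INR N + 1) ^ a1 by apply: pow_lt; lra.
have HP2 : 0 < (INR N + 1) ^ a2 by apply: pow_lt; lra.
have HXb : X <= 2 * K1 * K2 * ((INR N + 1) ^ a1 * (INR N + 1) ^ a2) * E * p N.
  have He := exp_pos (cz * s); have Hinv : exp (- (cz * s)) * exp (cz * s) = 1.
    by rewrite -exp_plus -exp_0; congr exp; ring.
  have H2cs : exp (2 * cz * s) = exp (cz * s) * exp (cz * s) by rewrite -exp_plus; congr exp; ring.
  rewrite Hzz in HX; rewrite H2cs in H2N.
  have := Rmult_le_compat_r _ _ _ (Rlt_le _ _ He) HX.
  rewrite Rmult_assoc Hinv Rmult_1_r => HX2; apply: Rle_trans HX2 _.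
  have -> : 2 * (K1 * (INR N + 1) ^ a1 * exp (cz * s)) * E * exp (cz * s)
    = (2 * K1 * (INR N + 1) ^ a1 * E) * (exp (cz * s) * exp (cz * s)) by ring.
  have -> : 2 * K1 * K2 * ((INR N + 1) ^ a1 * (INR N + 1) ^ a2) * E * p N
    = (2 * K1 * (INR N + 1) ^ a1 * E) * (K2 * (INR N + 1) ^ a2 * p N) by ring.
  by apply: Rmult_le_compat_l => //; repeat apply: Rmult_le_pos; lra.
apply: (Rle_trans _ (X * (K3 * (INR N + 1) ^ a3 * exp (2 * cz * s / INR t) * p N))).
  exact: Rmult_le_compat_l.
have HY0 : 0 <= K3 * (INR N + 1) ^ a3 * exp (2 * cz * s / INR t) * p N.
  have := exp_pos (2 * cz * s / INR t); have := pow_lt (INR N + 1) a3 ltac:(lra) => Q1 Q2.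
  by repeat apply: Rmult_le_pos; lra.
apply: Rle_trans (Rmult_le_compat_r _ _ _ HY0 HXb) _.
rewrite !pow_add; right; ring.
Qed.

(** A logarithm that is at least 1 for every [N], so that it may stand in denominators and absorb
    constants. *)
Definition lg (N : nat) := 1 + ln (INR N + 1).

Lemma lg_le m n : (m <= n)%nat -> lg m <= lg n.
Proof. by move=> /INR_leq H; have := pos_INR m; rewrite /lg => H0; have := @ln_le (INR m + 1) (INR n + 1); lra. Qed.

Lemma lg_ge1 N : 1 <= lg N.
Proof.
have := @ln_le 1 (INR N + 1); rewrite ln_1 /lg.
by have := pos_INR N; lra.
Qed.

Lemma INR_S_le_exp_lg N : INR N + 1 <= exp (lg N).
Proof.
have H := pos_INR N; rewrite /lg exp_plus exp_ln; last lra.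
by have := exp_ge1 1; nra.
Qed.

Lemma pow_le_exp_lg K a : 1 <= K -> exists A, 0 <= A /\ forall N, K * (INR N + 1) ^ a <= exp (A * lg N).
Proof.
move=> HK; have HlK : 0 <= ln K by rewrite -ln_1; apply: ln_le; lra.
exists (ln K + INR a); split; first by have := pos_INR a; lra.
move=> N; have HN := pos_INR N; have Hl := lg_ge1 N.
rewrite Rmult_plus_distr_r exp_plus exp_INR_mul; apply: Rmult_le_compat.
- lra.
- by apply: pow_le; lra.
- by rewrite -{1}(exp_ln K); [apply: exp_le; nra | lra].
- by apply: pow_incr; split; [lra | exact: INR_S_le_exp_lg].
Qed.

Lemma p_exp : exists A, 0 <= A /\ forall N n, (n <= N)%nat ->
  p n <= exp (A * lg N + 2 * cz * sqrt (INR n)) /\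
  1 <= exp (A * lg N - 2 * cz * sqrt (INR n)) * p n.
Proof.
have [C [HC H]] := ln_p_approx; exists C; split; first lra.
move=> N n /lg_le Hn; have Hb := H n; rewrite -/(lg n) in Hb.
have Hl : C * lg n <= C * lg N by apply: Rmult_le_compat_l; lra.
have Hp := p_gt0 n; have H1 := Rle_abs (ln (p n) - 2 * cz * sqrt (INR n)).
have H2 := Rle_abs (- (ln (p n) - 2 * cz * sqrt (INR n))); rewrite Rabs_Ropp in H2.
split; first by rewrite -{1}(exp_ln (p n)) //; apply: exp_le; lra.
by rewrite -{1}(exp_ln (p n)) // -exp_plus -exp_0; apply: exp_le; lra.
Qed.

(** Induction on [t]: the exponents combine by Cauchy-Schwarz, [sqrt (t i) + sqrt (w - i) <= sqrt
    ((t + 1) w)], and each convolution costs a power of [N]. *)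
Lemma pconv_le : exists A, 0 <= A /\ forall N t w, (w <= N)%nat ->
  INR (pconv t w) <= exp (INR t * (A * lg N) + 2 * cz * sqrt (INR t * INR w)).
Proof.
have [A [HA H]] := p_exp; exists (A + 1); split; first lra.
move=> N; elim=> [|t IH] w Hw.
  have -> : INR (pconv 0 w) = INR (w == 0%nat) by [].
  rewrite (_ : INR 0 = 0) // !Rmult_0_l sqrt_0 Rmult_0_r Rplus_0_r exp_0.
  by case: eqP => _ /=; [rewrite (_ : INR 1 = 1) // | rewrite (_ : INR 0 = 0) //]; lra.
have Hc := cz_gt1; have Hl := lg_ge1 N; have Ht := pos_INR t.
rewrite /= INR_sum -(@big_mkord R 0 Rplus w.+1 xpredT (fun i => INR (pconv t i * npart (w - i))%nat)).
set E := exp (INR t * ((A + 1) * lg N) + A * lg N + 2 * cz * sqrt (INR t.+1 * INR w)).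
apply: (Rle_trans _ (\rsum_(0 <= i < w.+1) E)); last first.
  rewrite rsum_const // subn0 S_INR; apply: (Rle_trans _ (exp (lg N) * E)).
    apply: Rmult_le_compat_r; first by left; apply: exp_pos.
    by apply: Rle_trans (INR_S_le_exp_lg N); have := INR_leq Hw; lra.
  by rewrite -exp_plus; apply: exp_le; rewrite S_INR; lra.
apply: rsum_le => i Hi _; rewrite INR_mul.
have [H1 _] := H N (w - i)%nat ltac:(lia); have H2 := IH i ltac:(lia).
apply: Rle_trans (Rmult_le_compat _ _ _ _ (pos_INR _) (pos_INR _) H2 H1) _.
rewrite -exp_plus; apply: exp_le.
suff : sqrt (INR t * INR i) + sqrt (INR (w - i)) <= sqrt (INR t.+1 * INR w).
  by move=> Hs; have := Rmult_le_compat_l (2 * cz) _ _ ltac:(lra) Hs; lra.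
have Hi0 := pos_INR i; have Hwi := pos_INR (w - i); have Hw0 := pos_INR w.
apply: Rsqr_incr_0_var; last exact: sqrt_pos.
rewrite /Rsqr sqrt_def; last by rewrite S_INR; nra.
rewrite sqrt_mult // S_INR.
have -> : INR w = INR i + INR (w - i) by rewrite -INR_add; congr INR; lia.
have E1 := sqrt_def _ Ht; have E2 := sqrt_def _ Hi0; have E3 := sqrt_def _ Hwi.
move: (sqrt (INR t)) (sqrt (INR i)) (sqrt (INR (w - i))) E1 E2 E3 => x y z <- <- <-.
by have : 0 <= (y - x * z) * (y - x * z) by [apply: Rle_0_sqr]; lra.
Qed.

Lemma count_by_value N (S : seq nat -> nat) (P : pred nat) :
  (forall la, is_partition N la -> (S la <= N)%nat) ->
  INR (count (fun la => P (S la)) (partitions_of N))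
  = \rsum_(0 <= w < N.+1) (INR (count (fun la => S la == w) (partitions_of N)) * INR (P w)).
Proof. by move=> HS; rewrite count_as_sum INR_sum; exact: (rsum_by_value (fun w => INR (P w)) HS). Qed.

(** If [Hcount t la < Pc t mu], then either [t * Hcount t la] is at most [15 N / 16] or
    [t * Pc t mu] exceeds it, which separates the two partitions. *)
Lemma pairs_gt_split t N : (0 < t)%nat ->
  (pairs_gt t N <= count (fun la => 16 * (t * Hcount t la) <= 15 * N) (partitions_of N) * npart N
    + npart N * count (fun mu => 15 * N < 16 * (t * Pc t mu)) (partitions_of N))%nat.
Proof.
move=> Ht; rewrite /pairs_gt !count_as_sum /npart.
have -> : ((\sum_(x <- partitions_of N) (16 * (t * Hcount t x) <= 15 * N)%nat) * size (partitions_of N)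
  = \sum_(la <- partitions_of N) \sum_(mu <- partitions_of N) (16 * (t * Hcount t la) <= 15 * N))%nat.
  by rewrite big_distrl /=; apply: eq_bigr => la _; rewrite big_const_seq iter_addn addn0 count_predT mulnC.
have -> : (size (partitions_of N) * (\sum_(x <- partitions_of N) (15 * N < 16 * (t * Pc t x))%nat)
  = \sum_(la <- partitions_of N) \sum_(mu <- partitions_of N) (15 * N < 16 * (t * Pc t mu)))%nat.
  by rewrite [RHS]big_const_seq iter_addn addn0 count_predT mulnC.
rewrite -big_split; apply: leq_sum => la _; rewrite /= -big_split; apply: leq_sum => mu _ /=.
case: (ltnP (Hcount t la) (Pc t mu)) => H; last exact: leq0n.
have {}H : (t * Hcount t la <= t * Pc t mu)%nat by rewrite leq_mul2l (ltnW H) orbT.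
case: (leqP (16 * (t * Hcount t la)) (15 * N)) => H2; first exact: leq_addr.
have -> : (15 * N < 16 * (t * Pc t mu))%nat; last exact: leq_addl.
by apply: leq_trans H2 _; rewrite leq_mul2l H orbT.
Qed.

Lemma sqrt_le_scal a x y : 0 <= a -> 0 <= y -> x <= a * a * y -> sqrt x <= a * sqrt y.
Proof.
move=> Ha Hy Hx; rewrite -{1}(sqrt_square a) // -sqrt_mult //; last exact: Rle_0_sqr.
exact: sqrt_le_1_alt.
Qed.

Lemma INR_15_16 : INR 15 = 15 /\ INR 16 = 16.
Proof. by rewrite !INR_IZR_INZ. Qed.

Lemma INR_exp m n : INR (expn m n) = INR m ^ n.
Proof.
elim: n => [|n IH]; first by rewrite expn0 pow_O.
by rewrite expnS INR_mul IH tech_pow_Rmult.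
Qed.

(** Both events of [pairs_gt_split] lower the exponent [2 cz sqrt N] to at most 97/100 of it:
    [sqrt (15 / 16) < 0.97] for the weight, and for the divisible parts
    [sqrt (1 / 2) + sqrt (1 / 16) < 0.97], where [t >= 2] enters. Cores contribute only
    [exp (O(t lg N))]. *)
Lemma pairs_gt_small : exists d, 0 < d /\ forall N t, (0 < N)%nat -> (2 <= t)%nat ->
  INR t * lg N <= d * sqrt (INR N) ->
  INR (pairs_gt t N) <= 2 * exp (- (sqrt (INR N) / 50)) * p N ^ 2.
Proof.
have [A0 [HA0 H0]] := p_exp; have [A1 [HA1 H1]] := pconv_le.
have [A2 [HA2 H2]] := @pow_le_exp_lg 4 1 ltac:(lra); have Hc := cz_gt1.
pose A := A1 + A2 + 1 + 3 * A0; have HA : 1 <= A by rewrite /A; lra.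
exists (/ (25 * A)); split; first by apply: Rinv_0_lt_compat; lra.
move=> N t HN Ht Hd; have Hs1 := sqrt_INR_ge1 HN; have Hss := sqrt_INR_sqr N.
set s := sqrt (INR N) in Hs1 Hss Hd *; have Hl := lg_ge1 N; have Hp := p_gt0 N.
have Ht2 : 2 <= INR t by rewrite (_ : 2 = INR 2) //; apply: INR_leq.
have Ht0 : (0 < t)%nat by lia.
have [E15 E16] := INR_15_16.
have HN0 := pos_INR N.
have Hd' : A * (INR t * lg N) <= s / 25.
  apply: Rle_trans (Rmult_le_compat_l A _ _ ltac:(lra) Hd) _.
  by right; field; lra.
have Htl : lg N <= INR t * lg N by nra.
(* Common end of both cases. The saving of at least [6 sqrt N / 100], less the [sqrt N / 25] spent
   on powers of [N], leaves [sqrt N / 50]. *)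
have Hgen (F : nat -> R) e : 0 <= e -> e + A0 <= A ->
   (forall k, (k < N.+1)%nat -> F k <= exp ((e - 1) * (INR t * lg N) + 2 * cz * (97 / 100 * s))) ->
   \rsum_(0 <= k < N.+1) F k <= exp (- (s / 50)) * p N.
  move=> He HeA HF.
  apply: (Rle_trans _ (\rsum_(0 <= k < N.+1) exp ((e - 1) * (INR t * lg N) + 2 * cz * (97 / 100 * s)))).
    by apply: rsum_le => k Hk _; apply: HF; lia.
  rewrite rsum_const // subn0 S_INR.
  apply: (Rle_trans _ (exp (e * (INR t * lg N) + 2 * cz * (97 / 100 * s)))).
    apply: Rle_trans (Rmult_le_compat_r _ _ _ (Rlt_le _ _ (exp_pos _)) (INR_S_le_exp_lg N)) _.
    by rewrite -exp_plus; apply: exp_le; nra.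
  have [_ HpN] := H0 N N (leqnn N); rewrite -/s in HpN.
  rewrite -[X in X <= _]Rmult_1_r.
  apply: Rle_trans (Rmult_le_compat_l _ _ _ (Rlt_le _ _ (exp_pos _)) HpN) _.
  rewrite -Rmult_assoc -exp_plus; apply: Rmult_le_compat_r; first lra.
  apply: exp_le; have : (e + A0) * (INR t * lg N) <= A * (INR t * lg N).
    by apply: Rmult_le_compat_r; nra.
  have : A0 * lg N <= A0 * (INR t * lg N) by apply: Rmult_le_compat_l.
  nra.
have HX : INR (count (fun la => 16 * (t * Hcount t la) <= 15 * N)%nat (partitions_of N)) <= exp (- (s / 50)) * p N.
  rewrite (@count_by_value N (Hcount t) (fun w => 16 * (t * w) <= 15 * N)%nat); last first.
    by move=> la Hla; have := mul_Hcount_le Ht0 Hla; nia.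
  apply: (Hgen _ (A1 + A2 + 1)); try by rewrite /A; lra.
  move=> w Hw; case: leqP => Hc2; last by rewrite /= Rmult_0_r; left; apply: exp_pos.
  rewrite /= Rmult_1_r -/(hcnt t N w) hcntE //; last by lia.
  rewrite INR_mul; have HwN : (w <= N)%nat by lia.
  have Hcore := INR_leq (@core_cnt_le t N (N - t * w) Ht0 (leq_subr _ _)).
  have Hpow : INR (expn (4 * N).+1 t) <= exp (INR t * (A2 * lg N)).
    rewrite INR_exp exp_INR_mul; apply: pow_incr; split; first exact: pos_INR.
    apply: Rle_trans (H2 N); rewrite pow_1 S_INR INR_mul (_ : INR 4 = 4); last by rewrite INR_IZR_INZ.
    lra.
  have Hpc := H1 N t w HwN.
  apply: Rle_trans (Rmult_le_compat _ _ _ _ (pos_INR _) (pos_INR _) (Rle_trans _ _ _ Hcore Hpow) Hpc) _.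
  rewrite -exp_plus; apply: exp_le.
  have : sqrt (INR t * INR w) <= 97 / 100 * s.
    apply: sqrt_le_scal; [lra | exact: HN0 |].
    have := INR_leq Hc2; rewrite !INR_mul E15 E16.
    by lra.
  nra.
have HY : INR (count (fun mu => 15 * N < 16 * (t * Pc t mu))%nat (partitions_of N)) <= exp (- (s / 50)) * p N.
  rewrite (@count_by_value N (Pc t) (fun w => 15 * N < 16 * (t * w))%nat); last first.
    by move=> mu Hmu; have := mul_Pc_le t Hmu; nia.
  apply: (Hgen _ (1 + 2 * A0)); try by rewrite /A; lra.
  move=> k Hk; case: ltnP => Hc2; last by rewrite /= Rmult_0_r; left; apply: exp_pos.
  rewrite /= Rmult_1_r; have HPc := count_Pc N k Ht0; case: (leqP (t * k) N) HPc => HtN Hcnt; last first.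
    have -> : count (fun mu => Pc t mu == k) (partitions_of N) = 0%nat by lia.
    by rewrite (_ : INR 0 = 0) //; left; apply: exp_pos.
  have {}Hcnt := INR_leq Hcnt; rewrite INR_mul in Hcnt; apply: Rle_trans Hcnt _.
  have [Hk1 _] := H0 N k ltac:(lia); have [Hk2 _] := H0 N (N - t * k)%nat (leq_subr _ _).
  apply: Rle_trans (Rmult_le_compat _ _ _ _ (pos_INR _) (pos_INR _) Hk1 Hk2) _.
  rewrite -exp_plus; apply: exp_le.
  have Hk0 := pos_INR k.
  have HtN' := INR_leq HtN; rewrite INR_mul in HtN'.
  have S1 : sqrt (INR k) <= 71 / 100 * s.
    by apply: sqrt_le_scal; [lra | exact: HN0 | nra].
  have S2 : sqrt (INR (N - t * k)) <= 25 / 100 * s.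
    apply: sqrt_le_scal; [lra | exact: HN0 |]; rewrite INR_sub // INR_mul.
    have := INR_ltn Hc2; rewrite !INR_mul E15 E16.
    lra.
  have : A0 * lg N <= A0 * (INR t * lg N) by apply: Rmult_le_compat_l.
  nra.
apply: Rle_trans (INR_leq (pairs_gt_split N Ht0)) _.
rewrite INR_add !INR_mul.
have := Rmult_le_compat_r (p N) _ _ ltac:(lra) HX; have := Rmult_le_compat_r (p N) _ _ ltac:(lra) HY.
by rewrite /= ; lra.
Qed.

Lemma lg_unbounded M : exists N0, forall N, (N0 <= N)%nat -> M <= ln (INR N).
Proof.
have [N0 HN0] := INR_unbounded (exp M); exists N0 => N /INR_leq HN.
by rewrite -(ln_exp M); apply: ln_le; [exact: exp_pos | lra].
Qed.

Lemma lg_ln N : (0 < N)%nat -> ln (INR N) <= lg N <= ln (INR N) + 2.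
Proof.
move=> HN; have H1 := INR_ge1 HN; rewrite /lg.
have Ha := @ln_le (INR N) (INR N + 1) ltac:(lra) ltac:(lra).
have Hb := @ln_le (INR N + 1) (INR N * 2) ltac:(lra) ltac:(lra).
rewrite ln_mult in Hb; try lra.
have := @ln_le_sub1 2 ltac:(lra); lra.
Qed.

Lemma lg_pow_le M k : exists N0, forall N, (N0 <= N)%nat -> M * lg N ^ k <= sqrt (INR N).
Proof.
pose K := INR (2 * k + 1) ^ (2 * k + 1).
have HK : 0 <= K by apply: pow_le; apply: pos_INR.
have [N0 HN0] := lg_unbounded (M * M * (6 * K)).
exists N0.+1 => N HN; have N1 := @INR_ge1 N ltac:(lia).
have Hl := lg_ge1 N; have [Hll _] := @lg_ln N ltac:(lia).
have HM := HN0 N ltac:(lia).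
have Hlk : 1 <= lg N ^ k by apply: pow_R1_Rle.
have H := @pow_le_exp (2 * k + 1) (lg N) ltac:(lia) ltac:(lra); rewrite -/K in H.
have Hexp : exp (lg N) <= 6 * INR N.
  rewrite /lg exp_plus exp_ln; last lra.
  by have := exp_le_3; have := exp_pos 1; nra.
case: (Rle_dec M 0) => HM0.
  by apply: (Rle_trans _ 0); [nra | exact: sqrt_pos].
rewrite -(sqrt_square (M * lg N ^ k)); last by nra.
apply: sqrt_le_1_alt.
have E : lg N ^ (2 * k + 1) = lg N ^ k * lg N ^ k * lg N.
  by rewrite pow_add pow_1 -pow_add; congr (_ ^ _ * _); lia.
rewrite E in H; set L := lg N ^ k in Hlk H *.
have H2 : L * L * lg N <= K * (6 * INR N).
  by apply: Rle_trans H _; apply: Rmult_le_compat_l.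
have HLL : 0 <= M * M * (L * L) by nra.
apply: (Rmult_le_reg_r (lg N)); first lra.
have H3 : M * M * (L * L * lg N) <= M * M * (K * (6 * INR N)) by apply: Rmult_le_compat_l => //; nra.
have H4 : M * M * (6 * K) * INR N <= lg N * INR N by apply: Rmult_le_compat_r; lra.
lra.
Qed.

Lemma exp_neg_half : exp (- / 2) <= 2 / 3.
Proof.
have := exp_ge1 (/ 2); have := exp_pos (/ 2); have : exp (/ 2) * exp (- / 2) = 1.
  by rewrite -exp_plus -exp_0; congr exp; ring.
have := exp_pos (- / 2); nra.
Qed.

(** Put [u = cz t / sqrt N], so that [zz N t = exp (- u)]. For [u <= 1] the right side is at least
    [t ^ 2 / (9 sqrt N)], of order at least [sqrt N / lg N ^ 2]. For [u > 1] the function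
    [u exp (- u)] decreases, so [t z] is least at the end of the range. *)
Lemma chernoff_exponent A d : 0 <= A -> 0 < d -> exists be N0, 0 <= be /\
  forall N t, (N0 <= N)%nat -> (0 < t)%nat -> d * sqrt (INR N) <= INR t * lg N ->
  cz * INR t / sqrt (INR N) <= / 2 * ln (INR N) - be ->
  2 * cz * sqrt (INR N) / INR t + A * lg N <= INR t * (zz N t * (1 - vv N t)).
Proof.
move=> HA Hd; have Hc := cz_gt1; have Hc2 := cz_lt2.
(* This choice makes [z] equal to [24 (A + 8) / sqrt N] at the end of the range, hence [t z] there a
   sufficient multiple of [lg N]. *)
pose be := ln (24 * (A + 8)); have Hbe : 0 <= be by rewrite -ln_1; apply: ln_le; lra.
have [N1 HN1] := lg_unbounded (4 * be + 2).
have [N2 HN2] := lg_pow_le (9 / (d * d) * (A + 4 / d)) 3.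
exists be, (N1 + N2).+1; split=> // N t HN Ht Hdt Hu.
have HN0 : (0 < N)%nat by lia.
have Hs1 := sqrt_INR_ge1 HN0; have Hss := sqrt_INR_sqr N; have Ht1 := INR_ge1 Ht.
have {}HN1 := HN1 N ltac:(lia); have {}HN2 := HN2 N ltac:(lia).
have [Hl1 Hl2] := lg_ln HN0; have Hl := lg_ge1 N.
set s := sqrt (INR N) in Hs1 Hss Hu Hdt HN2 *.
pose u := cz * INR t / s; rewrite -/u in Hu.
have Htu : INR t = s * u / cz by rewrite /u; field; lra.
have Hu0 : 0 < u by apply: Rdiv_lt_0_compat; nra.
have Ez : zz N t = exp (- u) by rewrite /zz -/s.
have Ev : vv N t = exp (- (u / 2)) by rewrite /vv -/s /u; congr (exp (- _)); field; lra.
rewrite Ez Ev.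
case: (Rle_dec u 1) => Hu1.
  have Hz : / 3 <= exp (- u).
    apply: (Rle_trans _ (exp (- (1)))); last by apply: exp_le; lra.
    rewrite exp_Ropp; apply: Rinv_le_contravar; [exact: exp_pos | exact: exp_le_3].
  have Hv : u / 3 <= 1 - exp (- (u / 2)).
    have H1 := exp_ge1 (u / 2); have H2 := exp_pos (- (u / 2)).
    have H3 : exp (u / 2) * exp (- (u / 2)) = 1 by rewrite -exp_plus -exp_0; congr exp; ring.
    have : (1 + u / 2) * exp (- (u / 2)) <= 1 by nra.
    nra.
  have Hzv : u / 9 <= exp (- u) * (1 - exp (- (u / 2))) by nra.
  have Hlow : INR t * INR t / (9 * s) <= INR t * (exp (- u) * (1 - exp (- (u / 2)))).
    have -> : INR t * INR t / (9 * s) = INR t * (u / 9 / cz) by rewrite /u; field; lra.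
    apply: Rmult_le_compat_l; first lra.
    apply: Rle_trans Hzv; apply: (Rmult_le_reg_r cz); first lra.
    rewrite (_ : u / 9 / cz * cz = u / 9); last by field; lra.
    nra.
  have Hst : 2 * cz * s / INR t <= 4 / d * lg N.
    apply: (Rmult_le_reg_r (INR t)); first lra.
    rewrite (_ : 2 * cz * s / INR t * INR t = 2 * cz * s); last by field; lra.
    have -> : 4 / d * lg N * INR t = 4 / d * (INR t * lg N) by ring.
    apply: (Rle_trans _ (4 / d * (d * s))).
      by rewrite (_ : 4 / d * (d * s) = 4 * s); [nra | field; lra].
    apply: Rmult_le_compat_l => //; apply: Rlt_le; apply: Rdiv_lt_0_compat; lra.
  have HdA : 0 < 4 / d by apply: Rdiv_lt_0_compat; lra.
  suff : (A + 4 / d) * lg N <= INR t * INR t / (9 * s) by nra.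
  have Htt : d * d * (s * s) <= (INR t * lg N) * (INR t * lg N).
    rewrite (_ : d * d * (s * s) = (d * s) * (d * s)); last by ring.
    by apply: Rmult_le_compat => //; nra.
  apply: (Rmult_le_reg_r (9 * s * (lg N * lg N))); first by nra.
  rewrite (_ : INR t * INR t / (9 * s) * (9 * s * (lg N * lg N)) = INR t * lg N * (INR t * lg N)); last by field; lra.
  apply: Rle_trans Htt.
  have HN3 := Rmult_le_compat_l (d * d * s) _ _ ltac:(nra) HN2.
  rewrite (_ : d * d * s * (9 / (d * d) * (A + 4 / d) * lg N ^ 3) = (A + 4 / d) * lg N * (9 * s * (lg N * lg N))) in HN3; last by field; lra.
  lra.
have Hv : / 3 <= 1 - exp (- (u / 2)).
  have := exp_neg_half; have : exp (- (u / 2)) <= exp (- / 2) by apply: exp_le; lra.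
  lra.
pose U := / 2 * ln (INR N) - be; rewrite -/U in Hu.
have HU : lg N / 4 <= U by rewrite /U; lra.
have Hst : 2 * cz * s / INR t <= 8 * lg N.
  have -> : 2 * cz * s / INR t = 2 * cz * cz / u by rewrite Htu; field; lra.
  apply: (Rmult_le_reg_r u); first lra.
  rewrite (_ : 2 * cz * cz / u * u = 2 * cz * cz); last by field; lra.
  nra.
have Hdec : U * exp (- U) <= u * exp (- u).
  have -> : exp (- u) = exp (U - u) * exp (- U) by rewrite -exp_plus; congr exp; ring.
  rewrite -Rmult_assoc; apply: Rmult_le_compat_r; first by left; apply: exp_pos.
  by have := exp_ge1 (U - u); nra.
have HeU : exp (- U) = 24 * (A + 8) / s.
  have -> : - U = be + - (/ 2 * ln (INR N)) by rewrite /U; ring.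
  rewrite exp_plus /be exp_ln; last lra.
  congr (_ * _); rewrite exp_Ropp; congr (/ _).
  have -> : / 2 * ln (INR N) = ln s.
    by rewrite -Hss ln_mult; lra.
  by rewrite exp_ln; lra.
have Htz : 12 * (A + 8) * U <= INR t * exp (- u).
  have -> : INR t * exp (- u) = s / cz * (u * exp (- u)) by rewrite Htu; field; lra.
  apply: (Rle_trans _ (s / cz * (U * exp (- U)))).
    rewrite HeU (_ : s / cz * (U * (24 * (A + 8) / s)) = 24 * (A + 8) * U * / cz); last by field; lra.
    have : / 2 <= / cz by apply: Rinv_le_contravar; lra.
    have : 0 <= (A + 8) * U by nra.
    nra.
  by apply: Rmult_le_compat_l => //; apply: Rlt_le; apply: Rdiv_lt_0_compat; lra.
have H12 : 3 * (A + 8) * lg N <= INR t * exp (- u) by nra.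
rewrite -Rmult_assoc.
have : (A + 8) * lg N <= INR t * exp (- u) * (1 - exp (- (u / 2))).
  have : 0 <= (A + 8) * lg N by nra.
  nra.
lra.
Qed.

Lemma pairs_gt_lt : exists be C N0, 0 <= be /\ 0 < C /\ forall N t, (N0 <= N)%nat -> (2 <= t)%nat ->
  cz * INR t / sqrt (INR N) <= / 2 * ln (INR N) - be ->
  INR (pairs_gt t N) <= C / INR N ^ 2 * p N ^ 2.
Proof.
have [d [Hd Hsmall]] := pairs_gt_small; have [K [a [HK Hch]]] := pairs_gt_chernoff.
have [A [HA HKA]] := @pow_le_exp_lg K a HK.
(* The extra [2 * lg N] in the exponent pays for [1 / N ^ 2]. *)
have [be [N0 [Hbe Hexp]]] := @chernoff_exponent (A + 2) d ltac:(lra) Hd.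
pose D := 2 * (50 ^ 4 * INR 4 ^ 4).
have HD : 0 < D by rewrite /D; have := @pow_lt (INR 4) 4 (@INR_gt0 4 isT); lra.
exists be, (D + 1), N0.+1; split=> //; split; first lra.
move=> N t HN Ht Hu; have HN1 : (0 < N)%nat by lia.
have N1 := INR_ge1 HN1; have Hp := p_gt0 N; have Hp2 : 0 < p N ^ 2 by apply: pow_lt.
have HiN : 0 < / INR N ^ 2 by apply: Rinv_0_lt_compat; apply: pow_lt; lra.
have Hs1 := sqrt_INR_ge1 HN1; have Hss := sqrt_INR_sqr N.
case: (Rle_dec (INR t * lg N) (d * sqrt (INR N))) => Hcase.
  apply: Rle_trans (Hsmall N t HN1 Ht Hcase) _; apply: Rmult_le_compat_r; first lra.
  set s := sqrt (INR N) in Hs1 Hss *.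
  have H4 := @pow_le_exp 4 (s / 50) isT ltac:(lra).
  have He : exp (s / 50) * exp (- (s / 50)) = 1 by rewrite -exp_plus -exp_0; congr exp; ring.
  have Hep := exp_pos (- (s / 50)).
  have H5 := Rmult_le_compat_r _ _ _ (Rlt_le _ _ Hep) H4.
  rewrite Rmult_assoc He Rmult_1_r in H5.
  have E : (s / 50) ^ 4 = INR N ^ 2 * / 50 ^ 4 by rewrite -Hss; field.
  apply: (Rmult_le_reg_r (INR N ^ 2 * / 50 ^ 4)).
    by apply: Rmult_lt_0_compat; [apply: pow_lt; lra | lra].
  rewrite -E (_ : (D + 1) / INR N ^ 2 * (s / 50) ^ 4 = (D + 1) * / 50 ^ 4); last by rewrite E; field; lra.
  rewrite /D; lra.
apply: Rle_trans (Hch N t HN1 ltac:(lia)) _; apply: Rmult_le_compat_r; first lra.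
have {}Hexp := Hexp N t ltac:(lia) ltac:(lia) ltac:(lra) Hu.
apply: (Rle_trans _ (exp (A * lg N) * exp (2 * cz * sqrt (INR N) / INR t) * exp (- (INR t * (zz N t * (1 - vv N t)))))).
  by repeat (apply: Rmult_le_compat_r; first by left; apply: exp_pos); exact: HKA.
rewrite -!exp_plus; apply: (Rle_trans _ (exp (- (lg N + lg N)))); first by apply: exp_le; lra.
rewrite exp_Ropp exp_plus; apply: (Rle_trans _ (/ INR N ^ 2)); last first.
  by rewrite /Rdiv; nra.
apply: Rinv_le_contravar; first by apply: pow_lt; lra.
have := INR_S_le_exp_lg N; simpl pow; nra.
Qed.

(** * Summation over [t] *)

Lemma zz_anti N a b : (a <= b)%nat -> zz N b <= zz N a.
Proof.
move=> Hab; rewrite -(subnKC Hab) zz_add.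
have := zz_le1 N (b - a); have := zz_gt0 N a; nra.
Qed.

Lemma zz1_le N : (0 < N)%nat -> zz N 1 * (1 + cz / sqrt (INR N)) <= 1.
Proof.
move=> HN; have Hs := sqrt_INR_ge1 HN; rewrite /zz (_ : INR 1 = 1) // Rmult_1_r exp_Ropp.
have H := exp_ge1 (cz / sqrt (INR N)); have Hp := exp_pos (cz / sqrt (INR N)).
apply: (Rmult_le_reg_l (exp (cz / sqrt (INR N)))) => //.
by rewrite -Rmult_assoc Rinv_r ?Rmult_1_l; lra.
Qed.

Lemma zz1_ge N : 1 - cz / sqrt (INR N) <= zz N 1.
Proof. by rewrite /zz (_ : INR 1 = 1) // Rmult_1_r; have := exp_ge1 (- (cz / sqrt (INR N))); lra. Qed.

Lemma zzS N t : zz N t.+1 = zz N t * zz N 1.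
Proof. by rewrite -zz_add addn1. Qed.

(** Discrete form of [d z / d t = - cz z / sqrt N]; the [+ 1] accounts for the unit step. *)
Lemma zz_step_le N t : (0 < N)%nat -> zz N t <= (sqrt (INR N) / cz + 1) * (zz N t - zz N t.+1).
Proof.
move=> HN; have Hs := sqrt_INR_ge1 HN; have Hc := cz_gt1; have H := zz1_le HN; rewrite zzS.
have Hz := zz_gt0 N t; have Hq : 0 < sqrt (INR N) / cz by apply: Rdiv_lt_0_compat; lra.
have H2 := Rmult_le_compat_l _ _ _ (Rlt_le _ _ Hq) H.
have E : sqrt (INR N) / cz * (zz N 1 * (1 + cz / sqrt (INR N))) = zz N 1 * (sqrt (INR N) / cz + 1).
  field; lra.
rewrite E in H2; nra.
Qed.

Lemma sum_zz_le N a b : (0 < N)%nat -> \rsum_(a <= t < b) zz N t <= 2 * sqrt (INR N) * zz N a.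
Proof.
move=> HN; have Hs := sqrt_INR_ge1 HN; have Hc := cz_gt1; have Hz := zz_gt0 N a.
case: (leqP a b) => Hab; last by rewrite big_geq; [nra | exact: ltnW].
apply: (Rle_trans _ (\rsum_(a <= t < b) ((sqrt (INR N) / cz + 1) * (zz N t - zz N t.+1)))).
  by apply: rsum_le => t _ _; apply: zz_step_le.
have Hq : sqrt (INR N) / cz <= sqrt (INR N).
  apply: (Rmult_le_reg_r cz); first lra.
  by rewrite (_ : sqrt (INR N) / cz * cz = sqrt (INR N)); [nra | field; lra].
have Hq0 : 0 < sqrt (INR N) / cz by apply: Rdiv_lt_0_compat; lra.
rewrite rsum_scal; have -> : \rsum_(a <= t < b) (zz N t - zz N t.+1) = zz N a - zz N b.
  elim: b Hab => [|b IH]; first by case: a {Hz} => // _; rewrite big_geq //; ring.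
  rewrite leq_eqVlt => /orP [/eqP <-|]; first by rewrite big_geq //; ring.
  by rewrite ltnS => Hab; rewrite big_nat_recr //= IH //; ring.
have := zz_gt0 N b; nra.
Qed.

Lemma rsum_telescope_le a b (F G : nat -> R) :
  (a <= b)%nat -> (forall t, (a <= t < b)%nat -> F t <= G t.+1 - G t) ->
  \rsum_(a <= t < b) F t <= G b - G a.
Proof.
elim: b => [|b IH] Hab H; first by case: a Hab H => // _ _; rewrite big_geq //; lra.
move: Hab; rewrite leq_eqVlt => /orP [/eqP <-|]; first by rewrite big_geq //; lra.
rewrite ltnS => Hab; rewrite big_nat_recr //=.
have := IH Hab (fun t Ht => H t ltac:(lia)); have := H b ltac:(lia); lra.
Qed.

Lemma rsum_telescope_ge a b (F G : nat -> R) :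
  (a <= b)%nat -> (forall t, (a <= t < b)%nat -> G t.+1 - G t <= F t) ->
  G b - G a <= \rsum_(a <= t < b) F t.
Proof.
elim: b => [|b IH] Hab H; first by case: a Hab H => // _ _; rewrite big_geq //; lra.
move: Hab; rewrite leq_eqVlt => /orP [/eqP <-|]; first by rewrite big_geq //; lra.
rewrite ltnS => Hab; rewrite big_nat_recr //=.
have := IH Hab (fun t Ht => H t ltac:(lia)); have := H b ltac:(lia); lra.
Qed.

(** A discrete substitution: [exp (- u z)] grows over the step at [t] by at least
    [u (zz N t - zz N t.+1) exp (- u zz N t)], so the sum telescopes. *)
Lemma sum_zz_exp_le N a b u : (0 < N)%nat -> 0 < u ->
  \rsum_(a <= t < b) (zz N t * exp (- (u * zz N t))) <= (sqrt (INR N) / cz + 1) / u.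
Proof.
move=> HN Hu; have Hs := sqrt_INR_ge1 HN; have Hc := cz_gt1.
set Q := sqrt (INR N) / cz + 1.
have HQ : 0 < Q by rewrite /Q; have := @Rdiv_lt_0_compat (sqrt (INR N)) cz; lra.
have HQu : 0 < Q / u by apply: Rdiv_lt_0_compat.
case: (leqP a b) => Hab; last by rewrite big_geq; [lra | exact: ltnW].
pose G t := Q / u * exp (- (u * zz N t)).
apply: (Rle_trans _ (G b - G a)); last first.
  have H1 : exp (- (u * zz N b)) <= 1.
    by rewrite -exp_0; apply: exp_le; have := zz_gt0 N b; nra.
  by have := exp_pos (- (u * zz N a)); rewrite /G; nra.
apply: rsum_telescope_le => // t _.
have Hst := zz_step_le t HN; rewrite -/Q in Hst.
have -> : G t.+1 = Q / u * (exp (- (u * zz N t)) * exp (u * (zz N t - zz N t.+1))).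
  by rewrite /G -exp_plus; congr (_ * exp _); ring.
have He := exp_ge1 (u * (zz N t - zz N t.+1)).
have Hp := exp_pos (- (u * zz N t)).
rewrite /G; set E := exp (- (u * zz N t)) in Hp *; set d := zz N t - zz N t.+1 in Hst He *.
apply: (Rle_trans _ (Q / u * (E * (u * d)))).
  rewrite (_ : Q / u * (E * (u * d)) = Q * d * E); last by field; lra.
  by apply: Rmult_le_compat_r; lra.
rewrite -Rmult_minus_distr_l; apply: Rmult_le_compat_l; first lra.
nra.
Qed.

(** For the lower bound the increment over a step is compared with the summand at its right end,
    hence the range shifted by one. *)
Lemma sum_zz_exp_ge N a b u : (a <= b)%nat -> cz <= sqrt (INR N) -> 0 < u ->
  (sqrt (INR N) / cz - 1) / u * (exp (- (u * zz N b)) - exp (- (u * zz N a)))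
  <= \rsum_(a.+1 <= t < b.+1) (zz N t * exp (- (u * zz N t))).
Proof.
move=> Hab Hs Hu; have Hc := cz_gt1; rewrite big_add1 /=.
set Q := sqrt (INR N) / cz - 1.
have HQ : 0 <= Q.
  suff : 1 <= sqrt (INR N) / cz by rewrite /Q; lra.
  apply: (Rmult_le_reg_r cz); first lra.
  by rewrite (_ : sqrt (INR N) / cz * cz = sqrt (INR N)); [lra | field; lra].
pose G t := Q / u * exp (- (u * zz N t)).
rewrite Rmult_minus_distr_l; apply: (@rsum_telescope_ge a b (fun t => zz N t.+1 * exp (- (u * zz N t.+1))) G) => // t _.
have Hst : Q * (zz N t - zz N t.+1) <= zz N t.+1.
  rewrite zzS; have Hz := zz_gt0 N t; have H1 := zz1_ge N.
  have H2 : (1 + Q) * (1 - cz / sqrt (INR N)) <= (1 + Q) * zz N 1 by apply: Rmult_le_compat_l; lra.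
  have E : (1 + Q) * (1 - cz / sqrt (INR N)) = Q by rewrite /Q; field; lra.
  rewrite E in H2; nra.
have -> : G t = Q / u * (exp (- (u * zz N t.+1)) * exp (- (u * (zz N t - zz N t.+1)))).
  by rewrite /G -exp_plus; congr (_ * exp _); ring.
have He := exp_ge1 (- (u * (zz N t - zz N t.+1))).
have Hp := exp_pos (- (u * zz N t.+1)).
rewrite /G; set E := exp (- (u * zz N t.+1)) in Hp *; set d := zz N t - zz N t.+1 in Hst He *.
have HQu : 0 <= Q / u by apply: Rmult_le_pos => //; left; apply: Rinv_0_lt_compat.
apply: (Rle_trans _ (Q / u * (E * (u * d)))); last first.
  rewrite (_ : Q / u * (E * (u * d)) = Q * d * E); last by field; lra.
  by apply: Rmult_le_compat_r; lra.
rewrite -Rmult_minus_distr_l; apply: Rmult_le_compat_l; first lra.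
nra.
Qed.

(** The bounds in [cnt2_le] form a geometric series in [z] that starts at [z ^ 2]. *)
Lemma cnt2_zz : exists C, 0 < C /\ forall N t, (0 < N)%nat -> zz N t <= / 2 ->
  INR (cnt2 t N) <= C * (zz N t * zz N t) * p N.
Proof.
have [C [HC H]] := p_shift_le; exists (3 * C); split; first lra.
move=> N t HN Hz2; have Hz := zz_gt0 N t; have Hp := p_gt0 N; set z := zz N t in Hz Hz2 *.
have Ht0 : (0 < t)%nat.
  case: (t) @z Hz Hz2 => // z _; rewrite /z /zz (_ : INR 0 = 0) // Rmult_0_r /Rdiv Rmult_0_l Ropp_0 exp_0; lra.
apply: Rle_trans (INR_leq (cnt2_le N Ht0)) _; rewrite INR_add INR_sum.
have Hb : INR (if (t + t <= N)%nat then npart (N - (t + t)) else 0%nat) <= C * (z * z) * p N.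
  case: ifP => Ht; last first.
    by rewrite (_ : INR 0 = 0) //; repeat apply: Rmult_le_pos; lra.
  by have := H N (t + t)%nat HN Ht; rewrite zz_add.
have Ha : \rsum_(2 <= m < N.+1 | (m * t <= N)%nat) p (N - m * t) <= 2 * C * (z * z) * p N.
  apply: (Rle_trans _ (\rsum_(2 <= m < N.+1) (C * (z * z) * p N * z ^ (m - 2)))).
    rewrite big_mkcond; apply: rsum_le => m Hm _; have Hzm := pow_lt z (m - 2) Hz.
    case: ifP => Hmt; last by repeat apply: Rmult_le_pos; lra.
    apply: Rle_trans (H N _ HN Hmt) _; rewrite mulnC zz_mul -/z.
    have -> : z ^ m = z * z * z ^ (m - 2).
      by rewrite -{1}(subnKC (proj1 (andP Hm))) pow_add; congr (_ * _); rewrite /= ; ring.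
    by right; ring.
  rewrite rsum_scal; have Hg : \rsum_(2 <= m < N.+1) z ^ (m - 2) <= 2.
    rewrite -{1}[2%nat]add0n big_addn.
    rewrite (eq_bigr (fun i => 1 * z ^ i)); last by move=> i _; rewrite addnK Rmult_1_l.
    have Hgs := geom_sum (N.+1 - 2) z; have := pow_lt z (N.+1 - 2) Hz.
    by move: Hgs; set S := \rsum_(0 <= i < _) _; nra.
  have : 0 <= C * (z * z) * p N by repeat apply: Rmult_le_pos; lra.
  nra.
lra.
Qed.

(** The sum of [z ^ 2] from [T] on is at most [zz N T] times a sum of order [sqrt N * zz N T]. *)
Lemma sum_cnt2 be : exists C, 0 < C /\ forall N T, (0 < N)%nat ->
  (forall t, (T <= t)%nat -> zz N t <= be / sqrt (INR N)) -> be / sqrt (INR N) <= / 2 ->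
  \rsum_(T <= t < N.+1) INR (npart N * cnt2 t N)%nat <= C / sqrt (INR N) * p N ^ 2.
Proof.
have [C [HC H]] := cnt2_zz; exists (2 * C * be ^ 2 + 1); split; first by have := pow2_ge_0 be; nra.
move=> N T HN HT Hb; have Hs := sqrt_INR_ge1 HN; have Hp := p_gt0 N.
set s := sqrt (INR N) in Hs HT Hb *.
have HzT := HT T (leqnn T); have HzT0 := zz_gt0 N T.
apply: (Rle_trans _ (\rsum_(T <= t < N.+1) (C * zz N T * p N ^ 2 * zz N t))).
  apply: rsum_le => t Ht _; rewrite INR_mul; have Ht' : (T <= t)%nat by lia.
  have H1 := H N t HN ltac:(have := HT t Ht'; lra).
  apply: Rle_trans (Rmult_le_compat_l _ _ _ (Rlt_le _ _ Hp) H1) _.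
  have Hz := zz_anti N Ht'; have Hz0 := zz_gt0 N t.
  rewrite (_ : p N * (C * (zz N t * zz N t) * p N) = C * p N ^ 2 * zz N t * zz N t); last by ring.
  rewrite (_ : C * zz N T * p N ^ 2 * zz N t = C * p N ^ 2 * zz N t * zz N T); last by ring.
  apply: Rmult_le_compat_l => //; repeat apply: Rmult_le_pos; try lra; apply: pow_le; lra.
rewrite rsum_scal; have Hsum := sum_zz_le T N.+1 HN; rewrite -/s in Hsum.
have Hp2 : 0 < p N ^ 2 by apply: pow_lt.
apply: (Rle_trans _ (C * zz N T * p N ^ 2 * (2 * s * zz N T))).
  by apply: Rmult_le_compat_l => //; repeat apply: Rmult_le_pos; lra.
have HTT : zz N T * zz N T <= be / s * (be / s) by apply: Rmult_le_compat; lra.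
apply: (Rle_trans _ (2 * C * be ^ 2 / s * p N ^ 2)).
  rewrite (_ : 2 * C * be ^ 2 / s * p N ^ 2 = 2 * C * p N ^ 2 * s * (be / s * (be / s))); last by field; lra.
  rewrite (_ : C * zz N T * p N ^ 2 * (2 * s * zz N T) = 2 * C * p N ^ 2 * s * (zz N T * zz N T)); last by ring.
  by apply: Rmult_le_compat_l => //; repeat apply: Rmult_le_pos; lra.
have : 0 < / s by apply: Rinv_0_lt_compat; lra.
by rewrite /Rdiv; nra.
Qed.

Lemma exp_neg_lg e k : (0 < k)%nat -> 0 < e ->
  exists C, 0 < C /\ forall N, exp (- (e * lg N)) <= C / lg N ^ k.
Proof.
move=> Hk He; have Hk0 := INR_gt0 Hk; exists (INR k ^ k / e ^ k); split.
  by apply: Rdiv_lt_0_compat; apply: pow_lt.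
move=> N; have Hl := lg_ge1 N; have Hel : 0 < e * lg N by nra.
have H := @pow_le_exp k (e * lg N) Hk ltac:(lra).
have He0 := pow_lt e k He; have Hl0 := pow_lt (lg N) k ltac:(lra).
rewrite exp_Ropp; have Hx := exp_pos (e * lg N).
rewrite Rpow_mult_distr in H.
apply: (Rmult_le_reg_r (exp (e * lg N) * (e ^ k * lg N ^ k))).
  by apply: Rmult_lt_0_compat => //; apply: Rmult_lt_0_compat.
rewrite (_ : / exp (e * lg N) * (exp (e * lg N) * (e ^ k * lg N ^ k)) = e ^ k * lg N ^ k); last by field; lra.
rewrite (_ : INR k ^ k / e ^ k / lg N ^ k * (exp (e * lg N) * (e ^ k * lg N ^ k)) = INR k ^ k * exp (e * lg N)) //.
by field; lra.
Qed.

(** Two errors brought under [1 / lg N ^ 2]: the finite-difference error of order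
    [lg N ^ 2 / sqrt N], amplified by [exp (2 t z) <= exp (lg N / 8)], and the proportion of cores
    that remains once [t z] exceeds [lg N / 16]. *)
Lemma lg_error : exists C, 0 < C /\ forall N, (0 < N)%nat ->
  lg N ^ 2 / sqrt (INR N) * exp (lg N / 8) <= C / lg N ^ 2 /\ exp (- (lg N / 16)) <= C / lg N ^ 2.
Proof.
have [C1 [HC1 H1]] := @exp_neg_lg (3 / 8) 4 isT ltac:(lra).
have [C2 [HC2 H2]] := @exp_neg_lg (/ 16) 2 isT ltac:(lra).
exists (3 * C1 + C2); split; first lra.
move=> N HN; have Hs := sqrt_INR_ge1 HN; have Hss := sqrt_INR_sqr N; have HN1 := INR_ge1 HN.
have Hl := lg_ge1 N; have Hl2 : 0 < / lg N ^ 2 by apply: Rinv_0_lt_compat; apply: pow_lt; lra.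
split; last first.
  have := H2 N; rewrite (_ : / 16 * lg N = lg N / 16); last by field.
  by rewrite /Rdiv; nra.
set s := sqrt (INR N) in Hs Hss *.
have Hes : exp (lg N / 2) <= 3 * s.
  have : exp (lg N / 2) * exp (lg N / 2) <= 6 * (s * s).
    rewrite -exp_plus Hss (_ : lg N / 2 + lg N / 2 = lg N); last by field.
    rewrite /lg exp_plus exp_ln; last lra.
    by have := exp_le_3; have := exp_pos 1; nra.
  have := exp_pos (lg N / 2); nra.
have H3 := H1 N; rewrite (_ : 3 / 8 * lg N = lg N / 2 - lg N / 8) in H3; last by field.
have He : exp (lg N / 8) <= 3 * s * exp (- (lg N / 2 - lg N / 8)).
  apply: (Rle_trans _ (exp (lg N / 2) * exp (- (lg N / 2 - lg N / 8)))).
    by rewrite -exp_plus; apply: exp_le; lra.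
  by apply: Rmult_le_compat_r => //; left; apply: exp_pos.
apply: (Rle_trans _ (lg N ^ 2 / s * (3 * s * (C1 / lg N ^ 4)))).
  apply: Rmult_le_compat_l.
    by apply: Rmult_le_pos; [apply: pow_le; lra | left; apply: Rinv_0_lt_compat; lra].
  by apply: Rle_trans He _; apply: Rmult_le_compat_l => //; lra.
rewrite (_ : lg N ^ 2 / s * (3 * s * (C1 / lg N ^ 4)) = 3 * C1 * / lg N ^ 2); last by field; lra.
by rewrite /Rdiv; nra.
Qed.

(** A rate [u] below [t] is allowed in the exponent so that the later sum over [t] telescopes with
    one fixed rate. *)
Lemma core_exp_upper : exists C, 0 < C /\ forall N t u, (0 < N)%nat ->
  sqrt (INR N) <= INR t -> INR t <= 2 * sqrt (INR N) * lg N -> 0 <= u <= INR t ->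
  INR (core_cnt t N) <= p N * (exp (- (u * zz N t)) + C / lg N ^ 2).
Proof.
have [C0 [HC0 H0]] := core_upper; have [C1 [HC1 H1]] := lg_error.
exists (4 * C0 * C1 + 3 * C1); split; first by nra.
move=> N t u HN Hst Htl Hu; have Hs := sqrt_INR_ge1 HN; have Hp := p_gt0 N.
have [Ha Hb] := H1 N HN; have Hl := lg_ge1 N.
have Ht : (0 < t)%nat by case: (t) Hst => // Hx; move: Hx; rewrite (_ : INR 0 = 0) //; lra.
set s := sqrt (INR N) in Hs Hst Htl Ha *.
have Hz := zz_gt0 N t; have Hz1 := zz_le1 N t; set z := zz N t in Hz Hz1 *.
have Hts : INR t ^ 2 / s ^ 3 <= 4 * (lg N ^ 2 / s).
  rewrite (_ : 4 * (lg N ^ 2 / s) = (2 * s * lg N) ^ 2 / s ^ 3); last by field; lra.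
  apply: Rmult_le_compat_r; first by left; apply: Rinv_0_lt_compat; apply: pow_lt; lra.
  by apply: pow_incr; split; [lra | exact: Htl].
have Hts0 : 0 <= INR t ^ 2 / s ^ 3.
  by apply: Rmult_le_pos; [apply: pow_le; lra | left; apply: Rinv_0_lt_compat; apply: pow_lt; lra].
have Hl2 : 0 < / lg N ^ 2 by apply: Rinv_0_lt_compat; apply: pow_lt; lra.
have Hcore r : (r <= t)%nat -> INR r * z <= lg N / 16 ->
    INR (core_cnt t N) <= p N * (exp (- (INR r * z)) + 4 * C0 * C1 / lg N ^ 2).
  move=> Hrt Hr; apply: Rle_trans (H0 N t r HN Ht Hst Hrt) _; rewrite -/s -/z.
  apply: Rmult_le_compat_l; first lra.
  apply: Rplus_le_compat; first exact: one_minus_pow_le.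
  apply: (Rle_trans _ (C0 * (4 * (lg N ^ 2 / s)) * exp (lg N / 8))).
    apply: Rmult_le_compat; [by nra | by left; apply: exp_pos | by nra | apply: exp_le; lra].
  have := Rmult_le_compat_l (4 * C0) _ _ ltac:(lra) Ha; rewrite /Rdiv; lra.
case: (Rle_dec (INR t * z) (lg N / 16)) => Hc.
  apply: Rle_trans (Hcore t (leqnn t) Hc) _; apply: Rmult_le_compat_l; first lra.
  have : exp (- (INR t * z)) <= exp (- (u * z)) by apply: exp_le; nra.
  by rewrite /Rdiv; nra.
(* Taking all [t] differences would amplify the error too much here. With [r] of them, where [r z]
   is just below [lg N / 16], the main term is already negligible. *)
have Hq0 : 0 <= lg N / 16 / z by apply: Rmult_le_pos; [lra | left; apply: Rinv_0_lt_compat].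
have [r [Hr1 Hr2]] := nat_floor Hq0.
have Hzq : lg N / 16 / z * z = lg N / 16 by field; lra.
have Hrz : INR r * z <= lg N / 16 by rewrite -Hzq; apply: Rmult_le_compat_r; lra.
have Hrz2 : lg N / 16 - 1 <= INR r * z by nra.
have Hrt : (r <= t)%nat.
  rewrite leqNgt; apply/negP => /ltnW /INR_leq Hx; nra.
apply: Rle_trans (Hcore r Hrt Hrz) _; apply: Rmult_le_compat_l; first lra.
have : exp (- (INR r * z)) <= 3 * (C1 / lg N ^ 2).
  apply: (Rle_trans _ (exp 1 * exp (- (lg N / 16)))); first by rewrite -exp_plus; apply: exp_le; lra.
  have := exp_le_3; have := exp_pos (- (lg N / 16)); have := exp_pos 1; nra.
have := exp_pos (- (u * z)); rewrite /Rdiv; nra.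
Qed.

Lemma xexp_decr a b : 1 <= a -> a <= b -> b * exp (- b) <= a * exp (- a).
Proof.
move=> Ha Hab; have -> : exp (- a) = exp (b - a) * exp (- b) by rewrite -exp_plus; congr exp; ring.
rewrite -Rmult_assoc; apply: Rmult_le_compat_r; first by left; apply: exp_pos.
by have := exp_ge1 (b - a); nra.
Qed.

Lemma pow_sub_le a b n : 0 <= b -> b <= a -> a <= 1 -> a ^ n - b ^ n <= INR n * (a - b).
Proof.
move=> Hb Hab Ha; elim: n => [|n IH]; first by rewrite !pow_O (_ : INR 0 = 0) //; lra.
rewrite -!tech_pow_Rmult S_INR.
have Hbn : 0 <= b ^ n <= 1 by split; [apply: pow_le | rewrite -(pow1 n); apply: pow_incr; lra].
have Hnab : 0 <= INR n * (a - b) by apply: Rmult_le_pos; [exact: pos_INR | lra].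
have H1 : a * (a ^ n - b ^ n) <= a * (INR n * (a - b)) by apply: Rmult_le_compat_l; lra.
have H2 : a * (INR n * (a - b)) <= INR n * (a - b) by nra.
have H3 : (a - b) * b ^ n <= a - b by nra.
lra.
Qed.

Lemma exp_neg_pow_le z n : 0 <= z <= 1 -> exp (- (INR n * z)) - INR n * z ^ 2 <= (1 - z) ^ n.
Proof.
move=> Hz; have He := exp_ge1 (- z); have He1 := exp_ge1 z; have Hp := exp_pos (- z).
have E : exp z * exp (- z) = 1 by rewrite -exp_plus -exp_0; congr exp; ring.
have Hle : exp (- z) <= 1 - z + z ^ 2.
  have H1 : (1 + z) * exp (- z) <= 1 by nra.
  have H2 : exp (- z) <= 1 by nra.
  simpl pow; nra.
have -> : exp (- (INR n * z)) = exp (- z) ^ n.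
  by rewrite -exp_INR_mul; congr exp; ring.
have := @pow_sub_le (exp (- z)) (1 - z) n ltac:(lra) ltac:(lra) ltac:(nra).
have : INR n * (exp (- z) - (1 - z)) <= INR n * z ^ 2 by apply: Rmult_le_compat_l; [exact: pos_INR | lra].
lra.
Qed.

(** With [be = ln 64] one gets [z <= 1 / (64 sqrt N)] and [t z <= lg N / 16], so that the amplified
    error is controlled with all [t] differences. *)
Lemma core_exp_lower : exists be C N0, 0 <= be /\ 0 < C /\ forall N t, (N0 <= N)%nat ->
  / 2 * ln (INR N) + be <= cz * INR t / sqrt (INR N) -> INR t <= 2 * sqrt (INR N) * lg N ->
  p N * (exp (- (INR t * zz N t)) - C / lg N ^ 2) <= INR (core_cnt t N).
Proof.
have [C0 [b [HC0 [Hb H0]]]] := core_lower; have [C1 [HC1 H1]] := lg_error.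
have Hc := cz_gt1; have Hc2 := cz_lt2.
pose be := ln 64; have Hbe : 0 <= be by rewrite -ln_1; apply: ln_le; lra.
have [N1 HN1] := lg_unbounded (2 * be + 4); have [N2 HN2] := lg_pow_le (4 * b * b) 1.
exists be, (5 * C0 * C1 + C1), (N1 + N2).+1; split=> //; split; first by nra.
move=> N t HN Hy Htl; have HN0 : (0 < N)%nat by lia.
have Hs := sqrt_INR_ge1 HN0; have Hss := sqrt_INR_sqr N; have Hp := p_gt0 N.
have [Ha _] := H1 N HN0; have Hl := lg_ge1 N; have [Hl1 Hl2] := lg_ln HN0.
have {}HN1 := HN1 N ltac:(lia); have {}HN2 := HN2 N ltac:(lia); rewrite pow_1 in HN2.
set s := sqrt (INR N) in Hs Hss Hy Htl Ha HN2 *.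
have Hz := zz_gt0 N t; have Hz1 := zz_le1 N t.
pose Y := / 2 * ln (INR N) + be; pose y := cz * INR t / s; rewrite -/Y -/y in Hy.
have Hty : INR t = s * y / cz by rewrite /y; field; lra.
have Ez : zz N t = exp (- y) by rewrite /zz -/s.
have HeY : exp (- Y) = / (64 * s).
  have -> : - Y = - be + - (/ 2 * ln (INR N)) by rewrite /Y; ring.
  rewrite exp_plus !exp_Ropp /be exp_ln; last lra.
  have -> : / 2 * ln (INR N) = ln s by rewrite -Hss ln_mult; lra.
  by rewrite exp_ln; [field; lra | lra].
have HY : 2 <= Y <= lg N by rewrite /Y; lra.
set z := zz N t in Hz Hz1 Ez *.
have Hzs : z <= / s.
  rewrite Ez; apply: (Rle_trans _ (exp (- Y))); first by apply: exp_le; lra.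
  by rewrite HeY; apply: Rinv_le_contravar; lra.
have Hst : s <= INR t.
  rewrite Hty; apply: (Rmult_le_reg_r cz); first lra.
  by rewrite (_ : s * y / cz * cz = s * y); [nra | field; lra].
have Ht : (0 < t)%nat by case: (t) Hst => // Hx; move: Hx; rewrite (_ : INR 0 = 0) //; lra.
have Htz : INR t * z <= lg N / 16.
  rewrite Ez Hty (_ : s * y / cz * exp (- y) = s / cz * (y * exp (- y))); last by field; lra.
  have Hsc : 0 <= s / cz by apply: Rmult_le_pos; [lra | left; apply: Rinv_0_lt_compat; lra].
  have Hd := @xexp_decr Y y ltac:(lra) Hy.
  apply: Rle_trans (Rmult_le_compat_l _ _ _ Hsc Hd) _.
  rewrite HeY (_ : s / cz * (Y * / (64 * s)) = Y / 64 * / cz); last by field; lra.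
  have : / cz <= 1 by rewrite -Rinv_1; apply: Rinv_le_contravar; lra.
  have : 0 < / cz by apply: Rinv_0_lt_compat; lra.
  nra.
have Hsi : 0 < / s by apply: Rinv_0_lt_compat; lra.
have Hbs : 4 * b * b * lg N * / s <= 1.
  apply: (Rmult_le_reg_r s); first lra.
  by rewrite Rmult_assoc Rinv_l ?Rmult_1_r ?Rmult_1_l; lra.
have Hbz : b * z <= / 2.
  apply: (Rle_trans _ (b * / s)); first by apply: Rmult_le_compat_l; lra.
  have : 4 * b * / s <= 4 * b * b * lg N * / s.
    by apply: Rmult_le_compat_r; [lra | nra].
  lra.
have Htzz : INR t * z ^ 2 <= lg N / 16 * / s.
  rewrite (_ : INR t * z ^ 2 = (INR t * z) * z); last by ring.
  by apply: Rmult_le_compat; try lra; apply: Rmult_le_pos; lra.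
have Hcond : 4 * INR t * (b * z) ^ 2 <= 1.
  rewrite (_ : 4 * INR t * (b * z) ^ 2 = 4 * (b * b) * (INR t * z ^ 2)); last by ring.
  apply: (Rle_trans _ (4 * (b * b) * (lg N / 16 * / s))).
    by apply: Rmult_le_compat_l => //; nra.
  have : 0 <= 4 * b * b * lg N * / s by apply: Rmult_le_pos; [nra | lra].
  lra.
apply: Rle_trans (H0 N t HN0 Ht Hst Hbz Hcond); rewrite -/s -/z.
apply: Rmult_le_compat_l; first lra.
have H2 := @exp_neg_pow_le z t ltac:(lra).
have Hts : INR t ^ 2 / s ^ 3 <= 4 * (lg N ^ 2 / s).
  rewrite (_ : 4 * (lg N ^ 2 / s) = (2 * s * lg N) ^ 2 / s ^ 3); last by field; lra.
  apply: Rmult_le_compat_r; first by left; apply: Rinv_0_lt_compat; apply: pow_lt; lra.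
  by apply: pow_incr; split; [lra | exact: Htl].
have Hts0 : 0 <= INR t ^ 2 / s ^ 3.
  by apply: Rmult_le_pos; [apply: pow_le; lra | left; apply: Rinv_0_lt_compat; apply: pow_lt; lra].
have HE1 : C0 * (INR t ^ 2 / s ^ 3) * exp (2 * INR t * z) <= 4 * C0 * (C1 / lg N ^ 2).
  apply: (Rle_trans _ (C0 * (4 * (lg N ^ 2 / s)) * exp (lg N / 8))).
    apply: Rmult_le_compat; [by nra | by left; apply: exp_pos | by nra | apply: exp_le; lra].
  have := Rmult_le_compat_l (4 * C0) _ _ ltac:(lra) Ha; lra.
have HE2 : INR t * z ^ 2 <= C1 / lg N ^ 2.
  apply: Rle_trans Ha; apply: Rle_trans Htzz _.
  apply: (Rle_trans _ (lg N ^ 2 / s * 1)).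
    by rewrite /Rdiv Rmult_1_r; apply: Rmult_le_compat_r; [lra | simpl pow; nra].
  apply: Rmult_le_compat_l; first by apply: Rmult_le_pos; [apply: pow_le; lra | lra].
  by rewrite -exp_0; apply: exp_le; lra.
have HE3 := Rmult_le_compat_l C0 _ _ ltac:(lra) HE2.
have -> : (5 * C0 * C1 + C1) / lg N ^ 2 = 4 * C0 * (C1 / lg N ^ 2) + C0 * (C1 / lg N ^ 2) + C1 / lg N ^ 2.
  by rewrite /Rdiv; ring.
lra.
Qed.

Lemma psh_near : exists C, 0 < C /\ forall N t, (0 < N)%nat ->
  INR t <= 2 * sqrt (INR N) * lg N -> Rabs (psh N t - zz N t) <= C / lg N ^ 2 * zz N t.
Proof.
have [C0 [HC0 H0]] := psh_approx; have [C1 [HC1 H1]] := lg_error.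
exists (C0 * (6 * C1)); split; first by nra.
move=> N t HN Ht; have Hs := sqrt_INR_ge1 HN; have Hss := sqrt_INR_sqr N.
have [Ha _] := H1 N HN; have Hl := lg_ge1 N; have Ht0 := pos_INR t.
apply: Rle_trans (H0 N t HN) _; apply: Rmult_le_compat_r; first by left; apply: zz_gt0.
rewrite -{1}Hss; set s := sqrt (INR N) in Hs Hss Ht Ha *.
have Hb : lg N ^ 2 / s <= C1 / lg N ^ 2.
  apply: Rle_trans Ha; rewrite -[X in X <= _]Rmult_1_r; apply: Rmult_le_compat_l.
    by apply: Rmult_le_pos; [apply: pow_le; lra | left; apply: Rinv_0_lt_compat; lra].
  by rewrite -exp_0; apply: exp_le; lra.
rewrite /Rdiv Rmult_assoc; apply: Rmult_le_compat_l; first lra.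
apply: (Rle_trans _ (6 * (lg N ^ 2 / s))); last by rewrite /Rdiv in Hb *; lra.
have E1 : INR t * / (s * s) <= 2 * (lg N ^ 2 / s).
  apply: (Rle_trans _ (2 * s * lg N * / (s * s))).
    by apply: Rmult_le_compat_r => //; left; apply: Rinv_0_lt_compat; nra.
  rewrite (_ : 2 * s * lg N * / (s * s) = 2 * (lg N / s)); last by field; lra.
  apply: Rmult_le_compat_l; first lra; apply: Rmult_le_compat_r; first by left; apply: Rinv_0_lt_compat; lra.
  simpl pow; nra.
have E2 : INR t ^ 2 * / s ^ 3 <= 4 * (lg N ^ 2 / s).
  rewrite (_ : 4 * (lg N ^ 2 / s) = (2 * s * lg N) ^ 2 * / s ^ 3); last by field; lra.
  apply: Rmult_le_compat_r; first by left; apply: Rinv_0_lt_compat; apply: pow_lt; lra.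
  by apply: pow_incr; split; [lra | exact: Ht].
lra.
Qed.

Lemma p_psh N t : (t <= N)%nat -> p (N - t) = psh N t * p N.
Proof. by move=> Ht; rewrite /psh Ht; have := p_gt0 N => Hp; field; lra. Qed.

Lemma zz_far N t : (0 < N)%nat -> 2 * sqrt (INR N) * lg N <= INR t -> zz N t <= / INR N ^ 2.
Proof.
move=> HN Ht; have Hs := sqrt_INR_ge1 HN; have Hc := cz_gt1; have Hl := lg_ge1 N; have HN1 := INR_ge1 HN.
apply: (Rle_trans _ (exp (- (lg N + lg N)))).
  apply: exp_le; suff : 2 * lg N <= cz * INR t / sqrt (INR N) by lra.
  apply: (Rmult_le_reg_r (sqrt (INR N))); first lra.
  by rewrite (_ : cz * INR t / sqrt (INR N) * sqrt (INR N) = cz * INR t); [have := pos_INR t; nra | field; lra].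
rewrite exp_Ropp exp_plus; apply: Rinv_le_contravar; first by apply: pow_lt; lra.
by have := INR_S_le_exp_lg N; simpl pow; nra.
Qed.

(** Up to [2 sqrt N lg N] both factors are estimated asymptotically; beyond it the shift alone is
    O([1 / N ^ 2]) and cores are bounded by all partitions. *)
Lemma term_upper : exists C, 0 < C /\ forall N t u, (0 < N)%nat -> (t <= N)%nat ->
  sqrt (INR N) <= INR t -> 0 <= u <= INR t ->
  INR (npart (N - t) * core_cnt t N)%nat <=
  p N ^ 2 * (zz N t * exp (- (u * zz N t)) + C / lg N ^ 2 * zz N t + C / INR N ^ 2).
Proof.
have [C1 [HC1 H1]] := psh_near; have [C2 [HC2 H2]] := core_exp_upper; have [C3 [HC3 H3]] := psh_le.
exists (C1 + C2 + C1 * C2 + C3); split; first by nra.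
move=> N t u HN HtN Hst Hu; rewrite INR_mul p_psh //.
have Hp := p_gt0 N; have Hz := zz_gt0 N t; have HN1 := INR_ge1 HN; have Hl := lg_ge1 N.
have Hi : 0 < / INR N ^ 2 by apply: Rinv_0_lt_compat; apply: pow_lt; lra.
have Hli : 0 < / lg N ^ 2 by apply: Rinv_0_lt_compat; apply: pow_lt; lra.
have Hli1 : / lg N ^ 2 <= 1 by rewrite -Rinv_1; apply: Rinv_le_contravar; [lra | simpl pow; nra].
have HE : 0 < exp (- (u * zz N t)) <= 1.
  by split; [exact: exp_pos | rewrite -exp_0; apply: exp_le; nra].
set E := exp _ in HE *; have Hps := psh_ge0 N t; have Hcp : 0 <= INR (core_cnt t N) by exact: pos_INR.
have Hzl : 0 < / lg N ^ 2 * zz N t by apply: Rmult_lt_0_compat.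
have HCC : 0 < C1 * C2 by nra.
case: (Rle_dec (INR t) (2 * sqrt (INR N) * lg N)) => Hc.
  have Ha := H2 N t u HN Hst Hc Hu; rewrite -/E in Ha.
  have Hb : psh N t <= (1 + C1 * / lg N ^ 2) * zz N t.
    by have := H1 N t HN Hc; have := Rle_abs (psh N t - zz N t); rewrite /Rdiv; lra.
  apply: (Rle_trans _ ((1 + C1 * / lg N ^ 2) * zz N t * p N * (p N * (E + C2 / lg N ^ 2)))).
    apply: Rmult_le_compat => //; first by apply: Rmult_le_pos; lra.
    by apply: Rmult_le_compat_r; lra.
  rewrite (_ : _ * zz N t * p N * _ = p N ^ 2 * ((1 + C1 * / lg N ^ 2) * (E + C2 * / lg N ^ 2) * zz N t)); last by rewrite /Rdiv; ring.
  apply: Rmult_le_compat_l; first by apply: pow_le; lra.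
  have Hx : (1 + C1 * / lg N ^ 2) * (E + C2 * / lg N ^ 2) <= E + (C1 + C2 + C1 * C2) * / lg N ^ 2.
    set q := / lg N ^ 2 in Hli Hli1 *; have Hq : q * q <= q by nra.
    have Hq2 : C1 * q * E <= C1 * q * 1 by apply: Rmult_le_compat_l; [nra | lra].
    have := Rmult_le_compat_l (C1 * C2) _ _ ltac:(lra) Hq; lra.
  have := Rmult_le_compat_r _ _ _ (Rlt_le _ _ Hz) Hx; rewrite /Rdiv.
  have : 0 <= C3 * (/ lg N ^ 2 * zz N t) by nra.
  have : 0 <= (C1 + C2 + C1 * C2 + C3) * / INR N ^ 2 by nra.
  lra.
have Hfar := @zz_far N t HN ltac:(lra).
apply: (Rle_trans _ (C3 * / INR N ^ 2 * p N * p N)).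
  apply: Rmult_le_compat => //; [by apply: Rmult_le_pos; lra | | exact: core_cnt_le_npart].
  apply: Rmult_le_compat_r; first lra.
  by apply: Rle_trans (H3 N t HN) _; apply: Rmult_le_compat_l; lra.
rewrite (_ : C3 * / INR N ^ 2 * p N * p N = p N ^ 2 * (C3 * / INR N ^ 2)); last by ring.
apply: Rmult_le_compat_l; first by apply: pow_le; lra.
have : 0 <= zz N t * E by nra.
have : 0 <= (C1 + C2 + C1 * C2 + C3) * (/ lg N ^ 2 * zz N t) by nra.
have : 0 <= (C1 + C2 + C1 * C2) * / INR N ^ 2 by nra.
rewrite /Rdiv; lra.
Qed.

Lemma sum_term_upper : exists C, 0 < C /\ forall N T u, (0 < N)%nat ->
  sqrt (INR N) <= INR T -> 0 < u <= INR T ->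
  \rsum_(T <= t < N.+1) INR (npart (N - t) * core_cnt t N)%nat <=
  p N ^ 2 * ((sqrt (INR N) / cz + 1) / u + C / lg N ^ 2 * (2 * sqrt (INR N) * zz N T + 1)).
Proof.
have [C [HC H]] := term_upper; have [C1 [HC1 H1]] := lg_error.
exists (C + 2 * C * C1); split; first by nra.
move=> N T u HN HsT Hu; have Hp := p_gt0 N; have HN1 := INR_ge1 HN; have Hl := lg_ge1 N.
have Hs := sqrt_INR_ge1 HN; have Hss := sqrt_INR_sqr N; have Hc := cz_gt1.
have Hli : 0 < / lg N ^ 2 by apply: Rinv_0_lt_compat; apply: pow_lt; lra.
apply: (Rle_trans _ (\rsum_(T <= t < N.+1) (p N ^ 2 * (zz N t * exp (- (u * zz N t)) + C / lg N ^ 2 * zz N t + C / INR N ^ 2)))).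
  apply: rsum_le => t Ht _; have /INR_leq HTt : (T <= t)%nat by lia.
  by apply: H => //; try lra; lia.
rewrite rsum_scal; apply: Rmult_le_compat_l; first by apply: pow_le; lra.
rewrite !rsum_plus rsum_scal.
have Ha := sum_zz_exp_le T N.+1 HN (proj1 Hu); have Hb := sum_zz_le T N.+1 HN.
have Hd : \rsum_(T <= t < N.+1) (C / INR N ^ 2) <= 2 * C * (C1 / lg N ^ 2).
  have Hi : 0 < C / INR N ^ 2 by apply: Rdiv_lt_0_compat => //; apply: pow_lt; lra.
  apply: (Rle_trans _ (INR N.+1 * (C / INR N ^ 2))).
    case: (leqP T N.+1) => HT; last by rewrite big_geq; [apply: Rmult_le_pos; [exact: pos_INR | lra] | exact: ltnW].
    by rewrite rsum_const //; apply: Rmult_le_compat_r; [lra | apply: INR_leq; exact: leq_subr].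
  apply: (Rle_trans _ (2 * C * (lg N ^ 2 / sqrt (INR N)))).
    apply: (Rle_trans _ (2 * C * / INR N)).
      rewrite (_ : INR N.+1 * (C / INR N ^ 2) = C * / INR N * ((INR N + 1) / INR N)); last by rewrite S_INR; field; lra.
      have : (INR N + 1) / INR N <= 2.
        by apply: (Rmult_le_reg_r (INR N)); [lra | rewrite (_ : (INR N + 1) / INR N * INR N = INR N + 1); [lra | field; lra]].
      have : 0 < C * / INR N by apply: Rmult_lt_0_compat => //; apply: Rinv_0_lt_compat; lra.
      nra.
    apply: Rmult_le_compat_l; first lra.
    apply: (Rle_trans _ (/ sqrt (INR N))); first by apply: Rinv_le_contravar; nra.
    rewrite -[X in X <= _]Rmult_1_l; apply: Rmult_le_compat_r; first by left; apply: Rinv_0_lt_compat; lra.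
    by simpl pow; nra.
  apply: Rmult_le_compat_l; first lra.
  have [Hx _] := H1 N HN; apply: Rle_trans Hx.
  rewrite -[X in X <= _]Rmult_1_r; apply: Rmult_le_compat_l.
    by apply: Rmult_le_pos; [apply: pow_le; lra | left; apply: Rinv_0_lt_compat; lra].
  by rewrite -exp_0; apply: exp_le; lra.
have He : C / lg N ^ 2 * \rsum_(T <= t < N.+1) zz N t <= C / lg N ^ 2 * (2 * sqrt (INR N) * zz N T).
  by apply: Rmult_le_compat_l => //; apply: Rmult_le_pos; lra.
have Hzs : 0 < 2 * sqrt (INR N) * zz N T by have := zz_gt0 N T; nra.
have : 0 <= 2 * C * C1 * / lg N ^ 2 * (2 * sqrt (INR N) * zz N T).
  by apply: Rmult_le_pos; [repeat apply: Rmult_le_pos; lra | lra].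
have : 0 <= C * / lg N ^ 2 by nra.
move: Ha He Hd; rewrite /Rdiv; lra.
Qed.

(** For fixed [t] the larger parts [r] contribute O([sqrt N z ^ 2]). One factor [z] is traded for
    [2 / u] through [w exp (- w) <= 1], which keeps half of the exponent for the telescoping sum.
    With [u] of order sqrt N log N the main loss [N / u ^ 2] has order [1 / (log N) ^ 2]. *)
Lemma loss_upper : exists C, 0 < C /\ forall N a b u, (0 < N)%nat ->
  sqrt (INR N) <= INR a -> 0 < u <= INR a ->
  (forall t, (t < b)%nat -> INR t <= 2 * sqrt (INR N) * lg N) ->
  \rsum_(a <= t < b) (INR (\sum_(t.+1 <= r < N.+1 | t + r <= N) npart (N - (t + r)))%nat * INR (core_cnt t N)) <=
  p N ^ 2 * (C * (sqrt (INR N) ^ 2 / u ^ 2 + (sqrt (INR N) * zz N a) ^ 2 / lg N ^ 2)).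
Proof.
have [C1 [HC1 H1]] := core_exp_upper; have [C3 [HC3 H3]] := p_shift_le.
exists (2 * C3 * (8 + 2 * C1)); split; first by nra.
move=> N a b u HN Hsa Hu Htb; have Hp := p_gt0 N; have Hl := lg_ge1 N.
have Hs := sqrt_INR_ge1 HN; have Hc := cz_gt1.
have Hli : 0 < / lg N ^ 2 by apply: Rinv_0_lt_compat; apply: pow_lt; lra.
set s := sqrt (INR N) in Hs Hsa Htb *.
apply: (Rle_trans _ (\rsum_(a <= t < b) (2 * C3 * s * p N ^ 2 *
   (2 / u * (zz N t * exp (- (u / 2 * zz N t))) + C1 / lg N ^ 2 * zz N a * zz N t)))).
  apply: rsum_le => t Ht _; have Hat : (a <= t)%nat by lia.
  have HaT := INR_leq Hat; have Hz := zz_gt0 N t; have Hza := zz_anti N Hat.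
  have Hcore := H1 N t u HN ltac:(rewrite -/s; lra) ltac:(by apply: Htb; lia) ltac:(lra).
  have Hsum : INR (\sum_(t.+1 <= r < N.+1 | (t + r <= N)%nat) npart (N - (t + r)))%nat <= 2 * C3 * s * p N * (zz N t * zz N t).
    rewrite INR_sum; apply: (Rle_trans _ (\rsum_(t.+1 <= r < N.+1) (C3 * p N * zz N t * zz N r))).
      rewrite big_mkcond; apply: rsum_le => r _ _; case: ifP => Hr; last first.
        by have := zz_gt0 N r; move=> Hzr; repeat apply: Rmult_le_pos; lra.
      by have := H3 N (t + r)%nat HN Hr; rewrite zz_add; lra.
    rewrite rsum_scal; have Hq := sum_zz_le t.+1 N.+1 HN; rewrite -/s in Hq.
    have Hq2 := zz_anti N (leqnSn t).
    apply: (Rle_trans _ (C3 * p N * zz N t * (2 * s * zz N t))); last by right; ring.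
    apply: Rmult_le_compat_l; first by repeat apply: Rmult_le_pos; lra.
    by apply: Rle_trans Hq _; apply: Rmult_le_compat_l; lra.
  apply: Rle_trans (Rmult_le_compat _ _ _ _ (pos_INR _) (pos_INR _) Hsum Hcore) _.
  rewrite (_ : 2 * C3 * s * p N * (zz N t * zz N t) * (p N * (exp (- (u * zz N t)) + C1 / lg N ^ 2))
    = 2 * C3 * s * p N ^ 2 * (zz N t * (zz N t * exp (- (u * zz N t))) + C1 / lg N ^ 2 * zz N t * zz N t)); last by ring.
  apply: Rmult_le_compat_l.
    by repeat apply: Rmult_le_pos; try lra; apply: pow_le; lra.
  apply: Rplus_le_compat; last first.
    apply: Rmult_le_compat_r; first lra; apply: Rmult_le_compat_l => //.
    by apply: Rmult_le_pos; lra.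
  rewrite (_ : 2 / u * (zz N t * exp (- (u / 2 * zz N t))) = zz N t * (2 / u * exp (- (u / 2 * zz N t)))); last by ring.
  apply: Rmult_le_compat_l; first lra.
  rewrite (_ : - (u * zz N t) = - (u / 2 * zz N t) + - (u / 2 * zz N t)); last by field.
  rewrite exp_plus -Rmult_assoc; apply: Rmult_le_compat_r; first by left; apply: exp_pos.
  apply: (Rmult_le_reg_l (u / 2)); first lra.
  rewrite (_ : u / 2 * (2 / u) = 1); last by field; lra.
  have Hw : 0 < u / 2 * zz N t by nra.
  rewrite -Rmult_assoc; set w := u / 2 * zz N t in Hw *.
  have : exp w * exp (- w) = 1 by rewrite -exp_plus -exp_0; congr exp; ring.
  by have := exp_ge1 w; have := exp_pos (- w); nra.
rewrite rsum_scal rsum_plus !rsum_scal.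
have Ha := @sum_zz_exp_le N a b (u / 2) HN ltac:(lra); have Hb := sum_zz_le a b HN.
rewrite -/s in Ha Hb; have Hza := zz_gt0 N a.
have Hsc : s / cz + 1 <= 2 * s.
  suff : s / cz <= s by lra.
  apply: (Rmult_le_reg_r cz); first lra.
  by rewrite (_ : s / cz * cz = s); [nra | field; lra].
have Hu2 : 0 < 2 / u by apply: Rdiv_lt_0_compat; lra.
have Hiu : 0 < / u by apply: Rinv_0_lt_compat; lra.
have Ha2 : 2 / u * \rsum_(a <= t < b) (zz N t * exp (- (u / 2 * zz N t))) <= 8 * s / u ^ 2.
  apply: Rle_trans (Rmult_le_compat_l _ _ _ (Rlt_le _ _ Hu2) Ha) _.
  rewrite (_ : 2 / u * ((s / cz + 1) / (u / 2)) = 4 * / u ^ 2 * (s / cz + 1)); last by field; lra.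
  rewrite (_ : 8 * s / u ^ 2 = 4 * / u ^ 2 * (2 * s)); last by field; lra.
  by apply: Rmult_le_compat_l => //; have := pow_lt (/ u) 2 Hiu; rewrite pow_inv; lra.
have HCl : 0 <= C1 / lg N ^ 2 * zz N a by repeat apply: Rmult_le_pos; lra.
have Hb2 := Rmult_le_compat_l _ _ _ HCl Hb.
rewrite (_ : 2 * C3 * s * p N ^ 2 * _ = p N ^ 2 * (2 * C3 * s * (2 / u * \rsum_(a <= t < b) (zz N t * exp (- (u / 2 * zz N t)))
  + C1 / lg N ^ 2 * zz N a * \rsum_(a <= t < b) zz N t))); last by ring.
apply: Rmult_le_compat_l; first by apply: pow_le; lra.
apply: (Rle_trans _ (2 * C3 * s * (8 * s / u ^ 2 + C1 / lg N ^ 2 * zz N a * (2 * s * zz N a)))).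
  by apply: Rmult_le_compat_l; [repeat apply: Rmult_le_pos; lra | lra].
rewrite (_ : 2 * C3 * s * (8 * s / u ^ 2 + C1 / lg N ^ 2 * zz N a * (2 * s * zz N a))
  = 2 * C3 * (8 * (s ^ 2 / u ^ 2) + 2 * C1 * ((s * zz N a) ^ 2 / lg N ^ 2))); last by field; lra.
rewrite (Rmult_assoc (2 * C3) (8 + 2 * C1)); apply: Rmult_le_compat_l; first lra.
have : 0 <= s ^ 2 / u ^ 2.
  by apply: Rmult_le_pos; [apply: pow_le; lra | left; apply: Rinv_0_lt_compat; apply: pow_lt; lra].
have : 0 <= (s * zz N a) ^ 2 / lg N ^ 2 by apply: Rmult_le_pos; [apply: pow2_ge_0 | lra].
nra.
Qed.

Lemma term_lower : exists be C N0, 0 <= be /\ 0 < C /\ forall N t, (N0 <= N)%nat -> (t <= N)%nat ->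
  / 2 * ln (INR N) + be <= cz * INR t / sqrt (INR N) -> INR t <= 2 * sqrt (INR N) * lg N ->
  p N ^ 2 * (zz N t * (exp (- (INR t * zz N t)) - C / lg N ^ 2)) <= INR (npart (N - t) * core_cnt t N)%nat.
Proof.
have [be [C1 [N0 [Hbe [HC1 H1]]]]] := core_exp_lower; have [C2 [HC2 H2]] := psh_near.
exists be, (C1 + C2), N0.+1; split=> //; split; first lra.
move=> N t HN HtN Hy Htl; have HN0 : (0 < N)%nat by lia.
have Ha := H1 N t ltac:(lia) Hy Htl; have Hb := H2 N t HN0 Htl.
have Hp := p_gt0 N; have Hz := zz_gt0 N t; have Hl := lg_ge1 N; have Ht := pos_INR t.
have HE : 0 < exp (- (INR t * zz N t)) <= 1.
  by split; [exact: exp_pos | rewrite -exp_0; apply: exp_le; nra].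
set E := exp _ in Ha HE *.
have Hli : 0 < / lg N ^ 2 by apply: Rinv_0_lt_compat; apply: pow_lt; lra.
have Hp2 : 0 < p N ^ 2 by apply: pow_lt.
have Hr := Rle_abs (- (psh N t - zz N t)); rewrite Rabs_Ropp in Hr.
rewrite INR_mul p_psh //; have Hps := psh_ge0 N t.
have Hcp : 0 <= INR (core_cnt t N) by exact: pos_INR.
rewrite /Rdiv in Ha Hb *; set q := / lg N ^ 2 in Hli Ha Hb *.
(* If the estimate for the cores is not positive, then the claimed lower bound is not either;
   otherwise it may be multiplied by the one for [psh]. *)
case: (Rle_dec (E - C1 * q) 0) => Hc.
  apply: (Rle_trans _ 0); last by apply: Rmult_le_pos => //; apply: Rmult_le_pos; lra.
  have : 0 <= zz N t * - (E - (C1 + C2) * q) by apply: Rmult_le_pos; nra.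
  nra.
apply: (Rle_trans _ (psh N t * p N * (p N * (E - C1 * q)))); last first.
  by apply: Rmult_le_compat_l => //; apply: Rmult_le_pos; lra.
rewrite (_ : psh N t * p N * (p N * (E - C1 * q)) = p N ^ 2 * (psh N t * (E - C1 * q))); last by ring.
apply: Rmult_le_compat_l; first lra.
have H3 : (zz N t - C2 * q * zz N t) * (E - C1 * q) <= psh N t * (E - C1 * q).
  by apply: Rmult_le_compat_r; lra.
apply: Rle_trans H3; have : C2 * q * zz N t * (E - C1 * q) <= C2 * q * zz N t.
  have : 0 < C2 * q * zz N t by repeat apply: Rmult_lt_0_compat.
  have : 0 < C1 * q by apply: Rmult_lt_0_compat.
  nra.
nra.
Qed.

(** One threshold [T] serves both claims: the first estimate bounds [Z_III - Z_II], and the two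
    together bound [Z_III]. *)
Lemma upper_sums : exists C N0, 0 < C /\ forall N, (N0 <= N)%nat -> exists T, (2 <= T)%nat /\
  \rsum_(2 <= t < T) INR (pairs_gt t N) + \rsum_(T <= t < N.+1) INR (npart N * cnt2 t N)%nat
    <= C / sqrt (INR N) * p N ^ 2 /\
  \rsum_(T <= t < N.+1) INR (npart (N - t) * core_cnt t N)%nat
    <= p N ^ 2 * (2 / ln (INR N) + C / ln (INR N) ^ 2).
Proof.
have [be [C1 [N1 [Hbe [HC1 H1]]]]] := pairs_gt_lt.
have [C2 [HC2 H2]] := sum_cnt2 (exp be); have [C3 [HC3 H3]] := sum_term_upper.
have [N2 HN2] := lg_unbounded (4 * be + 4); have [N3 HN3] := lg_pow_le (2 * exp be) 0.
have [N4 HN4] := lg_pow_le 1 1; have Heb := exp_pos be; have Hc := cz_gt1; have Hc2 := cz_lt2.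
pose C := 4 * C1 + C2 + 8 * be + 8 + C3 * (2 * exp be + 1).
have HCe : 0 < C3 * (2 * exp be + 1) by nra.
have HC : 0 < C by rewrite /C; lra.
exists C, (N1 + N2 + N3 + N4).+1; split=> // N HN.
have HN0 : (0 < N)%nat by lia.
have {}HN2 := HN2 N ltac:(lia); have {}HN3 := HN3 N ltac:(lia); have {}HN4 := HN4 N ltac:(lia).
rewrite pow_O in HN3; rewrite pow_1 in HN4.
have Hs := sqrt_INR_ge1 HN0; have Hss := sqrt_INR_sqr N; have [Hl1 _] := lg_ln HN0.
have Hp := p_gt0 N; have Hp2 : 0 < p N ^ 2 by apply: pow_lt.
set s := sqrt (INR N) in Hs Hss HN3 HN4 *; set L := ln (INR N) in HN2 Hl1 *.
(* The threshold [T] is the point where [zz N T] is about [exp be / s]. *)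
pose U := / 2 * L - be; have HU : 2 <= U by rewrite /U; lra.
pose u := s / cz * U; have Hsc : / 2 * s <= s / cz.
  apply: (Rmult_le_reg_r cz); first lra.
  by rewrite (_ : s / cz * cz = s); [nra | field; lra].
have Hsc1 : s / cz <= s.
  apply: (Rmult_le_reg_r cz); first lra.
  by rewrite (_ : s / cz * cz = s); [nra | field; lra].
have Hus : s <= u by rewrite /u; nra.
have [T [HT1 HT2]] := @nat_floor u ltac:(lra).
have HuT : u <= INR T.+1 by rewrite S_INR; lra.
have Hcz t : cz * INR t / s = INR t / (s / cz) by field; lra.
have Hz t : (T < t)%nat -> zz N t <= exp be / s.
  move=> /INR_leq Ht; rewrite /zz -/s Hcz.
  have HUt : U <= INR t / (s / cz).
    apply: (Rmult_le_reg_r (s / cz)); first lra.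
    by rewrite (_ : INR t / (s / cz) * (s / cz) = INR t); [rewrite /u in HuT; lra | field; lra].
  apply: (Rle_trans _ (exp (- U))); first by apply: exp_le; lra.
  rewrite (_ : - U = be + - (/ 2 * L)); last by rewrite /U; ring.
  have -> : / 2 * L = ln s by rewrite /L -Hss ln_mult; lra.
  by rewrite exp_plus exp_Ropp exp_ln /Rdiv; lra.
have HT : (2 <= T.+1)%nat.
  have : 0 < INR T by lra.
  by case: (T) => //; rewrite (_ : INR 0 = 0) //; lra.
exists T.+1; split=> //; split.
  have Ha : \rsum_(2 <= t < T.+1) INR (pairs_gt t N) <= 4 * C1 / s * p N ^ 2.
    apply: (Rle_trans _ (\rsum_(2 <= t < T.+1) (C1 / INR N ^ 2 * p N ^ 2))).
      apply: rsum_le => t Ht _; apply: H1; [lia | lia |].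
      have Ht' : INR t <= u by apply: Rle_trans HT1; apply: INR_leq; lia.
      rewrite -/s Hcz -/L -/U; apply: (Rmult_le_reg_r (s / cz)); first lra.
      by rewrite (_ : INR t / (s / cz) * (s / cz) = INR t); [rewrite /u in Ht'; lra | field; lra].
    rewrite rsum_const //.
    rewrite -Rmult_assoc; apply: Rmult_le_compat_r; first lra.
    have HL : lg N <= 2 * INR N.
      by have := @ln_le_sub1 (INR N + 1); rewrite /lg; have := INR_ge1 HN0; lra.
    have Hu : INR (T.+1 - 2) <= 2 * s * INR N.
      apply: (Rle_trans _ u); first by apply: Rle_trans HT1; apply: INR_leq; lia.
      rewrite /u; have : U <= lg N by rewrite /U; lra.
      nra.
    have HN1 := INR_ge1 HN0.
    apply: (Rle_trans _ (2 * s * INR N * (C1 / INR N ^ 2))).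
      by apply: Rmult_le_compat_r => //; left; apply: Rdiv_lt_0_compat => //; apply: pow_lt; lra.
    rewrite -Hss (_ : 2 * s * (s * s) * (C1 / (s * s) ^ 2) = 2 * C1 * / s); last by field; lra.
    have : 0 < C1 * / s by apply: Rmult_lt_0_compat => //; apply: Rinv_0_lt_compat; lra.
    rewrite /Rdiv; lra.
  have Hb := H2 N T.+1 HN0 Hz; rewrite -/s in Hb.
  have Hb2 : exp be / s <= / 2.
    apply: (Rmult_le_reg_r s); first lra.
    by rewrite (_ : exp be / s * s = exp be); [lra | field; lra].
  have {}Hb := Hb Hb2.
  have : 0 < / s * p N ^ 2 by apply: Rmult_lt_0_compat => //; apply: Rinv_0_lt_compat; lra.
  have : 0 < C3 * (2 * exp be + 1) by nra.
  move=> HA HB; have : 0 <= (8 * be + 8 + C3 * (2 * exp be + 1)) * (/ s * p N ^ 2) by nra.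
  by rewrite /C /Rdiv in Ha Hb *; lra.
apply: Rle_trans (H3 N T.+1 u HN0 ltac:(rewrite -/s; lra) ltac:(lra)) _.
rewrite -/s; apply: Rmult_le_compat_l; first lra.
have HzT : s * zz N T.+1 <= exp be.
  have := Hz T.+1 (leqnn _) => Hx; have := Rmult_le_compat_l s _ _ ltac:(lra) Hx.
  by rewrite (_ : s * (exp be / s) = exp be) //; field; lra.
have HL0 : 0 < L by lra.
have HlL : / lg N ^ 2 <= / L ^ 2.
  apply: Rinv_le_contravar; first exact: pow_lt.
  by apply: pow_incr; lra.
have HiL : 0 < / L ^ 2 by apply: Rinv_0_lt_compat; apply: pow_lt.
have E3 : C3 / lg N ^ 2 * (2 * s * zz N T.+1 + 1) <= C3 * (2 * exp be + 1) * / L ^ 2.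
  have Hli : 0 < / lg N ^ 2 by apply: Rinv_0_lt_compat; apply: pow_lt; lra.
  rewrite (_ : C3 / lg N ^ 2 * (2 * s * zz N T.+1 + 1) = C3 * ((2 * (s * zz N T.+1) + 1) * / lg N ^ 2)); last by rewrite /Rdiv; ring.
  rewrite Rmult_assoc; apply: Rmult_le_compat_l; first lra.
  have := zz_gt0 N T.+1; move=> Hz0.
  by apply: Rmult_le_compat; try lra; nra.
(* Since [U = L / 2 - be], its inverse differs from [2 / L] by O([1 / L ^ 2]). *)
have E1 : (s / cz + 1) / u <= 2 / L + (8 * be + 8) * / L ^ 2.
  have -> : (s / cz + 1) / u = (1 + cz / s) / U by rewrite /u; field; lra.
  have Hcs : cz / s <= 2 / L.
    rewrite /Rdiv; apply: Rmult_le_compat; try lra; first by left; apply: Rinv_0_lt_compat; lra.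
    by apply: Rinv_le_contravar; lra.
  apply: (Rmult_le_reg_r (U * L ^ 2)); first by apply: Rmult_lt_0_compat; [lra | exact: pow_lt].
  rewrite (_ : (1 + cz / s) / U * (U * L ^ 2) = (1 + cz / s) * L ^ 2); last by field; lra.
  rewrite (_ : (2 / L + (8 * be + 8) * / L ^ 2) * (U * L ^ 2) = U * (2 * L + (8 * be + 8))); last by field; lra.
  apply: (Rle_trans _ (L ^ 2 + 2 * L)).
    have := Rmult_le_compat_r (L ^ 2) _ _ ltac:(apply: pow_le; lra) Hcs.
    rewrite (_ : 2 / L * L ^ 2 = 2 * L); last by field; lra.
    lra.
  have HbL : 0 <= be * (L - 4 * be) by apply: Rmult_le_pos; lra.
  rewrite /U; simpl pow; nra.
rewrite /C /Rdiv in E1 E3 *.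
have : 0 <= (4 * C1 + C2) * / L ^ 2 by nra.
lra.
Qed.

(** * Passage to all [N >= 3], and the lower bound for [Z_I] *)

Lemma exp1_lt3 : exp 1 < 3.
Proof.
have H : exp (/ 6) <= 6 / 5.
  have := exp_ge1 (- / 6); have := exp_pos (/ 6); have : exp (/ 6) * exp (- / 6) = 1.
    by rewrite -exp_plus -exp_0; congr exp; ring.
  nra.
have -> : exp 1 = exp (/ 6) ^ 6.
  rewrite -exp_INR_mul (_ : INR 6 = 6); last by rewrite INR_IZR_INZ.
  by congr exp; field.
apply: (Rle_lt_trans _ ((6 / 5) ^ 6)); last by simpl pow; lra.
by apply: pow_incr; split; [left; apply: exp_pos |].
Qed.

Lemma ln_gt1 N : (3 <= N)%nat -> 1 < ln (INR N).
Proof.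
move=> /INR_leq HN; rewrite (_ : INR 3 = 3) in HN; last by rewrite INR_IZR_INZ.
by rewrite -(ln_exp 1); apply: ln_increasing; [exact: exp_pos | have := exp1_lt3; lra].
Qed.

(** The finitely many remaining [N] are absorbed into the constant one at a time. Positivity of [g]
    from 3 on means, for the first claim, [ln (ln 3) > 0], that is, [exp 1 < 3]. *)
Lemma extend_to_small (F g : nat -> R) : (forall N, (3 <= N)%nat -> 0 < g N) ->
  (exists C N0, forall N, (N0 <= N)%nat -> F N <= C * g N) ->
  exists C, forall N, (3 <= N)%nat -> F N <= C * g N.
Proof.
move=> Hg [C [N0 H]]; elim: N0 C H => [|n IH] C H; first by exists C => N _; apply: H.
case: (leqP 3 n) => Hn; last by exists C => N HN; apply: H; lia.
apply: (IH (Rmax C (F n / g n))) => N; rewrite leq_eqVlt => /orP [/eqP <-|HN].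
  have Hgn := Hg n Hn; apply: (Rle_trans _ (F n / g n * g n)); first by right; field; lra.
  by apply: Rmult_le_compat_r; [lra | exact: Rmax_r].
apply: Rle_trans (H N HN) _; apply: Rmult_le_compat_r; last exact: Rmax_l.
by left; apply: Hg; lia.
Qed.

Lemma INR_le_leq m n : INR m <= INR n -> (m <= n)%nat.
Proof. by move=> H; rewrite leqNgt; apply/negP => /INR_ltn; lra. Qed.

Lemma product_ge x y w : 0 <= x <= 1 -> 0 <= y <= 1 -> 0 <= w ->
  1 - x - y - w <= (1 - x) * (1 - y) * (1 - w).
Proof.
move=> Hx Hy Hw; have Hxy : 0 <= x * y by nra.
have : 0 <= (1 - x) * (1 - y) <= 1 by nra.
nra.
Qed.

Lemma ZI_lower : exists C N0, 0 < C /\ forall N, (N0 <= N)%nat ->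
  p N ^ 2 * (2 / ln (INR N) - C * (ln (ln (INR N)) ^ 2 / ln (INR N) ^ 2)) <= INR (ZI N).
Proof.
have [be [C1 [N1 [Hbe [HC1 H1]]]]] := term_lower; have [C2 [HC2 H2]] := loss_upper.
pose C5 := 9 / 2 + 12 * exp be; have Heb := exp_pos be.
have [N2 HN2] := lg_unbounded (exp (be + 1) + C5 + 4); have [N3 HN3] := lg_pow_le 4 1.
have Hc := cz_gt1; have Hc2 := cz_lt2.
pose C := 2 * (C5 + 1) + 8 + 2 * C1 + C2 * 17.
have HC5 : 0 < C5 by rewrite /C5; lra.
have HC : 0 < C by rewrite /C; lra.
exists C, (N1 + N2 + N3).+1; split=> // N HN.
have HN0 : (0 < N)%nat by lia.
have {}HN2 := HN2 N ltac:(lia); have {}HN3 := HN3 N ltac:(lia); rewrite pow_1 in HN3.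
have Hs := sqrt_INR_ge1 HN0; have Hss := sqrt_INR_sqr N; have [Hl1 _] := lg_ln HN0.
have Hp := p_gt0 N; have Hp2 : 0 < p N ^ 2 by apply: pow_lt.
set s := sqrt (INR N) in Hs Hss HN3 *; set L := ln (INR N) in HN2 Hl1 *.
have HL0 : 0 < L by have := exp_pos (be + 1); lra.
pose l := ln L; rewrite -/l.
have Hl : be + 1 <= l by rewrite -(ln_exp (be + 1)); apply: ln_le; [exact: exp_pos | lra].
have HlL : l <= L / 2.
  have := @ln_le_sub1 (L / 2) ltac:(lra); have := @ln_le_sub1 2 ltac:(lra).
  by rewrite ln_div; [rewrite -/l; lra | lra | lra].
have Hsc : / 2 * s <= s / cz.
  apply: (Rmult_le_reg_r cz); first lra.
  by rewrite (_ : s / cz * cz = s); [nra | field; lra].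
have Hsc1 : s / cz <= s.
  apply: (Rmult_le_reg_r cz); first lra.
  by rewrite (_ : s / cz * cz = s); [nra | field; lra].
have HLs : ln s = / 2 * L by rewrite /L -Hss ln_mult; lra.
(* Between [t = (s / cz) y1] and [t = (s / cz) y2] the proportion of [t]-cores
   increases from o(1) to 1 - o(1). *)
pose y1 := / 2 * L + be; pose y2 := / 2 * L + 2 * l.
pose u1 := s / cz * y1; pose u2 := s / cz * y2.
have Hu1 : s <= u1 by rewrite /u1 /y1; have := exp_pos (be + 1); nra.
have Hu12 : u1 + 2 <= u2.
  have : 1 <= y2 - y1 by rewrite /y1 /y2; lra.
  have : 2 <= s / cz by have := exp_pos (be + 1); lra.
  rewrite /u1 /u2; nra.
have Hu2 : u2 <= 3 / 2 * s * L.
  have : y2 <= 3 / 2 * L by rewrite /y2; lra.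
  have : 0 < y2 by rewrite /y2; lra.
  rewrite /u2; nra.
have [a' [Ha1 Ha2]] := @nat_floor u1 ltac:(lra); have [b [Hb1 Hb2]] := @nat_floor u2 ltac:(lra).
pose a := a'.+1; have Ha : INR a = INR a' + 1 by rewrite S_INR.
have Hab : (a <= b)%nat by apply: INR_le_leq; lra.
have HbN : (b <= N)%nat by apply: INR_le_leq; rewrite -Hss; nra.
have Htl t : (t < b.+1)%nat -> INR t <= 2 * s * lg N.
  by rewrite ltnS => /INR_leq Ht; nra.
have Hza : s * zz N a.+1 <= 1.
  have : zz N a.+1 <= exp (- ln s).
    apply: exp_le; rewrite HLs -/s S_INR.
    suff : / 2 * L <= cz * (INR a + 1) / s by lra.
    apply: (Rmult_le_reg_r (s / cz)); first lra.
    rewrite (_ : cz * (INR a + 1) / s * (s / cz) = INR a + 1); last by field; lra.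
    by rewrite /u1 /y1 in Ha2; nra.
  rewrite exp_Ropp exp_ln; last lra.
  move=> Hx; have := Rmult_le_compat_l s _ _ ltac:(lra) Hx; rewrite Rinv_r; lra.
have Hza0 := zz_gt0 N a.+1.
have HlgL : / lg N ^ 2 <= / L ^ 2.
  by apply: Rinv_le_contravar; [exact: pow_lt | apply: pow_incr; lra].
have Hlg0 : 0 < / lg N ^ 2 by apply: Rinv_0_lt_compat; apply: pow_lt; lra.
have Hmain : p N ^ 2 * (\rsum_(a.+1 <= t < b.+1) (zz N t * exp (- (u2 * zz N t))) - 2 * C1 * / L ^ 2)
   <= \rsum_(a.+1 <= t < b.+1) INR (npart (N - t) * core_cnt t N)%nat.
  apply: (Rle_trans _ (\rsum_(a.+1 <= t < b.+1) (p N ^ 2 * (zz N t * exp (- (u2 * zz N t)) - C1 / lg N ^ 2 * zz N t)))); last first.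
    apply: rsum_le => t Ht _; have Hz := zz_gt0 N t.
    have HtN : (t <= N)%nat by lia.
    have Hta : INR a <= INR t by apply: INR_leq; lia.
    have Htb : INR t <= u2 by apply: Rle_trans Hb1; apply: INR_leq; lia.
    have Hty : / 2 * ln (INR N) + be <= cz * INR t / sqrt (INR N).
      rewrite -/s -/L -/y1; apply: (Rmult_le_reg_r (s / cz)); first lra.
      rewrite (_ : cz * INR t / s * (s / cz) = INR t); last by field; lra.
      by rewrite /u1 in Ha2; lra.
    apply: Rle_trans (H1 N t ltac:(lia) HtN Hty (Htl t ltac:(lia))).
    apply: Rmult_le_compat_l; first lra.
    have : exp (- (u2 * zz N t)) <= exp (- (INR t * zz N t)) by apply: exp_le; nra.
    nra.
  rewrite rsum_scal; apply: Rmult_le_compat_l; first lra.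
  rewrite rsum_minus rsum_scal; apply: Rplus_le_compat_l; apply: Ropp_le_contravar.
  have Hsz := sum_zz_le a.+1 b.+1 HN0; rewrite -/s in Hsz.
  apply: (Rle_trans _ (C1 / lg N ^ 2 * 2)); last by rewrite /Rdiv; nra.
  by apply: Rmult_le_compat_l; [rewrite /Rdiv; nra | lra].
have Hge := @sum_zz_exp_ge N a b u2 Hab ltac:(rewrite -/s; have := exp_pos (be + 1); lra) ltac:(lra).
rewrite -/s in Hge.
(* The summand [2 * l] of [y2] makes [zz N b] of order [1 / (s L ^ 2)], so this exponential is
   [1 - O(1 / L)]. *)
have HE1 : 1 - 9 / 2 / L <= exp (- (u2 * zz N b)).
  apply: Rle_trans (exp_ge1 _); suff : u2 * zz N b <= 9 / 2 / L by lra.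
  have Hzb : zz N b <= 3 / (s * L ^ 2).
    apply: (Rle_trans _ (exp (1 + - (ln s + (l + l))))).
      apply: exp_le; rewrite -/s HLs; suff : / 2 * L + 2 * l - 1 <= cz * INR b / s by lra.
      rewrite -/y2; apply: (Rmult_le_reg_r (s / cz)); first lra.
      rewrite (_ : cz * INR b / s * (s / cz) = INR b); last by field; lra.
      have : 1 <= s / cz by have := exp_pos (be + 1); lra.
      by rewrite /u2 in Hb2; lra.
    rewrite exp_plus exp_Ropp !exp_plus /l !exp_ln; [|lra..].
    rewrite (_ : 3 / (s * L ^ 2) = 3 * / (s * (L * L))); last by field; lra.
    apply: Rmult_le_compat_r; last exact: exp_le_3.
    by left; apply: Rinv_0_lt_compat; nra.
  apply: (Rle_trans _ (3 / 2 * s * L * (3 / (s * L ^ 2)))); last by right; field; lra.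
  by apply: Rmult_le_compat; try lra; left; apply: zz_gt0.
(* At the left end [zz N a] is of order [1 / s], so [u2 * zz N a] is at least a multiple of [L], and
   [exp (- x) <= 1 / x] gives O([1 / L]). *)
have HE2 : exp (- (u2 * zz N a)) <= 12 * exp be / L.
  have Hzz : / (3 * exp be * s) <= zz N a.
    apply: (Rle_trans _ (exp (- (1 + be + ln s)))).
      rewrite exp_Ropp !exp_plus exp_ln; last lra.
      apply: Rinv_le_contravar; first by repeat apply: Rmult_lt_0_compat; try lra; exact: exp_pos.
      apply: Rmult_le_compat_r; first lra.
      by apply: Rmult_le_compat_r; [lra | exact: exp_le_3].
    apply: exp_le; rewrite -/s HLs Ha.
    suff : cz * (INR a' + 1) / s <= 1 + be + / 2 * L by lra.
    apply: (Rmult_le_reg_r (s / cz)); first lra.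
    rewrite (_ : cz * (INR a' + 1) / s * (s / cz) = INR a' + 1); last by field; lra.
    have : 1 <= s / cz by have := exp_pos (be + 1); lra.
    by rewrite /u1 /y1 in Ha1; lra.
  have Hu2L : s * L / 4 <= u2.
    have : / 2 * L <= y2 by rewrite /y2; lra.
    by rewrite /u2; nra.
  have Hk : L / (12 * exp be) <= u2 * zz N a.
    apply: (Rle_trans _ (s * L / 4 * / (3 * exp be * s))); first by right; field; lra.
    apply: Rmult_le_compat => //; [by nra |].
    by left; apply: Rinv_0_lt_compat; repeat apply: Rmult_lt_0_compat; lra.
  apply: (Rle_trans _ (exp (- (L / (12 * exp be))))); first by apply: exp_le; lra.
  rewrite exp_Ropp (_ : 12 * exp be / L = / (L / (12 * exp be))); last by field; lra.
  apply: Rinv_le_contravar; first by apply: Rdiv_lt_0_compat; lra.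
  have := exp_ge1 (L / (12 * exp be)); lra.
(* The main term is [1 / y2] with [y2 = L / 2 + 2 l]; the shift by [2 l] is the source of the
   iterated logarithm in the error. *)
have Hlow : 2 / L - (2 * (C5 + 1) + 8) * (l ^ 2 / L ^ 2)
     <= (s / cz - 1) / u2 * (exp (- (u2 * zz N b)) - exp (- (u2 * zz N a))).
  have Hy2 : 0 < y2 by rewrite /y2; lra.
  have H0 : 0 < (s / cz - 1) / u2.
    by apply: Rdiv_lt_0_compat; have := exp_pos (be + 1); lra.
  have HiL : 0 < / L by apply: Rinv_0_lt_compat.
  have HCL : 0 <= C5 / L <= 1.
    split; first by rewrite /Rdiv; nra.
    apply: (Rmult_le_reg_r L) => //; rewrite (_ : C5 / L * L = C5); last by field; lra.
    by have := exp_pos (be + 1); lra.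
  apply: (Rle_trans _ ((s / cz - 1) / u2 * (1 - C5 / L))); last first.
    apply: Rmult_le_compat_l; first lra.
    by rewrite /C5; rewrite (_ : (9 / 2 + 12 * exp be) / L = 9 / 2 / L + 12 * exp be / L); [lra | field; lra].
  have H1L : 0 <= 1 / L <= 1.
    split; first by rewrite /Rdiv; lra.
    apply: (Rmult_le_reg_r L) => //; rewrite (_ : 1 / L * L = 1); last by field; lra.
    by have := exp_pos (be + 1); lra.
  have HQ : 2 / L * ((1 - 1 / L) * (1 - 4 * l / L)) <= (s / cz - 1) / u2.
    have -> : (s / cz - 1) / u2 = (1 - cz / s) * / y2 by rewrite /u2; field; lra.
    have Hcs : cz / s <= 1 / L.
      apply: (Rmult_le_reg_r (s * L)); first by nra.
      rewrite (_ : cz / s * (s * L) = cz * L); last by field; lra.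
      by rewrite (_ : 1 / L * (s * L) = s); [nra | field; lra].
    have Hy : 2 / L * (1 - 4 * l / L) <= / y2.
      apply: (Rmult_le_reg_r (y2 * L ^ 2)); first by apply: Rmult_lt_0_compat => //; exact: pow_lt.
      rewrite (_ : 2 / L * (1 - 4 * l / L) * (y2 * L ^ 2) = 2 * (L - 4 * l) * y2); last by field; lra.
      rewrite (_ : / y2 * (y2 * L ^ 2) = L ^ 2); last by field; lra.
      by rewrite /y2; simpl pow; nra.
    have Hy2i : 0 < / y2 by apply: Rinv_0_lt_compat.
    have Hx := Rmult_le_compat_l (1 - 1 / L) _ _ ltac:(lra) Hy.
    have : (1 - 1 / L) * / y2 <= (1 - cz / s) * / y2 by apply: Rmult_le_compat_r; lra.
    lra.
  have Hx := Rmult_le_compat_r (1 - C5 / L) _ _ ltac:(lra) HQ.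
  apply: Rle_trans Hx.
  have Hlp : 0 <= 4 * l / L by rewrite /Rdiv; apply: Rmult_le_pos; lra.
  have Hpr := product_ge HCL H1L Hlp.
  have Hx := Rmult_le_compat_l (2 / L) _ _ ltac:(rewrite /Rdiv; nra) Hpr.
  rewrite (_ : 2 / L * ((1 - 1 / L) * (1 - 4 * l / L)) * (1 - C5 / L) = 2 / L * ((1 - C5 / L) * (1 - 1 / L) * (1 - 4 * l / L))); last by ring.
  apply: Rle_trans Hx.
  rewrite (_ : 2 / L * (1 - C5 / L - 1 / L - 4 * l / L) = 2 / L - (2 * (C5 + 1) + 8 * l) * / L ^ 2); last by field; lra.
  have : (2 * (C5 + 1) + 8 * l) <= (2 * (C5 + 1) + 8) * l ^ 2.
    have : 1 <= l ^ 2 by simpl pow; nra.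
    have : l <= l ^ 2 by simpl pow; nra.
    nra.
  have HiL2 : 0 < / L ^ 2 by apply: Rinv_0_lt_compat; exact: pow_lt.
  move=> Hy; have := Rmult_le_compat_r _ _ _ (Rlt_le _ _ HiL2) Hy; rewrite /Rdiv; lra.
(* The rate [(s / cz) (L / 2)] lies below every [t] of the window, as [loss_upper] requires. *)
have Hloss := H2 N a.+1 b.+1 (s / cz * (/ 2 * L)) HN0.
have HuL : 0 < s / cz * (/ 2 * L) <= INR a.+1.
  split; first by apply: Rmult_lt_0_compat; lra.
  by rewrite S_INR; rewrite /u1 /y1 in Ha2; nra.
have {}Hloss := Hloss ltac:(rewrite -/s S_INR; lra) HuL Htl; rewrite -/s in Hloss.
have Hloss2 : C2 * (s ^ 2 / (s / cz * (/ 2 * L)) ^ 2 + (s * zz N a.+1) ^ 2 / lg N ^ 2) <= C2 * 17 * / L ^ 2.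
  rewrite Rmult_assoc; apply: Rmult_le_compat_l; first lra.
  rewrite (_ : s ^ 2 / (s / cz * (/ 2 * L)) ^ 2 = 4 * cz ^ 2 * / L ^ 2); last by field; lra.
  have HiL2 : 0 < / L ^ 2 by apply: Rinv_0_lt_compat; exact: pow_lt.
  have Hq1 : 4 * cz ^ 2 <= 16 by simpl pow; nra.
  have Hq2 : (s * zz N a.+1) ^ 2 <= 1 by rewrite -(pow1 2); apply: pow_incr; split; [nra | lra].
  have Hq3 : (s * zz N a.+1) ^ 2 / lg N ^ 2 <= 1 * / L ^ 2.
    by apply: Rmult_le_compat => //; [apply: pow2_ge_0 | lra].
  have := Rmult_le_compat_r _ _ _ (Rlt_le _ _ HiL2) Hq1; lra.
have HZ := INR_leq (@ZI_ge N a.+1 b.+1 isT ltac:(lia)).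
rewrite INR_add !(INR_sum (index_iota _ _)) in HZ.
have Hl2 : / L ^ 2 <= l ^ 2 / L ^ 2.
  rewrite /Rdiv -[X in X <= _]Rmult_1_l; apply: Rmult_le_compat_r.
    by left; apply: Rinv_0_lt_compat; exact: pow_lt.
  by simpl pow; nra.
have Hloss3 : \rsum_(a.+1 <= t < b.+1) INR ((\sum_(t.+1 <= s < N.+1 | (t + s <= N)%nat) npart (N - (t + s))) * core_cnt t N)%nat
  <= p N ^ 2 * (C2 * 17 * / L ^ 2).
  rewrite (eq_bigr _ (fun t _ => INR_mul _ _)); apply: Rle_trans Hloss _.
  by apply: Rmult_le_compat_l; lra.
have Hfin : p N ^ 2 * (2 / L - C * (l ^ 2 / L ^ 2)) <=
   p N ^ 2 * (\rsum_(a.+1 <= t < b.+1) (zz N t * exp (- (u2 * zz N t))) - 2 * C1 * / L ^ 2) - p N ^ 2 * (C2 * 17 * / L ^ 2).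
  rewrite -Rmult_minus_distr_l; apply: Rmult_le_compat_l; first lra.
  have := Rmult_le_compat_l (2 * C1 + C2 * 17) _ _ ltac:(lra) Hl2; rewrite /C; lra.
lra.
Qed.

Theorem theorem1 :
  (forall Z : nat -> nat, (Z = ZI \/ Z = ZII \/ Z = ZIII) ->
     exists C : R, forall N : nat, (3 <= N)%nat ->
       Rabs (INR (Z N) - (INR (npart N))^2 * (2 / ln (INR N)))
         <= C * (INR (npart N))^2 * ((ln (ln (INR N)))^2 / (ln (INR N))^2)) /\
  (exists C : R, forall N : nat, (3 <= N)%nat ->
       Rabs (INR (ZIII N) - INR (ZII N))
         <= C * (/ sqrt (INR N)) * (INR (npart N))^2).
Proof.
have [C1 [N1 [HC1 H1]]] := upper_sums; have [C2 [N2 [HC2 H2]]] := ZI_lower.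
have [N3 HN3] := lg_pow_le 1 2; have [N4 HN4] := lg_unbounded (exp 1).
have Hpg N : 0 < p N ^ 2 by apply: pow_lt; exact: p_gt0.
split.
- move=> Z HZ.
  (* Since [Z] lies between [ZI] and [ZIII], the lower bound for [ZI] and the upper bound for [ZIII]
     settle all three counts. *)
  have Hbetween N : (0 < N)%nat -> INR (ZI N) <= INR (Z N) <= INR (ZIII N).
    move=> HN; have HA := ZI_le_ZII HN; have HB := ZII_le_ZIII N.
    by case: HZ => [->|[->|->]]; split; apply: INR_leq; lia.
  have [C H] : exists C, forall N, (3 <= N)%nat ->
      Rabs (INR (Z N) - p N ^ 2 * (2 / ln (INR N))) <= C * (p N ^ 2 * (ln (ln (INR N)) ^ 2 / ln (INR N) ^ 2)).
    apply: extend_to_small => [N HN|].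
      have HL := ln_gt1 HN; have Hl : 0 < ln (ln (INR N)) by rewrite -ln_1; apply: ln_increasing; lra.
      by apply: Rmult_lt_0_compat => //; apply: Rdiv_lt_0_compat; apply: pow_lt; lra.
    exists (2 * C1 + C2), (N1 + N2 + N3 + N4).+1 => N HN; have HN0 : (0 < N)%nat by lia.
    have [Hlo Hhi] := Hbetween N HN0; have Hlow := H2 N ltac:(lia).
    have [T [HT [Ha Hb]]] := H1 N ltac:(lia).
    have Hup := INR_leq (ZIII_le N HT); rewrite !INR_add !(INR_sum (index_iota _ _)) in Hup.
    have {}HN3 := HN3 N ltac:(lia); have {}HN4 := HN4 N ltac:(lia).
    have [Hl1 _] := lg_ln HN0; have Hs := sqrt_INR_ge1 HN0; have He := exp_pos 1.
    set L := ln (INR N) in Hb Hlow HN4 Hl1 *; pose l := ln L; rewrite -/l in Hlow *.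
    have He1 : 1 <= L by have := exp_ge1 1; lra.
    (* Errors of order [1 / L ^ 2], and with them those of order [1 / sqrt N], are absorbed by
       [l ^ 2 / L ^ 2] once [l >= 1]. *)
    have Hl : 1 <= l by rewrite -(ln_exp 1); apply: ln_le.
    have HL2 : 1 / sqrt (INR N) <= 1 / L ^ 2.
      apply: Rmult_le_compat_l; first lra.
      apply: Rinv_le_contravar; first by apply: pow_lt; lra.
      apply: (Rle_trans _ (lg N ^ 2)); last lra.
      by apply: pow_incr; lra.
    have Hl2 : 1 / L ^ 2 <= l ^ 2 / L ^ 2.
      apply: Rmult_le_compat_r; first by left; apply: Rinv_0_lt_compat; apply: pow_lt; lra.
      by simpl pow; nra.
    have HP := Hpg N; set P := p N ^ 2 in Ha Hb Hlow HP *.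
    have Ha2 : C1 / sqrt (INR N) * P <= C1 * (l ^ 2 / L ^ 2) * P.
      apply: Rmult_le_compat_r; first lra.
      rewrite (_ : C1 / sqrt (INR N) = C1 * (1 / sqrt (INR N))); last by rewrite /Rdiv; ring.
      by apply: Rmult_le_compat_l; lra.
    have Hb2 : P * (2 / L + C1 / L ^ 2) <= P * (2 / L) + C1 * (l ^ 2 / L ^ 2) * P.
      have := Rmult_le_compat_l (C1 * P) _ _ ltac:(nra) Hl2; rewrite /Rdiv; lra.
    have HPq : 0 <= P * (l ^ 2 / L ^ 2).
      by apply: Rmult_le_pos; [lra | apply: Rmult_le_pos; [apply: pow2_ge_0 | left; apply: Rinv_0_lt_compat; apply: pow_lt; lra]].
    have H3 : 0 <= C1 * (P * (l ^ 2 / L ^ 2)) by apply: Rmult_le_pos; lra.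
    have H4 : 0 <= C2 * (P * (l ^ 2 / L ^ 2)) by apply: Rmult_le_pos; lra.
    apply: Rabs_le; split; lra.
  by exists C => N HN; have := H N HN; lra.
have [C H] : exists C, forall N, (3 <= N)%nat -> Rabs (INR (ZIII N) - INR (ZII N)) <= C * (/ sqrt (INR N) * p N ^ 2).
  apply: extend_to_small => [N HN|].
    apply: Rmult_lt_0_compat => //; apply: Rinv_0_lt_compat.
    by have := @sqrt_INR_ge1 N ltac:(lia); lra.
  exists C1, N1 => N HN; have [T [HT [Ha _]]] := H1 N HN.
  have Hup := INR_leq (ZIII_le_ZII N HT); rewrite !INR_add !(INR_sum (index_iota _ _)) in Hup.
  have Hle := INR_leq (ZII_le_ZIII N).
  rewrite Rabs_pos_eq; last lra.
  by rewrite /Rdiv in Ha; lra.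
by exists C => N HN; have := H N HN; lra.
Qed.
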